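(* Suppose that $f(z)=h(z)+\overline{g(z)}=\sum_{n=0}^{\infty}a_nz^n+\overline{\sum_{n=1}^{\infty}b_nz^n}$ is a sense-preserving $K$-quasiconformal harmonic mapping in $\mathbb{D}$ and $h\prec\phi$, where $\phi\in\widehat{C_p}$ and $p\in(0,1)$. Then for arbitrary $t\in[0,1]$ and $m\in\mathbb{N}$, the inequality (with $b_0=0$) $$t|h(z^m)|+(1-t)\sum_{n=0}^{\infty}(|a_n|+|b_n|)r^n\le|\phi(0)|+d(\phi(0),\partial\phi(\mathbb{D}))$$ holds for $|z|=r\le\min\{R_{K,m,p,t},1/3\}$, where $R_{K,m,p,t}\in(0,p)$ is the unique root of the equation $$t\,k_p(r^m)+\frac{2K(1-t)}{K+1}\,k_p(r)-\frac{p}{(1+p)^2}=0,\qquad k_p(z)=\frac{pz}{(p-z)(1-pz)} .$$ The radius $R_{K,m,p,t}$ is sharp if $R_{K,m,p,t}\le1/3$.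
   Context: $\mathbb{D}=\{z\in\mathbb{C}:|z|<1\}$ and $\widehat{\mathbb{C}}=\mathbb{C}\cup\{\infty\}$. For $p\in(0,1)$, $\widehat{C_p}$ is the family of meromorphic univalent functions $\phi:\mathbb{D}\to\widehat{\mathbb{C}}$ that are analytic in $\mathbb{D}\setminus\{p\}$, have a simple pole at $p$, and are such that $\widehat{\mathbb{C}}\setminus\phi(\mathbb{D})$ is convex. $d(\phi(0),\partial\phi(\mathbb{D}))$ is the Euclidean distance from $\phi(0)$ to the boundary of $\phi(\mathbb{D})$. $h\prec\phi$ ($h$ is subordinate to $\phi$) means $h=\phi\circ w$ for some analytic $w:\mathbb{D}\to\mathbb{D}$ with $w(0)=0$. A harmonic mapping $f=h+\overline g$ in $\mathbb{D}$ ($h,g$ analytic in $\mathbb{D}$) is sense-preserving $K$-quasiconformal if it is locally univalent and sense-preserving (i.e. $h'\ne0$ and $|\omega|<1$ in $\mathbb{D}$, where $\omega=g'/h'$) and $|\omega(z)|\le k<1$ in $\mathbb{D}$, where $K=(1+k)/(1-k)\ge1$, i.e. $k=(K-1)/(K+1)$.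
   Formalization: h and g may have poles in the disk (the inequality covers the analytic case; sharpness, false for analytic h, is proved in this larger class), and for t=1, m≥2 existence of the root R in (0,p) is claimed only if k_p(p^m) > p/(1+p)^2, since otherwise there is none. *)

(* Defs.v *)
From Stdlib Require Import Reals.
From Coquelicot Require Import Coquelicot.

Open Scope R_scope.

(* Riemann sphere: [None] is the point at infinity. *)
Definition Chat : Type := option C.

(* Arbitrary value 0 at infinity; only meant to be used where [f] is finite. *)
Definition finite_part (f : C -> Chat) (z : C) : C :=
  match f z with Some w => w | None => RtoC 0 end.

Definition unit_disk (z : C) : Prop := Cmod z < 1.

(* [ex_derive] on [C -> C] is complex differentiability. *)
Definition analytic_at (f : C -> Chat) (z : C) : Prop :=
  locally z (fun u : C => f u <> None /\ ex_derive (finite_part f) u).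

Definition pole_at (f : C -> Chat) (z : C) : Prop :=
  f z = None /\
  locally' z (fun u : C => f u <> None /\ ex_derive (finite_part f) u) /\
  filterlim (fun u : C => Cmod (finite_part f u)) (locally' z)
            (Rbar_locally p_infty).

Definition simple_pole_at (f : C -> Chat) (z : C) : Prop :=
  pole_at f z /\
  exists c : C, c <> RtoC 0 /\
    filterlim (fun u : C => ((u - z) * finite_part f u)%C)
              (locally' z) (locally c).

Definition meromorphic_in_disk (f : C -> Chat) : Prop :=
  forall z : C, unit_disk z -> analytic_at f z \/ pole_at f z.

Definition disk_image (phi : C -> Chat) (x : Chat) : Prop :=
  exists z : C, unit_disk z /\ phi z = x.

(* The class of concave univalent functions with a simple pole at [p].
   As infinity is a value of [phi], the complement of the image lies in the
   finite plane, where convexity makes sense. *)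
Definition concave_with_pole (p : R) (phi : C -> Chat) : Prop :=
  (forall z : C, unit_disk z -> z <> RtoC p -> analytic_at phi z) /\
  simple_pole_at phi (RtoC p) /\
  (forall z1 z2 : C, unit_disk z1 -> unit_disk z2 ->
     phi z1 = phi z2 -> z1 = z2) /\
  (forall (u v : C) (s : R), 0 <= s <= 1 ->
     ~ disk_image phi (Some u) -> ~ disk_image phi (Some v) ->
     ~ disk_image phi (Some (RtoC s * u + RtoC (1 - s) * v)%C)).

Definition boundary (E : C -> Prop) (x : C) : Prop :=
  forall eps : R, 0 < eps ->
    (exists y : C, Cmod (y - x) < eps /\ E y) /\
    (exists y : C, Cmod (y - x) < eps /\ ~ E y).

Definition euclidean_dist (x : C) (E : C -> Prop) : R :=
  real (Glb_Rbar (fun d : R => exists y : C, E y /\ d = Cmod (x - y))).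

(* d(phi(0), boundary of phi(D)).  Infinity is interior to the image, so its
   boundary in the sphere is the boundary in the plane of its finite part. *)
Definition dist_to_boundary (phi : C -> Chat) : R :=
  euclidean_dist (finite_part phi (RtoC 0))
    (boundary (fun w : C => disk_image phi (Some w))).

Definition subordinate (h phi : C -> Chat) : Prop :=
  exists w : C -> C,
    (forall z : C, unit_disk z -> ex_derive w z) /\
    (forall z : C, unit_disk z -> unit_disk (w z)) /\
    w (RtoC 0) = RtoC 0 /\
    (forall z : C, unit_disk z -> h z = phi (w z)).

Definition dilatation (h g : C -> Chat) (z : C) : C :=
  (C_derive (finite_part g) z / C_derive (finite_part h) z)%C.

(* Canonical decomposition of a harmonic mapping h + conj g of the disk.  Since
   a function subordinate to a [phi] with a pole may itself have poles ([phi]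
   is subordinate to itself), poles of [h] are allowed and the conditions are
   imposed off them; functions analytic in the whole disk are the special case
   in which no value in the disk is [None].  With poles excluded, h = phi o w
   would force w to omit the pole of [phi], so w(z) = z would not be allowed
   and the radius would not be sharp. *)
Definition harmonic_mapping (h g : C -> Chat) : Prop :=
  meromorphic_in_disk h /\ meromorphic_in_disk g /\
  (forall z : C, unit_disk z -> analytic_at h z -> analytic_at g z).

Definition sense_preserving (h g : C -> Chat) : Prop :=
  forall z : C, unit_disk z -> analytic_at h z ->
    C_derive (finite_part h) z <> RtoC 0 /\ Cmod (dilatation h g z) < 1.

Definition quasiconformal (K : R) (h g : C -> Chat) : Prop :=
  forall z : C, unit_disk z -> analytic_at h z ->
    Cmod (dilatation h g z) <= (K - 1) / (K + 1).

Definition has_expansion (rho : R) (f : C -> Chat) (a : nat -> C) : Prop :=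
  forall z : C, Cmod z < rho ->
    exists s : C, f z = Some s /\ is_pseries a z s.

(* Taylor expansions are about 0, in the disk |z| < p, where h = phi o w is
   finite by the Schwarz lemma. *)
Definition admissible (p K : R) (phi h g : C -> Chat) (a b : nat -> C) : Prop :=
  concave_with_pole p phi /\
  harmonic_mapping h g /\
  sense_preserving h g /\
  quasiconformal K h g /\
  has_expansion p h a /\
  has_expansion p g b /\
  b 0%nat = RtoC 0 /\
  subordinate h phi.

Definition k_ (p r : R) : R := p * r / ((p - r) * (1 - p * r)).

Definition radius_equation (K : R) (m : nat) (p t r : R) : Prop :=
  t * k_ p (r ^ m) + 2 * K * (1 - t) / (K + 1) * k_ p r - p / (1 + p) ^ 2 = 0.

Definition is_radius (K : R) (m : nat) (p t r : R) : Prop :=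
  0 < r < p /\ radius_equation K m p t r.

(* For t = 1 and m >= 2 the left-hand side of the equation stays bounded on
   (0, p), and a root in (0, p) exists only when it is positive at r = p. *)
Definition radius_exists_condition (m : nat) (p t : R) : Prop :=
  t < 1 \/ m = 1%nat \/ p / (1 + p) ^ 2 < k_ p (p ^ m).

Definition bohr_lhs (t : R) (m : nat) (h : C -> Chat) (a b : nat -> C) (z : C)
  : R :=
  t * Cmod (finite_part h (z ^ m)%C) +
  (1 - t) * Series (fun n : nat => (Cmod (a n) + Cmod (b n)) * Cmod z ^ n).

Definition bohr_rhs (phi : C -> Chat) : R :=
  Cmod (finite_part phi (RtoC 0)) + dist_to_boundary phi.

(* [Series] is meaningful only for convergent series. *)
Definition bohr_inequality (t : R) (m : nat) (phi h : C -> Chat)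
  (a b : nat -> C) (z : C) : Prop :=
  ex_series (fun n : nat => (Cmod (a n) + Cmod (b n)) * Cmod z ^ n) /\
  bohr_lhs t m h a b z <= bohr_rhs phi.

(* The radius [r0] cannot be replaced by any larger one.  Below [p] the series
   converges, so the inequality genuinely fails rather than being undefined. *)
Definition sharp_radius (K : R) (m : nat) (p t r0 : R) : Prop :=
  forall rho : R, r0 < rho < p ->
    exists (phi h g : C -> Chat) (a b : nat -> C) (z : C),
      admissible p K phi h g a b /\ Cmod z <= rho /\
      ex_series (fun n : nat => (Cmod (a n) + Cmod (b n)) * Cmod z ^ n) /\
      bohr_rhs phi < bohr_lhs t m h a b z.

(* Main.v *)
(** Let E be the complement of phi(D), v a point of E, and move the pole to the
    origin: G = 1 / (phi o T - v) with T(z) = (p - z) / (1 - p z).  Study's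
    maximum principle argument with the convexity of E gives
    [Re (G(z) (G(x z) - G(z)) / (G(x z) z G'(z))) >= 0] for |x| = 1.  After scaling
    and transporting by T, this says that a function of two boundary points has
    nonnegative real part; Herglotz' coefficient bound for it is
    [|B| <= 1], where [B(z) = phi'(0) / (phi(z) - phi(0)) - 1/z + 1/p + p].
    As B(p) = p, the Schwarz lemma for B yields Wirths' representation
    [phi(z) = phi(0) + phi'(0) k_p(z) (1 - q z (1 + om(z)))] with
    [q = p / (1 + p^2)] and [|om| <= 1].  Hence [|phi(u) - phi(0)| <= |phi'(0)| k_p(|u|)],
    the distance from phi(0) to the boundary is at least [|phi'(0)| p / (1 + p)^2], and,
    by Bohr's theorem [sum |c_n| r^n <= sup |f|] for [r <= 1/3] applied to om, w and
    the dilatation, the majorant series of h and g are at most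
    [|phi(0)| + |phi'(0)| k_p(r)] and [(K - 1) / (K + 1) |phi'(0)| k_p(r)].
    Equality holds for phi = h = k_p and g = k h, with k = (K - 1) / (K + 1), at z = r. *)

Require Import Defs.
From Stdlib Require Import Reals Lra Lia ClassicalEpsilon Ranalysis5.
From Coquelicot Require Import Coquelicot.

Open Scope R_scope.

(** * Complex differentiability *)

(** Study's inequality is needed on |x| = 1, where G need not extend. So G(T(x)) is replaced by G(r
    T(x)) with r < 1, which is univalent on a disk slightly larger than the unit disk, and r tends
    to 1 only in the final bound. The removable singularities at 0, at p and at the second boundary
    point are absorbed into difference quotients, which never vanish for a univalent function. The
    function theory rests on one fact: the mean of a holomorphic function over a circle does not
    depend on the radius. Openness and nonvanishing derivatives are drawn from the maximum principle
    and from removability instead of the argument principle. Majorizing 1 - q z (1 + om) term by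
    term would be too wasteful. Written as (1 - p z) + (p - q) z - q z om with 0 < q < p, it yields
    k_p(r) exactly. The constant p / (1 + p)^2 is - k_p(-1). Since h may have poles in the disk, its
    coefficients are controlled through expansions at 0 only, and the dilatation is first extended
    across the poles. *)

Lemma Cmod_sub_sym (a b : C) : Cmod (a - b) = Cmod (b - a).
Proof. rewrite <- Cmod_opp. f_equal. ring. Qed.

Lemma Cmod_sub_triangle (a b c : C) : Cmod (a - c) <= Cmod (a - b) + Cmod (b - c).
Proof.
  replace (a - c)%C with ((a - b) + (b - c))%C by ring. apply Cmod_triangle.
Qed.

Lemma Cmod_triangle_rev (a b : C) : Cmod a - Cmod b <= Cmod (a - b).
Proof.
  assert (H := Cmod_triangle (a - b) b).
  replace (a - b + b)%C with a in H by ring. lra.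
Qed.

Lemma Cmod_le_ReIm (z : C) : Cmod z <= Rabs (Re z) + Rabs (Im z).
Proof.
  replace z with (RtoC (Re z) + Ci * RtoC (Im z))%C at 1.
  - eapply Rle_trans; [apply Cmod_triangle|].
    rewrite Cmod_mult, Cmod_Ci, !Cmod_R. lra.
  - destruct z as [x y]. unfold Cplus, Cmult, RtoC, Ci; simpl. f_equal; ring.
Qed.

Lemma im_le_Cmod (z : C) : Rabs (Im z) <= Cmod z.
Proof.
  eapply Rle_trans; [|apply Rmax_Cmod]. apply Rmax_r.
Qed.

Lemma re_bound (z : C) : - Cmod z <= Re z <= Cmod z.
Proof. assert (H := re_le_Cmod z). apply Rabs_le_between in H. lra. Qed.

Lemma Re_plus (a b : C) : Re (a + b)%C = Re a + Re b.
Proof. reflexivity. Qed.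
Lemma Im_plus (a b : C) : Im (a + b)%C = Im a + Im b.
Proof. reflexivity. Qed.
Lemma Re_minus (a b : C) : Re (a - b)%C = Re a - Re b.
Proof. reflexivity. Qed.
Lemma Re_scal (x : R) (a : C) : Re (RtoC x * a)%C = x * Re a.
Proof. destruct a; simpl; ring. Qed.

Lemma C_ext (a b : C) : Re a = Re b -> Im a = Im b -> a = b.
Proof. destruct a, b; simpl. intros; f_equal; assumption. Qed.

Lemma Csub_neq (a b : C) : a <> b -> (a - b)%C <> (RtoC 0).
Proof.
  intros H E. apply H. replace a with (a - b + b)%C by ring. rewrite E. ring.
Qed.

Lemma Cmod_sub_pos (a b : C) : a <> b -> 0 < Cmod (a - b).
Proof. intros H. apply Cmod_gt_0, Csub_neq, H. Qed.

(* [Q m u] is thought of as a uniform bound by [m] at [u]. *)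
Lemma local_uniform (r : R) (Q : R -> C -> Prop) :
  (forall m m' u, m' <= m -> Q m u -> Q m' u) ->
  (forall z, Cmod z <= r -> exists del, 0 < del /\ exists m, 0 < m /\
     forall u, Cmod (u - z) < del -> Cmod u <= r -> Q m u) ->
  exists m, 0 < m /\ forall u, Cmod u <= r -> Q m u.
Proof.
  intros Hmono Hloc.
  (* The factor 2 pays for the passage from coordinate distances, in which the compactness principle
     is stated, to the modulus. Centres outside the closed disk get a radius so small that their
     neighbourhood misses it. *)
  assert (H : forall x y : R, exists d : posreal, forall u,
    Cmod (u - (x, y)) < 2 * d -> Cmod u <= r -> Q d u).
  { intros x y. destruct (Rle_or_lt (Cmod (x, y)) r) as [Hz|Hz].
    - destruct (Hloc _ Hz) as (del & Hdel & m & Hm & H).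
      assert (Hp : 0 < Rmin (del / 2) m) by (apply Rmin_pos; lra).
      exists (mkposreal _ Hp). simpl. intros u Hu Hr.
      apply Hmono with m; [apply Rmin_r|]. apply H; [|exact Hr].
      assert (K := Rmin_l (del / 2) m). lra.
    - assert (Hp : 0 < (Cmod (x, y) - r) / 2) by lra.
      exists (mkposreal _ Hp). simpl. intros u Hu Hr.
      assert (K := Cmod_triangle_rev (x, y) u).
      rewrite Cmod_sub_sym in K. lra. }
  set (delta := fun x y => proj1_sig (constructive_indefinite_description _ (H x y))).
  destruct (compactness_value_2d (- r) r (- r) r delta) as [d Hd].
  exists d. split; [apply cond_pos|]. intros [x y] Hu.
  assert (Hx := re_le_Cmod (x, y)). assert (Hy := im_le_Cmod (x, y)).
  simpl in Hx, Hy. apply Rabs_le_between in Hx. apply Rabs_le_between in Hy.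
  apply NNPP. intro Hn.
  apply (Hd x y); [lra|lra|]. intros (u & v & _ & _ & Hxu & Hyv & Hdd).
  apply Hn. apply Hmono with (delta u v); [exact Hdd|].
  unfold delta in *. destruct (constructive_indefinite_description _ (H u v)) as [d' Hd'].
  simpl in *. apply Hd'; [|exact Hu].
  eapply Rle_lt_trans; [apply Cmod_le_ReIm|]. simpl.
  unfold Rminus in *. lra.
Qed.

(** * Continuity and complex derivatives by epsilon and delta *)

Definition ccont (f : C -> C) (z : C) : Prop :=
  forall eps, 0 < eps -> exists del, 0 < del /\
    forall u, Cmod (u - z) < del -> Cmod (f u - f z) < eps.

(** The error bound is not strict, so that u = z satisfies it. Moduli are Euclidean; the passage to
    the filters of the statement is made by [locally_near] and [cderiv_is_derive]. *)
Definition cderiv (f : C -> C) (z l : C) : Prop :=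
  forall eps, 0 < eps -> exists del, 0 < del /\
    forall u, Cmod (u - z) < del ->
      Cmod (f u - f z - l * (u - z)) <= eps * Cmod (u - z).

Definition holo (f : C -> C) (z : C) : Prop := exists l, cderiv f z l.

Definition near (z : C) (P : C -> Prop) : Prop :=
  exists del, 0 < del /\ forall u, Cmod (u - z) < del -> P u.

Lemma near_and (z : C) (P Q : C -> Prop) :
  near z P -> near z Q -> near z (fun u => P u /\ Q u).
Proof.
  intros (d1 & H1 & K1) (d2 & H2 & K2). exists (Rmin d1 d2).
  split; [apply Rmin_pos; assumption|]. intros u Hu.
  assert (A := Rmin_l d1 d2). assert (B := Rmin_r d1 d2).
  split; [apply K1|apply K2]; lra.
Qed.

Lemma near_imp (z : C) (P Q : C -> Prop) :
  (forall u, P u -> Q u) -> near z P -> near z Q.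
Proof. intros H (d & Hd & K). exists d. auto. Qed.

Lemma near_self (z : C) (P : C -> Prop) : near z P -> P z.
Proof.
  intros (d & Hd & K). apply K. replace (z - z)%C with (RtoC 0) by ring.
  rewrite Cmod_0. exact Hd.
Qed.

Lemma near_disk (a z : C) (r : R) :
  Cmod (z - a) < r -> near z (fun u => Cmod (u - a) < r).
Proof.
  intros H. exists (r - Cmod (z - a)). split; [lra|]. intros u Hu.
  assert (K := Cmod_sub_triangle u z a). lra.
Qed.

Lemma near_disk0 (z : C) (r : R) : Cmod z < r -> near z (fun u => Cmod u < r).
Proof.
  intros H. exists (r - Cmod z). split; [lra|]. intros u Hu.
  assert (K := Cmod_triangle_rev u z). lra.
Qed.

Lemma near_outside (a z : C) (r : R) :
  r < Cmod (z - a) -> near z (fun u => r < Cmod (u - a)).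
Proof.
  intros H. exists (Cmod (z - a) - r). split; [lra|]. intros u Hu.
  assert (K := Cmod_sub_triangle z u a). rewrite (Cmod_sub_sym z u) in K. lra.
Qed.

Lemma near_neq (a z : C) : z <> a -> near z (fun u => u <> a).
Proof.
  intros H. apply Cmod_sub_pos in H. exists (Cmod (z - a)). split; [lra|].
  intros u Hu E. subst u. rewrite Cmod_sub_sym in Hu. lra.
Qed.

Lemma near_near (z : C) (P : C -> Prop) : near z P -> near z (fun u => near u P).
Proof.
  intros (d & Hd & K). exists d. split; [exact Hd|]. intros u Hu.
  destruct (near_disk z u d Hu) as (e & He & L).
  exists e. split; [exact He|]. intros v Hv. auto.
Qed.

Lemma ccont_near (f : C -> C) (z : C) :
  ccont f z <-> forall eps, 0 < eps -> near z (fun u => Cmod (f u - f z) < eps).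
Proof. split; intros H eps He; exact (H eps He). Qed.

Lemma ccont_pull (f : C -> C) (z : C) (P : C -> Prop) :
  ccont f z -> near (f z) P -> near z (fun u => P (f u)).
Proof.
  intros Hf (e & He & K). destruct (Hf e He) as (d & Hd & L).
  exists d. split; auto.
Qed.

Lemma ccont_ext (f g : C -> C) (z : C) :
  near z (fun u => f u = g u) -> ccont f z -> ccont g z.
Proof.
  intros H Hf eps He. rewrite <- (near_self _ _ H).
  destruct (near_and _ _ _ H (Hf eps He)) as (d & Hd & K).
  exists d. split; [exact Hd|]. intros u Hu. destruct (K u Hu) as [E L].
  rewrite <- E. exact L.
Qed.

Lemma cderiv_ext (f g : C -> C) (z l : C) :
  near z (fun u => f u = g u) -> cderiv f z l -> cderiv g z l.
Proof.
  intros H Hf eps He. rewrite <- (near_self _ _ H).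
  destruct (near_and _ _ _ H (Hf eps He)) as (d & Hd & K).
  exists d. split; [exact Hd|]. intros u Hu. destruct (K u Hu) as [E L].
  rewrite <- E. exact L.
Qed.

Lemma holo_ext (f g : C -> C) (z : C) :
  near z (fun u => f u = g u) -> holo f z -> holo g z.
Proof. intros H [l Hl]. exists l. eapply cderiv_ext; eassumption. Qed.

Lemma cderiv_ccont (f : C -> C) (z l : C) : cderiv f z l -> ccont f z.
Proof.
  intros H eps He. destruct (H 1 Rlt_0_1) as (d & Hd & K).
  set (B := Cmod l + 1). assert (HB : 0 < B) by (assert (T := Cmod_ge_0 l); unfold B; lra).
  exists (Rmin d (eps / B)). split.
  - apply Rmin_pos; [exact Hd|]. apply Rdiv_lt_0_compat; lra.
  - intros u Hu. assert (A1 := Rmin_l d (eps / B)). assert (A2 := Rmin_r d (eps / B)).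
    assert (K' := K u ltac:(lra)).
    replace (f u - f z)%C with ((f u - f z - l * (u - z)) + l * (u - z))%C by ring.
    eapply Rle_lt_trans; [apply Cmod_triangle|]. rewrite Cmod_mult.
    assert (Hm : Cmod (u - z) < eps / B) by lra.
    apply (Rmult_lt_compat_l B) in Hm; [|exact HB].
    replace (B * (eps / B)) with eps in Hm by (field; lra). unfold B in Hm. lra.
Qed.

Lemma holo_ccont (f : C -> C) (z : C) : holo f z -> ccont f z.
Proof. intros [l Hl]. eapply cderiv_ccont, Hl. Qed.

Lemma ccont_const (c z : C) : ccont (fun _ => c) z.
Proof.
  intros eps He. exists 1. split; [lra|]. intros u _.
  replace (c - c)%C with (RtoC 0) by ring. rewrite Cmod_0. exact He.
Qed.

Lemma ccont_id (z : C) : ccont (fun u => u) z.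
Proof. intros eps He. exists eps. auto. Qed.

Lemma ccont_plus (f g : C -> C) (z : C) :
  ccont f z -> ccont g z -> ccont (fun u => f u + g u)%C z.
Proof.
  intros Hf Hg eps He.
  destruct (near_and _ _ _ (Hf (eps / 2) ltac:(lra)) (Hg (eps / 2) ltac:(lra)))
    as (d & Hd & K).
  exists d. split; [exact Hd|]. intros u Hu. destruct (K u Hu) as [K1 K2].
  replace (f u + g u - (f z + g z))%C with ((f u - f z) + (g u - g z))%C by ring.
  eapply Rle_lt_trans; [apply Cmod_triangle|]. lra.
Qed.

Lemma ccont_bounded (f : C -> C) (z : C) :
  ccont f z -> near z (fun u => Cmod (f u) < Cmod (f z) + 1).
Proof.
  intros Hf. apply near_imp with (2 := Hf 1 Rlt_0_1). intros u Hu.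
  assert (K := Cmod_triangle_rev (f u) (f z)). lra.
Qed.

Lemma Rdiv_mult_lt (a b c : R) : 0 < b -> a < c / b -> b * a < c.
Proof.
  intros Hb H. apply (Rmult_lt_compat_l b) in H; [|exact Hb].
  replace (b * (c / b)) with c in H by (field; lra). exact H.
Qed.

Lemma ccont_mult (f g : C -> C) (z : C) :
  ccont f z -> ccont g z -> ccont (fun u => f u * g u)%C z.
Proof.
  intros Hf Hg eps He.
  set (A := Cmod (f z) + 1). set (B := Cmod (g z) + 1).
  assert (HA : 0 < A) by (assert (T := Cmod_ge_0 (f z)); unfold A; lra).
  assert (HB : 0 < B) by (assert (T := Cmod_ge_0 (g z)); unfold B; lra).
  destruct (near_and _ _ _ (ccont_bounded _ _ Hf) (near_and _ _ _
    (Hf (eps / 2 / B) ltac:(apply Rdiv_lt_0_compat; lra))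
    (Hg (eps / 2 / A) ltac:(apply Rdiv_lt_0_compat; lra)))) as (d & Hd & K).
  exists d. split; [exact Hd|]. intros u Hu. destruct (K u Hu) as (K0 & K1 & K2).
  replace (f u * g u - f z * g z)%C
    with (f u * (g u - g z) + g z * (f u - f z))%C by ring.
  eapply Rle_lt_trans; [apply Cmod_triangle|]. rewrite !Cmod_mult.
  apply Rdiv_mult_lt in K1; [|exact HB]. apply Rdiv_mult_lt in K2; [|exact HA].
  assert (T1 := Cmod_ge_0 (f u)). assert (T2 := Cmod_ge_0 (g z)).
  assert (T3 := Cmod_ge_0 (g u - g z)). assert (T4 := Cmod_ge_0 (f u - f z)).
  assert (Cmod (f u) * Cmod (g u - g z) <= A * Cmod (g u - g z))
    by (apply Rmult_le_compat_r; [lra|unfold A; lra]).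
  assert (Cmod (g z) * Cmod (f u - f z) <= B * Cmod (f u - f z))
    by (apply Rmult_le_compat_r; [lra|unfold B; lra]).
  lra.
Qed.

Lemma ccont_comp (f g : C -> C) (z : C) :
  ccont g z -> ccont f (g z) -> ccont (fun u => f (g u)) z.
Proof. intros Hg Hf eps He. exact (ccont_pull _ _ _ Hg (Hf eps He)). Qed.

Lemma cderiv_const (c z : C) : cderiv (fun _ => c) z 0.
Proof.
  intros eps He. exists 1. split; [lra|]. intros u _.
  replace (c - c - 0 * (u - z))%C with (RtoC 0) by ring. rewrite Cmod_0.
  apply Rmult_le_pos; [lra|apply Cmod_ge_0].
Qed.

Lemma cderiv_id (z : C) : cderiv (fun u => u) z 1.
Proof.
  intros eps He. exists 1. split; [lra|]. intros u _.
  replace (u - z - 1 * (u - z))%C with (RtoC 0) by ring. rewrite Cmod_0.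
  apply Rmult_le_pos; [lra|apply Cmod_ge_0].
Qed.

Lemma cderiv_plus (f g : C -> C) (z a b : C) :
  cderiv f z a -> cderiv g z b -> cderiv (fun u => f u + g u)%C z (a + b).
Proof.
  intros Hf Hg eps He.
  destruct (near_and _ _ _ (Hf (eps / 2) ltac:(lra)) (Hg (eps / 2) ltac:(lra)))
    as (d & Hd & K).
  exists d. split; [exact Hd|]. intros u Hu. destruct (K u Hu) as [K1 K2].
  replace (f u + g u - (f z + g z) - (a + b) * (u - z))%C
    with ((f u - f z - a * (u - z)) + (g u - g z - b * (u - z)))%C by ring.
  eapply Rle_trans; [apply Cmod_triangle|]. lra.
Qed.

(* Caratheodory: differentiability is continuity of a slope. *)
Lemma cderiv_slope (f : C -> C) (z l : C) :
  cderiv f z l <-> exists s : C -> C,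
    s z = l /\ ccont s z /\ forall u, f u = (f z + s u * (u - z))%C.
Proof.
  split.
  - intros H.
    exists (fun u => match excluded_middle_informative (u = z) with
                     | left _ => l | right _ => ((f u - f z) / (u - z))%C end).
    split; [|split].
    + destruct (excluded_middle_informative (z = z)); tauto.
    + intros eps He. destruct (H (eps / 2) ltac:(lra)) as (d & Hd & K).
      exists d. split; [exact Hd|]. intros u Hu.
      destruct (excluded_middle_informative (z = z)) as [_|N]; [|tauto].
      destruct (excluded_middle_informative (u = z)) as [E|N].
      * replace (l - l)%C with (RtoC 0) by ring. rewrite Cmod_0. exact He.
      * assert (N' := Csub_neq _ _ N). assert (P := Cmod_sub_pos _ _ N).
        replace ((f u - f z) / (u - z) - l)%C
          with ((f u - f z - l * (u - z)) / (u - z))%C by (field; exact N').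
        rewrite Cmod_div by exact N'.
        apply Rle_lt_trans with (eps / 2); [|lra].
        apply (Rmult_le_reg_r (Cmod (u - z))); [exact P|].
        unfold Rdiv at 1. rewrite Rmult_assoc, Rinv_l by lra.
        specialize (K u Hu). lra.
    + intros u. destruct (excluded_middle_informative (u = z)) as [E|N].
      * subst u. ring.
      * field. apply Csub_neq, N.
  - intros (s & E & Hs & Hf). intros eps He. destruct (Hs eps He) as (d & Hd & K).
    exists d. split; [exact Hd|]. intros u Hu. rewrite (Hf u), <- E.
    replace (f z + s u * (u - z) - f z - s z * (u - z))%C
      with ((s u - s z) * (u - z))%C by ring.
    rewrite Cmod_mult. apply Rmult_le_compat_r; [apply Cmod_ge_0|].
    left. apply K, Hu.
Qed.

Lemma cderiv_mult (f g : C -> C) (z a b : C) :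
  cderiv f z a -> cderiv g z b ->
  cderiv (fun u => f u * g u)%C z (a * g z + f z * b).
Proof.
  intros Hf Hg. assert (Cg := cderiv_ccont _ _ _ Hg).
  apply cderiv_slope in Hf. apply cderiv_slope in Hg.
  destruct Hf as (s & Es & Cs & Hs). destruct Hg as (t & Et & Ct & Ht).
  apply cderiv_slope. exists (fun u => s u * g u + f z * t u)%C.
  split; [rewrite Es, Et; reflexivity|]. split.
  - apply ccont_plus; [apply ccont_mult; assumption|].
    apply ccont_mult; [apply ccont_const|exact Ct].
  - intros u. transitivity ((f z + s u * (u - z)) * g u)%C; [now rewrite <- Hs|].
    rewrite (Ht u). ring.
Qed.

Lemma cderiv_comp (f g : C -> C) (z a b : C) :
  cderiv g z b -> cderiv f (g z) a -> cderiv (fun u => f (g u)) z (a * b).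
Proof.
  intros Hg Hf. assert (Cg := cderiv_ccont _ _ _ Hg).
  apply cderiv_slope in Hf. apply cderiv_slope in Hg.
  destruct Hf as (s & Es & Cs & Hs). destruct Hg as (t & Et & Ct & Ht).
  apply cderiv_slope. exists (fun u => s (g u) * t u)%C.
  split; [rewrite Es, Et; reflexivity|]. split.
  - apply ccont_mult; [apply (ccont_comp s g); assumption|exact Ct].
  - intros u. rewrite (Hs (g u)) at 1. rewrite (Ht u) at 2. ring.
Qed.

Lemma ccont_inv (z : C) : z <> (RtoC 0) -> ccont (fun u => / u)%C z.
Proof.
  intros Hz eps He. assert (P : 0 < Cmod z) by (apply Cmod_gt_0, Hz).
  set (m := Cmod z) in *.
  exists (Rmin (m / 2) (eps * (m * m) / 2)). split.
  - apply Rmin_pos; [lra|].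
    assert (0 < m * m) by (apply Rmult_lt_0_compat; exact P).
    assert (0 < eps * (m * m)) by (apply Rmult_lt_0_compat; assumption). lra.
  - intros u Hu. assert (A1 := Rmin_l (m / 2) (eps * (m * m) / 2)).
    assert (A2 := Rmin_r (m / 2) (eps * (m * m) / 2)).
    assert (Hu2 : m / 2 < Cmod u).
    { assert (K := Cmod_triangle_rev z u). rewrite Cmod_sub_sym in K. fold m in K. lra. }
    assert (Hu0 : u <> (RtoC 0)) by (apply Cmod_gt_0; lra).
    replace (/ u - / z)%C with ((z - u) / (u * z))%C by (field; auto).
    rewrite Cmod_div by (apply Cmult_neq_0; assumption).
    rewrite Cmod_mult, Cmod_sub_sym. fold m.
    assert (Q : 0 < Cmod u * m) by (apply Rmult_lt_0_compat; lra).
    apply (Rmult_lt_reg_r (Cmod u * m)); [exact Q|].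
    unfold Rdiv. rewrite Rmult_assoc, Rinv_l by lra. rewrite Rmult_1_r.
    eapply Rlt_le_trans; [exact Hu|]. eapply Rle_trans; [exact A2|].
    assert (m / 2 * m <= Cmod u * m) by (apply Rmult_le_compat_r; lra).
    assert (eps * (m / 2 * m) <= eps * (Cmod u * m)) by (apply Rmult_le_compat_l; lra).
    lra.
Qed.

Lemma cderiv_inv (z : C) : z <> (RtoC 0) -> cderiv (fun u => / u)%C z (- / (z * z)).
Proof.
  intros Hz. assert (Hc := ccont_inv z Hz).
  (* [cderiv_slope] asks for its identity at every u, and [/ u] has a default value at 0; the
     function is therefore changed at that one point, away from z. *)
  apply cderiv_ext with
    (fun u => match excluded_middle_informative (u = (RtoC 0)) with
              | left _ => (/ z + (- / (z * z)) * (u - z))%C | right _ => (/ u)%C end).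
  - destruct (near_neq (RtoC 0) z Hz) as (d & Hd & K). exists d. split; [exact Hd|].
    intros u Hu. destruct (excluded_middle_informative (u = (RtoC 0))); [|reflexivity].
    exfalso. apply (K u Hu). assumption.
  - apply cderiv_slope.
    exists (fun u => match excluded_middle_informative (u = (RtoC 0)) with
       | left _ => (- / (z * z))%C | right _ => (- / z * / u)%C end).
    destruct (excluded_middle_informative (z = (RtoC 0))) as [E|_]; [tauto|].
    split; [field; exact Hz|]. split.
    + apply ccont_ext with (fun u => (- / z) * / u)%C.
      * destruct (near_neq (RtoC 0) z Hz) as (d & Hd & K). exists d. split; [exact Hd|].
        intros u Hu. destruct (excluded_middle_informative (u = (RtoC 0))); [|reflexivity].
        exfalso. apply (K u Hu). assumption.
      * apply ccont_mult; [apply ccont_const|exact Hc].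
    + intros u. destruct (excluded_middle_informative (u = (RtoC 0))) as [E|N].
      * reflexivity.
      * field. auto.
Qed.

Lemma holo_const (c z : C) : holo (fun _ => c) z.
Proof. eexists. apply cderiv_const. Qed.
Lemma holo_id (z : C) : holo (fun u => u) z.
Proof. eexists. apply cderiv_id. Qed.
Lemma holo_plus (f g : C -> C) (z : C) :
  holo f z -> holo g z -> holo (fun u => f u + g u)%C z.
Proof. intros [a Ha] [b Hb]. eexists. apply cderiv_plus; eassumption. Qed.
Lemma holo_mult (f g : C -> C) (z : C) :
  holo f z -> holo g z -> holo (fun u => f u * g u)%C z.
Proof. intros [a Ha] [b Hb]. eexists. apply cderiv_mult; eassumption. Qed.
Lemma holo_comp (f g : C -> C) (z : C) :
  holo g z -> holo f (g z) -> holo (fun u => f (g u)) z.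
Proof.
  intros [a Ha] [b Hb]. eexists. apply (cderiv_comp f g); eassumption.
Qed.
Lemma holo_inv (f : C -> C) (z : C) :
  holo f z -> f z <> (RtoC 0) -> holo (fun u => / f u)%C z.
Proof.
  intros Hf H0. apply (holo_comp (fun u => / u)%C f); [exact Hf|].
  eexists. apply cderiv_inv, H0.
Qed.
Lemma holo_opp (f : C -> C) (z : C) : holo f z -> holo (fun u => - f u)%C z.
Proof.
  intros Hf. apply holo_ext with (fun u => (- 1) * f u)%C.
  - exists 1. split; [lra|]. intros; ring.
  - apply holo_mult; [apply holo_const|exact Hf].
Qed.
Lemma holo_minus (f g : C -> C) (z : C) :
  holo f z -> holo g z -> holo (fun u => f u - g u)%C z.
Proof. intros Hf Hg. apply holo_plus; [exact Hf|apply holo_opp, Hg]. Qed.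
Lemma holo_div (f g : C -> C) (z : C) :
  holo f z -> holo g z -> g z <> (RtoC 0) -> holo (fun u => f u / g u)%C z.
Proof. intros Hf Hg H0. apply holo_mult; [exact Hf|apply holo_inv; assumption]. Qed.
Lemma holo_pow (f : C -> C) (z : C) (n : nat) :
  holo f z -> holo (fun u => f u ^ n)%C z.
Proof.
  intros Hf. induction n as [|n IH]; simpl; [apply holo_const|].
  apply holo_mult; assumption.
Qed.

Lemma cderiv_opp (f : C -> C) (z a : C) : cderiv f z a -> cderiv (fun u => - f u)%C z (- a).
Proof.
  intros Hf. apply cderiv_ext with (fun u => (- 1) * f u)%C.
  - exists 1. split; [lra|]. intros; ring.
  - replace (- a)%C with (0 * f z + (-1) * a)%C by ring.
    apply (cderiv_mult (fun _ => - 1)%C f); [apply cderiv_const|exact Hf].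
Qed.

Lemma cderiv_minus (f g : C -> C) (z a b : C) :
  cderiv f z a -> cderiv g z b -> cderiv (fun u => f u - g u)%C z (a - b).
Proof. intros Hf Hg. apply cderiv_plus; [exact Hf|apply cderiv_opp, Hg]. Qed.

Lemma cderiv_div (f g : C -> C) (z a b : C) :
  cderiv f z a -> cderiv g z b -> g z <> (RtoC 0) ->
  cderiv (fun u => f u / g u)%C z ((a * g z - f z * b) / (g z * g z)).
Proof.
  intros Hf Hg H0.
  replace ((a * g z - f z * b) / (g z * g z))%C
    with (a * / g z + f z * (- / (g z * g z) * b))%C by (field; exact H0).
  apply (cderiv_mult f (fun u => / g u)%C); [exact Hf|].
  apply (cderiv_comp (fun u => / u)%C g); [exact Hg|apply cderiv_inv, H0].
Qed.

Lemma cderiv_unique (f : C -> C) (z a b : C) : cderiv f z a -> cderiv f z b -> a = b.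
Proof.
  intros Ha Hb. apply NNPP. intros N. apply Cmod_sub_pos in N.
  set (e := Cmod (a - b) / 4) in *.
  destruct (near_and _ _ _ (Ha e ltac:(unfold e; lra)) (Hb e ltac:(unfold e; lra)))
    as (d & Hd & K).
  set (u := (z + RtoC (d / 2))%C).
  assert (Eu : (u - z)%C = RtoC (d / 2)) by (unfold u; ring).
  assert (Hm : Cmod (u - z) = d / 2) by (rewrite Eu, Cmod_R, Rabs_pos_eq; lra).
  destruct (K u ltac:(lra)) as [K1 K2].
  assert (T := Cmod_triangle (f u - f z - b * (u - z)) (- (f u - f z - a * (u - z)))).
  rewrite Cmod_opp in T.
  replace (f u - f z - b * (u - z) + - (f u - f z - a * (u - z)))%C
    with ((a - b) * (u - z))%C in T by ring.
  rewrite Cmod_mult, Hm in T. rewrite Hm in K1, K2. unfold e in *.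
  assert (0 < Cmod (a - b) * (d / 2)) by (apply Rmult_lt_0_compat; lra). lra.
Qed.

(* Junk value where [f] is not differentiable. *)
Definition dv (f : C -> C) (z : C) : C := epsilon (inhabits (RtoC 0)) (cderiv f z).

Lemma dv_correct (f : C -> C) (z : C) : holo f z -> cderiv f z (dv f z).
Proof. intros H. unfold dv. apply epsilon_spec. exact H. Qed.

Lemma dv_eq (f : C -> C) (z l : C) : cderiv f z l -> dv f z = l.
Proof.
  intros H. apply (cderiv_unique f z); [|exact H]. apply dv_correct. exists l. exact H.
Qed.

(** * Goursat's theorem *)

Definition rcont (f : R -> C) (t : R) : Prop :=
  forall eps, 0 < eps -> exists del, 0 < del /\
    forall u, Rabs (u - t) < del -> Cmod (f u - f t) < eps.

Definition CInt (f : R -> C) (a b : R) : C :=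
  (RInt (fun t => Re (f t)) a b, RInt (fun t => Im (f t)) a b).

Definition cintegrable (f : R -> C) (a b : R) : Prop :=
  ex_RInt (fun t => Re (f t)) a b /\ ex_RInt (fun t => Im (f t)) a b.

Lemma rcont_continuous (f : R -> C) (t : R) : rcont f t ->
  continuous (fun t => Re (f t)) t /\ continuous (fun t => Im (f t)) t.
Proof.
  intros H. split; intros P [e He]; destruct (H e (cond_pos e)) as (d & Hd & K);
    exists (mkposreal d Hd); intros u Hu; apply He; specialize (K u Hu).
  - apply Rle_lt_trans with (2 := K).
    apply (re_le_Cmod (f u - f t)).
  - apply Rle_lt_trans with (2 := K).
    apply (im_le_Cmod (f u - f t)).
Qed.

Lemma rcont_cintegrable (f : R -> C) (a b : R) : a <= b ->
  (forall t, a <= t <= b -> rcont f t) -> cintegrable f a b.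
Proof.
  intros Hab H. split; apply (ex_RInt_continuous (V := R_CompleteNormedModule));
    intros t Ht; rewrite Rmin_left, Rmax_right in Ht by exact Hab;
    apply rcont_continuous, H, Ht.
Qed.

Lemma cintegrable_plus (f g : R -> C) (a b : R) :
  cintegrable f a b -> cintegrable g a b -> cintegrable (fun t => f t + g t)%C a b.
Proof.
  intros [A B] [A' B']. split; apply (ex_RInt_plus (V := R_NormedModule)); assumption.
Qed.

Lemma CInt_plus (f g : R -> C) (a b : R) :
  cintegrable f a b -> cintegrable g a b ->
  CInt (fun t => f t + g t)%C a b = (CInt f a b + CInt g a b)%C.
Proof.
  intros [A B] [A' B']. unfold CInt, Cplus. simpl. f_equal.
  - exact (RInt_plus _ _ _ _ A A').
  - exact (RInt_plus _ _ _ _ B B').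
Qed.

Lemma cintegrable_scal (c : C) (f : R -> C) (a b : R) :
  cintegrable f a b -> cintegrable (fun t => c * f t)%C a b.
Proof.
  intros [A B]. destruct c as [x y]. split.
  - apply (ex_RInt_minus (V := R_NormedModule));
      apply (ex_RInt_scal (V := R_NormedModule)); assumption.
  - apply (ex_RInt_plus (V := R_NormedModule));
      apply (ex_RInt_scal (V := R_NormedModule)); assumption.
Qed.

Lemma CInt_scal (c : C) (f : R -> C) (a b : R) :
  cintegrable f a b -> CInt (fun t => c * f t)%C a b = (c * CInt f a b)%C.
Proof.
  intros [A B]. destruct c as [x y]. unfold CInt, Cmult. simpl. f_equal.
  - etransitivity; [apply (RInt_minus (V := R_CompleteNormedModule)); apply (ex_RInt_scal (V := R_NormedModule)); assumption|].
    unfold minus, plus, opp; simpl. unfold Rminus. f_equal; [|f_equal].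
    + exact (RInt_scal _ _ _ x A).
    + exact (RInt_scal _ _ _ y B).
  - etransitivity; [apply (RInt_plus (V := R_CompleteNormedModule)); apply (ex_RInt_scal (V := R_NormedModule)); assumption|].
    unfold plus; simpl. f_equal.
    + exact (RInt_scal _ _ _ x B).
    + exact (RInt_scal _ _ _ y A).
Qed.

Lemma CInt_Chasles (f : R -> C) (a b c : R) :
  cintegrable f a b -> cintegrable f b c ->
  (CInt f a b + CInt f b c)%C = CInt f a c.
Proof.
  intros [A B] [A' B']. unfold CInt, Cplus. simpl. f_equal.
  - exact (RInt_Chasles _ _ _ _ A A').
  - exact (RInt_Chasles _ _ _ _ B B').
Qed.

(** The factor 2 comes from estimating the real and imaginary parts separately; later uses need the
    estimate only up to a constant. *)
Lemma CInt_bound (f : R -> C) (a b M : R) : a <= b -> cintegrable f a b ->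
  (forall t, a <= t <= b -> Cmod (f t) <= M) -> Cmod (CInt f a b) <= 2 * ((b - a) * M).
Proof.
  intros Hab [A B] H. eapply Rle_trans; [apply Cmod_le_ReIm|]. unfold CInt; simpl.
  assert (H1 := abs_RInt_le_const _ a b M Hab A).
  assert (H2 := abs_RInt_le_const _ a b M Hab B).
  assert (Rabs (RInt (fun t => Re (f t)) a b) <= (b - a) * M).
  { apply H1. intros t Ht. eapply Rle_trans; [apply re_le_Cmod|auto]. }
  assert (Rabs (RInt (fun t => Im (f t)) a b) <= (b - a) * M).
  { apply H2. intros t Ht. eapply Rle_trans; [apply im_le_Cmod|auto]. }
  lra.
Qed.

Lemma RInt_ext_all (f g : R -> R) (a b : R) :
  (forall t : R, f t = g t :> R) -> RInt f a b = RInt g a b.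
Proof. intros H. apply RInt_ext. intros t _. apply H. Qed.

Lemma CInt_affine (p q : C) (a b : R) :
  CInt (fun t => p + q * RtoC t)%C a b =
  (p * RtoC (b - a) + q * RtoC ((b * b - a * a) / 2))%C.
Proof.
  assert (H : forall x y, RInt (fun t => x + y * t) a b =
    x * (b - a) + y * ((b * b - a * a) / 2)).
  { intros x y. apply is_RInt_unique.
    replace (x * (b - a) + y * ((b * b - a * a) / 2))
      with (minus (x * b + y * (b * b / 2)) (x * a + y * (a * a / 2)))
      by (unfold minus, plus, opp; simpl; field).
    apply (is_RInt_derive (fun t => x * t + y * (t * t / 2))).
    - intros t _. auto_derive; [exact I|]. field.
    - intros t _. apply (ex_derive_continuous (fun t => x + y * t)).
      auto_derive. exact I. }
  destruct p as [p1 p2], q as [q1 q2]. apply C_ext; unfold CInt; cbn [Re Im fst snd].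
  - rewrite (RInt_ext_all _ (fun t => p1 + q1 * t)); [|intros t; simpl; ring].
    rewrite H. simpl. ring.
  - rewrite (RInt_ext_all _ (fun t => p2 + q2 * t)); [|intros t; simpl; ring].
    rewrite H. simpl. ring.
Qed.

Lemma CInt_ext_all (f g : R -> C) (a b : R) :
  (forall t, f t = g t) -> CInt f a b = CInt g a b.
Proof.
  intros H. unfold CInt. f_equal; apply RInt_ext_all; intros t; rewrite H; reflexivity.
Qed.

Lemma CInt_point (f : R -> C) (a : R) : CInt f a a = RtoC 0.
Proof. unfold CInt. rewrite !RInt_point. reflexivity. Qed.

Lemma CInt_Re (f : R -> C) (a b : R) : Re (CInt f a b) = RInt (fun t => Re (f t)) a b.
Proof. reflexivity. Qed.

Global Opaque CInt.

Lemma ccont_rcont (F : C -> C) (g : R -> C) (t : R) :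
  rcont g t -> ccont F (g t) -> rcont (fun t => F (g t)) t.
Proof.
  intros Hg HF eps He. destruct (HF eps He) as (d & Hd & K).
  destruct (Hg d Hd) as (d' & Hd' & K'). exists d'. split; auto.
Qed.

Lemma rcont_hor (c t : R) : rcont (fun s => (s, c)) t.
Proof.
  intros eps He. exists eps. split; [exact He|]. intros u Hu.
  replace ((u, c) - (t, c))%C with (RtoC (u - t))
    by (apply C_ext; simpl; ring).
  rewrite Cmod_R. exact Hu.
Qed.

Lemma rcont_ver (c t : R) : rcont (fun s => (c, s)) t.
Proof.
  intros eps He. exists eps. split; [exact He|]. intros u Hu.
  replace ((c, u) - (c, t))%C with (Ci * RtoC (u - t))%C
    by (apply C_ext; simpl; ring).
  rewrite Cmod_mult, Cmod_Ci, Cmod_R. lra.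
Qed.

Ltac gen_CInt :=
  repeat match goal with |- context [CInt ?f ?a ?b] => generalize (CInt f a b); intro end.

(** The contour integral over the boundary, traversed counterclockwise; the vertical sides carry dz
    = i dt. *)
Definition rect_int (F : C -> C) (a b c d : R) : C :=
  (CInt (fun s => F (s, c)) a b - CInt (fun s => F (s, d)) a b +
   Ci * (CInt (fun t => F (b, t)) c d - CInt (fun t => F (a, t)) c d))%C.

Definition rect (a b c d : R) (z : C) : Prop := a <= Re z <= b /\ c <= Im z <= d.

Lemma rect_hor (F : C -> C) (a b c d x y s : R) :
  (forall z, rect a b c d z -> ccont F z) ->
  a <= x -> x <= y -> y <= b -> c <= s <= d -> cintegrable (fun t => F (t, s)) x y.
Proof.
  intros H Hx Hxy Hy Hs. apply rcont_cintegrable; [exact Hxy|]. intros t Ht.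
  apply (ccont_rcont F (fun t => (t, s))); [apply rcont_hor|].
  apply H. unfold rect; simpl. lra.
Qed.

Lemma rect_ver (F : C -> C) (a b c d x y s : R) :
  (forall z, rect a b c d z -> ccont F z) ->
  c <= x -> x <= y -> y <= d -> a <= s <= b -> cintegrable (fun t => F (s, t)) x y.
Proof.
  intros H Hx Hxy Hy Hs. apply rcont_cintegrable; [exact Hxy|]. intros t Ht.
  apply (ccont_rcont F (fun t => (s, t))); [apply rcont_ver|].
  apply H. unfold rect; simpl. lra.
Qed.

Lemma rect_int_split (F : C -> C) (a m b c n d : R) :
  (forall z, rect a b c d z -> ccont F z) ->
  a <= m -> m <= b -> c <= n -> n <= d ->
  rect_int F a b c d =
  (rect_int F a m c n + rect_int F m b c n + rect_int F a m n d + rect_int F m b n d)%C.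
Proof.
  intros H H1 H2 H3 H4. unfold rect_int.
  rewrite <- (CInt_Chasles (fun s => F (s, c)) a m b),
          <- (CInt_Chasles (fun s => F (s, d)) a m b),
          <- (CInt_Chasles (fun s => F (b, s)) c n d),
          <- (CInt_Chasles (fun s => F (a, s)) c n d);
    [gen_CInt; ring|
     apply (rect_ver F a b c d); [exact H|lra..]| apply (rect_ver F a b c d); [exact H|lra..]|
     apply (rect_ver F a b c d); [exact H|lra..]| apply (rect_ver F a b c d); [exact H|lra..]|
     apply (rect_hor F a b c d); [exact H|lra..]| apply (rect_hor F a b c d); [exact H|lra..]|
     apply (rect_hor F a b c d); [exact H|lra..]| apply (rect_hor F a b c d); [exact H|lra..]].
Qed.

Lemma rect_int_affine (p q : C) (a b c d : R) :
  rect_int (fun z => p + q * z)%C a b c d = RtoC 0.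
Proof.
  unfold rect_int.
  assert (Hh : forall s x y, CInt (fun t => p + q * (t, s))%C x y =
    ((p + q * (Ci * RtoC s)) * RtoC (y - x) + q * RtoC ((y * y - x * x) / 2))%C).
  { intros s x y. rewrite <- CInt_affine. apply CInt_ext_all.
    intros t. apply C_ext; simpl; ring. }
  assert (Hv : forall s x y, CInt (fun t => p + q * (s, t))%C x y =
    ((p + q * RtoC s) * RtoC (y - x) + q * Ci * RtoC ((y * y - x * x) / 2))%C).
  { intros s x y. rewrite <- CInt_affine. apply CInt_ext_all.
    intros t. apply C_ext; simpl; ring. }
  rewrite !Hh, !Hv. destruct p as [p1 p2], q as [q1 q2].
  apply C_ext; simpl; field.
Qed.

Lemma rect_int_bound (F : C -> C) (a b c d M : R) : a <= b -> c <= d ->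
  (forall z, rect a b c d z -> ccont F z) ->
  (forall z, rect a b c d z -> Cmod (F z) <= M) ->
  Cmod (rect_int F a b c d) <= 4 * ((b - a) + (d - c)) * M.
Proof.
  intros Hab Hcd HC HM. unfold rect_int.
  assert (Hh : forall s, c <= s <= d -> Cmod (CInt (fun t => F (t, s)) a b) <= 2 * ((b - a) * M)).
  { intros s Hs. apply CInt_bound; [exact Hab|eapply rect_hor; [exact HC|lra..]|].
    intros t Ht. apply HM. unfold rect; simpl; lra. }
  assert (Hv : forall s, a <= s <= b -> Cmod (CInt (fun t => F (s, t)) c d) <= 2 * ((d - c) * M)).
  { intros s Hs. apply CInt_bound; [exact Hcd|eapply rect_ver; [exact HC|lra..]|].
    intros t Ht. apply HM. unfold rect; simpl; lra. }
  eapply Rle_trans; [apply Cmod_triangle|]. rewrite Cmod_mult, Cmod_Ci.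
  assert (T1 := Cmod_triangle (CInt (fun t => F (t, c)) a b) (- CInt (fun t => F (t, d)) a b)).
  assert (T2 := Cmod_triangle (CInt (fun t => F (b, t)) c d) (- CInt (fun t => F (a, t)) c d)).
  rewrite Cmod_opp in T1, T2.
  assert (A1 := Hh c ltac:(lra)). assert (A2 := Hh d ltac:(lra)).
  assert (A3 := Hv a ltac:(lra)). assert (A4 := Hv b ltac:(lra)).
  unfold Cminus. lra.
Qed.

Lemma rect_int_plus (F G : C -> C) (a b c d : R) : a <= b -> c <= d ->
  (forall z, rect a b c d z -> ccont F z) ->
  (forall z, rect a b c d z -> ccont G z) ->
  rect_int (fun z => F z + G z)%C a b c d = (rect_int F a b c d + rect_int G a b c d)%C.
Proof.
  intros Hab Hcd HF HG. unfold rect_int.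
  assert (Hh : forall s, c <= s <= d -> CInt (fun t => F (t, s) + G (t, s))%C a b =
    (CInt (fun t => F (t, s)) a b + CInt (fun t => G (t, s)) a b)%C).
  { intros s Hs. exact (CInt_plus (fun t => F (t, s)) (fun t => G (t, s)) a b
      (rect_hor F a b c d a b s HF (Rle_refl _) Hab (Rle_refl _) Hs)
      (rect_hor G a b c d a b s HG (Rle_refl _) Hab (Rle_refl _) Hs)). }
  assert (Hv : forall s, a <= s <= b -> CInt (fun t => F (s, t) + G (s, t))%C c d =
    (CInt (fun t => F (s, t)) c d + CInt (fun t => G (s, t)) c d)%C).
  { intros s Hs. exact (CInt_plus (fun t => F (s, t)) (fun t => G (s, t)) c d
      (rect_ver F a b c d c d s HF (Rle_refl _) Hcd (Rle_refl _) Hs)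
      (rect_ver G a b c d c d s HG (Rle_refl _) Hcd (Rle_refl _) Hs)). }
  rewrite (Hh c), (Hh d), (Hv a), (Hv b) by lra. gen_CInt. ring.
Qed.

Lemma nested_intervals (a : nat -> R) (w : R) :
  (forall n, a n <= a (S n)) ->
  (forall n, a (S n) + w / 2 ^ S n <= a n + w / 2 ^ n) -> 0 <= w ->
  exists x, forall n, a n <= x <= a n + w / 2 ^ n.
Proof.
  intros H1 H2 Hw.
  assert (M1 : forall n k, a n <= a (n + k)%nat).
  { intros n k. induction k as [|k IH]; [rewrite Nat.add_0_r; lra|].
    rewrite Nat.add_succ_r. specialize (H1 (n + k)%nat). lra. }
  assert (M2 : forall n k, a (n + k)%nat + w / 2 ^ (n + k) <= a n + w / 2 ^ n).
  { intros n k. induction k as [|k IH]; [rewrite Nat.add_0_r; lra|].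
    rewrite Nat.add_succ_r. specialize (H2 (n + k)%nat). lra. }
  assert (P : forall n, 0 <= w / 2 ^ n).
  { intros n. apply Rmult_le_pos; [exact Hw|]. left. apply Rinv_0_lt_compat, pow_lt. lra. }
  assert (B : forall n k, a k <= a n + w / 2 ^ n).
  { intros n k. destruct (Nat.le_gt_cases n k) as [Hnk|Hnk].
    - replace k with (n + (k - n))%nat by lia. specialize (M2 n (k - n)%nat).
      specialize (P (n + (k - n))%nat). lra.
    - specialize (M1 k (n - k)%nat). replace (k + (n - k))%nat with n in M1 by lia.
      specialize (P n). lra. }
  destruct (completeness (fun x => exists n, x = a n)) as [x [Hx1 Hx2]].
  - exists (a O + w / 2 ^ O). intros y [n ->]. apply B.
  - exists (a O). exists O. reflexivity.
  - exists x. intros n. split.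
    + apply Hx1. exists n. reflexivity.
    + apply Hx2. intros y [k ->]. apply B.
Qed.

(** Bisection: an integral exceeding k times the squared half-perimeter passes to one of the four
    quarters, and differentiability at the limit point contradicts this at a small scale. *)
Lemma goursat (F : C -> C) (a b c d : R) : a <= b -> c <= d ->
  (forall z, rect a b c d z -> holo F z) -> rect_int F a b c d = RtoC 0.
Proof.
  intros Hab Hcd HF. apply NNPP. intros N. apply Cmod_gt_0 in N.
  set (w := b - a). set (h := d - c).
  assert (Hw : 0 <= w) by (unfold w; lra). assert (Hh : 0 <= h) by (unfold h; lra).
  assert (HC : forall z, rect a b c d z -> ccont F z) by (intros; apply holo_ccont; auto).
  assert (Hwh : 0 < w + h).
  { destruct (Rle_lt_or_eq_dec 0 (w + h)) as [L|L]; [lra|exact L|].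
    exfalso. destruct (HF (a, c)) as [l Hl]; [unfold rect; simpl; lra|].
    assert (Ea : b = a) by (unfold w, h in *; lra).
    assert (Ec : d = c) by (unfold w, h in *; lra). subst b d.
    unfold rect_int in N. rewrite !CInt_point in N.
    replace (RtoC 0 - RtoC 0 + Ci * (RtoC 0 - RtoC 0))%C with (RtoC 0) in N by ring.
    rewrite Cmod_0 in N. lra. }
  (* Half of the initial quotient, so that the whole rectangle is bad with a strict inequality. *)
  set (k := Cmod (rect_int F a b c d) / (2 * (w + h) ^ 2)).
  assert (Hsq : 0 < (w + h) ^ 2) by (apply pow_lt; lra).
  assert (Hk : 0 < k) by (unfold k; apply Rdiv_lt_0_compat; lra).
  set (bad := fun n (p : C) =>
    rect a b c d p /\ rect a b c d (Re p + w / 2 ^ n, Im p + h / 2 ^ n) /\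
    k * (w / 2 ^ n + h / 2 ^ n) ^ 2 <
    Cmod (rect_int F (Re p) (Re p + w / 2 ^ n) (Im p) (Im p + h / 2 ^ n))).
  assert (Hstep : forall n p, bad n p -> exists q, bad (S n) q /\
    Re p <= Re q /\ Re q + w / 2 ^ S n <= Re p + w / 2 ^ n /\
    Im p <= Im q /\ Im q + h / 2 ^ S n <= Im p + h / 2 ^ n).
  { intros n [x y] ([Hx Hy] & [Hx' Hy'] & Hb). cbn [Re Im fst snd] in *.
    assert (Q : forall v, v / 2 ^ n = v / 2 ^ S n + v / 2 ^ S n).
    { intros v. simpl. field. apply pow_nonzero. lra. }
    assert (P : forall v, 0 <= v -> 0 <= v / 2 ^ S n).
    { intros v Hv. apply Rmult_le_pos; [exact Hv|]. left.
      apply Rinv_0_lt_compat, pow_lt. lra. }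
    assert (Pw := P w Hw). assert (Ph := P h Hh).
    rewrite !Q in *. set (w' := w / 2 ^ S n) in *. set (h' := h / 2 ^ S n) in *.
    unfold bad. fold w' h'.
    apply NNPP. intros Hn.
    assert (G : forall x' y', (x' = x \/ x' = x + w') -> (y' = y \/ y' = y + h') ->
      Cmod (rect_int F x' (x' + w') y' (y' + h')) <= k * (w' + h') ^ 2).
    { intros x' y' Hx1 Hy1. apply Rnot_lt_le. intros L. apply Hn. exists (x', y').
      cbn [Re Im fst snd]. unfold rect; cbn [Re Im fst snd].
      repeat split; try (destruct Hx1, Hy1; subst; lra). }
    assert (Hs : forall z, rect x (x + (w' + w')) y (y + (h' + h')) z -> ccont F z).
    { intros z [Hz1 Hz2]. apply HC. unfold rect. lra. }
    rewrite (rect_int_split F x (x + w') _ y (y + h') _ Hs) in Hb by lra.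
    assert (G1 := G x y ltac:(lra) ltac:(lra)).
    assert (G2 := G (x + w') y ltac:(lra) ltac:(lra)).
    assert (G3 := G x (y + h') ltac:(lra) ltac:(lra)).
    assert (G4 := G (x + w') (y + h') ltac:(lra) ltac:(lra)).
    apply Rlt_not_le in Hb. apply Hb.
    rewrite <- (Rplus_assoc x w' w'), <- (Rplus_assoc y h' h').
    replace (k * (w' + w' + (h' + h')) ^ 2)
      with (k * (w' + h') ^ 2 + k * (w' + h') ^ 2 + k * (w' + h') ^ 2 + k * (w' + h') ^ 2)
      by ring.
    do 3 (eapply Rle_trans; [apply Cmod_triangle|]; apply Rplus_le_compat; [|assumption]).
    assumption. }
  assert (H0 : bad O (a, c)).
  { unfold bad; simpl. replace (a + w / 1) with b by (unfold w; field).
    replace (c + h / 1) with d by (unfold h; field).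
    unfold rect; simpl. repeat split; try lra.
    replace ((w / 1 + h / 1) * ((w / 1 + h / 1) * 1)) with ((w + h) ^ 2) by field.
    unfold k. replace (Cmod (rect_int F a b c d) / (2 * (w + h) ^ 2) * (w + h) ^ 2)
      with (Cmod (rect_int F a b c d) / 2) by (field; lra). lra. }
  set (st := fix st n := match n with
     | O => (a, c)
     | S n => epsilon (inhabits (RtoC 0)) (fun q => bad (S n) q /\
    Re (st n) <= Re q /\ Re q + w / 2 ^ S n <= Re (st n) + w / 2 ^ n /\
    Im (st n) <= Im q /\ Im q + h / 2 ^ S n <= Im (st n) + h / 2 ^ n) end).
  assert (Hst : forall n, bad n (st n)).
  { induction n as [|n IH]; [exact H0|]. simpl.
    apply (epsilon_spec (inhabits (RtoC 0)) _ (Hstep n (st n) IH)). }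
  assert (Hst' : forall n,
    Re (st n) <= Re (st (S n)) /\ Re (st (S n)) + w / 2 ^ S n <= Re (st n) + w / 2 ^ n /\
    Im (st n) <= Im (st (S n)) /\ Im (st (S n)) + h / 2 ^ S n <= Im (st n) + h / 2 ^ n).
  { intros n. apply (epsilon_spec (inhabits (RtoC 0)) _ (Hstep n (st n) (Hst n))). }
  destruct (nested_intervals (fun n => Re (st n)) w) as [x Hx];
    [apply Hst'|apply Hst'|exact Hw|].
  destruct (nested_intervals (fun n => Im (st n)) h) as [y Hy];
    [apply Hst'|apply Hst'|exact Hh|].
  destruct (HF (x, y)) as [l Hl].
  { destruct (Hst O) as ([A1 A2] & [A3 A4] & _). specialize (Hx O). specialize (Hy O).
    simpl in *. unfold rect; simpl. unfold w, h in *. lra. }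
  (* [rect_int_bound] turns an error of k / 8 per unit of distance into k / 2 times the squared
     half-perimeter, below the threshold k of a bad rectangle. *)
  destruct (Hl (k / 8) ltac:(lra)) as (del & Hdel & K).
  assert (Hlim : exists n, (w + h) / 2 ^ n < del).
  { destruct (pow_lt_1_zero (/ 2) ltac:(rewrite Rabs_pos_eq; lra) (del / (w + h))) as [n Hn].
    - apply Rdiv_lt_0_compat; lra.
    - exists n. specialize (Hn n (le_n n)). rewrite Rabs_pos_eq in Hn.
      + apply Rdiv_mult_lt in Hn; [|exact Hwh]. rewrite pow_inv in Hn. exact Hn.
      + apply pow_le. lra. }
  destruct Hlim as [n Hn].
  destruct (Hst n) as ([A1 A2] & [A3 A4] & Hb). specialize (Hx n). specialize (Hy n).
  replace ((w + h) / 2 ^ n) with (w / 2 ^ n + h / 2 ^ n) in Hn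
    by (field; apply pow_nonzero; lra).
  set (w' := w / 2 ^ n) in *. set (h' := h / 2 ^ n) in *.
  destruct (st n) as [x0 y0]. cbn [Re Im fst snd] in *.
  set (z0 := (x, y) : C) in *.
  set (A := fun z => (F z0 - l * z0 + l * z)%C).
  set (E := fun z => (F z - A z)%C).
  assert (HCA : forall z, ccont A z).
  { intros z. unfold A. apply ccont_plus; [apply ccont_const|].
    apply ccont_mult; [apply ccont_const|apply ccont_id]. }
  assert (Hsub : forall z, rect x0 (x0 + w') y0 (y0 + h') z -> rect a b c d z).
  { unfold rect; intros z Hz; lra. }
  assert (HCE : forall z, rect x0 (x0 + w') y0 (y0 + h') z -> ccont E z).
  { intros z Hz. unfold E. apply ccont_plus; [apply HC, Hsub, Hz|].
    apply ccont_ext with (fun u => (RtoC (-1)) * A u)%C.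
    - exists 1. split; [lra|]. intros; ring.
    - apply ccont_mult; [apply ccont_const|apply HCA]. }
  assert (HEb : forall z, rect x0 (x0 + w') y0 (y0 + h') z -> Cmod (E z) <= k / 8 * (w' + h')).
  { intros z Hz. unfold E, A.
    replace (F z - (F z0 - l * z0 + l * z))%C with (F z - F z0 - l * (z - z0))%C by ring.
    assert (Hd : Cmod (z - z0) <= w' + h').
    { eapply Rle_trans; [apply Cmod_le_ReIm|]. unfold rect in Hz.
      replace (Re (z - z0)%C) with (Re z - x) by reflexivity.
      replace (Im (z - z0)%C) with (Im z - y) by reflexivity.
      apply Rplus_le_compat; apply Rabs_le; lra. }
    eapply Rle_trans; [apply K; lra|]. apply Rmult_le_compat_l; lra. }
  assert (HI : rect_int F x0 (x0 + w') y0 (y0 + h') = rect_int E x0 (x0 + w') y0 (y0 + h')).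
  { transitivity (rect_int (fun z => A z + E z)%C x0 (x0 + w') y0 (y0 + h')).
    - unfold rect_int, E.
      f_equal; [|f_equal]; f_equal; try apply (f_equal Copp);
        apply CInt_ext_all; intros t; ring.
    - rewrite rect_int_plus; try lra; [|intros; apply HCA|exact HCE].
      unfold A at 1. rewrite rect_int_affine. ring. }
  rewrite HI in Hb.
  assert (HB := rect_int_bound E x0 (x0 + w') y0 (y0 + h') _ ltac:(lra) ltac:(lra) HCE HEb).
  assert (HP : 0 <= k * (w' + h') ^ 2) by (apply Rmult_le_pos; [lra|apply pow2_ge_0]).
  lra.
Qed.

(** * Mean values on circles *)

Definition cis (t : R) : C := (cos t, sin t).

Definition Cexp (z : C) : C := (RtoC (exp (Re z)) * cis (Im z))%C.

Lemma cis_plus (s t : R) : cis (s + t) = (cis s * cis t)%C.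
Proof. apply C_ext; simpl; [rewrite cos_plus|rewrite sin_plus]; ring. Qed.

Lemma Cmod_cis (t : R) : Cmod (cis t) = 1.
Proof.
  unfold Cmod, cis; simpl. rewrite !Rmult_1_r, Rplus_comm.
  replace (sin t * sin t + cos t * cos t) with 1; [apply sqrt_1|].
  symmetry. exact (sin2_cos2 t).
Qed.

Lemma Cexp_plus (u v : C) : Cexp (u + v) = (Cexp u * Cexp v)%C.
Proof.
  unfold Cexp. rewrite Re_plus, Im_plus, exp_plus, cis_plus, RtoC_mult. ring.
Qed.

Lemma derivable_bound (f : R -> R) (l eps : R) : derivable_pt_lim f 0 l -> 0 < eps ->
  exists del, 0 < del /\ forall x, Rabs x < del -> Rabs (f x - f 0 - l * x) <= eps * Rabs x.
Proof.
  intros H He. destruct (H eps He) as [d Hd]. exists d. split; [apply cond_pos|].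
  intros x Hx. destruct (Req_dec x 0) as [->|N].
  - rewrite Rmult_0_r, !Rminus_diag, Rabs_R0. lra.
  - specialize (Hd x N Hx). rewrite Rplus_0_l in Hd.
    replace (f x - f 0 - l * x) with (((f x - f 0) / x - l) * x) by (field; exact N).
    rewrite Rabs_mult. apply Rmult_le_compat_r; [apply Rabs_pos|lra].
Qed.

(** The addition theorem transports the derivative from 0 to every other point, so an estimate is
    needed only here. *)
Lemma cderiv_Cexp_0 : cderiv Cexp 0 1.
Proof.
  (* Of the eight units eps / 8, one serves exp in the real part, two the product of exp with cos,
     four the product (exp x - 1) sin y, and one sin. *)
  intros eps He. set (e := Rmin (eps / 8) (1 / 2)).
  assert (E1 : e <= eps / 8) by apply Rmin_l. assert (E2 : e <= 1 / 2) by apply Rmin_r.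
  assert (E0 : 0 < e) by (apply Rmin_pos; lra).
  destruct (derivable_bound exp 1 e derivable_pt_lim_exp_0 E0) as (d1 & D1 & K1).
  destruct (derivable_bound sin 1 e) as (d2 & D2 & K2); [|exact E0|].
  { rewrite <- cos_0. apply derivable_pt_lim_sin. }
  destruct (derivable_bound cos 0 e) as (d3 & D3 & K3); [|exact E0|].
  { replace 0 with (- sin 0) at 2 by (rewrite sin_0; ring). apply derivable_pt_lim_cos. }
  exists (Rmin (Rmin d1 d2) (Rmin d3 e)). split; [repeat apply Rmin_pos; lra|].
  intros [x y] Hu. replace ((x, y) - 0)%C with ((x, y) : C) in * by (apply C_ext; simpl; ring).
  assert (M1 := Rmin_l (Rmin d1 d2) (Rmin d3 e)).
  assert (M2 := Rmin_r (Rmin d1 d2) (Rmin d3 e)).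
  assert (M3 := Rmin_l d1 d2). assert (M4 := Rmin_r d1 d2).
  assert (M5 := Rmin_l d3 e). assert (M6 := Rmin_r d3 e).
  assert (Hx := re_le_Cmod (x, y)). assert (Hy := im_le_Cmod (x, y)).
  cbn [Re Im fst snd] in Hx, Hy.
  specialize (K1 x ltac:(lra)). specialize (K2 y ltac:(lra)). specialize (K3 y ltac:(lra)).
  rewrite exp_0 in K1. rewrite sin_0 in K2. rewrite cos_0 in K3.
  set (m := Cmod (x, y)) in *.
  assert (P := Rabs_pos x). assert (P' := Rabs_pos y).
  assert (exx : e * Rabs x <= eps / 8 * m) by (apply Rmult_le_compat; lra).
  assert (eyy : e * Rabs y <= eps / 8 * m) by (apply Rmult_le_compat; lra).
  assert (hx : e * Rabs x <= 1 / 2 * Rabs x) by (apply Rmult_le_compat_r; lra).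
  assert (hy : e * Rabs y <= 1 / 2 * Rabs y) by (apply Rmult_le_compat_r; lra).
  assert (Ex1 : Rabs (exp x - 1) <= 2 * Rabs x).
  { replace (exp x - 1) with ((exp x - 1 - 1 * x) + x) by ring.
    eapply Rle_trans; [apply Rabs_triang|]. lra. }
  assert (Ex : Rabs (exp x) <= 2).
  { replace (exp x) with ((exp x - 1) + 1) by ring.
    eapply Rle_trans; [apply Rabs_triang|]. rewrite Rabs_R1. lra. }
  assert (Sy : Rabs (sin y) <= 2 * Rabs y).
  { replace (sin y) with ((sin y - 0 - 1 * y) + y) by ring.
    eapply Rle_trans; [apply Rabs_triang|]. lra. }
  eapply Rle_trans; [apply Cmod_le_ReIm|].
  assert (HRe : Re (Cexp (x, y) - Cexp 0 - 1 * (x, y)) =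
    (exp x - 1 - 1 * x) + exp x * (cos y - 1 - 0 * y)).
  { unfold Cexp, cis; simpl. rewrite exp_0, cos_0, sin_0. ring. }
  assert (HIm : Im (Cexp (x, y) - Cexp 0 - 1 * (x, y)) =
    (exp x - 1) * sin y + (sin y - 0 - 1 * y)).
  { unfold Cexp, cis; simpl. rewrite exp_0, cos_0, sin_0. ring. }
  rewrite HRe, HIm.
  assert (A := Rabs_triang (exp x - 1 - 1 * x) (exp x * (cos y - 1 - 0 * y))).
  assert (B := Rabs_triang ((exp x - 1) * sin y) (sin y - 0 - 1 * y)).
  rewrite Rabs_mult in A, B.
  assert (Rabs (exp x) * Rabs (cos y - 1 - 0 * y) <= 2 * (e * Rabs y))
    by (apply Rmult_le_compat; try apply Rabs_pos; lra).
  assert (Rabs (exp x - 1) * Rabs (sin y) <= (2 * e) * (2 * Rabs y))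
    by (apply Rmult_le_compat; try apply Rabs_pos; lra).
  lra.
Qed.

Lemma cderiv_Cexp (z : C) : cderiv Cexp z (Cexp z).
Proof.
  apply cderiv_ext with (fun u => Cexp z * Cexp (u - z))%C.
  { exists 1. split; [lra|]. intros u _. rewrite <- Cexp_plus. f_equal. ring. }
  assert (H : cderiv (fun u => Cexp (u - z)) z (1 * (1 - 0))).
  { apply (cderiv_comp Cexp (fun u => u - z)%C).
    - apply cderiv_minus; [apply cderiv_id|apply cderiv_const].
    - replace (z - z)%C with (RtoC 0) by ring. apply cderiv_Cexp_0. }
  assert (H' := cderiv_mult (fun _ => Cexp z) _ _ _ _ (cderiv_const (Cexp z) z) H).
  cbv beta in H'. replace (0 * Cexp (z - z) + Cexp z * (1 * (1 - 0)))%C with (Cexp z) in H'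
    by ring. exact H'.
Qed.

Lemma rcont_cis (t : R) : rcont cis t.
Proof.
  assert (H : rcont (fun t => Cexp (0, t)) t).
  { apply (ccont_rcont Cexp (fun t => (0, t))); [apply rcont_ver|].
    eapply cderiv_ccont, cderiv_Cexp. }
  intros eps He. destruct (H eps He) as (d & Hd & K). exists d. split; [exact Hd|].
  intros u Hu. specialize (K u Hu). unfold Cexp in K; cbn [Re Im fst snd] in K.
  rewrite exp_0 in K. replace (cis u - cis t)%C with (1 * cis u - 1 * cis t)%C by ring.
  exact K.
Qed.

(** Not divided by 2 PI. It is the contour integral of f(z) dz / (i z), which is why Cauchy's kernel
    appears below as z / (z - b). *)
Definition mean (f : C -> C) (r : R) : C := CInt (fun t => f (RtoC r * cis t)%C) 0 (2 * PI).

Lemma two_PI_pos : 0 < 2 * PI.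
Proof. assert (H := PI_RGT_0). lra. Qed.

Lemma Cmod_circle (r t : R) : 0 <= r -> Cmod (RtoC r * cis t) = r.
Proof. intros H. rewrite Cmod_mult, Cmod_cis, Cmod_R, Rabs_pos_eq; lra. Qed.

Lemma rcont_circle (r t : R) : rcont (fun t => RtoC r * cis t)%C t.
Proof.
  apply (ccont_rcont (fun z => RtoC r * z)%C cis); [apply rcont_cis|].
  apply ccont_mult; [apply ccont_const|apply ccont_id].
Qed.

Lemma cintegrable_circle (f : C -> C) (r : R) : 0 <= r ->
  (forall z, Cmod z = r -> ccont f z) ->
  cintegrable (fun t => f (RtoC r * cis t)%C) 0 (2 * PI).
Proof.
  intros Hr H. assert (P := two_PI_pos).
  apply rcont_cintegrable; [lra|]. intros t _.
  apply (ccont_rcont f (fun t => RtoC r * cis t)%C); [apply rcont_circle|].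
  apply H, Cmod_circle, Hr.
Qed.

Lemma mean_plus (f g : C -> C) (r : R) : 0 <= r ->
  (forall z, Cmod z = r -> ccont f z) -> (forall z, Cmod z = r -> ccont g z) ->
  mean (fun z => f z + g z)%C r = (mean f r + mean g r)%C.
Proof.
  intros Hr Hf Hg. unfold mean.
  exact (CInt_plus (fun t => f (RtoC r * cis t)%C) (fun t => g (RtoC r * cis t)%C) 0 (2 * PI)
    (cintegrable_circle f r Hr Hf) (cintegrable_circle g r Hr Hg)).
Qed.

Lemma mean_scal (c : C) (f : C -> C) (r : R) : 0 <= r ->
  (forall z, Cmod z = r -> ccont f z) -> mean (fun z => c * f z)%C r = (c * mean f r)%C.
Proof.
  intros Hr Hf. unfold mean.
  exact (CInt_scal c (fun t => f (RtoC r * cis t)%C) 0 (2 * PI) (cintegrable_circle f r Hr Hf)).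
Qed.

Lemma mean_ext (f g : C -> C) (r : R) : 0 <= r ->
  (forall z, Cmod z = r -> f z = g z) -> mean f r = mean g r.
Proof.
  intros Hr H. unfold mean. apply CInt_ext_all. intros t. apply H, Cmod_circle, Hr.
Qed.

Lemma mean_const (c : C) (r : R) : mean (fun _ => c) r = (RtoC (2 * PI) * c)%C.
Proof.
  unfold mean. transitivity (CInt (fun t => c + 0 * RtoC t)%C 0 (2 * PI)).
  - apply CInt_ext_all. intros t. ring.
  - rewrite CInt_affine. rewrite Rminus_0_r. ring.
Qed.

Lemma mean_bound (f : C -> C) (r M : R) : 0 <= r ->
  (forall z, Cmod z = r -> ccont f z) -> (forall z, Cmod z = r -> Cmod (f z) <= M) ->
  Cmod (mean f r) <= 4 * PI * M.
Proof.
  intros Hr Hf HM. assert (P := two_PI_pos). replace (4 * PI * M) with (2 * ((2 * PI - 0) * M)) by ring.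
  apply CInt_bound; [lra|apply cintegrable_circle; assumption|].
  intros t _. apply HM, Cmod_circle, Hr.
Qed.

(* In logarithmic polar coordinates the two radial sides cancel by periodicity. *)
Lemma mean_annulus (f : C -> C) (r1 r2 : R) : 0 < r1 -> r1 <= r2 ->
  (forall z, r1 <= Cmod z <= r2 -> holo f z) -> mean f r1 = mean f r2.
Proof.
  intros H1 H12 Hf. assert (P := two_PI_pos).
  assert (Hln : ln r1 <= ln r2).
  { destruct H12 as [L| ->]; [left; apply ln_increasing; assumption|lra]. }
  assert (G := goursat (fun z => f (Cexp z)) (ln r1) (ln r2) 0 (2 * PI) Hln ltac:(lra)).
  assert (Hh : forall z, rect (ln r1) (ln r2) 0 (2 * PI) z -> holo (fun z => f (Cexp z)) z).
  { intros z [Hz _]. apply (holo_comp f Cexp); [eexists; apply cderiv_Cexp|].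
    apply Hf. unfold Cexp. rewrite Cmod_mult, Cmod_cis, Cmod_R, Rmult_1_r, Rabs_pos_eq
      by (left; apply exp_pos).
    rewrite <- (exp_ln r1), <- (exp_ln r2) by lra.
    destruct Hz as [Ha Hb]. split.
    - destruct Ha as [L|E]; [left; apply exp_increasing; exact L|rewrite E; lra].
    - destruct Hb as [L|E]; [left; apply exp_increasing; exact L|rewrite E; lra]. }
  specialize (G Hh). unfold rect_int in G.
  assert (E1 : CInt (fun s => f (Cexp (s, 0))) (ln r1) (ln r2) =
    CInt (fun s => f (Cexp (s, 2 * PI))) (ln r1) (ln r2)).
  { apply CInt_ext_all. intros s. f_equal. unfold Cexp, cis. cbn [Re Im fst snd].
    rewrite cos_2PI, sin_2PI, cos_0, sin_0. reflexivity. }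
  assert (E2 : forall r, 0 < r -> CInt (fun t => f (Cexp (ln r, t))) 0 (2 * PI) = mean f r).
  { intros r Hr. apply CInt_ext_all. intros t. f_equal. unfold Cexp. cbn [Re Im fst snd].
    rewrite exp_ln by exact Hr. reflexivity. }
  rewrite E1, E2, E2 in G by lra.
  generalize dependent (CInt (fun s => f (Cexp (s, 2 * PI))) (ln r1) (ln r2)).
  intros A G _.
  assert (G2 : (Ci * (mean f r2 - mean f r1) = 0)%C) by (rewrite <- G; ring).
  assert (G3 : (mean f r2 - mean f r1 = 0)%C).
  { replace (mean f r2 - mean f r1)%C with (- Ci * (Ci * (mean f r2 - mean f r1)))%C.
    - rewrite G2. ring.
    - transitivity ((- (Ci * Ci)) * (mean f r2 - mean f r1))%C; [ring|].
      replace (Ci * Ci)%C with (RtoC (-1)) by (apply C_ext; simpl; ring).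
      apply C_ext; simpl; ring. }
  replace (mean f r1) with (mean f r2 - (mean f r2 - mean f r1))%C by ring.
  rewrite G3. ring.
Qed.

Lemma mean_continuous (f : C -> C) (R0 r0 : R) :
  (forall z, Cmod z < R0 -> ccont f z) -> 0 <= r0 < R0 ->
  forall eps, 0 < eps -> exists del, 0 < del /\
    forall r, 0 <= r < R0 -> Rabs (r - r0) < del -> Cmod (mean f r - mean f r0) <= eps.
Proof.
  intros Hf Hr0 eps He. assert (P := two_PI_pos).
  set (e := eps / (4 * PI)). assert (E0 : 0 < e) by (apply Rdiv_lt_0_compat; lra).
  (* Compactness of the interval of angles is taken from the closed disk of radius 2 PI, the angle
     being the real part of its points. *)
  destruct (local_uniform (2 * PI) (fun m u => forall r, 0 <= r < R0 -> Rabs (r - r0) < m ->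
    Cmod (f (RtoC r * cis (Re u))%C - f (RtoC r0 * cis (Re u))%C) <= e)) as (m & Hm & K).
  - intros m m' u L H r Hr Hr'. apply H; [exact Hr|lra].
  - intros z _. set (t := Re z).
    destruct (Hf (RtoC r0 * cis t)%C ltac:(rewrite Cmod_circle; lra) (e / 2) ltac:(lra))
      as (d & Hd & K).
    destruct (rcont_circle r0 t (d / 2) ltac:(lra)) as (d' & Hd' & K').
    exists d'. split; [exact Hd'|]. exists (d / 2). split; [lra|].
    intros u Hu _ r Hr Hr'. set (s := Re u).
    assert (Hs : Rabs (s - t) < d').
    { eapply Rle_lt_trans; [apply (re_le_Cmod (u - z))|exact Hu]. }
    specialize (K' s Hs).
    assert (C1 := K (RtoC r0 * cis s)%C ltac:(lra)).
    assert (C2 : Cmod (f (RtoC r * cis s)%C - f (RtoC r0 * cis t)%C) < e / 2).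
    { apply K. replace (RtoC r * cis s - RtoC r0 * cis t)%C with
        (RtoC (r - r0) * cis s + (RtoC r0 * cis s - RtoC r0 * cis t))%C
        by (rewrite RtoC_minus; ring).
      eapply Rle_lt_trans; [apply Cmod_triangle|].
      rewrite (Cmod_mult (RtoC (r - r0))), Cmod_cis, Cmod_R. lra. }
    assert (T := Cmod_sub_triangle (f (RtoC r * cis s)%C) (f (RtoC r0 * cis t)%C)
      (f (RtoC r0 * cis s)%C)).
    rewrite (Cmod_sub_sym (f (RtoC r0 * cis t)%C)) in T. lra.
  - exists m. split; [exact Hm|]. intros r Hr Hr'.
    assert (I1 : cintegrable (fun t => f (RtoC r * cis t)%C) 0 (2 * PI))
      by (apply cintegrable_circle; [lra|intros; apply Hf; lra]).
    assert (I2 : cintegrable (fun t => f (RtoC r0 * cis t)%C) 0 (2 * PI))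
      by (apply cintegrable_circle; [lra|intros; apply Hf; lra]).
    unfold mean.
    replace (CInt (fun t => f (RtoC r * cis t)%C) 0 (2 * PI) -
      CInt (fun t => f (RtoC r0 * cis t)%C) 0 (2 * PI))%C
      with (CInt (fun t => f (RtoC r * cis t)%C + (-1) * f (RtoC r0 * cis t)%C)%C 0 (2 * PI)).
    + replace eps with (2 * ((2 * PI - 0) * e)) by (unfold e; field; apply PI_neq0).
      apply CInt_bound; [lra| |].
      * apply (cintegrable_plus (fun t => f (RtoC r * cis t)%C)
          (fun t => (-1) * f (RtoC r0 * cis t)%C)%C); [exact I1|].
        apply (cintegrable_scal (-1) (fun t => f (RtoC r0 * cis t)%C)), I2.
      * intros t Ht.
        replace (f (RtoC r * cis t)%C + -1 * f (RtoC r0 * cis t)%C)%C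
          with (f (RtoC r * cis t)%C - f (RtoC r0 * cis t)%C)%C by ring.
        apply (K (RtoC t)); [|exact Hr|exact Hr'].
        rewrite Cmod_R, Rabs_pos_eq; lra.
    + rewrite (CInt_plus (fun t => f (RtoC r * cis t)%C)
          (fun t => (-1) * f (RtoC r0 * cis t)%C)%C); [|exact I1|].
      * rewrite (CInt_scal (-1) (fun t => f (RtoC r0 * cis t)%C)); [gen_CInt; ring|exact I2].
      * apply (cintegrable_scal (-1) (fun t => f (RtoC r0 * cis t)%C)), I2.
Qed.

Lemma Ceq_eps (a b : C) : (forall eps, 0 < eps -> Cmod (a - b) <= eps) -> a = b.
Proof.
  intros H. apply NNPP. intros N. apply Cmod_sub_pos in N.
  specialize (H (Cmod (a - b) / 2) ltac:(lra)). lra.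
Qed.

(* The means are constant on either side of the exceptional circle and continuous in the radius. *)
Lemma mean_value (f : C -> C) (R0 rho r : R) :
  (forall z, Cmod z < R0 -> ccont f z) ->
  (forall z, 0 < Cmod z < R0 -> Cmod z <> rho -> holo f z) ->
  0 < r < R0 -> mean f r = (RtoC (2 * PI) * f (RtoC 0))%C.
Proof.
  intros HC HH Hr.
  assert (Z : mean f 0 = (RtoC (2 * PI) * f (RtoC 0))%C).
  { rewrite <- (mean_const (f (RtoC 0)) 0). unfold mean. apply CInt_ext_all.
    intros t. f_equal. ring. }
  assert (S1 : forall s, 0 < s < R0 -> (s < rho \/ rho <= 0) ->
    mean f s = (RtoC (2 * PI) * f (RtoC 0))%C).
  { intros s Hs Hrho. rewrite <- Z. apply Ceq_eps. intros eps He.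
    destruct (mean_continuous f R0 0 HC ltac:(lra) eps He) as (d & Hd & K).
    set (s' := Rmin (s / 2) (d / 2)). assert (A := Rmin_l (s / 2) (d / 2)).
    assert (B := Rmin_r (s / 2) (d / 2)). fold s' in A, B.
    assert (S0 : 0 < s') by (apply Rmin_pos; lra).
    rewrite <- (mean_annulus f s' s); [|lra|lra|intros z Hz; apply HH; lra].
    apply K; [lra|]. rewrite Rminus_0_r, Rabs_pos_eq; lra. }
  assert (S2 : 0 < rho < R0 -> mean f rho = (RtoC (2 * PI) * f (RtoC 0))%C).
  { intros Hrho. apply Ceq_eps. intros eps He.
    destruct (mean_continuous f R0 rho HC ltac:(lra) eps He) as (d & Hd & K).
    set (s' := Rmax (rho / 2) (rho - d / 2)). assert (A := Rmax_l (rho / 2) (rho - d / 2)).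
    assert (B := Rmax_r (rho / 2) (rho - d / 2)). fold s' in A, B.
    assert (S0 : s' < rho) by (apply Rmax_lub_lt; lra).
    rewrite <- (S1 s' ltac:(lra) ltac:(lra)). rewrite Cmod_sub_sym.
    apply K; [lra|]. rewrite Rabs_left; lra. }
  destruct (Rlt_or_le r rho) as [L|L]; [apply S1; lra|].
  destruct (Rle_or_lt rho 0) as [L0|L0]; [apply S1; lra|].
  destruct L as [L|L]; [|rewrite <- L; apply S2; lra].
  rewrite <- S2 by lra. apply Ceq_eps. intros eps He.
  destruct (mean_continuous f R0 rho HC ltac:(lra) eps He) as (d & Hd & K).
  set (s' := Rmin ((rho + r) / 2) (rho + d / 2)).
  assert (A := Rmin_l ((rho + r) / 2) (rho + d / 2)).
  assert (B := Rmin_r ((rho + r) / 2) (rho + d / 2)). fold s' in A, B.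
  assert (S0 : rho < s') by (apply Rmin_glb_lt; lra).
  rewrite <- (mean_annulus f s' r); [|lra|lra|intros z Hz; apply HH; lra].
  apply K; [lra|]. rewrite Rabs_pos_eq; lra.
Qed.

(** * Taylor expansions *)

Fixpoint psum (c : nat -> C) (z : C) (n : nat) : C :=
  match n with O => RtoC 0 | S n => (psum c z n + c n * z ^ n)%C end.

(* Determines the Taylor coefficients without reference to the value of [f] at 0. *)
Definition asy (f : C -> C) (c : nat -> C) : Prop :=
  forall N, exists B rho, 0 < rho /\
    forall z, 0 < Cmod z < rho -> Cmod (f z - psum c z N) <= B * Cmod z ^ N.

(** One constant serves all orders N at a given radius r, so this contains both the asymptotic
    expansion at 0 and the convergence of the series. *)
Definition taylor (f : C -> C) (R0 : R) (c : nat -> C) : Prop :=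
  forall r, 0 < r < R0 -> exists B,
    forall z N, Cmod z <= r -> Cmod (f z - psum c z N) <= B * (Cmod z / r) ^ N.

Lemma taylor_asy (f : C -> C) (R0 : R) (c : nat -> C) : 0 < R0 -> taylor f R0 c -> asy f c.
Proof.
  intros HR H N. destruct (H (R0 / 2) ltac:(lra)) as [B K].
  exists (B * (/ (R0 / 2)) ^ N), (R0 / 2). split; [lra|]. intros z Hz.
  specialize (K z N ltac:(lra)).
  change (Cmod z / (R0 / 2)) with (Cmod z * / (R0 / 2)) in K. rewrite Rpow_mult_distr in K. lra.
Qed.

(** If the coefficients below n agree, the difference of the partial sums of length n + 1 is a
    single term of degree n, which is not of order n + 1 unless it vanishes. *)
Lemma psum_unique (c d : nat -> C) :
  (forall N, exists B rho, 0 < rho /\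
    forall z, 0 < Cmod z < rho -> Cmod (psum c z N - psum d z N) <= B * Cmod z ^ N) ->
  forall n, c n = d n.
Proof.
  intros H n. induction n as [n IH] using Wf_nat.lt_wf_ind.
  assert (E : forall z k, (k <= n)%nat -> psum c z k = psum d z k).
  { intros z k. induction k as [|k IHk]; intros Hk; simpl; [reflexivity|].
    rewrite IHk, IH by lia. reflexivity. }
  destruct (H (S n)) as (B & rho & Hrho & K).
  apply Ceq_eps. intros eps He.
  set (x := Rmin (rho / 2) (eps / (Rabs B + 1))).
  assert (HB := Rabs_pos B). assert (HB' := Rle_abs B).
  assert (X0 : 0 < x) by (apply Rmin_pos; [lra|apply Rdiv_lt_0_compat; lra]).
  assert (X1 : x <= rho / 2) by apply Rmin_l.
  assert (X2 : x <= eps / (Rabs B + 1)) by apply Rmin_r.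
  assert (Mx : Cmod (RtoC x) = x) by (rewrite Cmod_R, Rabs_pos_eq; lra).
  specialize (K (RtoC x)). rewrite Mx in K. specialize (K ltac:(lra)).
  simpl psum in K. rewrite (E _ n) in K by lia.
  replace (psum d (RtoC x) n + c n * RtoC x ^ n - (psum d (RtoC x) n + d n * RtoC x ^ n))%C
    with ((c n - d n) * RtoC x ^ n)%C in K by ring.
  rewrite Cmod_mult, Cmod_pow, Mx in K. simpl in K.
  assert (P : 0 < x ^ n) by (apply pow_lt; exact X0).
  assert (K' : Cmod (c n - d n) <= B * x).
  { apply (Rmult_le_reg_r (x ^ n)); [exact P|]. lra. }
  assert (B * x <= Rabs B * x) by (apply Rmult_le_compat_r; lra).
  assert ((Rabs B + 1) * x <= eps).
  { apply (Rmult_le_compat_l (Rabs B + 1)) in X2; [|lra].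
    replace ((Rabs B + 1) * (eps / (Rabs B + 1))) with eps in X2 by (field; lra). exact X2. }
  lra.
Qed.

Lemma asy_unique (f g : C -> C) (c d : nat -> C) :
  near 0 (fun z => z <> RtoC 0 -> f z = g z) -> asy f c -> asy g d -> forall n, c n = d n.
Proof.
  intros (e & He & E) Hc Hd. apply psum_unique. intros N.
  destruct (Hc N) as (B & r & Hr & K). destruct (Hd N) as (B' & r' & Hr' & K').
  exists (B + B'), (Rmin e (Rmin r r')). split; [repeat apply Rmin_pos; assumption|].
  intros z [Z0 Z1]. assert (M1 := Rmin_l e (Rmin r r')). assert (M2 := Rmin_r e (Rmin r r')).
  assert (M3 := Rmin_l r r'). assert (M4 := Rmin_r r r').
  specialize (K z ltac:(lra)). specialize (K' z ltac:(lra)).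
  rewrite <- E in K'.
  - assert (T := Cmod_sub_triangle (psum c z N) (f z) (psum d z N)).
    rewrite (Cmod_sub_sym (psum c z N) (f z)) in T. lra.
  - replace (z - 0)%C with z by ring. lra.
  - apply Cmod_gt_0. exact Z0.
Qed.

Lemma bounded_disk (f : C -> C) (r : R) :
  (forall z, Cmod z <= r -> ccont f z) ->
  exists M, 0 < M /\ forall z, Cmod z <= r -> Cmod (f z) <= M.
Proof.
  (* Bounds are coded by their reciprocals, since [local_uniform] produces one positive m that works
     everywhere. *)
  intros H. destruct (local_uniform r (fun m u => 0 < m -> Cmod (f u) <= / m)) as (m & Hm & K).
  - intros m m' u L Q Hm'. eapply Rle_trans; [apply Q; lra|]. apply Rinv_le_contravar; lra.
  - intros z Hz. destruct (ccont_bounded _ _ (H z Hz)) as (d & Hd & K).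
    exists d. split; [exact Hd|]. assert (P := Cmod_ge_0 (f z)).
    exists (/ (Cmod (f z) + 1)). split; [apply Rinv_0_lt_compat; lra|].
    intros u Hu _ _. rewrite Rinv_inv. left. apply K, Hu.
  - exists (/ m). split; [apply Rinv_0_lt_compat; exact Hm|]. auto.
Qed.

Lemma ccont_kernel (b z : C) : z <> b -> ccont (fun z => z / (z - b))%C z.
Proof.
  intros H. apply holo_ccont, holo_div; [apply holo_id| |apply Csub_neq, H].
  apply holo_minus; [apply holo_id|apply holo_const].
Qed.

Lemma circle_neq (b z : C) (r : R) : Cmod b < r -> Cmod z = r -> z <> b.
Proof. intros H1 H2 E. subst. lra. Qed.

(** The mean does not depend on the radius, and on large circles z / (z - b) is nearly 1. *)
Lemma mean_kernel_one (b : C) (r : R) : Cmod b < r ->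
  mean (fun z => z / (z - b))%C r = RtoC (2 * PI).
Proof.
  intros Hb. assert (B0 := Cmod_ge_0 b). assert (P := two_PI_pos).
  apply Ceq_eps. intros eps He.
  set (s := Rmax r (Cmod b + (4 * PI * Cmod b / eps + 1))).
  assert (S1 : r <= s) by apply Rmax_l.
  assert (S2 : Cmod b + (4 * PI * Cmod b / eps + 1) <= s) by apply Rmax_r.
  assert (Q : 0 <= 4 * PI * Cmod b / eps).
  { apply Rmult_le_pos; [apply Rmult_le_pos; lra|]. left. apply Rinv_0_lt_compat, He. }
  rewrite (mean_annulus _ r s); [|lra|lra|].
  2:{ intros z Hz. apply holo_div; [apply holo_id| |].
      - apply holo_minus; [apply holo_id|apply holo_const].
      - apply Csub_neq. intros E. subst. lra. }
  assert (HC : forall z, Cmod z = s -> ccont (fun z => z / (z - b))%C z).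
  { intros z Hz. apply ccont_kernel, (circle_neq b z s); lra. }
  replace (mean (fun z => z / (z - b))%C s - RtoC (2 * PI))%C with
    (mean (fun z => z / (z - b) + (-1))%C s).
  - eapply Rle_trans; [apply (mean_bound _ s (Cmod b / (s - Cmod b)))|].
    + lra.
    + intros z Hz. apply ccont_plus; [apply HC, Hz|apply ccont_const].
    + intros z Hz. assert (N := Csub_neq _ _ (circle_neq b z s ltac:(lra) Hz)).
      replace (z / (z - b) + -1)%C with (b / (z - b))%C by (field; exact N).
      rewrite Cmod_div by exact N. apply Rmult_le_compat_l; [exact B0|].
      apply Rinv_le_contravar; [lra|]. assert (T := Cmod_triangle_rev z b). lra.
    + apply (Rmult_le_reg_r (s - Cmod b)); [lra|].
      replace (4 * PI * (Cmod b / (s - Cmod b)) * (s - Cmod b)) with (4 * PI * Cmod b)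
        by (field; lra).
      assert (L : 4 * PI * Cmod b / eps <= s - Cmod b) by lra.
      apply (Rmult_le_compat_l eps) in L; [|lra].
      replace (eps * (4 * PI * Cmod b / eps)) with (4 * PI * Cmod b) in L by (field; lra).
      exact L.
  - rewrite (mean_plus (fun z => z / (z - b))%C (fun _ => (-1))%C);
      [|lra|exact HC|intros; apply ccont_const].
    rewrite mean_const. ring.
Qed.

(** The mean value property is applied to z times the difference quotient of f at b, which vanishes
    at 0 and is known only to be continuous at b. At 0 the function f is assumed merely continuous,
    so that removability can be deduced from this formula. *)
Lemma cauchy_formula (f : C -> C) (R0 r : R) (b : C) :
  (forall z, Cmod z < R0 -> ccont f z) ->
  (forall z, 0 < Cmod z < R0 -> holo f z) ->
  Cmod b < r < R0 ->
  mean (fun z => f z * (z / (z - b)))%C r = (RtoC (2 * PI) * f b)%C.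
Proof.
  intros HC HH Hb. assert (B0 := Cmod_ge_0 b).
  destruct (Ceq_dec b (RtoC 0)) as [->|Nb].
  - rewrite <- (mean_value f R0 0 r HC); [|intros z Hz _; apply HH; lra|lra].
    apply mean_ext; [lra|]. intros z Hz. field.
    intros E. subst z. rewrite Cmod_0 in Hz. lra.
  - assert (Pb : 0 < Cmod b) by (apply Cmod_gt_0, Nb).
    destruct (HH b ltac:(lra)) as [l Hl]. apply cderiv_slope in Hl.
    destruct Hl as (s & Es & Cs & Hs).
    assert (Es' : forall u, u <> b -> s u = ((f u - f b) / (u - b))%C).
    { intros u Hu. rewrite (Hs u). field. apply Csub_neq, Hu. }
    set (G := fun z => (z * s z)%C).
    assert (HG1 : forall z, z <> b -> near z (fun u => (u * ((f u - f b) / (u - b)))%C = G u)).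
    { intros z Hz. eapply near_imp; [|apply (near_neq b z Hz)].
      intros u Hu. unfold G. rewrite (Es' u Hu). reflexivity. }
    assert (M : mean G r = (RtoC (2 * PI) * G (RtoC 0))%C).
    { apply (mean_value G R0 (Cmod b)).
      - intros z Hz. destruct (Ceq_dec z b) as [->|N].
        + apply ccont_mult; [apply ccont_id|exact Cs].
        + apply (ccont_ext _ _ _ (HG1 z N)). apply ccont_mult; [apply ccont_id|].
          apply ccont_mult; [apply ccont_plus; [apply HC, Hz|apply ccont_const]|].
          apply holo_ccont, holo_inv; [|apply Csub_neq, N].
          apply holo_minus; [apply holo_id|apply holo_const].
      - intros z Hz Hn. assert (N : z <> b) by (intros E; subst; lra).
        apply (holo_ext _ _ _ (HG1 z N)). apply holo_mult; [apply holo_id|].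
        apply holo_div; [|apply holo_minus; [apply holo_id|apply holo_const]|apply Csub_neq, N].
        apply holo_minus; [apply HH, Hz|apply holo_const].
      - lra. }
    assert (G0 : (RtoC (2 * PI) * G (RtoC 0) = 0)%C) by (unfold G; ring).
    rewrite G0 in M.
    assert (HCk : forall z, Cmod z = r -> ccont (fun z => z / (z - b))%C z).
    { intros z Hz. apply ccont_kernel, (circle_neq b z r); lra. }
    assert (HCf : forall z, Cmod z = r -> ccont f z) by (intros; apply HC; lra).
    rewrite (mean_ext _ (fun z => G z + f b * (z / (z - b)))%C); [|lra|].
    + rewrite (mean_plus G (fun z => f b * (z / (z - b)))%C); [|lra| |].
      * rewrite M, (mean_scal (f b) (fun z => z / (z - b))%C), mean_kernel_one;
          [ring|lra|lra|exact HCk].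
      * intros z Hz. assert (N := circle_neq b z r ltac:(lra) Hz).
        apply (ccont_ext _ _ _ (HG1 z N)). apply ccont_mult; [apply ccont_id|].
        apply ccont_mult; [apply ccont_plus; [apply HCf, Hz|apply ccont_const]|].
        apply holo_ccont, holo_inv; [|apply Csub_neq, N].
        apply holo_minus; [apply holo_id|apply holo_const].
      * intros z Hz. apply ccont_mult; [apply ccont_const|apply HCk, Hz].
    + intros z Hz. assert (N := circle_neq b z r ltac:(lra) Hz).
      unfold G. rewrite (Es' z N). field. apply Csub_neq, N.
Qed.

Definition coef (f : C -> C) (r : R) (n : nat) : C :=
  (/ RtoC (2 * PI) * mean (fun z => f z / z ^ n) r)%C.

Lemma two_PI_neq : RtoC (2 * PI) <> RtoC 0.
Proof. intros E. apply RtoC_inj in E. assert (P := two_PI_pos). lra. Qed.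

Lemma ccont_pow_inv (n : nat) (z : C) : z <> RtoC 0 -> ccont (fun z => / z ^ n)%C z.
Proof.
  intros H. apply holo_ccont, holo_inv; [apply holo_pow, holo_id|]. apply Cpow_nz, H.
Qed.

Lemma circle_neq_0 (z : C) (r : R) : 0 < r -> Cmod z = r -> z <> RtoC 0.
Proof. intros H1 H2. apply Cmod_gt_0. lra. Qed.

(** A finite geometric expansion of the kernel: z / (z - b) is the sum of (b / z)^n over n < N plus
    (b / z)^N z / (z - b). *)
Lemma taylor_remainder (f : C -> C) (R0 r : R) (b : C) (N : nat) :
  (forall z, Cmod z < R0 -> ccont f z) ->
  (forall z, 0 < Cmod z < R0 -> holo f z) ->
  Cmod b < r < R0 ->
  (f b - psum (coef f r) b N =
   / RtoC (2 * PI) * mean (fun z => f z * ((b / z) ^ N * (z / (z - b))))  r)%C.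
Proof.
  intros HC HH Hb. assert (B0 := Cmod_ge_0 b). assert (Q := two_PI_neq).
  assert (HCk : forall n z, Cmod z = r ->
    ccont (fun z => f z * ((b / z) ^ n * (z / (z - b))))%C z).
  { intros n z Hz. apply ccont_mult; [apply HC; lra|]. apply ccont_mult.
    - apply holo_ccont, (holo_pow (fun z => b / z)%C).
      apply holo_div; [apply holo_const|apply holo_id|apply (circle_neq_0 z r); lra].
    - apply ccont_kernel, (circle_neq b z r); lra. }
  assert (HCc : forall n z, Cmod z = r -> ccont (fun z => f z / z ^ n)%C z).
  { intros n z Hz. apply ccont_mult; [apply HC; lra|].
    apply ccont_pow_inv, (circle_neq_0 z r); lra. }
  induction N as [|N IH].
  - simpl psum. rewrite (mean_ext _ (fun z => f z * (z / (z - b)))%C); [|lra|].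
    + rewrite (cauchy_formula f R0 r b HC HH Hb). field. exact Q.
    + intros z Hz. simpl. ring.
  - simpl psum.
    replace (f b - (psum (coef f r) b N + coef f r N * b ^ N))%C
      with ((f b - psum (coef f r) b N) - coef f r N * b ^ N)%C by ring.
    rewrite IH. unfold coef.
    rewrite (mean_ext (fun z => f z * ((b / z) ^ N * (z / (z - b))))%C
      (fun z => f z * ((b / z) ^ S N * (z / (z - b))) + b ^ N * (f z / z ^ N))%C); [|lra|].
    + rewrite (mean_plus (fun z => f z * ((b / z) ^ S N * (z / (z - b))))%C
        (fun z => b ^ N * (f z / z ^ N))%C); [|lra|apply HCk|].
      * rewrite (mean_scal (b ^ N)%C (fun z => f z / z ^ N)%C); [ring|lra|apply HCc].
      * intros z Hz. apply ccont_mult; [apply ccont_const|apply HCc, Hz].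
    + intros z Hz. assert (N1 := circle_neq_0 z r ltac:(lra) Hz).
      assert (N2 := Csub_neq _ _ (circle_neq b z r ltac:(lra) Hz)).
      assert (E : ((b / z) ^ N = b ^ N / z ^ N)%C).
      { unfold Cdiv. rewrite Cpow_mult_l, Cpow_inv by exact N1. reflexivity. }
      simpl Cpow at 2. rewrite E. assert (N3 := Cpow_nz z N N1). field. auto.
Qed.

(** The remainder is estimated on a circle larger than the one where the expansion is used, and
    uniqueness of asymptotic expansions makes the coefficients independent of that circle. *)
Lemma taylor_exists (f : C -> C) (R0 : R) : 0 < R0 ->
  (forall z, Cmod z < R0 -> ccont f z) ->
  (forall z, 0 < Cmod z < R0 -> holo f z) ->
  exists c, taylor f R0 c /\ forall r, 0 < r < R0 -> forall n, coef f r n = c n.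
Proof.
  intros HR HC HH. assert (PP := PI_RGT_0).
  assert (T : forall s r, 0 < r < s -> s < R0 -> exists B, forall z N, Cmod z <= r ->
    Cmod (f z - psum (coef f s) z N) <= B * (Cmod z / r) ^ N).
  { intros s r Hr Hs. destruct (bounded_disk f s) as (M & HM & K); [intros; apply HC; lra|].
    exists (2 * (M * (s / (s - r)))). intros z N Hz. assert (Z0 := Cmod_ge_0 z).
    rewrite (taylor_remainder f R0 s z N HC HH) by lra.
    rewrite Cmod_mult, Cmod_inv by apply two_PI_neq.
    rewrite Cmod_R, Rabs_pos_eq by lra.
    assert (P : 0 < 2 * PI) by lra.
    apply (Rmult_le_reg_l (2 * PI)); [exact P|].
    rewrite <- Rmult_assoc, Rinv_r, Rmult_1_l by lra.
    replace (2 * PI * (2 * (M * (s / (s - r))) * (Cmod z / r) ^ N))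
      with (4 * PI * (M * ((Cmod z / r) ^ N * (s / (s - r))))) by ring.
    apply mean_bound; [lra| |].
    - intros u Hu. apply ccont_mult; [apply HC; lra|]. apply ccont_mult.
      + apply holo_ccont, (holo_pow (fun u => z / u)%C).
        apply holo_div; [apply holo_const|apply holo_id|apply (circle_neq_0 u s); lra].
      + apply ccont_kernel, (circle_neq z u s); lra.
    - intros u Hu. assert (N1 := circle_neq_0 u s ltac:(lra) Hu).
      assert (N2 := Csub_neq _ _ (circle_neq z u s ltac:(lra) Hu)).
      rewrite !Cmod_mult, Cmod_pow, !Cmod_div, Hu by assumption.
      assert (Q : 0 <= Cmod z / s) by (apply Rmult_le_pos; [lra|left; apply Rinv_0_lt_compat; lra]).
      assert (T := Cmod_triangle_rev u z).
      apply Rmult_le_compat; [apply Cmod_ge_0| |apply K; lra|].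
      + apply Rmult_le_pos; [apply pow_le, Q|].
        apply Rmult_le_pos; [lra|left; apply Rinv_0_lt_compat; lra].
      + apply Rmult_le_compat; [apply pow_le, Q| | |].
        * apply Rmult_le_pos; [lra|left; apply Rinv_0_lt_compat; lra].
        * apply pow_incr. split; [exact Q|]. apply Rmult_le_compat_l; [lra|].
          apply Rinv_le_contravar; lra.
        * apply Rmult_le_compat_l; [lra|]. apply Rinv_le_contravar; lra. }
  assert (A : forall s, 0 < s < R0 -> asy f (coef f s)).
  { intros s Hs. apply (taylor_asy f s); [lra|]. intros r Hr. apply T; lra. }
  assert (E : forall s s', 0 < s < R0 -> 0 < s' < R0 -> forall n, coef f s n = coef f s' n).
  { intros s s' Hs Hs'. apply (asy_unique f f); [|apply A, Hs|apply A, Hs'].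
    exists 1. split; [lra|]. reflexivity. }
  assert (Eps : forall s s' z N, 0 < s < R0 -> 0 < s' < R0 ->
    psum (coef f s) z N = psum (coef f s') z N).
  { intros s s' z N Hs Hs'. induction N as [|N IH]; simpl; [reflexivity|].
    rewrite IH, (E s s' Hs Hs' N). reflexivity. }
  exists (coef f (R0 / 2)). split.
  - intros r Hr. destruct (T ((r + R0) / 2) r ltac:(lra) ltac:(lra)) as [B K].
    exists B. intros z N Hz. rewrite (Eps _ ((r + R0) / 2)) by lra. apply K, Hz.
  - intros r Hr n. apply E; lra.
Qed.

Lemma mean_Re_le (f g : C -> C) (r : R) : 0 <= r ->
  (forall z, Cmod z = r -> ccont f z) -> (forall z, Cmod z = r -> ccont g z) ->
  (forall z, Cmod z = r -> Re (f z) <= Re (g z)) -> Re (mean f r) <= Re (mean g r).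
Proof.
  intros Hr Hf Hg H. unfold mean. rewrite !CInt_Re. assert (P := two_PI_pos).
  apply RInt_le; [lra|apply (cintegrable_circle f r Hr Hf)|apply (cintegrable_circle g r Hr Hg)|].
  intros t _. apply H, Cmod_circle, Hr.
Qed.

Lemma Cmod_rotate (z : C) : exists e, Cmod e = 1 /\ (e * z = RtoC (Cmod z))%C.
Proof.
  destruct (Ceq_dec z (RtoC 0)) as [->|N].
  - exists (RtoC 1). rewrite Cmod_1, Cmod_0. split; [reflexivity|ring].
  - exists (Cconj z / RtoC (Cmod z))%C. assert (P : 0 < Cmod z) by (apply Cmod_gt_0, N).
    assert (N' : RtoC (Cmod z) <> RtoC 0) by (intros E; apply RtoC_inj in E; lra).
    split.
    + rewrite Cmod_div, Cmod_conj, Cmod_R, Rabs_pos_eq by (exact N' || lra). field. lra.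
    + replace (Cconj z / RtoC (Cmod z) * z)%C with (z * Cconj z / RtoC (Cmod z))%C
        by (field; exact N').
      rewrite <- Cmod2_conj. rewrite RtoC_pow. field. exact N'.
Qed.

(* Adding the vanishing moment of [z ^ n] makes the weight of [Re f] real. *)
Lemma herglotz (f : C -> C) (R0 : R) (c : nat -> C) (r : R) :
  (forall z, Cmod z < R0 -> ccont f z) ->
  (forall z, 0 < Cmod z < R0 -> holo f z) ->
  (forall n, coef f r n = c n) ->
  0 < r < R0 -> (forall z, Cmod z = r -> 0 <= Re (f z)) ->
  0 <= Re (c O) /\ forall n, (1 <= n)%nat -> Cmod (c n) * r ^ n <= 2 * Re (c O).
Proof.
  intros HC HH Hc Hr Hpos. assert (P := two_PI_pos). assert (Q := two_PI_neq).
  assert (HCf : forall z, Cmod z = r -> ccont f z) by (intros; apply HC; lra).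
  assert (M0 : mean f r = (RtoC (2 * PI) * c O)%C).
  { rewrite <- Hc. unfold coef. rewrite (mean_ext f (fun z => f z / z ^ 0)%C).
    - field. exact Q.
    - lra.
    - intros z _. simpl. field. }
  assert (R0' : 0 <= Re (c O)).
  { assert (H : Re (mean (fun _ => 0)%C r) <= Re (mean f r)).
    { apply mean_Re_le; [lra|intros; apply ccont_const|exact HCf|exact Hpos]. }
    rewrite mean_const, M0, !Re_scal in H. simpl in H.
    apply (Rmult_le_reg_l (2 * PI)); lra. }
  split; [exact R0'|]. intros n Hn.
  destruct (Cmod_rotate (c n)) as (e & He & Ee).
  assert (Hrn : 0 < r ^ n) by (apply pow_lt; lra).
  assert (Nr : RtoC (r ^ n) <> RtoC 0) by (intros E; apply RtoC_inj in E; lra).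
  (* On |z| = r the two terms are conjugate and unimodular, so the weight is real and at most 2,
     while its second term integrates to 0 against f. *)
  set (w := fun z => (e * RtoC (r ^ n) / z ^ n + Cconj e / RtoC (r ^ n) * z ^ n)%C).
  assert (HCc : forall z, Cmod z = r -> ccont (fun z => f z / z ^ n)%C z).
  { intros z Hz. apply ccont_mult; [apply HCf, Hz|].
    apply ccont_pow_inv, (circle_neq_0 z r); lra. }
  assert (Hpc : forall z, ccont (fun z => z ^ n)%C z)
    by (intros; apply holo_ccont, holo_pow, holo_id).
  assert (HCp : forall z, Cmod z = r -> ccont (fun z => f z * z ^ n)%C z).
  { intros z Hz. apply ccont_mult; [apply HCf, Hz|apply Hpc]. }
  assert (Mp : mean (fun z => f z * z ^ n)%C r = RtoC 0).
  { rewrite (mean_value _ R0 0).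
    - destruct n; [lia|]. simpl. ring.
    - intros z Hz. apply ccont_mult; [apply HC, Hz|apply Hpc].
    - intros z Hz _. apply holo_mult; [apply HH, Hz|apply holo_pow, holo_id].
    - exact Hr. }
  assert (Mw : mean (fun z => f z * w z)%C r = (RtoC (2 * PI) * RtoC (Cmod (c n) * r ^ n))%C).
  { rewrite (mean_ext _ (fun z => (e * RtoC (r ^ n)) * (f z / z ^ n) +
      (Cconj e / RtoC (r ^ n)) * (f z * z ^ n))%C); [|lra|].
    - rewrite (mean_plus (fun z => (e * RtoC (r ^ n)) * (f z / z ^ n))%C
        (fun z => (Cconj e / RtoC (r ^ n)) * (f z * z ^ n))%C).
      + rewrite (mean_scal (e * RtoC (r ^ n))%C (fun z => f z / z ^ n)%C) by (exact HCc || lra).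
        rewrite (mean_scal (Cconj e / RtoC (r ^ n))%C (fun z => f z * z ^ n)%C)
          by (exact HCp || lra).
        rewrite Mp. rewrite (RtoC_mult (Cmod (c n))), <- Ee, <- (Hc n). unfold coef. field.
        split; assumption.
      + lra.
      + intros z Hz. apply ccont_mult; [apply ccont_const|apply HCc, Hz].
      + intros z Hz. apply ccont_mult; [apply ccont_const|apply HCp, Hz].
    - intros z Hz. unfold w. field. split; [exact Nr|].
      apply Cpow_nz, (circle_neq_0 z r); lra. }
  assert (L : Re (mean (fun z => f z * w z)%C r) <= Re (mean (fun z => RtoC 2 * f z)%C r)).
  { apply mean_Re_le; [lra| | |].
    - intros z Hz. apply ccont_mult; [apply HCf, Hz|]. unfold w. apply ccont_plus.
      + apply ccont_mult; [apply ccont_const|].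
        apply ccont_pow_inv, (circle_neq_0 z r); lra.
      + apply ccont_mult; [apply ccont_const|apply Hpc].
    - intros z Hz. apply ccont_mult; [apply ccont_const|apply HCf, Hz].
    - intros z Hz. assert (Nz : (z ^ n)%C <> RtoC 0) by (apply Cpow_nz, (circle_neq_0 z r); lra).
      set (x := (e * RtoC (r ^ n) / z ^ n)%C).
      assert (Mzn : Cmod (z ^ n) = r ^ n) by (rewrite Cmod_pow, Hz; reflexivity).
      assert (Mx : Cmod x = 1).
      { unfold x. rewrite Cmod_div, Cmod_mult, He, Mzn, Cmod_R, Rabs_pos_eq by (exact Nz || lra).
        field. lra. }
      assert (Ew : w z = RtoC (2 * Re x)).
      { unfold w. fold x.
        assert (Ec : (Cconj e / RtoC (r ^ n) * z ^ n)%C = Cconj x).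
        { unfold x. rewrite Cdiv_conj, Cmult_conj by exact Nz.
          assert (Cr : Cconj (RtoC (r ^ n)) = RtoC (r ^ n)) by (apply C_ext; simpl; ring).
          rewrite Cr.
          assert (Z2 := Cmod2_conj (z ^ n)%C). rewrite Mzn in Z2.
          assert (Nc : Cconj (z ^ n)%C <> RtoC 0).
          { apply Cmod_gt_0. rewrite Cmod_conj, Mzn. exact Hrn. }
          rewrite RtoC_pow in Z2.
          apply (f_equal (fun y => (Cconj e * y / (RtoC (r ^ n) * Cconj (z ^ n)))%C)) in Z2.
          transitivity (Cconj e * (z ^ n * Cconj (z ^ n)) / (RtoC (r ^ n) * Cconj (z ^ n)))%C.
          - field. split; assumption.
          - rewrite <- Z2. simpl. field. split; assumption. }
        rewrite Ec. apply C_ext; simpl; ring. }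
      rewrite Ew. replace (f z * RtoC (2 * Re x))%C with (RtoC (2 * Re x) * f z)%C by ring.
      rewrite !Re_scal. apply Rmult_le_compat_r; [apply Hpos, Hz|].
      assert (T := re_bound x). lra. }
  rewrite Mw, (mean_scal 2 f), M0 in L by (exact HCf || lra).
  rewrite !Re_scal in L. simpl in L.
  apply (Rmult_le_reg_l (2 * PI)); [exact P|]. lra.
Qed.

(** * Removable singularities and the maximum principle *)

Lemma asy_ccont_0 (f : C -> C) (c : nat -> C) : ccont f 0 -> asy f c -> c O = f 0.
Proof.
  intros Hf Hc. apply Ceq_eps. intros eps He.
  destruct (Hc 1%nat) as (B & rho & Hrho & K). destruct (Hf (eps / 2) ltac:(lra)) as (d & Hd & L).
  assert (HB := Rabs_pos B). assert (HB' := Rle_abs B).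
  set (x := Rmin (Rmin (rho / 2) (d / 2)) (eps / 2 / (Rabs B + 1))).
  assert (X3 : x <= eps / 2 / (Rabs B + 1)) by apply Rmin_r.
  assert (X0 : 0 < x) by (repeat apply Rmin_pos; try lra; apply Rdiv_lt_0_compat; lra).
  assert (X1 : x <= rho / 2) by (eapply Rle_trans; [apply Rmin_l|apply Rmin_l]).
  assert (X2 : x <= d / 2) by (eapply Rle_trans; [apply Rmin_l|apply Rmin_r]).
  assert (Mx : Cmod (RtoC x) = x) by (rewrite Cmod_R, Rabs_pos_eq; lra).
  specialize (K (RtoC x) ltac:(lra)). specialize (L (RtoC x)).
  replace (RtoC x - 0)%C with (RtoC x) in L by ring. specialize (L ltac:(lra)).
  simpl in K. replace (0 + c O * 1)%C with (c O) in K by ring. rewrite Mx in K.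
  assert (T := Cmod_sub_triangle (c O) (f x) (f 0)).
  rewrite (Cmod_sub_sym (c O) (f x)) in T.
  assert (B * x <= Rabs B * x) by (apply Rmult_le_compat_r; lra).
  apply (Rmult_le_compat_l (Rabs B + 1)) in X3; [|lra].
  replace ((Rabs B + 1) * (eps / 2 / (Rabs B + 1))) with (eps / 2) in X3 by (field; lra).
  lra.
Qed.

Lemma asy_cderiv_0 (f : C -> C) (c : nat -> C) : ccont f 0 -> asy f c -> cderiv f 0 (c 1%nat).
Proof.
  intros Hf Hc eps He. assert (E0 := asy_ccont_0 f c Hf Hc).
  destruct (Hc 2%nat) as (B & rho & Hrho & K).
  assert (HB := Rabs_pos B). assert (HB' := Rle_abs B).
  exists (Rmin rho (eps / (Rabs B + 1))). split.
  { apply Rmin_pos; [exact Hrho|apply Rdiv_lt_0_compat; lra]. }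
  intros u Hu. assert (M1 := Rmin_l rho (eps / (Rabs B + 1))).
  assert (M2 := Rmin_r rho (eps / (Rabs B + 1))).
  replace (u - 0)%C with u in * by ring.
  destruct (Ceq_dec u (RtoC 0)) as [->|N].
  - replace (f 0 - f 0 - c 1%nat * 0)%C with (RtoC 0) by ring. rewrite Cmod_0. lra.
  - assert (P : 0 < Cmod u) by (apply Cmod_gt_0, N).
    specialize (K u ltac:(lra)). simpl in K. rewrite E0 in K.
    replace (f u - (0 + f 0 * 1 + c 1%nat * (u * 1)))%C
      with (f u - f 0 - c 1%nat * u)%C in K by ring.
    eapply Rle_trans; [exact K|]. rewrite Rmult_1_r, <- Rmult_assoc.
    apply Rmult_le_compat_r; [lra|].
    assert (B * Cmod u <= Rabs B * Cmod u) by (apply Rmult_le_compat_r; lra).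
    assert (Hq := Rdiv_mult_lt (Cmod u) (Rabs B + 1) eps ltac:(lra) ltac:(lra)). lra.
Qed.

Lemma holo_shift (f : C -> C) (a h : C) : holo f (a + h) -> holo (fun h => f (a + h)%C) h.
Proof.
  intros H. apply (holo_comp f (fun h => a + h)%C); [|exact H].
  apply holo_plus; [apply holo_const|apply holo_id].
Qed.

Lemma cderiv_shift (f : C -> C) (a h l : C) :
  cderiv f (a + h) l -> cderiv (fun h => f (a + h)%C) h l.
Proof.
  intros H. replace l with (l * (0 + 1))%C by ring.
  apply (cderiv_comp f (fun h => a + h)%C); [|exact H].
  apply cderiv_plus; [apply cderiv_const|apply cderiv_id].
Qed.

Lemma cderiv_unshift (f : C -> C) (a l : C) :
  cderiv (fun h => f (a + h)%C) 0 l -> cderiv f a l.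
Proof.
  intros H. apply cderiv_ext with (fun z => f (a + (- a + z))%C).
  - exists 1. split; [lra|]. intros u _. f_equal. ring.
  - apply (cderiv_shift (fun h => f (a + h)%C) (- a) a).
    replace (- a + a)%C with (RtoC 0) by ring. exact H.
Qed.

Lemma ccont_shift (f : C -> C) (a h : C) : ccont f (a + h) -> ccont (fun h => f (a + h)%C) h.
Proof.
  intros H. apply (ccont_comp f (fun h => a + h)%C); [|exact H].
  apply ccont_plus; [apply ccont_const|apply ccont_id].
Qed.

(** Continuity at the centre suffices for the Taylor expansion, and its linear coefficient is the
    missing derivative. *)
Lemma removable (f : C -> C) (a : C) :
  ccont f a -> near a (fun z => z <> a -> holo f z) -> holo f a.
Proof.
  intros Hf (R0 & HR & H). exists (dv (fun h => f (a + h)%C) 0).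
  assert (E : forall h, (a + h - a = h)%C) by (intros; ring).
  assert (H' : forall h, 0 < Cmod h < R0 -> holo (fun h => f (a + h)%C) h).
  { intros h Hh. apply holo_shift, H; [rewrite E; lra|]. intros E'.
    apply (f_equal (fun z => z - a)%C) in E'. rewrite E in E'.
    replace (a - a)%C with (RtoC 0) in E' by ring. subst h. rewrite Cmod_0 in Hh. lra. }
  assert (C' : forall h, Cmod h < R0 -> ccont (fun h => f (a + h)%C) h).
  { intros h Hh. destruct (Ceq_dec h (RtoC 0)) as [->|N].
    - apply ccont_shift. replace (a + 0)%C with a by ring. exact Hf.
    - apply holo_ccont, H'. split; [apply Cmod_gt_0, N|exact Hh]. }
  destruct (taylor_exists _ R0 HR C' H') as (c & T & _).
  apply cderiv_unshift. apply dv_correct. exists (c 1%nat).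
  apply asy_cderiv_0; [apply C'; rewrite Cmod_0; exact HR|].
  eapply taylor_asy; eassumption.
Qed.

Lemma herglotz_coef (f : C -> C) (R0 r : R) (c : nat -> C) :
  (forall z, Cmod z < R0 -> holo f z) -> asy f c -> 0 < r < R0 ->
  (forall z, Cmod z = r -> 0 <= Re (f z)) ->
  0 <= Re (c O) /\ forall n, (1 <= n)%nat -> Cmod (c n) * r ^ n <= 2 * Re (c O).
Proof.
  intros Hf Hc Hr Hp.
  assert (C' : forall z, Cmod z < R0 -> ccont f z) by (intros; apply holo_ccont; auto).
  assert (H' : forall z, 0 < Cmod z < R0 -> holo f z) by (intros; apply Hf; lra).
  destruct (taylor_exists f R0 ltac:(lra) C' H') as (c' & T & K).
  apply (herglotz f R0 c r C' H'); [|exact Hr|exact Hp].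
  intros n. rewrite K by exact Hr.
  apply (asy_unique f f); [|eapply taylor_asy; [|exact T]; lra|exact Hc].
  exists 1. split; [lra|reflexivity].
Qed.

Lemma asy_exists (f : C -> C) : near 0 (holo f) -> exists c, asy f c.
Proof.
  intros (R0 & HR & H).
  assert (H' : forall z, Cmod z < R0 -> holo f z).
  { intros z Hz. apply H. replace (z - 0)%C with z by ring. exact Hz. }
  destruct (taylor_exists f R0 HR) as (c & T & _).
  - intros; apply holo_ccont; auto.
  - intros; apply H'; lra.
  - exists c. eapply taylor_asy; eassumption.
Qed.

Lemma near_0_disk (f : C -> C) (R0 : R) : 0 < R0 ->
  (forall z, Cmod z < R0 -> holo f z) -> near 0 (holo f).
Proof.
  intros HR H. exists R0. split; [exact HR|]. intros u Hu. apply H.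
  replace (u - 0)%C with u in Hu by ring. exact Hu.
Qed.

Lemma herglotz_at (f : C -> C) (a : C) (R0 r : R) :
  (forall z, Cmod (z - a) < R0 -> holo f z) -> 0 < r < R0 ->
  (forall z, Cmod (z - a) = r -> 0 <= Re (f z)) ->
  0 <= Re (f a) /\ Cmod (dv f a) * r <= 2 * Re (f a).
Proof.
  intros Hf Hr Hp. assert (E : forall h, (a + h - a = h)%C) by (intros; ring).
  set (g := fun h => f (a + h)%C).
  assert (Hg : forall h, Cmod h < R0 -> holo g h).
  { intros h Hh. apply holo_shift, Hf. rewrite E. exact Hh. }
  destruct (asy_exists g) as (c & Hc). { apply (near_0_disk g R0); [lra|exact Hg]. }
  destruct (herglotz_coef g R0 r c Hg Hc Hr) as [H0 H1].
  { intros z Hz. apply Hp. rewrite E. exact Hz. }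
  assert (C0 : ccont g 0) by (apply holo_ccont, Hg; rewrite Cmod_0; lra).
  assert (E0 : c O = f a).
  { rewrite (asy_ccont_0 g c C0 Hc). unfold g. f_equal. ring. }
  assert (E1 : dv f a = c 1%nat).
  { apply dv_eq, cderiv_unshift. apply asy_cderiv_0; assumption. }
  rewrite E1, <- E0. split; [exact H0|]. specialize (H1 1%nat (le_n _)). lra.
Qed.

(** Herglotz' bound for M - e f, where the unimodular e turns f(a) into its modulus; this is where
    the defect M - |f(a)| comes from. *)
Lemma cauchy_estimate (f : C -> C) (a : C) (R0 r M : R) :
  (forall z, Cmod (z - a) < R0 -> holo f z) -> 0 < r < R0 ->
  (forall z, Cmod (z - a) = r -> Cmod (f z) <= M) ->
  Cmod (f a) <= M /\ Cmod (dv f a) * r <= 2 * (M - Cmod (f a)).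
Proof.
  intros Hf Hr HM. destruct (Cmod_rotate (f a)) as (e & He & Ee).
  destruct (herglotz_at (fun z => RtoC M - e * f z)%C a R0 r) as [H0 H1].
  - intros z Hz. apply holo_minus; [apply holo_const|].
    apply holo_mult; [apply holo_const|auto].
  - exact Hr.
  - intros z Hz. rewrite Re_minus. assert (T := re_bound (e * f z)%C).
    rewrite Cmod_mult, He in T. specialize (HM z Hz). simpl Re at 1. lra.
  - rewrite Ee in H0, H1. rewrite Re_minus in H0, H1. simpl Re in H0, H1.
    split; [lra|].
    assert (Ha : cderiv f a (dv f a)).
    { apply dv_correct, Hf. replace (a - a)%C with (RtoC 0) by ring. rewrite Cmod_0. lra. }
    assert (D : dv (fun z => RtoC M - e * f z)%C a = (- (e * dv f a))%C).
    { apply dv_eq. replace (- (e * dv f a))%C with (0 - (0 * f a + e * dv f a))%C by ring.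
      apply cderiv_minus; [apply cderiv_const|].
      apply (cderiv_mult (fun _ => e) f); [apply cderiv_const|exact Ha]. }
    rewrite D, Cmod_opp, Cmod_mult, He in H1. lra.
Qed.

Definition copen (U : C -> Prop) : Prop := forall z, U z -> near z U.

Lemma near_sq (f : C -> C) (z : C) (e : R) : ccont f z -> 0 < e ->
  near z (fun u => Cmod (f u) ^ 2 <= Cmod (f z) ^ 2 + e).
Proof.
  intros Hf He. assert (P := Cmod_ge_0 (f z)). set (m := Cmod (f z)) in *.
  set (d := Rmin 1 (e / (2 * m + 1))).
  assert (D1 : d <= 1) by apply Rmin_l. assert (D2 : d <= e / (2 * m + 1)) by apply Rmin_r.
  assert (D0 : 0 < d) by (apply Rmin_pos; [lra|apply Rdiv_lt_0_compat; lra]).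
  eapply near_imp; [|exact (Hf d D0)]. intros u Hu.
  assert (T := Cmod_triangle_rev (f u) (f z)). fold m in T.
  assert (Q := Cmod_ge_0 (f u)).
  apply (Rmult_le_compat_l (2 * m + 1)) in D2; [|lra].
  replace ((2 * m + 1) * (e / (2 * m + 1))) with e in D2 by (field; lra).
  assert (Cmod (f u) ^ 2 <= (m + d) ^ 2) by (apply pow_incr; lra).
  assert (d * d <= d * 1) by (apply Rmult_le_compat_l; lra). nra.
Qed.

Lemma Cmod_sq_plus (z h : C) :
  Cmod (z + h) ^ 2 = Cmod z ^ 2 + 2 * Re (Cconj z * h)%C + Cmod h ^ 2.
Proof. rewrite !Cmod2_alt. destruct z, h; simpl. ring. Qed.

Lemma Re_conj_mult_le (a b : C) : 2 * Re (Cconj a * b)%C <= Cmod a ^ 2 + Cmod b ^ 2.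
Proof.
  assert (H := re_bound (Cconj a * b)%C). rewrite Cmod_mult, Cmod_conj in H.
  assert (0 <= (Cmod a - Cmod b) ^ 2) by apply pow2_ge_0. nra.
Qed.

(* [|f|^2 + eps |z|^2] is strictly subharmonic, hence has no local maximum. *)
Lemma no_local_max (f : C -> C) (z : C) (eps r : R) : 0 < eps -> 0 < r ->
  (forall u, Cmod (u - z) < r -> holo f u) ->
  ~ (forall u, Cmod (u - z) < r ->
       Cmod (f u) ^ 2 + eps * Cmod u ^ 2 <= Cmod (f z) ^ 2 + eps * Cmod z ^ 2).
Proof.
  intros He Hr Hf Hmax.
  (* On the circle of radius r / 2 the supposed maximum makes the real part of this function
     nonnegative, by 2 Re (conj a b) <= |a|^2 + |b|^2. At the centre its value is - eps (r / 2)^2 /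
     2, a contradiction. *)
  destruct (herglotz_at (fun u => RtoC (Cmod (f z) ^ 2) - Cconj (f z) * f u
     - RtoC eps * (Cconj z * (u - z)) - RtoC (eps * (r / 2) ^ 2 / 2))%C z r (r / 2)) as [H _].
  - intros u Hu. repeat apply holo_minus; try apply holo_const.
    + apply holo_mult; [apply holo_const|auto].
    + apply holo_mult; [apply holo_const|]. apply holo_mult; [apply holo_const|].
      apply holo_minus; [apply holo_id|apply holo_const].
  - lra.
  - intros u Hu. rewrite !Re_minus, Re_scal. simpl Re at 1 4.
    specialize (Hmax u ltac:(lra)).
    assert (T := Re_conj_mult_le (f z) (f u)).
    assert (S := Cmod_sq_plus z (u - z)). replace (z + (u - z))%C with u in S by ring.
    rewrite Hu in S. rewrite S in Hmax.
    set (q := Re (Cconj z * (u - z))) in *. nra.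
  - rewrite !Re_minus in H. replace (z - z)%C with (RtoC 0) in H by ring.
    rewrite Cmult_0_r, Cmult_0_r in H. replace (Cconj (f z) * f z)%C with (f z * Cconj (f z))%C in H by ring.
    rewrite <- Cmod2_conj in H. simpl Re in H.
    assert (0 < eps * (r / 2) ^ 2) by (apply Rmult_lt_0_compat; [lra|apply pow_lt; lra]). lra.
Qed.

(** U is any open subset of a closed disk, and smallness of f near each point outside U replaces
    boundary values. The strictly subharmonic perturbation [v] has no interior maximum, so near
    every point it stays below its supremum by some margin; compactness makes the margin uniform,
    which contradicts the supremum. *)
Lemma max_modulus (U : C -> Prop) (f : C -> C) (R0 M : R) : 0 <= M ->
  copen U -> (forall z, U z -> holo f z) -> (forall z, U z -> Cmod z <= R0) ->
  (forall z, Cmod z <= R0 -> ~ U z ->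
     forall e, 0 < e -> near z (fun u => U u -> Cmod (f u) <= M + e)) ->
  forall z, U z -> Cmod (f z) <= M.
Proof.
  intros HM HU Hf HR HB z0 Hz0. apply Rnot_lt_le. intros L.
  set (A := Cmod (f z0)) in *. set (M1 := (M + A) / 2).
  assert (HM1 : M1 ^ 2 < A ^ 2).
  { unfold M1. nra. }
  assert (R0pos : 0 <= R0) by (eapply Rle_trans; [apply Cmod_ge_0|apply (HR z0 Hz0)]).
  (* Chosen so that M1^2 + eps R0^2 stays below A^2, where M1 is halfway between M and A. *)
  set (eps := (A ^ 2 - M1 ^ 2) / (2 * (R0 ^ 2 + 1))).
  assert (R2 : 0 <= R0 ^ 2) by apply pow2_ge_0.
  assert (He : 0 < eps) by (unfold eps; apply Rdiv_lt_0_compat; lra).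
  assert (HeR : M1 ^ 2 + eps * R0 ^ 2 < A ^ 2).
  { assert (E : eps * (2 * (R0 ^ 2 + 1)) = A ^ 2 - M1 ^ 2) by (unfold eps; field; lra). nra. }
  set (v := fun u => Cmod (f u) ^ 2 + eps * Cmod u ^ 2).
  assert (Hout : forall z, Cmod z <= R0 -> ~ U z ->
    near z (fun u => U u -> v u <= M1 ^ 2 + eps * R0 ^ 2)).
  { intros z Hz Hn. eapply near_imp; [|apply (HB z Hz Hn ((A - M) / 2)); lra].
    intros u Hu Uu. specialize (Hu Uu). unfold v. apply Rplus_le_compat.
    - apply pow_incr. split; [apply Cmod_ge_0|]. unfold M1. lra.
    - apply Rmult_le_compat_l; [lra|]. apply pow_incr. split; [apply Cmod_ge_0|]. auto. }
  assert (Hin : forall z e, U z -> 0 < e -> near z (fun u => v u <= v z + e)).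
  { intros z e Hz Hpe.
    assert (N1 := near_sq f z (e / 2) (holo_ccont _ _ (Hf z Hz)) ltac:(lra)).
    assert (N2 := near_sq (fun u => u) z (e / 2 / eps) (ccont_id z)
      ltac:(apply Rdiv_lt_0_compat; lra)).
    eapply near_imp; [|exact (near_and _ _ _ N1 N2)]. intros u [K1 K2]. unfold v.
    apply (Rmult_le_compat_l eps) in K2; [|lra].
    replace (eps * (Cmod z ^ 2 + e / 2 / eps)) with (eps * Cmod z ^ 2 + e / 2) in K2
      by (field; lra). lra. }
  destruct (local_uniform R0 (fun m u => 0 < m -> U u -> v u <= / m)) as (m & Hm & Km).
  { intros m m' u Lm Q Hm' Uu. eapply Rle_trans; [apply Q; [lra|exact Uu]|].
    apply Rinv_le_contravar; lra. }
  { intros z Hz.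
    assert (V0 : forall u, 0 <= v u).
    { intros u. unfold v. apply Rplus_le_le_0_compat; [apply pow2_ge_0|].
      apply Rmult_le_pos; [lra|apply pow2_ge_0]. }
    set (b := Rmax (v z + 1) (M1 ^ 2 + eps * R0 ^ 2)).
    assert (B0 : 0 < b).
    { eapply Rlt_le_trans; [|apply Rmax_l]. specialize (V0 z). lra. }
    assert (Nb : near z (fun u => U u -> v u <= b)).
    { destruct (classic (U z)) as [Uz|Nz].
      - eapply near_imp; [|exact (Hin z 1 Uz Rlt_0_1)]. intros u Hu _.
        eapply Rle_trans; [exact Hu|apply Rmax_l].
      - eapply near_imp; [|exact (Hout z Hz Nz)]. intros u Hu Uu.
        eapply Rle_trans; [exact (Hu Uu)|apply Rmax_r]. }
    destruct Nb as (d & Hd & K). exists d. split; [exact Hd|].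
    exists (/ b). split; [apply Rinv_0_lt_compat, B0|].
    intros u Hu _ _ Uu. rewrite Rinv_inv. auto. }
  destruct (completeness (fun x => exists u, U u /\ x = v u)) as [S [HS1 HS2]].
  { exists (/ m). intros x (u & Uu & ->). apply Km; auto. }
  { exists (v z0), z0. auto. }
  assert (HS : forall u, U u -> v u <= S) by (intros u Uu; apply HS1; exists u; auto).
  assert (HSA : A ^ 2 <= S).
  { eapply Rle_trans; [|apply (HS z0 Hz0)]. unfold v. fold A.
    assert (0 <= eps * Cmod z0 ^ 2) by (apply Rmult_le_pos; [lra|apply pow2_ge_0]). lra. }
  assert (Hlt : forall z, U z -> v z < S).
  { intros z Uz. destruct (Rle_lt_or_eq_dec _ _ (HS z Uz)) as [Q|Q]; [exact Q|].
    exfalso. destruct (HU z Uz) as (r & Hr & K).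
    apply (no_local_max f z eps r He Hr).
    - intros u Hu. apply Hf, K, Hu.
    - intros u Hu. fold (v u) (v z). rewrite Q. apply HS, K, Hu. }
  destruct (local_uniform R0 (fun m u => U u -> v u <= S - m)) as (g & Hg & Kg).
  { intros x x' u Lm Q Uu. specialize (Q Uu). lra. }
  { intros z Hz. destruct (classic (U z)) as [Uz|Nz].
    - specialize (Hlt z Uz).
      destruct (Hin z ((S - v z) / 2) Uz ltac:(lra)) as (d & Hd & K).
      exists d. split; [exact Hd|]. exists ((S - v z) / 2). split; [lra|].
      intros u Hu _ _. specialize (K u Hu). lra.
    - destruct (Hout z Hz Nz) as (d & Hd & K). exists d. split; [exact Hd|].
      exists (S - (M1 ^ 2 + eps * R0 ^ 2)). split; [lra|].
      intros u Hu _ Uu. specialize (K u Hu Uu). lra. }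
  assert (S <= S - g); [|lra].
  apply HS2. intros x (u & Uu & ->). apply Kg; auto.
Qed.

(* Boundary values on the unit circle are only used in the limit. *)
Lemma max_modulus_disk (f : C -> C) (M : R) : 0 <= M ->
  (forall z, Cmod z < 1 -> holo f z) ->
  (forall e, 0 < e -> exists rho, rho < 1 /\
     forall z, rho < Cmod z < 1 -> Cmod (f z) <= M + e) ->
  forall z, Cmod z < 1 -> Cmod (f z) <= M.
Proof.
  intros HM Hf HB. apply (max_modulus (fun z => Cmod z < 1) f 1 M HM).
  - intros z Hz. apply near_disk0, Hz.
  - exact Hf.
  - intros; lra.
  - intros z Hz Hn e He. destruct (HB e He) as (rho & Hrho & K).
    exists (1 - rho). split; [lra|]. intros u Hu Uu. apply K.
    assert (T := Cmod_triangle_rev z u). rewrite Cmod_sub_sym in T. lra.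
Qed.

(** * Difference quotients and derivatives of holomorphic functions *)

Definition sl (f : C -> C) (a z : C) : C :=
  match Ceq_dec z a with left _ => dv f a | right _ => ((f z - f a) / (z - a))%C end.

Lemma sl_at (f : C -> C) (a : C) : sl f a a = dv f a.
Proof. unfold sl. destruct (Ceq_dec a a); tauto. Qed.

Lemma sl_off (f : C -> C) (a z : C) : z <> a -> sl f a z = ((f z - f a) / (z - a))%C.
Proof. unfold sl. destruct (Ceq_dec z a); tauto. Qed.

Lemma sl_eq (f : C -> C) (a z : C) : f z = (f a + sl f a z * (z - a))%C.
Proof.
  destruct (Ceq_dec z a) as [->|N]; [ring|]. rewrite sl_off by exact N. field.
  apply Csub_neq, N.
Qed.

Lemma sl_holo_off (f : C -> C) (a z : C) : z <> a -> holo f z -> holo (sl f a) z.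
Proof.
  intros N H. apply holo_ext with (fun u => (f u - f a) / (u - a))%C.
  - eapply near_imp; [|apply (near_neq a z N)]. intros u Hu. symmetry. apply sl_off, Hu.
  - apply holo_div; [|apply holo_minus; [apply holo_id|apply holo_const]|apply Csub_neq, N].
    apply holo_minus; [exact H|apply holo_const].
Qed.

Lemma sl_ccont (f : C -> C) (a : C) : holo f a -> ccont (sl f a) a.
Proof.
  intros H. apply dv_correct, cderiv_slope in H. destruct H as (s & Es & Cs & Hs).
  apply ccont_ext with s; [|exact Cs]. exists 1. split; [lra|]. intros u _.
  destruct (Ceq_dec u a) as [->|N]; [rewrite sl_at; exact Es|].
  rewrite sl_off by exact N. rewrite (Hs u). field. apply Csub_neq, N.
Qed.

Lemma sl_holo (f : C -> C) (a z : C) :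
  near a (holo f) -> holo f z -> holo (sl f a) z.
Proof.
  intros Ha Hz. destruct (Ceq_dec z a) as [->|N]; [|apply sl_holo_off; assumption].
  apply removable.
  - apply sl_ccont, Hz.
  - eapply near_imp; [|exact Ha]. intros u Hu N. apply sl_holo_off; assumption.
Qed.

Lemma cderiv_pow (z : C) (n : nat) : cderiv (fun u => u ^ n)%C z (RtoC (INR n) * z ^ pred n)%C.
Proof.
  induction n as [|n IH].
  - simpl. replace (RtoC 0 * 1)%C with (RtoC 0) by ring. apply cderiv_const.
  - replace (RtoC (INR (S n)) * z ^ pred (S n))%C
      with (1 * z ^ n + z * (RtoC (INR n) * z ^ pred n))%C.
    + apply (cderiv_mult (fun u => u) (fun u => u ^ n)%C); [apply cderiv_id|exact IH].
    + rewrite S_INR, RtoC_plus. destruct n; simpl; ring.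
Qed.

Definition dcoef (c : nat -> C) (n : nat) : C := (RtoC (INR (S n)) * c (S n))%C.

Lemma cderiv_psum (c : nat -> C) (z : C) (N : nat) :
  cderiv (fun u => psum c u (S N)) z (psum (dcoef c) z N).
Proof.
  induction N as [|N IH].
  - simpl. apply cderiv_ext with (fun _ => c O).
    + exists 1. split; [lra|]. intros; ring.
    + apply cderiv_const.
  - apply cderiv_ext with (fun u => psum c u (S N) + c (S N) * u ^ S N)%C.
    { exists 1. split; [lra|]. reflexivity. }
    change (psum (dcoef c) z (S N)) with (psum (dcoef c) z N + dcoef c N * z ^ N)%C.
    replace (dcoef c N * z ^ N)%C
      with (0 * z ^ S N + c (S N) * (RtoC (INR (S N)) * z ^ pred (S N)))%C
      by (unfold dcoef; simpl pred; ring).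
    apply cderiv_plus; [exact IH|].
    apply (cderiv_mult (fun _ => c (S N)) (fun u => u ^ S N)%C);
      [apply cderiv_const|apply cderiv_pow].
Qed.

(* Cauchy's estimate on the circle of radius [|z| / 2] about [z] differentiates
   the remainder. *)
Lemma asy_dv (f : C -> C) (c : nat -> C) :
  near 0 (holo f) -> asy f c -> asy (dv f) (dcoef c).
Proof.
  intros (R0 & HR & Hf) Hc N. destruct (Hc (S N)) as (B & rho & Hrho & K).
  assert (Hf' : forall z, Cmod z < R0 -> holo f z).
  { intros z Hz. apply Hf. replace (z - 0)%C with z by ring. exact Hz. }
  assert (HB := Rabs_pos B). assert (HB' := Rle_abs B).
  exists (4 * (Rabs B * 2 ^ S N)), (Rmin (rho / 2) (R0 / 2)).
  split; [apply Rmin_pos; lra|]. intros z Hz.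
  assert (M1 := Rmin_l (rho / 2) (R0 / 2)). assert (M2 := Rmin_r (rho / 2) (R0 / 2)).
  set (g := fun u => (f u - psum c u (S N))%C).
  assert (Hg : forall u, Cmod (u - z) < Cmod z -> holo g u).
  { intros u Hu. assert (T := Cmod_triangle_rev u z). apply holo_minus; [apply Hf'; lra|].
    eexists. apply cderiv_psum. }
  destruct (cauchy_estimate g z (Cmod z) (Cmod z / 2) (Rabs B * (2 * Cmod z) ^ S N) Hg)
    as [_ D]; [lra| |].
  - intros u Hu. assert (T := Cmod_triangle_rev u z). assert (T' := Cmod_triangle_rev z u).
    rewrite Cmod_sub_sym in T'. unfold g. eapply Rle_trans; [apply K; lra|].
    assert (P : 0 <= Cmod u ^ S N) by (apply pow_le, Cmod_ge_0).
    apply Rle_trans with (Rabs B * Cmod u ^ S N); [apply Rmult_le_compat_r; lra|].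
    apply Rmult_le_compat_l; [exact HB|]. apply pow_incr. lra.
  - assert (E : dv g z = (dv f z - psum (dcoef c) z N)%C).
    { apply dv_eq, cderiv_minus; [|apply cderiv_psum]. apply dv_correct, Hf'. lra. }
    rewrite E in D. rewrite Rpow_mult_distr in D. simpl pow in D at 2.
    assert (G := Cmod_ge_0 (g z)).
    apply (Rmult_le_reg_r (Cmod z / 2)); [lra|].
    eapply Rle_trans; [exact D|]. rewrite <- !tech_pow_Rmult. nra.
Qed.

(** The derivative has the formally differentiated expansion at the point: its constant term gives
    continuity there, and its linear term is then the second derivative. *)
Lemma dv_holo (f : C -> C) (a : C) : near a (holo f) -> holo (dv f) a.
Proof.
  intros (R0 & HR & Hf). set (g := fun h => f (a + h)%C).
  assert (E : forall h, (a + h - a = h)%C) by (intros; ring).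
  assert (Hg : forall h, Cmod h < R0 -> holo g h).
  { intros h Hh. apply holo_shift, Hf. rewrite E. exact Hh. }
  assert (Ng := near_0_disk g R0 HR Hg).
  destruct (asy_exists g Ng) as (c & Hc).
  assert (Hd := asy_dv g c Ng Hc).
  assert (G1 : cderiv g 0 (c 1%nat)).
  { apply asy_cderiv_0; [|exact Hc]. apply holo_ccont, Hg. rewrite Cmod_0. exact HR. }
  assert (H : holo (dv g) 0).
  { eexists. apply asy_cderiv_0; [|exact Hd].
    destruct (Hd 1%nat) as (B & rho & Hrho & K). intros eps He.
    assert (HB := Rabs_pos B). assert (HB' := Rle_abs B).
    exists (Rmin rho (eps / (Rabs B + 1))). split.
    { apply Rmin_pos; [exact Hrho|apply Rdiv_lt_0_compat; lra]. }
    intros u Hu. assert (M1 := Rmin_l rho (eps / (Rabs B + 1))).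
    assert (M2 := Rmin_r rho (eps / (Rabs B + 1))).
    replace (u - 0)%C with u in * by ring.
    destruct (Ceq_dec u (RtoC 0)) as [->|N].
    - replace (dv g 0 - dv g 0)%C with (RtoC 0) by ring. rewrite Cmod_0. exact He.
    - assert (P : 0 < Cmod u) by (apply Cmod_gt_0, N).
      specialize (K u ltac:(lra)). simpl in K.
      replace (0 + dcoef c 0 * 1)%C with (c 1%nat) in K
        by (unfold dcoef; simpl; ring).
      rewrite (dv_eq g 0 _ G1). rewrite Rmult_1_r in K.
      assert (B * Cmod u <= Rabs B * Cmod u) by (apply Rmult_le_compat_r; lra).
      assert (Hq := Rdiv_mult_lt (Cmod u) (Rabs B + 1) eps ltac:(lra) ltac:(lra)). lra. }
  destruct H as [l Hl]. exists l. apply cderiv_unshift.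
  eapply cderiv_ext; [|exact Hl]. exists R0. split; [exact HR|].
  intros h Hh. replace (h - 0)%C with h in Hh by ring.
  apply dv_eq, cderiv_shift, dv_correct, Hf. rewrite E. exact Hh.
Qed.

(** * Univalent functions *)

Lemma Cmod_ccont_near (f : C -> C) (z : C) (m : R) :
  ccont f z -> m < Cmod (f z) -> near z (fun u => m < Cmod (f u)).
Proof.
  intros Hf Hm. eapply near_imp; [|exact (Hf (Cmod (f z) - m) ltac:(lra))].
  intros u Hu. assert (T := Cmod_triangle_rev (f z) (f u)). rewrite Cmod_sub_sym in T. lra.
Qed.

Lemma Cmod_ccont_near_le (f : C -> C) (z : C) (m : R) :
  ccont f z -> Cmod (f z) < m -> near z (fun u => Cmod (f u) < m).
Proof.
  intros Hf Hm. eapply near_imp; [|exact (Hf (m - Cmod (f z)) ltac:(lra))].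
  intros u Hu. assert (T := Cmod_triangle_rev (f u) (f z)). lra.
Qed.

Lemma near_true (z : C) (P : C -> Prop) : (forall u, P u) -> near z P.
Proof. intros H. exists 1. split; [lra|auto]. Qed.

Lemma sub_self (a : C) : (a - a)%C = RtoC 0.
Proof. ring. Qed.

Lemma center_disk (a : C) (r : R) : 0 < r -> Cmod (a - a) < r.
Proof. intros H. rewrite sub_self, Cmod_0. exact H. Qed.

(* If [w] is omitted, the maximum principle for [1 / (f - w)] fails. *)
Lemma open_map (f : C -> C) (z0 : C) (rho : R) : 0 < rho ->
  (forall z, Cmod (z - z0) <= rho -> holo f z) ->
  (forall z, Cmod (z - z0) = rho -> f z <> f z0) ->
  exists eta, 0 < eta /\ forall w, Cmod (w - f z0) < eta ->
    exists z, Cmod (z - z0) < rho /\ f z = w.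
Proof.
  intros Hr Hf Hinj. assert (E : forall h, (z0 + h - z0 = h)%C) by (intros; ring).
  destruct (local_uniform rho (fun m u => Cmod u = rho -> m <= Cmod (f (z0 + u)%C - f z0)))
    as (m & Hm & K).
  { intros m m' u L Q Hu. specialize (Q Hu). lra. }
  { intros u Hu. destruct (Req_dec (Cmod u) rho) as [Eu|Nu].
    - assert (P : 0 < Cmod (f (z0 + u)%C - f z0)).
      { apply Cmod_sub_pos, Hinj. rewrite E. exact Eu. }
      assert (Cc : ccont (fun u => f (z0 + u)%C - f z0)%C u).
      { apply holo_ccont, holo_minus; [|apply holo_const]. apply holo_shift, Hf.
        rewrite E. lra. }
      destruct (Cmod_ccont_near _ u (Cmod (f (z0 + u)%C - f z0) / 2) Cc ltac:(lra))
        as (d & Hd & L).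
      exists d. split; [exact Hd|]. exists (Cmod (f (z0 + u)%C - f z0) / 2).
      split; [lra|]. intros v Hv _ _. left. apply L, Hv.
    - exists (Rabs (Cmod u - rho)). split; [apply Rabs_pos_lt; lra|].
      exists 1. split; [lra|]. intros v Hv _ Ev. exfalso.
      assert (T1 := Cmod_triangle_rev v u). assert (T2 := Cmod_triangle_rev u v).
      rewrite Cmod_sub_sym in T2. rewrite Ev in *.
      revert Hv. unfold Rabs. destruct (Rcase_abs (Cmod u - rho)); lra. }
  exists (m / 2). split; [lra|]. intros w Hw. apply NNPP. intros Hn.
  assert (Hmiss : forall z, Cmod (z - z0) < rho -> f z <> w).
  { intros z Hz Ez. apply Hn. exists z. auto. }
  assert (Hcirc : forall z, Cmod (z - z0) = rho -> m / 2 <= Cmod (f z - w)).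
  { intros z Hz. specialize (K (z - z0)%C ltac:(lra) Hz).
    replace (z0 + (z - z0))%C with z in K by ring.
    assert (T := Cmod_sub_triangle (f z) w (f z0)). lra. }
  assert (HM : Cmod (/ (f z0 - w)) <= 2 / m).
  { apply (max_modulus (fun z => Cmod (z - z0) < rho) (fun z => / (f z - w))%C
      (Cmod z0 + rho) (2 / m)).
    - left. apply Rdiv_lt_0_compat; lra.
    - intros z Hz. apply near_disk, Hz.
    - intros z Hz. apply holo_inv; [|apply Csub_neq, Hmiss, Hz].
      apply holo_minus; [apply Hf; lra|apply holo_const].
    - intros z Hz. assert (T := Cmod_triangle_rev z z0). lra.
    - intros z _ Hz e He. apply Rnot_lt_le in Hz. destruct Hz as [Hz|Hz].
      + eapply near_imp; [|apply (near_outside z0 z rho Hz)]. intros u Hu Hu'. lra.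
      + symmetry in Hz. assert (P := Hcirc z Hz).
        assert (N : (f z - w)%C <> RtoC 0) by (apply Cmod_gt_0; lra).
        assert (Cc : ccont (fun z => / (f z - w))%C z).
        { apply holo_ccont, holo_inv; [|exact N].
          apply holo_minus; [apply Hf; lra|apply holo_const]. }
        eapply near_imp; [|apply (Cmod_ccont_near_le _ z (2 / m + e) Cc)].
        * intros u Hu _. lra.
        * rewrite Cmod_inv by exact N. apply Rle_lt_trans with (2 / m); [|lra].
          replace (2 / m) with (/ (m / 2)) by (field; lra). apply Rinv_le_contravar; lra.
    - apply center_disk, Hr. }
  assert (N : (f z0 - w)%C <> RtoC 0) by (apply Csub_neq, Hmiss, center_disk, Hr).
  rewrite Cmod_inv in HM by exact N. rewrite Cmod_sub_sym in Hw.
  assert (P : 0 < Cmod (f z0 - w)) by (apply Cmod_gt_0, N).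
  apply (Rmult_le_compat_l (Cmod (f z0 - w))) in HM; [|lra].
  rewrite Rinv_r in HM by lra.
  assert (Cmod (f z0 - w) * (2 / m) < m / 2 * (2 / m)).
  { apply Rmult_lt_compat_r; [apply Rdiv_lt_0_compat; lra|exact Hw]. }
  replace (m / 2 * (2 / m)) with 1 in H by (field; lra). lra.
Qed.

(** The first nonzero coefficient dominates near 0. This isolates the zeros of a derivative in
    [injective_dv_neq_0]. *)
Lemma nonzero_near (g : C -> C) (c : nat -> C) (n : nat) :
  asy g c -> c n <> RtoC 0 -> near 0 (fun z => z <> RtoC 0 -> g z <> RtoC 0).
Proof.
  intros Hg. induction n as [n IH] using Wf_nat.lt_wf_ind. intros Hn.
  destruct (classic (exists k, (k < n)%nat /\ c k <> RtoC 0)) as [(k & Hk & Nk)|Hz].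
  { apply (IH k Hk Nk). }
  assert (Z : forall z k, (k <= n)%nat -> psum c z k = RtoC 0).
  { intros z k. induction k as [|k IHk]; intros Hk; simpl; [reflexivity|].
    rewrite IHk by lia. destruct (classic (c k = RtoC 0)) as [->|Nk]; [ring|].
    exfalso. apply Hz. exists k. split; [lia|exact Nk]. }
  destruct (Hg (S n)) as (B & rho & Hrho & K).
  assert (HB := Rabs_pos B). assert (HB' := Rle_abs B).
  assert (P : 0 < Cmod (c n)) by (apply Cmod_gt_0, Hn).
  exists (Rmin rho (Cmod (c n) / (Rabs B + 1))). split.
  { apply Rmin_pos; [exact Hrho|apply Rdiv_lt_0_compat; lra]. }
  intros z Hz0 Nz Ez. replace (z - 0)%C with z in Hz0 by ring.
  assert (M1 := Rmin_l rho (Cmod (c n) / (Rabs B + 1))).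
  assert (M2 := Rmin_r rho (Cmod (c n) / (Rabs B + 1))).
  assert (Pz : 0 < Cmod z) by (apply Cmod_gt_0, Nz).
  specialize (K z ltac:(lra)). rewrite Ez in K. simpl psum in K.
  rewrite Z in K by lia.
  replace (0 - (0 + c n * z ^ n))%C with (- (c n * z ^ n))%C in K by ring.
  rewrite Cmod_opp, Cmod_mult, Cmod_pow, <- tech_pow_Rmult, <- Rmult_assoc in K.
  assert (Pn : 0 < Cmod z ^ n) by (apply pow_lt; exact Pz).
  assert (K' : Cmod (c n) <= B * Cmod z).
  { apply (Rmult_le_reg_r (Cmod z ^ n)); [exact Pn|exact K]. }
  assert (B * Cmod z <= Rabs B * Cmod z) by (apply Rmult_le_compat_r; lra).
  assert (Hq := Rdiv_mult_lt (Cmod z) (Rabs B + 1) (Cmod (c n)) ltac:(lra) ltac:(lra)). lra.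
Qed.

Lemma taylor_constant (f : C -> C) (R0 : R) (c : nat -> C) : taylor f R0 c ->
  (forall n, c (S n) = RtoC 0) -> forall z, Cmod z < R0 -> f z = c O.
Proof.
  intros HT H0 z Hz. assert (Z0 := Cmod_ge_0 z).
  set (r := (Cmod z + R0) / 2). destruct (HT r) as [B K]; [unfold r; lra|].
  assert (E : forall N, psum c z (S N) = c O).
  { induction N as [|N IH]; [simpl; ring|].
    change (psum c z (S (S N))) with (psum c z (S N) + c (S N) * z ^ S N)%C.
    rewrite IH, H0. ring. }
  apply Ceq_eps. intros eps He.
  assert (HB := Rabs_pos B). assert (HB' := Rle_abs B).
  assert (Q : 0 <= Cmod z / r < 1).
  { split; [apply Rmult_le_pos; [lra|left; apply Rinv_0_lt_compat; unfold r; lra]|].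
    apply (Rmult_lt_reg_r r); [unfold r; lra|].
    unfold Rdiv. rewrite Rmult_assoc, Rinv_l by (unfold r; lra). unfold r; lra. }
  destruct (pow_lt_1_zero (Cmod z / r) ltac:(rewrite Rabs_pos_eq; lra) (eps / (Rabs B + 1)))
    as [N HN]; [apply Rdiv_lt_0_compat; lra|].
  specialize (HN (S N) ltac:(lia)). rewrite Rabs_pos_eq in HN by (apply pow_le; lra).
  specialize (K z (S N) ltac:(unfold r; lra)). rewrite E in K.
  assert (P : 0 <= (Cmod z / r) ^ S N) by (apply pow_le; lra).
  assert (B * (Cmod z / r) ^ S N <= Rabs B * (Cmod z / r) ^ S N)
    by (apply Rmult_le_compat_r; lra).
  assert (Hq := Rdiv_mult_lt _ (Rabs B + 1) eps ltac:(lra) HN). lra.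
Qed.

(** * Inverses of injective holomorphic functions *)

Definition inverse (f : C -> C) (U : C -> Prop) (w : C) : C :=
  epsilon (inhabits (RtoC 0)) (fun z => U z /\ f z = w).

Definition image (f : C -> C) (U : C -> Prop) (w : C) : Prop := exists z, U z /\ f z = w.

Definition injective_on (U : C -> Prop) (f : C -> C) : Prop :=
  forall z1 z2, U z1 -> U z2 -> f z1 = f z2 -> z1 = z2.

Definition holo_on (U : C -> Prop) (f : C -> C) : Prop := forall z, U z -> holo f z.

Lemma inverse_l (f : C -> C) (U : C -> Prop) (z : C) :
  injective_on U f -> U z -> inverse f U (f z) = z.
Proof.
  intros Hi Uz. unfold inverse.
  destruct (epsilon_spec (inhabits (RtoC 0)) (fun u => U u /\ f u = f z)) as [H1 H2].
  - exists z. auto.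
  - apply Hi; assumption.
Qed.

Lemma inverse_r (f : C -> C) (U : C -> Prop) (w : C) :
  image f U w -> U (inverse f U w) /\ f (inverse f U w) = w.
Proof.
  intros H. unfold inverse.
  exact (epsilon_spec (inhabits (RtoC 0)) (fun u => U u /\ f u = w) H).
Qed.

(** Injectivity supplies what [open_map] asks on a circle, namely that the value at the centre is
    not taken there. *)
Lemma injective_open (f : C -> C) (U : C -> Prop) (z : C) (eps : R) :
  copen U -> holo_on U f -> injective_on U f -> U z -> 0 < eps ->
  near (f z) (image f (fun u => U u /\ Cmod (u - z) < eps)).
Proof.
  intros HU Hf Hi Uz He. destruct (HU z Uz) as (d & Hd & K).
  set (rho := Rmin (d / 2) (eps / 2)).
  assert (M1 : rho <= d / 2) by apply Rmin_l. assert (M2 : rho <= eps / 2) by apply Rmin_r.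
  assert (Hr : 0 < rho) by (apply Rmin_pos; lra).
  destruct (open_map f z rho Hr) as (eta & Heta & L).
  - intros u Hu. apply Hf, K. lra.
  - intros u Hu E. apply Hi in E; [|apply K; lra|exact Uz].
    subst u. rewrite sub_self, Cmod_0 in Hu. lra.
  - exists eta. split; [exact Heta|]. intros w Hw. destruct (L w Hw) as (u & Hu & Eu).
    exists u. split; [|exact Eu]. split; [apply K|]; lra.
Qed.

Lemma image_open (f : C -> C) (U : C -> Prop) :
  copen U -> holo_on U f -> injective_on U f -> copen (image f U).
Proof.
  intros HU Hf Hi w (z & Uz & <-).
  eapply near_imp; [|apply (injective_open f U z 1 HU Hf Hi Uz Rlt_0_1)].
  intros w' (u & [Uu _] & Eu). exists u. auto.
Qed.

Lemma inverse_ccont (f : C -> C) (U : C -> Prop) (z : C) :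
  copen U -> holo_on U f -> injective_on U f -> U z -> ccont (inverse f U) (f z).
Proof.
  intros HU Hf Hi Uz. apply ccont_near. intros eps He.
  eapply near_imp; [|apply (injective_open f U z eps HU Hf Hi Uz He)].
  intros w (u & [Uu Hu] & <-). rewrite !inverse_l by assumption. exact Hu.
Qed.

Lemma inverse_cderiv_aux (f : C -> C) (U : C -> Prop) (z : C) :
  copen U -> holo_on U f -> injective_on U f -> U z -> dv f z <> RtoC 0 ->
  cderiv (inverse f U) (f z) (/ dv f z).
Proof.
  intros HU Hf Hi Uz Nd. assert (Hc := inverse_ccont f U z HU Hf Hi Uz).
  assert (Hio := image_open f U HU Hf Hi).
  assert (N : forall u, U u -> sl f z u <> RtoC 0).
  { intros u Uu E. destruct (Ceq_dec u z) as [->|Nu]; [rewrite sl_at in E; tauto|].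
    apply Nu, Hi; try assumption. rewrite (sl_eq f z u), E. ring. }
  (* Off the image [inverse] is an arbitrary choice; there it is replaced by the tangent, so that
     the slope identity holds for every w. *)
  apply cderiv_ext with (fun w => match excluded_middle_informative (image f U w) with
     left _ => inverse f U w
   | right _ => (z + / dv f z * (w - f z))%C end).
  { eapply near_imp; [|apply (Hio (f z)); exists z; auto]. intros w Hw.
    destruct (excluded_middle_informative (image f U w)); tauto. }
  apply cderiv_slope.
  exists (fun w => match excluded_middle_informative (image f U w) with
     left _ => (/ sl f z (inverse f U w))%C | right _ => (/ dv f z)%C end).
  assert (Iz : image f U (f z)) by (exists z; auto).
  destruct (excluded_middle_informative (image f U (f z))) as [_|Q]; [|tauto].
  rewrite inverse_l by assumption. split; [rewrite sl_at; reflexivity|]. split.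
  - apply ccont_ext with (fun w => / sl f z (inverse f U w))%C.
    + eapply near_imp; [|apply (Hio (f z)); exact Iz]. intros w Hw.
      destruct (excluded_middle_informative (image f U w)); tauto.
    + apply (ccont_comp (fun u => / sl f z u)%C (inverse f U)); [exact Hc|].
      rewrite inverse_l by assumption.
      apply (ccont_comp (fun u => / u)%C (sl f z)); [apply sl_ccont, Hf, Uz|].
      apply ccont_inv, N, Uz.
  - intros w. destruct (excluded_middle_informative (image f U w)) as [Hw|_]; [|reflexivity].
    destruct Hw as (u & Uu & <-). rewrite inverse_l by assumption.
    replace (f u - f z)%C with (sl f z u * (u - z))%C; [field; apply N, Uu|].
    rewrite (sl_eq f z u) at 1. ring.
Qed.

(** If the derivative vanished at z, this zero would be isolated, so the continuous inverse would be
    differentiable near f(z) off that point and, by removability, at it; the chain rule then gives 0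
    = 1. *)
Lemma injective_dv_neq_0 (f : C -> C) (U : C -> Prop) (z : C) :
  copen U -> holo_on U f -> injective_on U f -> U z -> dv f z <> RtoC 0.
Proof.
  intros HU Hf Hi Uz E0. destruct (HU z Uz) as (R0 & HR & KU).
  set (g := fun h => f (z + h)%C). assert (E : forall h, (z + h - z = h)%C) by (intros; ring).
  assert (Hg : forall h, Cmod h < R0 -> holo g h).
  { intros h Hh. apply holo_shift, Hf, KU. rewrite E. exact Hh. }
  assert (Ng := near_0_disk g R0 HR Hg).
  destruct (taylor_exists g R0 HR) as (c & HT & _).
  { intros; apply holo_ccont; auto. }
  { intros; apply Hg; lra. }
  assert (Hc := taylor_asy g R0 c HR HT).
  assert (Hn : exists n, c (S n) <> RtoC 0).
  { apply NNPP. intros Hn. assert (Z : forall n, c (S n) = RtoC 0).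
    { intros n. apply NNPP. intros Q. apply Hn. exists n. exact Q. }
    assert (K := taylor_constant g R0 c HT Z).
    assert (Mh : Cmod (RtoC (R0 / 2)) = R0 / 2) by (rewrite Cmod_R, Rabs_pos_eq; lra).
    assert (Q : RtoC (R0 / 2) = RtoC 0).
    { assert (Q : (z + RtoC (R0 / 2) = z + 0)%C).
      { apply Hi.
        - apply KU. rewrite E. lra.
        - apply KU. rewrite E, Cmod_0. exact HR.
        - fold (g (RtoC (R0 / 2))) (g 0). rewrite !K; [reflexivity|rewrite Cmod_0; lra|lra]. }
      apply (f_equal (fun u => u - z)%C) in Q. rewrite !E in Q. exact Q. }
    rewrite Q, Cmod_0 in Mh. lra. }
  destruct Hn as [n Hn].
  assert (Nd : near 0 (fun h => h <> RtoC 0 -> dv g h <> RtoC 0)).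
  { apply (nonzero_near (dv g) (dcoef c) n); [apply asy_dv; assumption|].
    unfold dcoef. apply Cmult_neq_0; [|exact Hn]. intros Q.
    apply RtoC_inj in Q. assert (P := pos_INR n). rewrite S_INR in Q. lra. }
  destruct Nd as (d & Hd & KN).
  set (rho := Rmin d R0). assert (Hrho : 0 < rho) by (apply Rmin_pos; assumption).
  assert (M1 : rho <= d) by apply Rmin_l. assert (M2 : rho <= R0) by apply Rmin_r.
  assert (KN' : forall u, Cmod (u - z) < rho -> u <> z -> dv f u <> RtoC 0).
  { intros u Hu Nu. assert (Eu : dv g (u - z)%C = dv f u).
    { apply dv_eq, cderiv_shift. replace (z + (u - z))%C with u by ring.
      apply dv_correct, Hf, KU. lra. }
    rewrite <- Eu. apply KN; [|apply Csub_neq, Nu].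
    replace (u - z - 0)%C with (u - z)%C by ring. lra. }
  set (L := inverse f U).
  assert (HL : holo L (f z)).
  { apply removable; [apply inverse_ccont; assumption|].
    eapply near_imp; [|apply (injective_open f U z rho HU Hf Hi Uz Hrho)].
    intros w (u & [Uu Hu] & <-) Nw. exists (/ dv f u)%C.
    apply inverse_cderiv_aux; try assumption. apply KN'; [exact Hu|].
    intros ->. tauto. }
  destruct HL as [l Hl].
  assert (D := cderiv_comp L f z l (dv f z) (dv_correct _ _ (Hf z Uz)) Hl).
  assert (D' : cderiv (fun u => L (f u)) z 1).
  { apply cderiv_ext with (fun u => u); [|apply cderiv_id].
    eapply near_imp; [|apply (HU z Uz)]. intros u Uu. symmetry.
    apply inverse_l; assumption. }
  assert (Q := cderiv_unique _ _ _ _ D D'). rewrite E0, Cmult_0_r in Q.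
  apply RtoC_inj in Q. lra.
Qed.

Lemma inverse_cderiv (f : C -> C) (U : C -> Prop) (z : C) :
  copen U -> holo_on U f -> injective_on U f -> U z ->
  cderiv (inverse f U) (f z) (/ dv f z).
Proof.
  intros HU Hf Hi Uz. apply inverse_cderiv_aux; try assumption.
  eapply injective_dv_neq_0; eassumption.
Qed.

Lemma inverse_holo (f : C -> C) (U : C -> Prop) (w : C) :
  copen U -> holo_on U f -> injective_on U f -> image f U w -> holo (inverse f U) w.
Proof.
  intros HU Hf Hi (z & Uz & <-). eexists. apply inverse_cderiv; assumption.
Qed.

Lemma sl_neq_0 (f : C -> C) (U : C -> Prop) (a z : C) :
  copen U -> holo_on U f -> injective_on U f -> U a -> U z -> sl f a z <> RtoC 0.
Proof.
  intros HU Hf Hi Ua Uz E. destruct (Ceq_dec z a) as [->|N].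
  - rewrite sl_at in E. revert E. eapply injective_dv_neq_0; eassumption.
  - apply N, Hi; try assumption. rewrite (sl_eq f a z), E. ring.
Qed.

(** * The Schwarz lemma and Liouville's theorem *)

Lemma schwarz (f : C -> C) :
  (forall z, Cmod z < 1 -> holo f z) -> (forall z, Cmod z < 1 -> Cmod (f z) <= 1) ->
  f 0 = RtoC 0 -> forall z, Cmod z < 1 -> Cmod (sl f 0 z) <= 1.
Proof.
  intros Hf Hb H0. apply max_modulus_disk; [lra| |].
  - intros z Hz. apply sl_holo; [|auto]. apply (near_0_disk f 1); [lra|exact Hf].
  (* Beyond this radius |f(z) / z| <= 1 / |z| < 1 + e. *)
  - intros e He. exists (/ (1 + e)). split.
    { rewrite <- Rinv_1. apply Rinv_lt_contravar; lra. }
    intros z Hz. assert (P : 0 < / (1 + e)) by (apply Rinv_0_lt_compat; lra).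
    assert (N : z <> RtoC 0) by (apply Cmod_gt_0; lra).
    rewrite sl_off by exact N. rewrite H0.
    replace ((f z - 0) / (z - 0))%C with (f z / z)%C by (field; exact N).
    rewrite Cmod_div by exact N. specialize (Hb z ltac:(lra)).
    apply (Rmult_le_reg_r (Cmod z)); [lra|]. unfold Rdiv. rewrite Rmult_assoc, Rinv_l by lra.
    assert (Q : (1 + e) * / (1 + e) <= (1 + e) * Cmod z) by (apply Rmult_le_compat_l; lra).
    rewrite Rinv_r in Q by lra. lra.
Qed.

Lemma schwarz_le (f : C -> C) :
  (forall z, Cmod z < 1 -> holo f z) -> (forall z, Cmod z < 1 -> Cmod (f z) <= 1) ->
  f 0 = RtoC 0 -> forall z, Cmod z < 1 -> Cmod (f z) <= Cmod z.
Proof.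
  intros Hf Hb H0 z Hz. rewrite (sl_eq f 0 z), H0.
  replace (0 + sl f 0 z * (z - 0))%C with (sl f 0 z * z)%C by ring.
  rewrite Cmod_mult. assert (K := schwarz f Hf Hb H0 z Hz). assert (P := Cmod_ge_0 z). nra.
Qed.

Lemma liouville (f : C -> C) (M : R) :
  (forall z, holo f z) -> (forall z, Cmod (f z) <= M) -> forall z, f z = f 0.
Proof.
  intros Hf HM z. assert (M0 : 0 <= M) by (eapply Rle_trans; [apply Cmod_ge_0|apply (HM 0)]).
  assert (Z0 := Cmod_ge_0 z).
  assert (Hs : forall u, holo (sl f 0) u).
  { intros u. apply sl_holo; [apply near_true; exact Hf|apply Hf]. }
  assert (E : sl f 0 z = RtoC 0).
  (* Every u on the circle of radius r about z has |u| > 2 M / eps, so the difference quotient there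
     is at most eps. *)
  { apply Ceq_eps. intros eps He. set (r := 1 + Cmod z + 2 * M / eps).
    assert (Q : 0 <= 2 * M / eps)
      by (apply Rmult_le_pos; [lra|left; apply Rinv_0_lt_compat, He]).
    destruct (cauchy_estimate (sl f 0) z (r + 1) r eps) as [K _].
    - intros u _. apply Hs.
    - unfold r. lra.
    - intros u Hu. assert (T := Cmod_triangle_rev (u - z) (- z)%C).
      rewrite Cmod_opp, Hu in T. replace (u - z - - z)%C with u in T by ring.
      assert (N : u <> RtoC 0) by (apply Cmod_gt_0; unfold r in T; lra).
      rewrite sl_off by exact N. replace (u - 0)%C with u by ring.
      rewrite Cmod_div by exact N.
      assert (T' := Cmod_triangle (f u) (- f 0)). rewrite Cmod_opp in T'.
      assert (H1 := HM u). assert (H2 := HM 0).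
      assert (P : 0 < Cmod u) by (apply Cmod_gt_0, N).
      apply (Rmult_le_reg_r (Cmod u)); [exact P|]. unfold Rdiv.
      rewrite Rmult_assoc, Rinv_l by lra. unfold Cminus.
      assert (L : eps * (2 * M / eps) <= eps * Cmod u)
        by (apply Rmult_le_compat_l; unfold r in T; lra).
      replace (eps * (2 * M / eps)) with (2 * M) in L by (field; lra). lra.
    - replace (sl f 0 z - 0)%C with (sl f 0 z) by ring. exact K. }
  rewrite (sl_eq f 0 z), E. ring.
Qed.

(** * Study's argument *)

(** [v] is omitted by 1 / G, written without a division so that a zero of G, where 1 / G is
    infinite, needs no case of its own. *)
Definition omitted (G : C -> C) (v : C) : Prop :=
  forall z, unit_disk z -> (v * G z)%C <> RtoC 1.

(* [1 / G] maps the disk onto the complement of a compact convex set. *)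
Definition inv_concave (G : C -> C) : Prop :=
  holo_on unit_disk G /\ injective_on unit_disk G /\ G 0 = RtoC 0 /\
  forall (u v : C) (s : R), 0 <= s <= 1 -> omitted G u -> omitted G v ->
    omitted G (RtoC s * u + RtoC (1 - s) * v)%C.

Lemma copen_disk : copen unit_disk.
Proof. intros z Hz. apply near_disk0, Hz. Qed.

Lemma unit_disk_0 : unit_disk 0.
Proof. unfold unit_disk. rewrite Cmod_0. lra. Qed.

Lemma inv_concave_neq_0 (G : C -> C) (z : C) :
  inv_concave G -> unit_disk z -> z <> RtoC 0 -> G z <> RtoC 0.
Proof.
  intros (_ & Hi & H0 & _) Hz N E. apply N, Hi; [exact Hz|apply unit_disk_0|].
  rewrite E, H0. reflexivity.
Qed.

(** The points 1 / G(xi) with |xi| <= rho keep a fixed distance from the omitted set: a v too close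
    to one of them would have 1 / v in the neighbourhood of G(xi) that the image of G covers.
    Openness is made uniform by compactness. *)
Lemma omitted_far (G : C -> C) (rho : R) : inv_concave G -> rho < 1 ->
  exists del, 0 < del /\ forall xi u v, Cmod xi <= rho -> omitted G v ->
    (u * G xi)%C = RtoC 1 -> del <= Cmod (u - v).
Proof.
  intros (Hf & Hi & H0 & _) Hrho.
  destruct (local_uniform rho (fun m xi => forall w, Cmod (w - G xi) < m -> image G unit_disk w))
    as (eta & Heta & K).
  { intros m m' u L Q w Hw. apply Q. lra. }
  { intros xi Hxi. assert (Dxi : unit_disk xi) by (unfold unit_disk; lra).
    destruct (image_open G unit_disk copen_disk Hf Hi (G xi)) as (d & Hd & L);
      [exists xi; auto|].
    destruct (holo_ccont _ _ (Hf xi Dxi) (d / 2) ltac:(lra)) as (d' & Hd' & L').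
    exists d'. split; [exact Hd'|]. exists (d / 2). split; [lra|].
    intros xi' Hxi' _ w Hw. apply L. specialize (L' xi' Hxi').
    assert (T := Cmod_sub_triangle w (G xi') (G xi)). lra. }
  destruct (bounded_disk G rho) as (B & HB & KB).
  { intros z Hz. apply holo_ccont, Hf. unfold unit_disk; lra. }
  assert (B2 : 0 < B * B) by (apply Rmult_lt_0_compat; exact HB).
  (* The first bound keeps |v G(xi)| above 1/2, the second brings 1 / v within eta of G(xi). *)
  exists (Rmin (/ (2 * B)) (eta / (4 * (B * B)))). split.
  { apply Rmin_pos; [apply Rinv_0_lt_compat; lra|apply Rdiv_lt_0_compat; lra]. }
  intros xi u v Hxi Hv Hu. apply Rnot_lt_le. intros L.
  assert (M1 := Rmin_l (/ (2 * B)) (eta / (4 * (B * B)))).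
  assert (M2 := Rmin_r (/ (2 * B)) (eta / (4 * (B * B)))).
  rewrite Cmod_sub_sym in L. set (d := Cmod (v - u)) in *. assert (D0 : 0 <= d) by apply Cmod_ge_0.
  specialize (KB xi Hxi). assert (G0 := Cmod_ge_0 (G xi)).
  assert (E : (v * G xi = 1 + (v - u) * G xi)%C) by (rewrite <- Hu; ring).
  assert (L1 : d * B < 1 / 2).
  { apply Rlt_le_trans with (/ (2 * B) * B); [apply Rmult_lt_compat_r; lra|].
    right. field. lra. }
  assert (L2 : 4 * (B * B) * d < eta) by (apply Rdiv_mult_lt; lra).
  assert (Hd : Cmod ((v - u) * G xi) <= d * B).
  { rewrite Cmod_mult. apply Rmult_le_compat_l; assumption. }
  assert (Hv2 : 1 / 2 < Cmod (v * G xi)).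
  { rewrite E. assert (T := Cmod_triangle_rev 1 (- ((v - u) * G xi))).
    rewrite Cmod_opp, Cmod_1 in T.
    replace (1 - - ((v - u) * G xi))%C with (1 + (v - u) * G xi)%C in T by ring. lra. }
  assert (NvG : (v * G xi)%C <> RtoC 0) by (apply Cmod_gt_0; lra).
  assert (Nv : v <> RtoC 0) by (intros ->; apply NvG; ring).
  destruct (K xi Hxi (/ v)%C) as (z & Hz & Ez).
  - assert (Eq : (/ v - G xi = - (G xi * ((v - u) * G xi)) / (v * G xi))%C).
    { apply (f_equal (fun y => (y / v)%C)) in E.
      assert (NG : G xi <> RtoC 0) by (intros Q; apply NvG; rewrite Q; ring).
      replace ((v - u) * G xi)%C with (v * G xi - 1)%C.
      - field. auto.
      - rewrite <- Hu. ring. }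
    rewrite Eq, Cmod_div, Cmod_opp, (Cmod_mult (G xi)) by exact NvG.
    apply (Rmult_lt_reg_r (Cmod (v * G xi))); [lra|].
    unfold Rdiv. rewrite Rmult_assoc, Rinv_l, Rmult_1_r by lra.
    assert (Cmod (G xi) * Cmod ((v - u) * G xi) <= B * (d * B))
      by (apply Rmult_le_compat; try apply Cmod_ge_0; assumption).
    assert (eta * (1 / 2) <= eta * Cmod (v * G xi)) by (apply Rmult_le_compat_l; lra).
    assert (0 <= B * B * d) by (apply Rmult_le_pos; lra). lra.
  - apply (Hv z Hz). rewrite Ez. field. exact Nv.
Qed.

(** Properness of a univalent map: for |z| >= 1/2 the values 1 / G(z) stay in a compact disk. Each
    point of that disk is either close to an omitted value or attained well inside the unit disk,
    hence, by injectivity, not attained near the circle. *)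
Lemma boundary_near_omitted (G : C -> C) (del : R) : inv_concave G -> 0 < del ->
  exists rho, 0 < rho < 1 /\ forall z, rho < Cmod z < 1 ->
    exists v, omitted G v /\ Cmod (/ G z - v) < del.
Proof.
  intros HG Hdel. assert (HG' := HG). destruct HG' as (Hf & Hi & H0 & _).
  destruct (injective_open G unit_disk 0 (1 / 2) copen_disk Hf Hi unit_disk_0 ltac:(lra))
    as (eta & Heta & K0). rewrite H0 in K0.
  assert (Hbig : forall z, 1 / 2 <= Cmod z < 1 -> eta <= Cmod (G z)).
  { intros z Hz. apply Rnot_lt_le. intros L.
    destruct (K0 (G z)) as (u & [Du Hu] & Eu).
    - replace (G z - 0)%C with (G z) by ring. exact L.
    - apply Hi in Eu; [|exact Du|unfold unit_disk; lra]. subst u.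
      replace (z - 0)%C with z in Hu by ring. lra. }
  destruct (local_uniform (/ eta) (fun m u => (exists v, omitted G v /\ Cmod (u - v) < del) \/
     exists xi, unit_disk xi /\ Cmod xi <= 1 - m /\ (u * G xi)%C = RtoC 1)) as (m & Hm & K).
  { intros m m' u L [Q|(xi & Q1 & Q2 & Q3)]; [left; exact Q|].
    right. exists xi. repeat split; [exact Q1|lra|exact Q3]. }
  { intros u0 _. destruct (classic (omitted G u0)) as [Ho|Ho].
    - exists del. split; [exact Hdel|]. exists 1. split; [lra|].
      intros u Hu _. left. exists u0. auto.
    - apply not_all_ex_not in Ho. destruct Ho as [xi Ho].
      apply imply_to_and in Ho. destruct Ho as [Dxi Ho]. apply NNPP in Ho.
      assert (Nu : u0 <> RtoC 0).
      { intros ->. rewrite Cmult_0_l in Ho. apply RtoC_inj in Ho. lra. }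
      assert (Hx : Cmod xi < 1) by exact Dxi.
      assert (NI := injective_open G unit_disk xi ((1 - Cmod xi) / 2) copen_disk Hf Hi Dxi
         ltac:(lra)).
      replace (G xi) with (/ u0)%C in NI.
      2:{ replace (/ u0)%C with (u0 * G xi / u0)%C by (rewrite Ho; field; exact Nu).
          field. exact Nu. }
      destruct (near_and _ _ _ (near_neq 0 u0 Nu) (ccont_pull _ _ _ (ccont_inv u0 Nu) NI))
        as (d & Hd & L).
      exists d. split; [exact Hd|]. exists ((1 - Cmod xi) / 2). split; [lra|].
      intros u Hu _. right. destruct (L u Hu) as [Nu' (xi' & [Dxi' Hxi'] & E)].
      exists xi'. split; [exact Dxi'|]. split.
      + assert (T := Cmod_triangle_rev xi' xi). lra.
      + rewrite E. field. exact Nu'. }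
  assert (S1 := Rmax_l (1 / 2) (1 - m)). assert (S2 := Rmax_r (1 / 2) (1 - m)).
  exists (Rmax (1 / 2) (1 - m)). split; [split; [lra|apply Rmax_lub_lt; lra]|].
  intros z Hz. assert (Dz : unit_disk z) by (unfold unit_disk; lra).
  assert (Nz : z <> RtoC 0) by (apply Cmod_gt_0; lra).
  assert (NG := inv_concave_neq_0 G z HG Dz Nz).
  destruct (K (/ G z)%C) as [Q|(xi & Dxi & Hxi & E)].
  - rewrite Cmod_inv by exact NG. apply Rinv_le_contravar; [exact Heta|apply Hbig; lra].
  - exact Q.
  - exfalso. assert (E2 : G xi = G z).
    { replace (G xi) with (/ G z * G xi * G z)%C by (field; exact NG). rewrite E. ring. }
    apply Hi in E2; [|exact Dxi|exact Dz]. subst xi. lra.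
Qed.

Lemma unit_disk_rotate (x z : C) : Cmod x = 1 -> unit_disk z -> unit_disk (x * z).
Proof. unfold unit_disk. intros Hx Hz. rewrite Cmod_mult, Hx. lra. Qed.

Lemma holo_rotate (f : C -> C) (x z : C) : holo f (x * z)%C -> holo (fun z => f (x * z)%C) z.
Proof.
  intros H. apply (holo_comp f (fun z => x * z)%C); [|exact H].
  apply holo_mult; [apply holo_const|apply holo_id].
Qed.

(* Study's argument: the points [s / G (x z) + (1 - s) / G z] off the convex set
   pull back under [1 / G] to points of modulus at least [|z|], by the maximum
   principle for [z / pull-back] on the open set where the pull-back exists. *)
Lemma study (G : C -> C) (x : C) (s : R) (z xi : C) : inv_concave G ->
  Cmod x = 1 -> 0 < s < 1 / 2 -> unit_disk z -> z <> RtoC 0 -> unit_disk xi ->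
  ((RtoC s / G (x * z)%C + RtoC (1 - s) / G z) * G xi)%C = RtoC 1 ->
  Cmod z <= Cmod xi.
Proof.
  intros HG Hx Hs Hz Nz Hxi HE. assert (HG' := HG). destruct HG' as (Hf & Hi & H0 & Hconv).
  set (g := sl G 0). set (L := inverse G unit_disk).
  assert (Nx : x <> RtoC 0) by (apply Cmod_gt_0; lra).
  assert (N0 : near 0 (holo G)) by (apply (near_0_disk G 1); [lra|exact Hf]).
  assert (Hg : forall u, unit_disk u -> holo g u) by (intros; apply sl_holo; auto).
  assert (Ng : forall u, unit_disk u -> g u <> RtoC 0).
  { intros u Du. apply (sl_neq_0 G unit_disk); try assumption; [apply copen_disk|apply unit_disk_0]. }
  assert (Eg : forall u, G u = (g u * u)%C).
  { intros u. rewrite (sl_eq G 0 u), H0. fold g. ring. }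
  assert (Dr : forall u, unit_disk u -> unit_disk (x * u)) by (intros; apply unit_disk_rotate; assumption).
  (* The combination s / G(x u) + (1 - s) / G(u) is N(u) / (u Q(u)). Dividing the factor u out of G
     keeps N and Q regular at 0, and Q has no zeros. *)
  set (N := fun u => (RtoC s * g u + RtoC (1 - s) * x * g (x * u)%C)%C).
  set (Q := fun u => (x * g u * g (x * u)%C)%C).
  assert (HN : forall u, unit_disk u -> holo N u).
  { intros u Du. apply holo_plus; (apply holo_mult; [apply holo_const|]); [auto|].
    apply holo_rotate; auto. }
  assert (HQ : forall u, unit_disk u -> holo Q u).
  { intros u Du. apply holo_mult; [apply holo_mult; [apply holo_const|auto]|].
    apply holo_rotate; auto. }
  assert (NQ : forall u, unit_disk u -> Q u <> RtoC 0).
  { intros u Du. unfold Q. repeat apply Cmult_neq_0; auto. }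
  set (Th := fun u => (u * Q u / N u)%C).
  assert (HTh : forall u, unit_disk u -> N u <> RtoC 0 -> holo Th u).
  { intros u Du Nu. apply holo_div; auto. apply holo_mult; [apply holo_id|auto]. }
  set (U := fun u => unit_disk u /\ N u <> RtoC 0 /\ image G unit_disk (Th u)).
  (* This is u divided by its pull-back under G, with the common zero at 0 cancelled. *)
  set (f := fun u => (N u * g (L (Th u)) / Q u)%C).
  assert (HL : forall u, U u -> unit_disk (L (Th u)) /\ G (L (Th u)) = Th u).
  { intros u (_ & _ & Iu). apply inverse_r, Iu. }
  assert (Hf' : forall u, U u -> holo f u).
  { intros u Uu. assert (HLu := HL u Uu). destruct Uu as (Du & Nu & Iu).
    apply holo_div; [|auto|auto]. apply holo_mult; [auto|].
    apply (holo_comp g (fun u => L (Th u))); [|apply Hg, HLu].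
    apply (holo_comp L Th); [auto|]. apply inverse_holo; auto using copen_disk. }
  assert (EfL : forall u, U u -> (f u * L (Th u) = u)%C).
  { intros u Uu. destruct (HL u Uu) as [DL EL]. destruct Uu as (Du & Nu & Iu).
    rewrite Eg in EL. unfold f.
    replace (N u * g (L (Th u)) / Q u * L (Th u))%C
      with (N u * (g (L (Th u)) * L (Th u)) / Q u)%C by (field; auto).
    rewrite EL. unfold Th. field. auto. }
  assert (HUo : copen U).
  { intros u (Du & Nu & Iu). apply near_and; [apply copen_disk, Du|]. apply near_and.
    - apply (ccont_pull N u (fun w => w <> RtoC 0)); [apply holo_ccont; auto|].
      apply near_neq, Nu.
    - apply (ccont_pull Th u (image G unit_disk)); [apply holo_ccont; auto|].
      apply image_open; auto using copen_disk. }
  assert (U0 : U 0).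
  { assert (N00 : N 0 <> RtoC 0).
    { unfold N. rewrite Cmult_0_r.
      replace (RtoC s * g 0 + RtoC (1 - s) * x * g 0)%C
        with ((RtoC s + RtoC (1 - s) * x) * g 0)%C by ring.
      apply Cmult_neq_0; [|apply Ng, unit_disk_0]. apply Cmod_gt_0.
      assert (T := Cmod_triangle_rev (RtoC (1 - s) * x)%C (- RtoC s)%C).
      rewrite Cmod_opp, Cmod_mult, Hx, !Cmod_R, !Rabs_pos_eq in T by lra.
      replace (RtoC (1 - s) * x - - RtoC s)%C with (RtoC s + RtoC (1 - s) * x)%C in T by ring.
      lra. }
    split; [apply unit_disk_0|]. split; [exact N00|].
    exists (RtoC 0). split; [apply unit_disk_0|]. rewrite H0. unfold Th. field. exact N00. }
  set (F := fun u => (N u / (u * Q u))%C).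
  assert (EF : forall u, unit_disk u -> u <> RtoC 0 ->
    F u = (RtoC s / G (x * u)%C + RtoC (1 - s) / G u)%C).
  { intros u Du Nu. unfold F, N, Q. rewrite !Eg. assert (A1 := Ng u Du).
    assert (A2 := Ng _ (Dr u Du)). field. auto. }
  assert (Hfar : forall e, 0 < e -> exists del, 0 < del /\ forall u, U u -> u <> RtoC 0 ->
    (exists v, omitted G v /\ Cmod (F u - v) < del) -> Cmod (f u) <= 1 + e).
  { intros e He. set (r1 := / (1 + e)).
    assert (R1 : r1 < 1) by (unfold r1; rewrite <- Rinv_1; apply Rinv_lt_contravar; lra).
    assert (R1' : 0 < r1) by (apply Rinv_0_lt_compat; lra).
    destruct (omitted_far G r1 HG R1) as (del & Hdel & K).
    exists del. split; [exact Hdel|]. intros u Uu Nu (v & Hv & Hvd).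
    destruct (HL u Uu) as [DL EL]. assert (EfLu := EfL u Uu).
    destruct Uu as (Du & N1 & Iu).
    destruct (Rle_or_lt (Cmod (L (Th u))) r1) as [Hle|Hgt].
    - exfalso. assert (C1 := K (L (Th u)) (F u) v Hle Hv).
      assert (C2 : (F u * G (L (Th u)))%C = RtoC 1).
      { rewrite EL. unfold F, Th. field. auto. }
      specialize (C1 C2). lra.
    - apply (f_equal Cmod) in EfLu. rewrite Cmod_mult in EfLu. unfold unit_disk in Du.
      apply (Rmult_le_reg_r r1); [exact R1'|].
      replace ((1 + e) * r1) with 1 by (unfold r1; field; lra).
      assert (Cmod (f u) * r1 <= Cmod (f u) * Cmod (L (Th u)))
        by (apply Rmult_le_compat_l; [apply Cmod_ge_0|lra]). lra. }
  assert (HM : forall u, U u -> Cmod (f u) <= 1).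
  { apply (max_modulus U f 1 1); [lra|exact HUo|exact Hf'| |].
    - intros u (Du & _). unfold unit_disk in Du. lra.
    (* A point w outside U either lies in the disk, where F(w) is omitted, or on the circle, near
       which F is close to a convex combination of omitted values. In both cases the pull-backs of
       nearby points of U are close to the unit circle. *)
    - intros w Hw Hn e He. destruct (Hfar e He) as (del & Hdel & K).
      assert (Nw : w <> RtoC 0) by (intros ->; tauto).
      destruct (Rle_lt_or_eq_dec _ _ Hw) as [Dw|Ew].
      + assert (Ho : omitted G (F w)).
        { intros z' Dz' E'. apply Hn. split; [exact Dw|].
          assert (N1 : N w <> RtoC 0).
          { intros E. unfold F in E'. rewrite E in E'.
            replace (0 / (w * Q w) * G z')%C with (RtoC 0) in E'.
            - apply RtoC_inj in E'. lra.
            - field. split; auto. }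
          split; [exact N1|]. exists z'. split; [exact Dz'|].
          unfold Th. unfold F in E'. replace (G z') with
            (N w / (w * Q w) * G z' * (w * Q w) / N w)%C by (field; auto).
          rewrite E'. field. exact N1. }
        assert (HF : ccont F w).
        { apply holo_ccont, holo_div; [auto| |apply Cmult_neq_0; auto].
          apply holo_mult; [apply holo_id|auto]. }
        eapply near_imp; [|exact (near_and _ _ _ (near_neq 0 w Nw) (HF del Hdel))].
        intros u [Nu Hu] Uu. apply K; [exact Uu|exact Nu|]. exists (F w). auto.
      + destruct (boundary_near_omitted G del HG Hdel) as (rho & Hrho & K').
        eapply near_imp; [|apply (near_outside 0 w rho)].
        2:{ replace (w - 0)%C with w by ring. lra. }
        intros u Hu Uu. cbv beta in Hu. replace (u - 0)%C with u in Hu by ring.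
                assert (Nu : u <> RtoC 0) by (apply Cmod_gt_0; lra).
        apply K; [exact Uu|exact Nu|]. destruct Uu as (Du & _).
        destruct (K' u) as (v1 & O1 & D1); [unfold unit_disk in Du; lra|].
        destruct (K' (x * u)%C) as (v2 & O2 & D2).
        { rewrite Cmod_mult, Hx. unfold unit_disk in Du. lra. }
        exists (RtoC s * v2 + RtoC (1 - s) * v1)%C. split; [apply Hconv; [lra|assumption..]|].
        rewrite EF by assumption.
        replace (RtoC s / G (x * u)%C + RtoC (1 - s) / G u - (RtoC s * v2 + RtoC (1 - s) * v1))%C
          with (RtoC s * (/ G (x * u)%C - v2) + RtoC (1 - s) * (/ G u - v1))%C.
        * eapply Rle_lt_trans; [apply Cmod_triangle|].
          rewrite !Cmod_mult, !Cmod_R, !Rabs_pos_eq by lra. nra.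
        * unfold Cdiv. ring. }
  assert (NF : N z <> RtoC 0).
  { intros E. rewrite <- EF in HE by assumption. unfold F in HE. rewrite E in HE.
    replace (0 / (z * Q z) * G xi)%C with (RtoC 0) in HE.
    - apply RtoC_inj in HE. lra.
    - field. split; auto. }
  rewrite <- EF in HE by assumption.
  assert (EGxi : G xi = Th z).
  { unfold Th, F in *. replace (G xi) with
      (N z / (z * Q z) * G xi * (z * Q z) / N z)%C by (field; auto).
    rewrite HE. field. exact NF. }
  assert (Uz : U z).
  { split; [exact Hz|]. split; [exact NF|]. exists xi. auto. }
  assert (ELx : L (Th z) = xi) by (rewrite <- EGxi; apply inverse_l; assumption).
  assert (E := EfL z Uz). rewrite ELx in E. apply (f_equal Cmod) in E.
  rewrite Cmod_mult in E. assert (M := HM z Uz). assert (P := Cmod_ge_0 xi). nra.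
Qed.

(** Re (l / psi(0)) is the derivative of log |psi| at 0 along the positive axis, where |psi| does
    not drop below its value at 0. *)
Lemma outward_derivative (psi : C -> C) (l : C) (d : R) : cderiv psi 0 l ->
  psi 0 <> RtoC 0 -> 0 < d -> (forall s, 0 < s < d -> Cmod (psi 0) <= Cmod (psi (RtoC s))) ->
  0 <= Re (l / psi 0)%C.
Proof.
  intros Hd N0 Hd0 H. apply Rnot_lt_le. intros L.
  set (a := psi 0) in *. set (lam := (l / a)%C) in *. set (k := - Re lam).
  assert (Hk : 0 < k) by (unfold k; lra).
  assert (Pa : 0 < Cmod a) by (apply Cmod_gt_0, N0).
  destruct (Hd (Cmod a * (k / 4)) ltac:(apply Rmult_lt_0_compat; lra)) as (e & He & K).
  assert (P0 := Cmod_ge_0 lam).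
  assert (Q : 0 <= Cmod lam ^ 2) by apply pow2_ge_0.
  set (s := Rmin (Rmin (d / 2) (e / 2)) (Rmin (k / (Cmod lam ^ 2 + 1)) (1 / k))).
  assert (S1 : s <= d / 2) by (eapply Rle_trans; apply Rmin_l).
  assert (S2 : s <= e / 2) by (eapply Rle_trans; [apply Rmin_l|apply Rmin_r]).
  assert (S3 : s <= k / (Cmod lam ^ 2 + 1)) by (eapply Rle_trans; [apply Rmin_r|apply Rmin_l]).
  assert (S4 : s <= 1 / k) by (eapply Rle_trans; [apply Rmin_r|apply Rmin_r]).
  assert (S0 : 0 < s) by (repeat apply Rmin_pos; try lra; apply Rdiv_lt_0_compat; lra).
  apply (Rmult_le_compat_r (Cmod lam ^ 2 + 1)) in S3; [|lra].
  replace (k / (Cmod lam ^ 2 + 1) * (Cmod lam ^ 2 + 1)) with k in S3 by (field; lra).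
  apply (Rmult_le_compat_r k) in S4; [|lra].
  replace (1 / k * k) with 1 in S4 by (field; lra).
  specialize (H s ltac:(lra)). specialize (K (RtoC s)).
  replace (RtoC s - 0)%C with (RtoC s) in K by ring.
  rewrite Cmod_R, Rabs_pos_eq in K by lra. specialize (K ltac:(lra)). fold a in K.
  assert (T := Cmod_triangle (psi (RtoC s) - a - l * RtoC s) (a * (1 + RtoC s * lam))).
  replace (psi (RtoC s) - a - l * RtoC s + a * (1 + RtoC s * lam))%C with (psi (RtoC s)) in T
    by (unfold lam; field; exact N0).
  rewrite Cmod_mult in T.
  assert (Sq : Cmod (1 + RtoC s * lam) <= 1 - s * k / 2).
  { assert (A := Cmod_sq_plus 1 (RtoC s * lam)). rewrite Cmod_1 in A.
    rewrite Cmod_mult, Cmod_R, Rabs_pos_eq in A by lra.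
    replace (Re (Cconj 1 * (RtoC s * lam))%C) with (- s * k) in A
      by (unfold k; destruct lam; simpl; ring).
    apply Rsqr_incr_0_var; [unfold Rsqr; nra|nra]. }
  assert (Cmod a * Cmod (1 + RtoC s * lam) <= Cmod a * (1 - s * k / 2))
    by (apply Rmult_le_compat_l; lra).
  assert (0 < Cmod a * (s * k)) by (repeat apply Rmult_lt_0_compat; lra).
  lra.
Qed.

(** The limit case s -> 0 of [study]: the pull-back psi(s) starts at z and never has smaller
    modulus. With A = G(z) and B = G(x z) the convex combination has reciprocal A B / (s A + (1 - s)
    B), which is [Th]. *)
Lemma study_derivative (G : C -> C) (x z : C) : inv_concave G ->
  Cmod x = 1 -> unit_disk z -> z <> RtoC 0 ->
  0 <= Re (G z * (G (x * z)%C - G z) / (G (x * z)%C * (z * dv G z)))%C.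
Proof.
  intros HG Hx Hz Nz. assert (HG' := HG). destruct HG' as (Hf & Hi & H0 & Hconv).
  assert (Nx : x <> RtoC 0) by (apply Cmod_gt_0; lra).
  assert (Dxz := unit_disk_rotate x z Hx Hz).
  assert (NG := inv_concave_neq_0 G z HG Hz Nz).
  assert (NGx := inv_concave_neq_0 G (x * z)%C HG Dxz (Cmult_neq_0 _ _ Nx Nz)).
  assert (Nd := injective_dv_neq_0 G unit_disk z copen_disk Hf Hi Hz).
  set (A := G z) in *. set (B := G (x * z)%C) in *.
  set (D := fun s => (s * A + (1 - s) * B)%C).
  assert (D0 : D 0 = B) by (unfold D; ring).
  assert (HD : cderiv D 0 (A - B)).
  { unfold D. replace (A - B)%C with ((1 * A + 0 * 0) + ((0 - 1) * B + (1 - 0) * 0))%C by ring.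
    apply cderiv_plus.
    - apply (cderiv_mult (fun s => s) (fun _ => A)); [apply cderiv_id|apply cderiv_const].
    - apply (cderiv_mult (fun s => 1 - s)%C (fun _ => B)); [|apply cderiv_const].
      apply cderiv_minus; [apply cderiv_const|apply cderiv_id]. }
  set (Th := fun s => (A * B / D s)%C).
  assert (Th0 : Th 0 = A) by (unfold Th; rewrite D0; field; exact NGx).
  assert (HTh : cderiv Th 0 (A * (B - A) / B)).
  { assert (E := cderiv_div (fun _ => (A * B)%C) D 0 0 (A - B) (cderiv_const _ _) HD).
    rewrite D0 in E. specialize (E NGx).
    replace (A * (B - A) / B)%C with ((0 * B - A * B * (A - B)) / (B * B))%C
      by (field; exact NGx). exact E. }
  set (psi := fun s => inverse G unit_disk (Th s)).
  assert (P0 : psi 0 = z) by (unfold psi; rewrite Th0; apply inverse_l; assumption).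
  assert (HP : cderiv psi 0 (/ dv G z * (A * (B - A) / B))).
  { apply (cderiv_comp (inverse G unit_disk) Th); [exact HTh|]. rewrite Th0.
    apply inverse_cderiv; auto using copen_disk. }
  replace (A * (B - A) / (B * (z * dv G z)))%C
    with (/ dv G z * (A * (B - A) / B) / psi 0)%C by (rewrite P0; field; auto).
  assert (Hnear : near 0 (fun s => D s <> RtoC 0 /\ image G unit_disk (Th s))).
  { apply near_and.
    - apply (ccont_pull D 0 (fun w => w <> RtoC 0)); [eapply cderiv_ccont, HD|].
      rewrite D0. apply near_neq, NGx.
    - apply (ccont_pull Th 0 (image G unit_disk)); [eapply cderiv_ccont, HTh|].
      rewrite Th0. apply image_open; auto using copen_disk. exists z. auto. }
  destruct Hnear as (d & Hd & K).
  apply (outward_derivative psi _ (Rmin d (1 / 2)) HP).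
  - rewrite P0. exact Nz.
  - apply Rmin_pos; lra.
  - intros s Hs. assert (M1 := Rmin_l d (1 / 2)). assert (M2 := Rmin_r d (1 / 2)).
    destruct (K (RtoC s)) as [ND IT].
    { replace (RtoC s - 0)%C with (RtoC s) by ring. rewrite Cmod_R, Rabs_pos_eq; lra. }
    destruct (inverse_r G unit_disk (Th (RtoC s)) IT) as [DP EP]. fold (psi (RtoC s)) in DP, EP.
    rewrite P0. apply (study G x s z (psi (RtoC s)) HG Hx); [lra|exact Hz|exact Nz|exact DP|].
    rewrite EP. fold A B. unfold Th, D in *. rewrite RtoC_minus. field. auto.
Qed.

(** * The bound for B *)

(** The involutive automorphism T of the disk that exchanges 0 and p. *)
Definition mob (p : R) (z : C) : C := ((RtoC p - z) / (1 - RtoC p * z))%C.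

Lemma mob_den (p : R) (z : C) : 0 < p < 1 -> p * Cmod z < 1 -> (1 - RtoC p * z)%C <> RtoC 0.
Proof.
  intros Hp Hz E. assert (T := Cmod_triangle_rev 1 (RtoC p * z)). rewrite E in T.
  rewrite Cmod_0, Cmod_1, Cmod_mult, Cmod_R, Rabs_pos_eq in T by lra. lra.
Qed.

Lemma mob_identity (p : R) (z : C) :
  Cmod (1 - RtoC p * z) ^ 2 - Cmod (RtoC p - z) ^ 2 = (1 - p ^ 2) * (1 - Cmod z ^ 2).
Proof. rewrite !Cmod2_alt. destruct z; simpl. ring. Qed.

Lemma sq_lt_inv (a b : R) : 0 <= b -> a ^ 2 < b ^ 2 -> a < b.
Proof. intros Hb H. apply Rnot_le_lt. intros L. nra. Qed.

Lemma mob_disk (p : R) (z : C) : 0 < p < 1 -> Cmod z < 1 -> Cmod (mob p z) < 1.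
Proof.
  intros Hp Hz. assert (Z0 := Cmod_ge_0 z).
  assert (N : (1 - RtoC p * z)%C <> RtoC 0) by (apply mob_den; nra).
  unfold mob. rewrite Cmod_div by exact N.
  assert (P : 0 < Cmod (1 - RtoC p * z)) by (apply Cmod_gt_0, N).
  apply (Rmult_lt_reg_r (Cmod (1 - RtoC p * z))); [exact P|].
  unfold Rdiv. rewrite Rmult_assoc, Rinv_l, Rmult_1_r, Rmult_1_l by lra.
  apply sq_lt_inv; [lra|]. assert (E := mob_identity p z).
  assert (0 < (1 - p ^ 2) * (1 - Cmod z ^ 2)) by (apply Rmult_lt_0_compat; nra). lra.
Qed.

Lemma mob_circle (p : R) (z : C) : 0 < p < 1 -> Cmod z = 1 -> Cmod (mob p z) = 1.
Proof.
  intros Hp Hz. assert (N : (1 - RtoC p * z)%C <> RtoC 0) by (apply mob_den; nra).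
  unfold mob. rewrite Cmod_div by exact N.
  assert (P : 0 < Cmod (1 - RtoC p * z)) by (apply Cmod_gt_0, N).
  assert (E := mob_identity p z). rewrite Hz in E.
  assert (Cmod (RtoC p - z) = Cmod (1 - RtoC p * z)).
  { apply Rsqr_inj; [apply Cmod_ge_0|apply Cmod_ge_0|]. unfold Rsqr. nra. }
  rewrite H. field. lra.
Qed.

Lemma RtoC_neq (a b : R) : a <> b -> RtoC a <> RtoC b.
Proof. intros H E. apply H, RtoC_inj, E. Qed.

Lemma one_sub_sq_neq (p : R) : 0 < p < 1 -> (1 - RtoC p * RtoC p)%C <> RtoC 0.
Proof.
  intros Hp. rewrite <- RtoC_mult, <- RtoC_minus. apply RtoC_neq. nra.
Qed.

Lemma mob_invol (p : R) (z : C) : 0 < p < 1 -> p * Cmod z < 1 -> mob p (mob p z) = z.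
Proof.
  intros Hp Hz. assert (N := mob_den p z Hp Hz). assert (N' := one_sub_sq_neq p Hp).
  unfold mob. field. split; [exact N|].
  replace (1 - RtoC p * z - RtoC p * (RtoC p - z))%C with (1 - RtoC p * RtoC p)%C by ring.
  exact N'.
Qed.

Lemma mob_inj (p : R) (z1 z2 : C) : 0 < p < 1 -> p * Cmod z1 < 1 -> p * Cmod z2 < 1 ->
  mob p z1 = mob p z2 -> z1 = z2.
Proof.
  intros Hp H1 H2 E. rewrite <- (mob_invol p z1 Hp H1), E. apply mob_invol; assumption.
Qed.

Lemma mob_cderiv (p : R) (z : C) : 0 < p < 1 -> p * Cmod z < 1 ->
  cderiv (mob p) z (- (1 - RtoC p * RtoC p) / ((1 - RtoC p * z) * (1 - RtoC p * z))).
Proof.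
  intros Hp Hz. assert (N := mob_den p z Hp Hz). unfold mob.
  replace (- (1 - RtoC p * RtoC p) / ((1 - RtoC p * z) * (1 - RtoC p * z)))%C
    with (((0 - 1) * (1 - RtoC p * z) - (RtoC p - z) * (0 - (0 * z + RtoC p * 1))) /
          ((1 - RtoC p * z) * (1 - RtoC p * z)))%C by (field; exact N).
  apply (cderiv_div (fun z => RtoC p - z)%C (fun z => 1 - RtoC p * z)%C); [| |exact N].
  - apply cderiv_minus; [apply cderiv_const|apply cderiv_id].
  - apply cderiv_minus; [apply cderiv_const|].
    apply (cderiv_mult (fun _ => RtoC p) (fun z => z)); [apply cderiv_const|apply cderiv_id].
Qed.

Lemma mob_0 (p : R) : mob p 0 = RtoC p.
Proof. unfold mob. replace (1 - RtoC p * 0)%C with (RtoC 1) by ring. field. Qed.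

Lemma mob_p (p : R) : 0 < p < 1 -> mob p p = RtoC 0.
Proof.
  intros Hp. unfold mob. field. apply one_sub_sq_neq, Hp.
Qed.

(** After contraction by r, T sends a disk larger than the unit disk into the unit disk. So G(r
    T(x)) is univalent across the unit circle and can be evaluated on it. *)
Lemma mob_shrink (p r : R) : 0 < p < 1 -> 0 < r < 1 ->
  exists R1, 1 < R1 /\ p * R1 < 1 /\ forall x, Cmod x < R1 -> r * Cmod (mob p x) < 1.
Proof.
  intros Hp Hr.
  set (d := Rmin ((1 - p) / 2) ((1 - r ^ 2) * ((1 - p) / 2) ^ 2 / 4)).
  assert (Q : 0 < (1 - r ^ 2) * ((1 - p) / 2) ^ 2)
    by (apply Rmult_lt_0_compat; [nra|apply pow_lt; lra]).
  assert (D1 : d <= (1 - p) / 2) by apply Rmin_l.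
  assert (D2 : d <= (1 - r ^ 2) * ((1 - p) / 2) ^ 2 / 4) by apply Rmin_r.
  assert (D0 : 0 < d) by (apply Rmin_pos; lra).
  exists (1 + d). split; [lra|].
  assert (HpR : p * (1 + d) <= (1 + p) / 2) by nra. split; [lra|].
  intros x Hx. assert (X0 := Cmod_ge_0 x).
  assert (N : (1 - RtoC p * x)%C <> RtoC 0) by (apply mob_den; nra).
  unfold mob. rewrite Cmod_div by exact N.
  assert (P : 0 < Cmod (1 - RtoC p * x)) by (apply Cmod_gt_0, N).
  apply (Rmult_lt_reg_r (Cmod (1 - RtoC p * x))); [exact P|].
  unfold Rdiv. rewrite Rmult_assoc, (Rmult_assoc (Cmod (RtoC p - x))), Rinv_l, Rmult_1_r, Rmult_1_l by lra.
  apply sq_lt_inv; [lra|]. assert (E := mob_identity p x).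
  assert (B : (1 - p) / 2 <= Cmod (1 - RtoC p * x)).
  { assert (T := Cmod_triangle_rev 1 (RtoC p * x)).
    rewrite Cmod_1, Cmod_mult, Cmod_R, Rabs_pos_eq in T by lra. nra. }
  assert (B2 : ((1 - p) / 2) ^ 2 <= Cmod (1 - RtoC p * x) ^ 2) by (apply pow_incr; lra).
  set (m := Cmod (1 - RtoC p * x) ^ 2) in *. rewrite Rpow_mult_distr.
  set (n := Cmod (RtoC p - x) ^ 2) in *.
  assert (Hn : n <= m + 3 * d).
  { assert (X2 : Cmod x ^ 2 <= (1 + d) ^ 2) by (apply pow_incr; lra).
    assert (P2 : 0 < p ^ 2) by (apply pow_lt; lra).
    assert (P3 : p ^ 2 < 1) by nra.
    assert (d ^ 2 <= d) by nra.
    destruct (Rle_or_lt (Cmod x ^ 2) 1) as [L|L].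
    - assert (0 <= (1 - p ^ 2) * (1 - Cmod x ^ 2)) by (apply Rmult_le_pos; lra). lra.
    - assert ((1 - p ^ 2) * (Cmod x ^ 2 - 1) <= 1 * (Cmod x ^ 2 - 1))
        by (apply Rmult_le_compat_r; lra). nra. }
  assert (r ^ 2 * n <= r ^ 2 * (m + 3 * d)) by (apply Rmult_le_compat_l; [apply pow2_ge_0|lra]).
  assert (R2 : r ^ 2 < 1) by nra.
  assert (r ^ 2 * (3 * d) <= 1 * (3 * d)) by (apply Rmult_le_compat_r; lra).
  assert ((1 - r ^ 2) * ((1 - p) / 2) ^ 2 <= (1 - r ^ 2) * m) by (apply Rmult_le_compat_l; lra).
  lra.
Qed.

Lemma sl_dv (f : C -> C) (a x : C) : x <> a -> holo f x ->
  dv (sl f a) x = ((dv f x * (x - a) - (f x - f a)) / ((x - a) * (x - a)))%C.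
Proof.
  intros N H. apply dv_eq. apply cderiv_ext with (fun u => (f u - f a) / (u - a))%C.
  { eapply near_imp; [|apply (near_neq a x N)]. intros u Hu. symmetry. apply sl_off, Hu. }
  replace ((dv f x * (x - a) - (f x - f a)) / ((x - a) * (x - a)))%C
    with (((dv f x - 0) * (x - a) - (f x - f a) * (1 - 0)) / ((x - a) * (x - a)))%C
    by (field; apply Csub_neq, N).
  apply (cderiv_div (fun u => f u - f a)%C (fun u => u - a)%C); [| |apply Csub_neq, N].
  - apply cderiv_minus; [apply dv_correct, H|apply cderiv_const].
  - apply cderiv_minus; [apply cderiv_id|apply cderiv_const].
Qed.

Lemma Re_ccont_circle (f : C -> C) (z : C) : ccont f z -> Cmod z = 1 ->
  (forall x, Cmod x = 1 -> x <> z -> 0 <= Re (f x)) -> 0 <= Re (f z).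
Proof.
  intros Hf Hz H. apply Rnot_lt_le. intros L.
  destruct (Hf (- Re (f z)) ltac:(lra)) as (d & Hd & K).
  set (e := Rmin (d / 4) 1). assert (E0 : 0 < e) by (apply Rmin_pos; lra).
  assert (E1 : e <= d / 4) by apply Rmin_l.
  (* u / v is unimodular: a rotation by a small angle in rational form, which moves z along the
     circle to a point where the hypothesis applies. *)
  set (u := (1 + Ci * RtoC e)%C). set (v := (1 - Ci * RtoC e)%C).
  assert (Mu : Cmod u = Cmod v) by (unfold Cmod, u, v; simpl; f_equal; ring).
  assert (Pv : 1 <= Cmod v).
  { assert (T := re_le_Cmod v). unfold v in T at 1. simpl in T.
    replace (1 + - (0 * e - 1 * 0)) with 1 in T by ring. rewrite Rabs_R1 in T. exact T. }
  assert (Nv : v <> RtoC 0) by (apply Cmod_gt_0; lra).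
  assert (Nz : z <> RtoC 0) by (apply Cmod_gt_0; lra).
  assert (Ex : (z * u / v - z = z * (2 * Ci * RtoC e) / v)%C)
    by (unfold u; replace (2 * Ci * RtoC e)%C with (1 + Ci * RtoC e - v)%C by (unfold v; ring);
        field; exact Nv).
  assert (Md : Cmod (z * u / v - z) = 2 * e / Cmod v).
  { rewrite Ex, Cmod_div, !Cmod_mult, Hz, Cmod_Ci, !Cmod_R, !Rabs_pos_eq by (exact Nv || lra).
    field. lra. }
  assert (P : 0 < 2 * e / Cmod v) by (apply Rdiv_lt_0_compat; lra).
  assert (P' : 2 * e / Cmod v <= 2 * e).
  { apply (Rmult_le_reg_r (Cmod v)); [lra|]. replace (2 * e / Cmod v * Cmod v) with (2 * e)
      by (field; lra). nra. }
  assert (R1 : 0 <= Re (f (z * u / v)%C)).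
  { apply H.
    - rewrite Cmod_div, Cmod_mult, Hz, Mu by exact Nv. field. lra.
    - intros E. rewrite E, sub_self, Cmod_0 in Md. lra. }
  specialize (K (z * u / v)%C ltac:(lra)).
  assert (T := re_bound (f (z * u / v)%C - f z)). rewrite Re_minus in T. lra.
Qed.

Lemma Re_zero_conj (u : C) : (u + Cconj u)%C = RtoC 0 -> Re u = 0.
Proof. intros H. apply (f_equal Re) in H. destruct u; simpl in *. lra. Qed.

Lemma conj_circle (x : C) : Cmod x = 1 -> Cconj x = (/ x)%C.
Proof.
  intros H. assert (N : x <> RtoC 0) by (apply Cmod_gt_0; lra).
  assert (E := Cmod2_conj x). rewrite H in E.
  replace (Cconj x) with (x * Cconj x / x)%C by (field; exact N). rewrite <- E.
  replace (RtoC (1 ^ 2)) with (RtoC 1) by (f_equal; ring). field. exact N.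
Qed.

Lemma conj_real (a : R) : Cconj (RtoC a) = RtoC a.
Proof. apply C_ext; simpl; ring. Qed.

(** On the circle 2 x / (x - z) has real part 1, and 2 x / (x - p) = 1 + (x + p) / (x - p), where
    the last fraction is the conjugate of (1 + p x) / (1 - p x). The real parts cancel. *)
Lemma kernel_sum_imaginary (p : R) (x z : C) : 0 < p < 1 -> Cmod x = 1 -> Cmod z = 1 -> x <> z ->
  Re (- (2 * x / (x - RtoC p)) + 2 * x / (x - z) + (1 + RtoC p * x) / (1 - RtoC p * x))%C = 0.
Proof.
  intros Hp Hx Hz N. assert (Nx : x <> RtoC 0) by (apply Cmod_gt_0; lra).
  assert (Nz : z <> RtoC 0) by (apply Cmod_gt_0; lra).
  assert (N1 : (x - RtoC p)%C <> RtoC 0).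
  { apply Csub_neq. intros ->. rewrite Cmod_R, Rabs_pos_eq in Hx; lra. }
  assert (N2 := Csub_neq _ _ N). assert (N3 : (z - x)%C <> RtoC 0) by (apply Csub_neq; auto).
  assert (N4 : (1 - RtoC p * x)%C <> RtoC 0) by (apply mob_den; [exact Hp|rewrite Hx; lra]).
  apply Re_zero_conj.
  rewrite !Cplus_conj, Copp_conj, !Cdiv_conj, !Cminus_conj, !Cplus_conj, !Cmult_conj, !conj_real,
    (conj_circle x Hx), (conj_circle z Hz) by assumption.
  field. repeat split; try assumption.
Qed.

Lemma Cinv_neq_0 (w : C) : w <> RtoC 0 -> (/ w)%C <> RtoC 0.
Proof.
  intros N. apply Cmod_gt_0. rewrite Cmod_inv by exact N.
  apply Rinv_0_lt_compat, Cmod_gt_0, N.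
Qed.

Lemma Re_inv_nonneg (w : C) : w <> RtoC 0 -> 0 <= Re w -> 0 <= Re (/ w)%C.
Proof.
  intros N H. assert (P : 0 < Cmod w) by (apply Cmod_gt_0, N).
  assert (P2 := Cmod2_alt w). destruct w as [a b]. simpl in *.
  apply Rmult_le_pos; [exact H|]. left. apply Rinv_0_lt_compat. nra.
Qed.

(** T maps the unit circle to itself preserving orientation, so x T'(x) / T(x) is positive there. *)
Lemma mob_log_derivative (p : R) (x : C) : 0 < p < 1 -> Cmod x = 1 ->
  (x * (- (1 - RtoC p * RtoC p) / ((1 - RtoC p * x) * (1 - RtoC p * x))))%C =
  (mob p x * RtoC ((1 - p * p) / Cmod (1 - RtoC p * x) ^ 2))%C.
Proof.
  intros Hp Hx. assert (Nx : x <> RtoC 0) by (apply Cmod_gt_0; lra).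
  assert (N4 : (1 - RtoC p * x)%C <> RtoC 0) by (apply mob_den; [exact Hp|rewrite Hx; lra]).
  assert (N1 : (x - RtoC p)%C <> RtoC 0).
  { apply Csub_neq. intros ->. rewrite Cmod_R, Rabs_pos_eq in Hx; lra. }
  assert (P : 0 < Cmod (1 - RtoC p * x)) by (apply Cmod_gt_0, N4).
  rewrite RtoC_div, Cmod2_conj by (apply pow_nonzero; lra).
  rewrite Cminus_conj, Cmult_conj, !conj_real, (conj_circle x Hx), RtoC_minus, RtoC_mult.
  unfold mob. field. repeat split; assumption.
Qed.

(** [Phi] is regular across the circle, equals 1 at 0 and has nonnegative real part on |x| = 1, so
    Herglotz bounds its linear coefficient by 2; that coefficient is twice the expression to be
    estimated. *)
Lemma beta_bound_circle (G : C -> C) (p r R1 : R) (S : C -> C) (z : C) :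
  inv_concave G -> 0 < p < 1 -> 0 < r < 1 -> 1 < R1 -> p * R1 < 1 ->
  (forall x, Cmod x < R1 -> r * Cmod (mob p x) < 1) ->
  S = (fun x => G (RtoC r * mob p x)%C) ->
  copen (fun x => Cmod x < R1) -> holo_on (fun x => Cmod x < R1) S ->
  injective_on (fun x => Cmod x < R1) S ->
  Cmod z = 1 ->
  Cmod (dv S 0 / S 0 - dv S 0 / (S 0 - S z) - / z + / RtoC p + RtoC p) <= 1.
Proof.
  intros HG Hp Hr HR HpR HT ES HV HS HSi Hz. assert (HG' := HG).
  destruct HG' as (Hf & Hi & H0 & _).
  set (V := fun x => Cmod x < R1) in *.
  assert (V0 : V 0) by (unfold V; rewrite Cmod_0; lra).
  assert (Vz : V z) by (unfold V; lra).
  assert (Vp : V p) by (unfold V; rewrite Cmod_R, Rabs_pos_eq; lra).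
  assert (Np : RtoC p <> RtoC 0) by (apply RtoC_neq; lra).
  assert (Nz : z <> RtoC 0) by (apply Cmod_gt_0; lra).
  assert (Nzp : z <> RtoC p) by (intros ->; rewrite Cmod_R, Rabs_pos_eq in Hz; lra).
  assert (Sp : S p = RtoC 0) by (rewrite ES, mob_p by exact Hp; rewrite Cmult_0_r; exact H0).
  assert (NS : forall x, V x -> x <> RtoC p -> S x <> RtoC 0).
  { intros x Vx N E. apply N, HSi; [exact Vx|exact Vp|]. rewrite E, Sp. reflexivity. }
  set (sp := sl S p). set (sz := sl S z).
  assert (Hsp : forall x, V x -> holo sp x).
  { intros x Vx. apply sl_holo; [|apply HS, Vx]. eapply near_imp; [exact HS|apply HV, Vp]. }
  assert (Hsz : forall x, V x -> holo sz x).
  { intros x Vx. apply sl_holo; [|apply HS, Vx]. eapply near_imp; [exact HS|apply HV, Vz]. }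
  assert (Nsp : forall x, V x -> sp x <> RtoC 0) by (intros; eapply sl_neq_0; eassumption).
  assert (Nsz : forall x, V x -> sz x <> RtoC 0) by (intros; eapply sl_neq_0; eassumption).
  assert (ND : forall x, V x -> (1 - RtoC p * x)%C <> RtoC 0).
  { intros x Vx. apply mob_den; [exact Hp|]. unfold V in Vx. nra. }
  assert (dvh : forall f, (forall x, V x -> holo f x) -> forall x, V x -> holo (dv f) x).
  { intros f Hff x Vx. apply dv_holo. eapply near_imp; [exact Hff|apply HV, Vx]. }
  (* Twice the logarithmic derivative of the quotient of the slopes of S at p and at z. Neither
     slope vanishes, so the singularities at p and z are already removed. *)
  set (E := fun x => (2 * (dv sp x / sp x - dv sz x / sz x))%C).
  assert (HE : forall x, V x -> holo E x).
  { intros x Vx. apply holo_mult; [apply holo_const|]. apply holo_minus; apply holo_div; auto. }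
  (* The added term combines with the kernels from 1 / (x - p) and 1 / (x - z) into a purely
     imaginary quantity on the circle. *)
  set (Phi := fun x => (x * E x + (1 + RtoC p * x) / (1 - RtoC p * x))%C).
  assert (HPhi : forall x, V x -> holo Phi x).
  { intros x Vx. apply holo_plus; [apply holo_mult; [apply holo_id|auto]|].
    apply holo_div; [| |auto].
    - apply holo_plus; [apply holo_const|]. apply holo_mult; [apply holo_const|apply holo_id].
    - apply holo_minus; [apply holo_const|]. apply holo_mult; [apply holo_const|apply holo_id]. }
  assert (EE : forall x, V x -> x <> RtoC p -> x <> z ->
    E x = (2 * (dv S x / S x - / (x - RtoC p) - (dv S x / (S x - S z) - / (x - z))))%C).
  { intros x Vx N1 N2. unfold E, sp, sz. rewrite !sl_dv, !sl_off by auto. rewrite Sp.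
    assert (A1 := Csub_neq _ _ N1). assert (A2 := Csub_neq _ _ N2). assert (A3 := NS x Vx N1).
    assert (A4 : (S x - S z)%C <> RtoC 0) by (apply Csub_neq; intros Q; apply N2, HSi; assumption).
    field. replace (S x - 0)%C with (S x) by ring. auto. }
  assert (Hpos : forall x, Cmod x = 1 -> x <> z -> 0 <= Re (Phi x)).
  { intros x Hx Nxz. assert (Vx : V x) by (unfold V; lra).
    assert (Nx : x <> RtoC 0) by (apply Cmod_gt_0; lra).
    assert (Nxp : x <> RtoC p) by (intros ->; rewrite Cmod_R, Rabs_pos_eq in Hx; lra).
    assert (A1 := Csub_neq _ _ Nxp). assert (A2 := Csub_neq _ _ Nxz).
    assert (A3 := NS x Vx Nxp). assert (A5 := NS z Vz Nzp).
    assert (A4 : (S x - S z)%C <> RtoC 0) by (apply Csub_neq; intros Q; apply Nxz, HSi; assumption).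
    assert (A6 : (S z - S x)%C <> RtoC 0) by (apply Csub_neq; intros Q; apply Nxz, HSi; auto).
    assert (A7 := ND x Vx).
    set (zeta := (RtoC r * mob p x)%C).
    assert (Mx := mob_circle p x Hp Hx). assert (Mz := mob_circle p z Hp Hz).
    assert (Nmx : mob p x <> RtoC 0) by (apply Cmod_gt_0; lra).
    assert (Nr : RtoC r <> RtoC 0) by (apply RtoC_neq; lra).
    assert (Dz : unit_disk zeta).
    { unfold unit_disk, zeta. rewrite Cmod_mult, Cmod_R, Rabs_pos_eq, Mx; lra. }
    assert (Nzeta : zeta <> RtoC 0) by (apply Cmult_neq_0; assumption).
    (* The unimodular factor T(z) / T(x) carries r T(x) to r T(z), so that Study's inequality
       compares S(x) with S(z). *)
    assert (Hst := study_derivative G (mob p z / mob p x)%C zeta HG).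
    rewrite Cmod_div, Mz, Mx in Hst by exact Nmx. specialize (Hst ltac:(field) Dz Nzeta).
    replace (mob p z / mob p x * zeta)%C with (RtoC r * mob p z)%C in Hst
      by (unfold zeta; field; exact Nmx).
    assert (ESx : G zeta = S x) by (rewrite ES; reflexivity).
    assert (ESz : G (RtoC r * mob p z)%C = S z) by (rewrite ES; reflexivity).
    rewrite ESx, ESz in Hst.
    assert (Nd := injective_dv_neq_0 G unit_disk zeta copen_disk Hf Hi Dz).
    set (k := (1 - p * p) / Cmod (1 - RtoC p * x) ^ 2).
    assert (Hk : 0 < k).
    { unfold k. apply Rdiv_lt_0_compat; [nra|]. apply pow_lt, Cmod_gt_0, A7. }
    assert (ES' : (x * dv S x = zeta * dv G zeta * RtoC k)%C).
    { assert (D : dv S x = (dv G zeta * (RtoC r *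
         (- (1 - RtoC p * RtoC p) / ((1 - RtoC p * x) * (1 - RtoC p * x)))))%C).
      { apply dv_eq. rewrite ES. apply (cderiv_comp G (fun x => RtoC r * mob p x)%C).
        - assert (D := cderiv_mult (fun _ => RtoC r) (mob p) x _ _ (cderiv_const _ _)
            (mob_cderiv p x Hp ltac:(rewrite Hx; lra))). cbv beta in D.
          rewrite Cmult_0_l, Cplus_0_l in D. exact D.
        - apply dv_correct, Hf, Dz. }
      rewrite D. transitivity (dv G zeta * RtoC r * (x * (- (1 - RtoC p * RtoC p) /
        ((1 - RtoC p * x) * (1 - RtoC p * x)))))%C; [ring|].
      rewrite mob_log_derivative by assumption. fold k. unfold zeta. ring. }
    set (W0 := (S x * (S z - S x) / (S z * (zeta * dv G zeta)))%C) in *.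
    assert (NW0 : W0 <> RtoC 0).
    { unfold W0. apply Cmult_neq_0; [apply Cmult_neq_0; assumption|].
      apply Cinv_neq_0, Cmult_neq_0; [exact A5|apply Cmult_neq_0; assumption]. }
    assert (HW := Re_inv_nonneg W0 NW0 Hst).
    (* x S'(x) is k times zeta G'(zeta), so the part of [Phi] that comes from S is a positive
       multiple of 1 / W0. *)
    assert (EPhi : Phi x = (RtoC (2 * k) * / W0 + (- (2 * x / (x - RtoC p)) + 2 * x / (x - z) +
       (1 + RtoC p * x) / (1 - RtoC p * x)))%C).
    { unfold Phi. rewrite (EE x Vx Nxp Nxz).
      transitivity ((2 * (x * dv S x) * (S z / (S x * (S z - S x)))) +
        (- (2 * x / (x - RtoC p)) + 2 * x / (x - z) + (1 + RtoC p * x) / (1 - RtoC p * x)))%C.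
      - field. repeat split; assumption.
      - rewrite ES'. f_equal. rewrite RtoC_mult. unfold W0. field. repeat split; assumption. }
    rewrite EPhi, Re_plus, Re_scal, kernel_sum_imaginary by assumption.
    assert (0 <= 2 * k * Re (/ W0)%C) by (apply Rmult_le_pos; lra). lra. }
  assert (Hpos' : forall x, Cmod x = 1 -> 0 <= Re (Phi x)).
  { intros x Hx. destruct (Ceq_dec x z) as [->|N]; [|auto].
    apply Re_ccont_circle; [apply holo_ccont, HPhi, Vz|exact Hz|exact Hpos]. }
  destruct (herglotz_at Phi 0 R1 1) as [_ HH].
  - intros x Hx. apply HPhi. unfold V. replace (x - 0)%C with x in Hx by ring. exact Hx.
  - lra.
  - intros x Hx. apply Hpos'. replace (x - 0)%C with x in Hx by ring. exact Hx.
  - assert (P0 : Phi 0 = RtoC 1).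
    { unfold Phi. rewrite Cmult_0_l, Cmult_0_r. field. }
    assert (D0 : dv Phi 0 = (E 0 + 2 * RtoC p)%C).
    { apply dv_eq. unfold Phi.
      replace (E 0 + 2 * RtoC p)%C with ((1 * E 0 + 0 * dv E 0) +
        (((0 + (0 * 0 + RtoC p * 1)) * (1 - RtoC p * 0) -
          (1 + RtoC p * 0) * (0 - (0 * 0 + RtoC p * 1))) /
        ((1 - RtoC p * 0) * (1 - RtoC p * 0))))%C.
      - apply cderiv_plus.
        + apply (cderiv_mult (fun x => x) E); [apply cderiv_id|apply dv_correct, HE, V0].
        + apply (cderiv_div (fun x => 1 + RtoC p * x)%C (fun x => 1 - RtoC p * x)%C);
            [| |apply ND, V0].
          * apply cderiv_plus; [apply cderiv_const|].
            apply (cderiv_mult (fun _ => RtoC p) (fun x => x)); [apply cderiv_const|apply cderiv_id].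
          * apply cderiv_minus; [apply cderiv_const|].
            apply (cderiv_mult (fun _ => RtoC p) (fun x => x)); [apply cderiv_const|apply cderiv_id].
      - replace (1 - RtoC p * 0)%C with (RtoC 1) by ring. field. }
    rewrite P0, D0, (EE 0 V0) in HH by auto.
    set (b := (dv S 0 / S 0 - dv S 0 / (S 0 - S z) - / z + / RtoC p + RtoC p)%C).
    assert (N0p : RtoC 0 <> RtoC p) by auto.
    assert (A3 := NS 0 V0 N0p).
    assert (A4 : (S 0 - S z)%C <> RtoC 0)
      by (apply Csub_neq; intros Q; apply Nz; symmetry; apply HSi; assumption).
    assert (Eb : (2 * (dv S 0 / S 0 - / (0 - RtoC p) - (dv S 0 / (S 0 - S z) - / (0 - z))) +
       2 * RtoC p)%C = (RtoC 2 * b)%C).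
    { unfold b. assert (Q1 : (0 - RtoC p)%C <> RtoC 0) by (apply Csub_neq; exact N0p).
      assert (Q2 : (0 - z)%C <> RtoC 0) by (apply Csub_neq; auto).
      replace (0 - RtoC p)%C with (- RtoC p)%C by ring. replace (0 - z)%C with (- z)%C by ring.
      field. auto. }
    rewrite Eb, Cmod_mult, Cmod_R, Rabs_pos_eq in HH by lra. simpl Re in HH. lra.
Qed.

(** From the circle to the disk by the maximum principle; two nested slopes at 0 write the
    expression as a function [b] that is regular at 0. *)
Lemma beta_bound_scaled (G : C -> C) (p r : R) (S : C -> C) (z : C) :
  inv_concave G -> 0 < p < 1 -> 0 < r < 1 ->
  S = (fun x => G (RtoC r * mob p x)%C) -> Cmod z < 1 -> z <> RtoC 0 ->
  Cmod (dv S 0 / S 0 - dv S 0 / (S 0 - S z) - / z + / RtoC p + RtoC p) <= 1.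
Proof.
  intros HG Hp Hr ES Hz Nz. assert (HG' := HG). destruct HG' as (Hf & Hi & H0 & _).
  destruct (mob_shrink p r Hp Hr) as (R1 & HR & HpR & HT).
  set (V := fun x => Cmod x < R1).
  assert (HV : copen V) by (intros u Hu; apply near_disk0, Hu).
  assert (DT : forall x, V x -> unit_disk (RtoC r * mob p x)%C).
  { intros x Vx. unfold unit_disk. rewrite Cmod_mult, Cmod_R, Rabs_pos_eq by lra. apply HT, Vx. }
  assert (pV : forall x, V x -> p * Cmod x < 1) by (unfold V; intros; nra).
  assert (Nr : RtoC r <> RtoC 0) by (apply RtoC_neq; lra).
  assert (HS : holo_on V S).
  { intros x Vx. rewrite ES. apply (holo_comp G (fun x => RtoC r * mob p x)%C); [|apply Hf, DT, Vx].
    apply holo_mult; [apply holo_const|]. eexists. apply mob_cderiv; auto. }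
  assert (HSi : injective_on V S).
  { intros x y Vx Vy E. rewrite ES in E. apply Hi in E; auto.
    apply (mob_inj p); auto.
    replace (mob p x) with (RtoC r * mob p x / RtoC r)%C by (field; exact Nr).
    rewrite E. field. exact Nr. }
  assert (V0 : V 0) by (unfold V; rewrite Cmod_0; lra).
  set (s0 := sl S 0).
  assert (Hs0 : forall x, V x -> holo s0 x).
  { intros x Vx. apply sl_holo; [|apply HS, Vx]. eapply near_imp; [exact HS|apply HV, V0]. }
  assert (Ns0 : forall x, V x -> s0 x <> RtoC 0) by (intros; eapply sl_neq_0; eassumption).
  set (b := fun z => (dv S 0 / S 0 + / RtoC p + RtoC p - sl s0 0 z / s0 z)%C).
  assert (Hb : forall x, V x -> holo b x).
  { intros x Vx. apply holo_minus; [apply holo_const|]. apply holo_div; auto.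
    apply sl_holo; [|auto]. eapply near_imp; [exact Hs0|apply HV, V0]. }
  assert (Eb : forall x, V x -> x <> RtoC 0 ->
    b x = (dv S 0 / S 0 - dv S 0 / (S 0 - S x) - / x + / RtoC p + RtoC p)%C).
  { intros x Vx Nx. unfold b. rewrite (sl_off s0) by exact Nx.
    assert (E0 : s0 0 = dv S 0) by apply sl_at. rewrite E0.
    assert (N1 : (S x - S 0)%C <> RtoC 0) by (apply Csub_neq; intros Q; apply Nx, HSi; assumption).
    assert (N2 : (S 0 - S x)%C <> RtoC 0)
      by (apply Csub_neq; intros Q; apply Nx; symmetry; apply HSi; assumption).
    assert (Es : s0 x = ((S x - S 0) / x)%C).
    { unfold s0. rewrite sl_off by exact Nx. replace (x - 0)%C with x by ring. reflexivity. }
    rewrite Es. replace (x - 0)%C with x by ring.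
    replace (((S x - S 0) / x - dv S 0) / x / ((S x - S 0) / x))%C
      with (/ x - dv S 0 / (S x - S 0))%C by (field; auto).
    replace (dv S 0 / (S 0 - S x))%C with (- (dv S 0 / (S x - S 0)))%C by (field; auto).
    ring. }
  rewrite <- Eb; [|unfold V; lra|exact Nz].
  revert z Hz Nz. cut (forall z, Cmod z < 1 -> Cmod (b z) <= 1); [auto|].
  apply (max_modulus (fun z => Cmod z < 1) b 1 1); [lra| | |intros; lra|].
  - intros z Hz. apply near_disk0, Hz.
  - intros z Hz. apply Hb. unfold V; lra.
  - intros z Hz Hn e He. assert (Ez : Cmod z = 1) by lra.
    assert (Vz : V z) by (unfold V; lra).
    assert (Nz : z <> RtoC 0) by (apply Cmod_gt_0; lra).
    eapply near_imp; [|apply (Cmod_ccont_near_le b z (1 + e))].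
    + intros u Hu _. lra.
    + apply holo_ccont, Hb, Vz.
    + apply Rle_lt_trans with 1; [|lra]. rewrite (Eb z Vz Nz).
      apply (beta_bound_circle G p r R1 S z); assumption.
Qed.

(** The contraction r tends to 1: the expression is continuous in r at 1, so a violation at r = 1
    would persist for some r < 1. *)
Lemma beta_bound (G : C -> C) (p : R) (z : C) :
  inv_concave G -> 0 < p < 1 -> Cmod z < 1 -> z <> RtoC 0 ->
  Cmod (- (1 - RtoC p * RtoC p) * dv G p * (/ G p + / (G (mob p z) - G p))
        - / z + / RtoC p + RtoC p) <= 1.
Proof.
  intros HG Hp Hz Nz. assert (HG' := HG). destruct HG' as (Hf & Hi & H0 & _).
  assert (Np : RtoC p <> RtoC 0) by (apply RtoC_neq; lra).
  assert (Dp : unit_disk p) by (unfold unit_disk; rewrite Cmod_R, Rabs_pos_eq; lra).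
  assert (Dz : unit_disk (mob p z)) by (apply mob_disk; assumption).
  set (b := fun r => (- (1 - RtoC p * RtoC p) * (r * dv G (r * RtoC p)%C) *
     (/ G (r * RtoC p)%C + / (G (r * mob p z)%C - G (r * RtoC p)%C)) - / z + / RtoC p + RtoC p)%C).
  assert (Hm : forall c, holo (fun r => r * c)%C 1)
    by (intros; apply holo_mult; [apply holo_id|apply holo_const]).
  assert (N1 : G p <> RtoC 0) by (apply inv_concave_neq_0; assumption).
  assert (N2 : (G (mob p z) - G p)%C <> RtoC 0).
  { apply Csub_neq. intros Q. apply Hi in Q; [|exact Dz|exact Dp]. apply Nz.
    rewrite <- (mob_invol p z Hp) by (assert (Z0 := Cmod_ge_0 z); nra). rewrite Q.
    apply mob_p, Hp. }
  assert (E1 : forall c, (1 * c)%C = c) by (intros; ring).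
  assert (HGc : forall c, unit_disk c -> holo (fun r => G (r * c)%C) 1).
  { intros c Dc. apply (holo_comp G (fun r => r * c)%C); [apply Hm|]. rewrite E1. auto. }
  assert (Hb : ccont b 1).
  { apply holo_ccont. unfold b. repeat apply holo_plus; try apply holo_const.
    - apply holo_mult.
      + apply holo_mult; [apply holo_const|]. apply holo_mult; [apply holo_id|].
        apply (holo_comp (dv G) (fun r => r * RtoC p)%C); [apply Hm|]. rewrite E1.
        apply dv_holo. eapply near_imp; [exact Hf|apply copen_disk, Dp].
      + apply holo_plus; apply holo_inv; auto; [rewrite E1; exact N1| |rewrite !E1; exact N2].
        apply holo_minus; auto. }
  assert (Eb : b 1 = (- (1 - RtoC p * RtoC p) * dv G p * (/ G p + / (G (mob p z) - G p))
        - / z + / RtoC p + RtoC p)%C) by (unfold b; rewrite !E1; reflexivity).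
  rewrite <- Eb. apply Rnot_lt_le. intros L.
  destruct (Cmod_ccont_near b 1 1 Hb L) as (d & Hd & K).
  set (r := 1 - Rmin (d / 2) (1 / 2)).
  assert (M1 := Rmin_l (d / 2) (1 / 2)). assert (M2 := Rmin_r (d / 2) (1 / 2)).
  assert (M0 : 0 < Rmin (d / 2) (1 / 2)) by (apply Rmin_pos; lra).
  assert (Hr : 0 < r < 1) by (unfold r; lra).
  specialize (K (RtoC r)). rewrite <- RtoC_minus, Cmod_R, Rabs_left in K by lra.
  specialize (K ltac:(unfold r; lra)).
  assert (Q := beta_bound_scaled G p r _ z HG Hp Hr eq_refl Hz Nz). cbv beta in Q.
  rewrite mob_0 in Q.
  assert (Drp : unit_disk (RtoC r * RtoC p)%C).
  { unfold unit_disk. rewrite Cmod_mult, !Cmod_R, !Rabs_pos_eq by lra. nra. }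
  assert (D : dv (fun x => G (RtoC r * mob p x)%C) 0 =
    (dv G (RtoC r * RtoC p)%C * (RtoC r * - (1 - RtoC p * RtoC p)))%C).
  { apply dv_eq. apply (cderiv_comp G (fun x => RtoC r * mob p x)%C).
    - assert (D := cderiv_mult (fun _ => RtoC r) (mob p) 0 _ _ (cderiv_const _ _)
            (mob_cderiv p 0 Hp ltac:(rewrite Cmod_0; lra))). cbv beta in D.
      rewrite Cmult_0_l, Cplus_0_l in D.
      replace (RtoC r * - (1 - RtoC p * RtoC p))%C with
        (RtoC r * (- (1 - RtoC p * RtoC p) / ((1 - RtoC p * 0) * (1 - RtoC p * 0))))%C; [exact D|].
      replace (1 - RtoC p * 0)%C with (RtoC 1) by ring. field.
    - rewrite mob_0. apply dv_correct, Hf, Drp. }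
  rewrite D in Q.
  set (A := G (RtoC r * RtoC p)%C) in *. set (B := G (RtoC r * mob p z)%C) in *.
  assert (Drz : unit_disk (RtoC r * mob p z)%C).
  { unfold unit_disk. rewrite Cmod_mult, Cmod_R, Rabs_pos_eq by lra.
    assert (T := Cmod_ge_0 (mob p z)). unfold unit_disk in Dz. nra. }
  assert (Nr : RtoC r <> RtoC 0) by (apply RtoC_neq; lra).
  assert (NA : A <> RtoC 0)
    by (apply inv_concave_neq_0; [exact HG|exact Drp|apply Cmult_neq_0; assumption]).
  assert (NBA : B <> A).
  { intros E. apply Hi in E; [|exact Drz|exact Drp].
    apply (f_equal (fun u => u / RtoC r)%C) in E.
    replace (RtoC r * mob p z / RtoC r)%C with (mob p z) in E by (field; exact Nr).
    replace (RtoC r * RtoC p / RtoC r)%C with (RtoC p) in E by (field; exact Nr).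
    apply N2. rewrite E. ring. }
  assert (N3 := Csub_neq _ _ NBA).
  assert (N4 : (A - B)%C <> RtoC 0) by (apply Csub_neq; auto).
  unfold b in K. fold A B in K.
  assert (EK : (- (1 - RtoC p * RtoC p) * (RtoC r * dv G (RtoC r * RtoC p)%C) * (/ A + / (B - A)) -
    / z + / RtoC p + RtoC p)%C =
    (dv G (RtoC r * RtoC p)%C * (RtoC r * - (1 - RtoC p * RtoC p)) / A -
     dv G (RtoC r * RtoC p)%C * (RtoC r * - (1 - RtoC p * RtoC p)) / (A - B) -
     / z + / RtoC p + RtoC p)%C).
  { replace (/ (B - A))%C with (- / (A - B))%C by (field; auto). unfold Cdiv. ring. }
  rewrite EK in K. lra.
Qed.

(** * Concave functions with a pole *)

(** The filters of the statement use the product metric on C, with separate bounds on the two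
    coordinates, whence the d / 2 below. *)
Lemma locally_near (z : C) (P : C -> Prop) : locally z P <-> near z P.
Proof.
  split.
  - intros [e He]. exists e. split; [apply cond_pos|]. intros u Hu. apply He.
    apply C_NormedModule_mixin_compat1. exact Hu.
  - intros (d & Hd & K). assert (Hd2 : 0 < d / 2) by lra.
    exists (mkposreal _ Hd2). intros u Hu. apply K.
    eapply Rle_lt_trans; [apply Cmod_le_ReIm|].
    destruct Hu as [H1 H2]. change (Rabs (Re u - Re z) < d / 2) in H1.
    change (Rabs (Im u - Im z) < d / 2) in H2.
    change (Re (u - z)%C) with (Re u - Re z). change (Im (u - z)%C) with (Im u - Im z). lra.
Qed.

Lemma locally'_near (z : C) (P : C -> Prop) :
  locally' z P <-> near z (fun u => u <> z -> P u).
Proof.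
  unfold locally', within. apply (locally_near z (fun u => u <> z -> P u)).
Qed.

Lemma cderiv_is_derive (f : C -> C) (z l : C) : cderiv f z l <-> is_derive f z l.
Proof.
  split.
  - intros H. split; [apply is_linear_scal_l|]. intros x Hx.
    apply (is_filter_lim_locally_unique (V := AbsRing_NormedModule C_AbsRing)) in Hx. subst x.
    intros eps. destruct (H eps (cond_pos eps)) as (d & Hd & K).
    exists (mkposreal d Hd). intros u Hu. specialize (K u Hu).
    replace (f u - f z - l * (u - z))%C with (f u - f z - (u - z) * l)%C in K by ring.
    exact K.
  - intros [_ H] eps He. specialize (H z (fun P HP => HP) (mkposreal eps He)).
    destruct H as [d Hd]. exists d. split; [apply cond_pos|]. intros u Hu.
    specialize (Hd u Hu).
    replace (f u - f z - l * (u - z))%C with (f u - f z - (u - z) * l)%C by ring.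
    exact Hd.
Qed.

Lemma holo_ex_derive (f : C -> C) (z : C) : holo f z <-> ex_derive f z.
Proof. split; intros [l Hl]; exists l; apply cderiv_is_derive, Hl. Qed.

Lemma C_derive_dv (f : C -> C) (z : C) : holo f z -> C_derive f z = dv f z.
Proof. intros H. apply is_C_derive_unique, cderiv_is_derive, dv_correct, H. Qed.

Lemma analytic_near (f : C -> Chat) (z : C) :
  analytic_at f z <-> near z (fun u => f u <> None /\ holo (finite_part f) u).
Proof.
  unfold analytic_at. rewrite locally_near.
  split; apply near_imp; intros u [H1 H2]; (split; [exact H1|apply holo_ex_derive, H2]).
Qed.

Lemma finite_part_Some (f : C -> Chat) (z : C) : f z <> None -> f z = Some (finite_part f z).
Proof. unfold finite_part. destruct (f z); congruence. Qed.

Lemma Cmod_real (p : R) : 0 < p -> Cmod p = p.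
Proof. intros H. rewrite Cmod_R, Rabs_pos_eq; lra. Qed.

Definition off_pole (p : R) (z : C) : Prop := unit_disk z /\ z <> RtoC p.

Lemma copen_off_pole (p : R) : copen (off_pole p).
Proof. intros z [H1 H2]. apply near_and; [apply copen_disk, H1|apply near_neq, H2]. Qed.

Lemma off_pole_0 (p : R) : 0 < p < 1 -> off_pole p 0.
Proof. intros Hp. split; [apply unit_disk_0|]. apply RtoC_neq. lra. Qed.

Lemma concave_holo (p : R) (phi : C -> Chat) : concave_with_pole p phi ->
  holo_on (off_pole p) (finite_part phi) /\
  (forall z, off_pole p z -> phi z = Some (finite_part phi z)).
Proof.
  intros (Ha & _). split; intros z [H1 H2]; specialize (Ha z H1 H2);
    apply analytic_near, near_self in Ha; destruct Ha as [A B];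
    [exact B|apply finite_part_Some, A].
Qed.

Lemma concave_injective (p : R) (phi : C -> Chat) : concave_with_pole p phi ->
  injective_on (off_pole p) (finite_part phi).
Proof.
  intros H z1 z2 O1 O2 E. assert (K := concave_holo p phi H). destruct K as [_ K].
  destruct H as (_ & _ & Hi & _). apply Hi; [apply O1|apply O2|].
  rewrite (K z1 O1), (K z2 O2), E. reflexivity.
Qed.

Lemma concave_at_pole (p : R) (phi : C -> Chat) : concave_with_pole p phi ->
  phi p = None /\ forall M, near p (fun u => u <> RtoC p -> M < Cmod (finite_part phi u)).
Proof.
  intros (_ & [(H1 & _ & H2) _] & _). split; [exact H1|]. intros M.
  apply locally'_near. apply (H2 (fun x => M < x)). exists M. auto.
Qed.

(* Otherwise the inverse function would be a bounded entire function. *)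
Lemma exists_omitted (p : R) (phi : C -> Chat) : 0 < p < 1 -> concave_with_pole p phi ->
  exists e, ~ disk_image phi (Some e).
Proof.
  intros Hp H. apply NNPP. intros Hn. assert (Hi := concave_injective p phi H).
  destruct (concave_holo p phi H) as [Hh Hs]. destruct (concave_at_pole p phi H) as [Hpole _].
  set (P := finite_part phi) in *. set (U := off_pole p) in *.
  assert (Him : forall w, image P U w).
  { intros w. apply NNPP. intros Hw. apply Hn. exists w. intros (z & Dz & Ez).
    apply Hw. assert (Oz : U z).
    { split; [exact Dz|]. intros ->. rewrite Hpole in Ez. discriminate. }
    exists z. split; [exact Oz|]. rewrite (Hs z Oz) in Ez. congruence. }
  assert (HL : forall w, inverse P U w = inverse P U 0).
  { apply (liouville (inverse P U) 1).
    - intros w. apply inverse_holo; [apply copen_off_pole|exact Hh|exact Hi|apply Him].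
    - intros w. destruct (inverse_r P U w (Him w)) as [[D _] _]. unfold unit_disk in D. lra. }
  assert (O1 : U 0) by (apply off_pole_0, Hp).
  assert (O2 : U (RtoC (p / 2))).
  { split; [unfold unit_disk; rewrite Cmod_real; lra|apply RtoC_neq; lra]. }
  assert (E1 := inverse_l P U _ Hi O1). assert (E2 := inverse_l P U _ Hi O2).
  rewrite HL in E1, E2. rewrite E1 in E2. apply RtoC_inj in E2. lra.
Qed.

(** T(0) = p, and [finite_part] has a default value at the pole, so the value 0 at 0 is imposed
    rather than computed. *)
Definition pole_inv (p : R) (phi : C -> Chat) (e z : C) : C :=
  match Ceq_dec z 0 with
  | left _ => RtoC 0
  | right _ => (/ (finite_part phi (mob p z) - e))%C
  end.

Lemma pole_inv_0 (p : R) (phi : C -> Chat) (e : C) : pole_inv p phi e 0 = RtoC 0.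
Proof. unfold pole_inv. destruct (Ceq_dec 0 0); tauto. Qed.

Lemma pole_inv_off (p : R) (phi : C -> Chat) (e z : C) : z <> RtoC 0 ->
  pole_inv p phi e z = (/ (finite_part phi (mob p z) - e))%C.
Proof. intros H. unfold pole_inv. destruct (Ceq_dec z 0); tauto. Qed.

Lemma p_unit_disk (p : R) (z : C) : 0 < p < 1 -> unit_disk z -> p * Cmod z < 1.
Proof. unfold unit_disk. intros Hp Hz. assert (Z0 := Cmod_ge_0 z). nra. Qed.

Lemma mob_off_pole (p : R) (z : C) : 0 < p < 1 -> unit_disk z -> z <> RtoC 0 ->
  off_pole p (mob p z).
Proof.
  intros Hp Hz Nz. split; [apply mob_disk; assumption|]. intros E. apply Nz.
  rewrite <- (mob_invol p z Hp (p_unit_disk p z Hp Hz)), E. apply mob_p, Hp.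
Qed.

Lemma mob_neq_0 (p : R) (z : C) : 0 < p < 1 -> off_pole p z -> mob p z <> RtoC 0.
Proof.
  intros Hp [Hz N] E. apply N.
  rewrite <- (mob_invol p z Hp (p_unit_disk p z Hp Hz)), E. apply mob_0.
Qed.

(** v is omitted by 1 / G exactly when e + v is omitted by phi, so convexity is inherited by
    translation. Regularity at 0 is the removal of a singularity, since 1 / (phi - e) tends to 0 at
    the pole. *)
Lemma pole_inv_concave (p : R) (phi : C -> Chat) (e : C) : 0 < p < 1 ->
  concave_with_pole p phi -> ~ disk_image phi (Some e) -> inv_concave (pole_inv p phi e).
Proof.
  intros Hp H He. assert (Hi := concave_injective p phi H).
  destruct (concave_holo p phi H) as [Hh Hs].
  destruct (concave_at_pole p phi H) as [Hpole Hinf].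
  destruct H as (_ & _ & _ & Hconv).
  set (P := finite_part phi) in *. set (G := pole_inv p phi e).
  assert (NP : forall z, off_pole p z -> (P z - e)%C <> RtoC 0).
  { intros z Oz. apply Csub_neq. intros E. apply He. exists z. split; [apply Oz|].
    rewrite (Hs z Oz), E. reflexivity. }
  assert (HG1 : forall z, unit_disk z -> z <> RtoC 0 -> holo G z).
  { intros z Hz Nz. apply holo_ext with (fun z => / (P (mob p z) - e))%C.
    - eapply near_imp; [|apply (near_neq 0 z Nz)]. intros u Hu. symmetry.
      apply pole_inv_off, Hu.
    - assert (Oz := mob_off_pole p z Hp Hz Nz). apply holo_inv; [|apply NP, Oz].
      apply holo_minus; [|apply holo_const]. apply (holo_comp P (mob p)); [|apply Hh, Oz].
      eexists. apply mob_cderiv; [exact Hp|apply p_unit_disk; assumption]. }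
  assert (HG0 : ccont G 0).
  { intros eps Heps. unfold G. rewrite pole_inv_0.
    assert (Cm : ccont (mob p) 0).
    { eapply cderiv_ccont, mob_cderiv; [exact Hp|rewrite Cmod_0; lra]. }
    assert (N1 := Hinf (Cmod e + / eps)). rewrite <- mob_0 in N1.
    destruct (near_and _ _ _ (ccont_pull _ _ _ Cm N1) (copen_disk _ unit_disk_0)) as (d & Hd & K).
    exists d. split; [exact Hd|]. intros u Hu. destruct (K u Hu) as [K1 Du].
    destruct (Ceq_dec u (RtoC 0)) as [->|Nu].
    - rewrite pole_inv_0, sub_self, Cmod_0. exact Heps.
    - assert (Ou := mob_off_pole p u Hp Du Nu). rewrite pole_inv_off by exact Nu. fold P.
      replace (/ (P (mob p u) - e) - 0)%C with (/ (P (mob p u) - e))%C by ring.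
      rewrite Cmod_inv by (apply NP, Ou).
      rewrite mob_0 in K1. specialize (K1 (proj2 Ou)).
      assert (T := Cmod_triangle_rev (P (mob p u)) e).
      assert (Pe : 0 < / eps) by (apply Rinv_0_lt_compat, Heps).
      rewrite <- (Rinv_inv eps). apply Rinv_lt_contravar; [|lra].
      apply Rmult_lt_0_compat; [exact Pe|]. lra. }
  assert (HG : holo_on unit_disk G).
  { intros z Hz. destruct (Ceq_dec z (RtoC 0)) as [->|Nz]; [|auto].
    apply removable; [exact HG0|]. eapply near_imp; [|apply copen_disk, unit_disk_0].
    intros u Du Nu. auto. }
  assert (NG : forall z, unit_disk z -> z <> RtoC 0 -> G z <> RtoC 0).
  { intros z Hz Nz. unfold G. rewrite pole_inv_off by exact Nz.
    apply Cinv_neq_0, NP, mob_off_pole; assumption. }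
  assert (Hom : forall v, omitted G v <-> ~ disk_image phi (Some (e + v)%C)).
  { intros v. split.
    - intros Hv (z & Dz & Ez). assert (Oz : off_pole p z).
      { split; [exact Dz|]. intros ->. rewrite Hpole in Ez. discriminate. }
      assert (Nm := mob_neq_0 p z Hp Oz). apply (Hv (mob p z)).
      + apply mob_disk; [exact Hp|exact Dz].
      + unfold G. rewrite pole_inv_off by exact Nm.
        rewrite mob_invol by (exact Hp || apply p_unit_disk; assumption).
        rewrite (Hs z Oz) in Ez. fold P. assert (N1 := NP z Oz).
        assert (Ev : (P z - e)%C = v).
        { injection Ez as Ez. rewrite Ez. ring. }
        rewrite Ev in *. field. exact N1.
    - intros Hv z Dz E. apply Hv. assert (Nz : z <> RtoC 0).
      { intros ->. unfold G in E. rewrite pole_inv_0, Cmult_0_r in E.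
        apply RtoC_inj in E. lra. }
      assert (Oz := mob_off_pole p z Hp Dz Nz). exists (mob p z). split; [apply Oz|].
      rewrite (Hs _ Oz). f_equal. unfold G in E. rewrite pole_inv_off in E by exact Nz.
      fold P in E |- *. assert (N1 := NP _ Oz).
      replace v with (v * / (P (mob p z) - e) * (P (mob p z) - e))%C by (field; exact N1).
      rewrite E. ring. }
  split; [exact HG|]. split; [|split; [apply pole_inv_0|]].
  - intros z1 z2 D1 D2 E.
    destruct (Ceq_dec z1 (RtoC 0)) as [->|N1]; destruct (Ceq_dec z2 (RtoC 0)) as [->|N2];
      [reflexivity| | |].
    + exfalso. apply (NG z2 D2 N2). rewrite <- E. apply pole_inv_0.
    + exfalso. apply (NG z1 D1 N1). rewrite E. apply pole_inv_0.
    + unfold G in E. rewrite !pole_inv_off in E by assumption. fold P in E.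
      assert (O1 := mob_off_pole p z1 Hp D1 N1). assert (O2 := mob_off_pole p z2 Hp D2 N2).
      assert (M1 := NP _ O1). assert (M2 := NP _ O2).
      apply (mob_inj p); [exact Hp|apply p_unit_disk; assumption|apply p_unit_disk; assumption|].
      apply Hi; [exact O1|exact O2|].
      set (a := (P (mob p z1) - e)%C) in *. set (b := (P (mob p z2) - e)%C) in *.
      assert (Eab : a = b).
      { replace a with (b * (a * / b))%C by (field; exact M2). rewrite <- E. field. exact M1. }
      replace (P (mob p z1)) with (a + e)%C by (unfold a; ring). rewrite Eab. unfold b. ring.
  - intros u v s Hs' Hu Hv. apply Hom. apply Hom in Hu. apply Hom in Hv.
    replace (e + (RtoC s * u + RtoC (1 - s) * v))%C
      with (RtoC s * (e + u) + RtoC (1 - s) * (e + v))%C by (rewrite RtoC_minus; ring).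
    apply Hconv; assumption.
Qed.

Lemma concave_dv_neq_0 (p : R) (phi : C -> Chat) : 0 < p < 1 -> concave_with_pole p phi ->
  dv (finite_part phi) 0 <> RtoC 0.
Proof.
  intros Hp H. apply (injective_dv_neq_0 _ (off_pole p)).
  - apply copen_off_pole.
  - apply (concave_holo p phi H).
  - apply (concave_injective p phi H).
  - apply off_pole_0, Hp.
Qed.

Lemma concave_beta (p : R) (phi : C -> Chat) : 0 < p < 1 -> concave_with_pole p phi ->
  let P := finite_part phi in
  exists B : C -> C,
    holo_on unit_disk B /\ (forall z, unit_disk z -> Cmod (B z) <= 1) /\ B p = RtoC p /\
    forall z, off_pole p z -> z <> RtoC 0 ->
      (dv P 0 / (P z - P 0) = B z + / z - / RtoC p - RtoC p)%C.
Proof.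
  intros Hp H P. destruct (exists_omitted p phi Hp H) as [e He].
  assert (HG := pole_inv_concave p phi e Hp H He). set (G := pole_inv p phi e) in *.
  assert (HG' := HG). destruct HG' as (Hf & Hi & H0 & _).
  destruct (concave_holo p phi H) as [Hh Hs]. assert (HPi := concave_injective p phi H).
  fold P in Hh, Hs, HPi.
  assert (NP : forall z, off_pole p z -> (P z - e)%C <> RtoC 0).
  { intros z Oz. apply Csub_neq. intros E. apply He. exists z. split; [apply Oz|].
    rewrite (Hs z Oz), E. reflexivity. }
  assert (Np : RtoC p <> RtoC 0) by (apply RtoC_neq; lra).
  assert (Dp : unit_disk p) by (unfold unit_disk; rewrite Cmod_real; lra).
  assert (Hm : forall z, unit_disk z -> holo (mob p) z).
  { intros z Dz. eexists. apply mob_cderiv; [exact Hp|apply p_unit_disk; assumption]. }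
  assert (Dm : forall z, unit_disk z -> unit_disk (mob p z)) by (intros; apply mob_disk; assumption).
  set (S := fun z => G (mob p z)).
  assert (HS : holo_on unit_disk S).
  { intros z Dz. apply (holo_comp G (mob p)); [auto|]. apply Hf, Dm, Dz. }
  assert (HSi : injective_on unit_disk S).
  { intros z1 z2 D1 D2 E. apply Hi in E; [|apply Dm, D1|apply Dm, D2].
    apply (mob_inj p) in E; auto using p_unit_disk. }
  assert (ES : forall z, off_pole p z -> S z = (/ (P z - e))%C).
  { intros z Oz. unfold S, G. rewrite pole_inv_off by (apply mob_neq_0; assumption).
    rewrite (mob_invol p z Hp (p_unit_disk p z Hp (proj1 Oz))). reflexivity. }
  assert (Sp : S p = RtoC 0) by (unfold S; rewrite mob_p by exact Hp; exact H0).
  assert (O0 := off_pole_0 p Hp).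
  assert (NS0 : S 0 <> RtoC 0) by (rewrite ES by exact O0; apply Cinv_neq_0, NP, O0).
  assert (D0 := unit_disk_0).
  set (s0 := sl S 0).
  assert (Hs0 : holo_on unit_disk s0).
  { intros x Vx. apply sl_holo; [|apply HS, Vx]. eapply near_imp; [exact HS|apply copen_disk, D0]. }
  assert (Ns0 : forall x, unit_disk x -> s0 x <> RtoC 0).
  { intros x Dx. apply (sl_neq_0 S unit_disk); auto using copen_disk. }
  set (B := fun z => (dv S 0 / S 0 + / RtoC p + RtoC p - sl s0 0 z / s0 z)%C).
  assert (HB : holo_on unit_disk B).
  { intros x Vx. apply holo_minus; [apply holo_const|]. apply holo_div; auto.
    apply sl_holo; [|auto]. eapply near_imp; [exact Hs0|apply copen_disk, D0]. }
  assert (EB : forall x, unit_disk x -> x <> RtoC 0 ->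
    B x = (dv S 0 * (/ S 0 + / (S x - S 0)) - / x + / RtoC p + RtoC p)%C).
  { intros x Vx Nx. unfold B. rewrite (sl_off s0) by exact Nx.
    assert (E0 : s0 0 = dv S 0) by apply sl_at. rewrite E0.
    assert (N1 : (S x - S 0)%C <> RtoC 0) by (apply Csub_neq; intros Q; apply Nx, HSi; assumption).
    assert (Es : s0 x = ((S x - S 0) / x)%C).
    { unfold s0. rewrite sl_off by exact Nx. replace (x - 0)%C with x by ring. reflexivity. }
    rewrite Es. replace (x - 0)%C with x by ring. field. auto. }
  assert (DS : dv S 0 = (- (1 - RtoC p * RtoC p) * dv G p)%C).
  { apply dv_eq.
    replace (- (1 - RtoC p * RtoC p) * dv G p)%C with
      (dv G p * (- (1 - RtoC p * RtoC p) / ((1 - RtoC p * 0) * (1 - RtoC p * 0))))%C.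
    - apply (cderiv_comp G (mob p)).
      + apply mob_cderiv; [exact Hp|rewrite Cmod_0; lra].
      + rewrite mob_0. apply dv_correct, Hf, Dp.
    - replace (1 - RtoC p * 0)%C with (RtoC 1) by ring. field. }
  assert (HB1 : forall x, unit_disk x -> x <> RtoC 0 -> Cmod (B x) <= 1).
  { intros x Dx Nx. rewrite EB, DS by assumption. unfold S. rewrite mob_0.
    apply beta_bound; assumption. }
  exists B. split; [exact HB|]. split; [|split].
  - apply max_modulus_disk; [lra|exact HB|]. intros eps Heps. exists (1 / 2). split; [lra|].
    intros z Hz. apply Rle_trans with 1; [|lra]. apply HB1; [apply Hz|]. apply Cmod_gt_0. lra.
  (* S(p) = 0 makes 1 / S(0) + 1 / (S(p) - S(0)) vanish, and - 1 / p + 1 / p + p remains. *)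
  - rewrite EB, Sp by assumption. field. repeat split; try assumption.
  - intros z Oz Nz. rewrite EB by (apply Oz || exact Nz).
    assert (DP : dv S 0 = (- (dv P 0 / ((P 0 - e) * (P 0 - e))))%C).
    { apply dv_eq. apply cderiv_ext with (fun z => / (P z - e))%C.
      - eapply near_imp; [|apply (copen_off_pole p 0 O0)]. intros u Ou. symmetry. apply ES, Ou.
      - replace (- (dv P 0 / ((P 0 - e) * (P 0 - e))))%C
          with (- / ((P 0 - e) * (P 0 - e)) * (dv P 0 - 0))%C
          by (field; apply NP, O0).
        apply (cderiv_comp (fun u => / u)%C (fun z => P z - e)%C); [|apply cderiv_inv, NP, O0].
        apply cderiv_minus; [apply dv_correct, Hh, O0|apply cderiv_const]. }
    rewrite DP, !ES by assumption. assert (M1 := NP z Oz). assert (M2 := NP 0 O0).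
    assert (M3 : (P z - P 0)%C <> RtoC 0).
    { apply Csub_neq. intros Q. apply Nz, HPi; assumption. }
    (* With S = 1 / (P - e), the product of S'(0) and 1 / S(0) + 1 / (S(z) - S(0)) reduces to P'(0)
       / (P(z) - P(0)): the omitted point e drops out. *)
    assert (E3 : (/ (P z - e) - / (P 0 - e) = - ((P z - P 0) / ((P z - e) * (P 0 - e))))%C)
      by (field; auto).
    rewrite E3. field. repeat split; auto.
Qed.

Lemma mob_closed (p : R) (z : C) : 0 < p < 1 -> Cmod z <= 1 -> Cmod (mob p z) <= 1.
Proof.
  intros Hp [Hz|Hz]; [left; apply mob_disk; assumption|].
  right. apply mob_circle; assumption.
Qed.

Lemma mob_holo (p : R) (z : C) : 0 < p < 1 -> Cmod z <= 1 -> holo (mob p) z.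
Proof.
  intros Hp Hz. eexists. apply mob_cderiv; [exact Hp|]. assert (Z0 := Cmod_ge_0 z). nra.
Qed.

(* Wirths' representation: the Schwarz lemma for [B], which fixes the pole. *)
Lemma concave_representation (p : R) (phi : C -> Chat) : 0 < p < 1 -> concave_with_pole p phi ->
  let P := finite_part phi in
  exists om : C -> C,
    holo_on unit_disk om /\ (forall z, unit_disk z -> Cmod (om z) <= 1) /\
    forall z, off_pole p z ->
      (P z = P 0 + dv P 0 * (z * (1 - RtoC (p / (1 + p ^ 2)) * z * (1 + om z)) * RtoC p /
        ((RtoC p - z) * (1 - RtoC p * z))))%C.
Proof.
  intros Hp H P. destruct (concave_beta p phi Hp H) as (B & HB & B1 & Bp & EB). fold P in EB.
  assert (HPi := concave_injective p phi H). fold P in HPi.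
  assert (Dm : forall z, unit_disk z -> unit_disk (mob p z)) by (intros; apply mob_disk; assumption).
  (* T sends the fixed value p of B to 0, so [g], which is T after B after T, fixes 0, and the
     Schwarz lemma gives C'(z) = T(z) s(z). *)
  set (C' := fun z => mob p (B z)).
  assert (HC : holo_on unit_disk C').
  { intros z Dz. apply (holo_comp (mob p) B); [auto|]. apply mob_holo; auto. }
  assert (C1 : forall z, unit_disk z -> Cmod (C' z) <= 1).
  { intros z Dz. apply mob_closed; auto. }
  set (g := fun z => C' (mob p z)).
  assert (Hg : forall z, Cmod z < 1 -> holo g z).
  { intros z Dz. apply (holo_comp C' (mob p)); [apply mob_holo; [exact Hp|lra]|].
    apply HC, Dm, Dz. }
  assert (g0 : g 0 = RtoC 0) by (unfold g, C'; rewrite mob_0, Bp; apply mob_p, Hp).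
  assert (g1 : forall z, Cmod z < 1 -> Cmod (g z) <= 1) by (intros z Dz; apply C1, Dm, Dz).
  set (s := fun z => sl g 0 (mob p z)).
  assert (Hs : holo_on unit_disk s).
  { intros z Dz. apply (holo_comp (sl g 0) (mob p)); [apply mob_holo; [exact Hp|unfold unit_disk in Dz; lra]|].
    apply sl_holo; [apply (near_0_disk g 1); [lra|exact Hg]|]. apply Hg, Dm, Dz. }
  assert (s1 : forall z, unit_disk z -> Cmod (s z) <= 1).
  { intros z Dz. apply (schwarz g Hg g1 g0). apply Dm, Dz. }
  assert (Es : forall z, unit_disk z -> C' z = (mob p z * s z)%C).
  { intros z Dz. assert (E := sl_eq g 0 (mob p z)). fold (s z) in E. rewrite g0 in E.
    unfold g in E. rewrite mob_invol in E by (exact Hp || apply p_unit_disk; assumption).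
    rewrite E. ring. }
  assert (Hp2 : 0 < p ^ 2 < 1) by nra.
  (* Chosen because 1 + om = (1 + p^2) (1 - s) / (1 - p^2 s), the expression produced by solving B =
     T(T(z) s) for phi. *)
  exists (fun z => mob (p ^ 2) (s z)). split; [|split].
  - intros z Dz. apply (holo_comp (mob (p ^ 2)) s); [auto|]. apply mob_holo; auto.
  - intros z Dz. apply mob_closed; auto.
  - intros z Oz. assert (Dz := proj1 Oz). assert (Nzp := Csub_neq _ _ (proj2 Oz)).
    destruct (Ceq_dec z (RtoC 0)) as [->|Nz].
    { replace (0 * (1 - RtoC (p / (1 + p ^ 2)) * 0 * (1 + mob (p ^ 2) (s 0))) * RtoC p /
        ((RtoC p - 0) * (1 - RtoC p * 0)))%C with (RtoC 0); [ring|].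
      unfold Cdiv. ring. }
    assert (E := EB z Oz Nz).
    assert (NP : (P z - P 0)%C <> RtoC 0).
    { apply Csub_neq. intros Q. apply Nz, HPi; [exact Oz|apply off_pole_0, Hp|exact Q]. }
    assert (Np : RtoC p <> RtoC 0) by (apply RtoC_neq; lra).
    assert (N1 := mob_den p z Hp (p_unit_disk p z Hp Dz)).
    assert (N2 : (1 - RtoC p * C' z)%C <> RtoC 0).
    { apply mob_den; [exact Hp|]. assert (K := C1 z Dz). assert (K0 := Cmod_ge_0 (C' z)). nra. }
    assert (N3 : (1 - RtoC (p ^ 2) * s z)%C <> RtoC 0).
    { apply mob_den; [exact Hp2|]. assert (K := s1 z Dz). assert (K0 := Cmod_ge_0 (s z)). nra. }
    assert (N4 : (1 + RtoC p * RtoC p)%C <> RtoC 0).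
    { rewrite <- RtoC_mult, <- RtoC_plus. apply RtoC_neq. nra. }
    assert (EBz : B z = mob p (C' z)).
    { unfold C'. rewrite mob_invol; [reflexivity|exact Hp|].
      assert (K := B1 z Dz). assert (K0 := Cmod_ge_0 (B z)). nra. }
    rewrite EBz in E. rewrite (Es z Dz) in E, N2.
    set (sg := s z) in *. rewrite RtoC_pow in N3.
    assert (Nzp' : (RtoC p - z)%C <> RtoC 0) by (apply Csub_neq; intros Q; apply (proj2 Oz); auto).
    set (X := (z * (1 - RtoC (p / (1 + p ^ 2)) * z * (1 + mob (p ^ 2) sg)) * RtoC p /
        ((RtoC p - z) * (1 - RtoC p * z)))%C).
    assert (N5 : (1 - RtoC p * z - RtoC p * (RtoC p - z) * sg)%C <> RtoC 0).
    { intros Q. apply N2. unfold mob.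
      replace (1 - RtoC p * ((RtoC p - z) / (1 - RtoC p * z) * sg))%C
        with ((1 - RtoC p * z - RtoC p * (RtoC p - z) * sg) / (1 - RtoC p * z))%C
        by (field; exact N1). rewrite Q. field. exact N1. }
    assert (EX : X = (z * RtoC p * (1 - RtoC p * z - RtoC p * (RtoC p - z) * sg) /
       ((RtoC p - z) * (1 - RtoC p * z) * (1 - RtoC p * RtoC p * sg)))%C).
    { unfold X, mob. rewrite RtoC_div, RtoC_plus, !RtoC_pow by nra. field.
      replace (RtoC p ^ 2)%C with (RtoC p * RtoC p)%C in * by ring. auto. }
    assert (EY : (mob p (mob p z * sg) + / z - / RtoC p - RtoC p)%C =
       ((RtoC p - z) * (1 - RtoC p * z) * (1 - RtoC p * RtoC p * sg) /
       (z * RtoC p * (1 - RtoC p * z - RtoC p * (RtoC p - z) * sg)))%C).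
    { unfold mob. field. repeat split; auto. }
    replace (RtoC p ^ 2)%C with (RtoC p * RtoC p)%C in N3 by ring.
    rewrite EY in E. fold X. rewrite EX.
    replace (dv P 0) with (dv P 0 / (P z - P 0) * (P z - P 0))%C by (field; exact NP).
    rewrite E. field. repeat split; auto.
Qed.

(* With [j = B - 1/p - p - c], an omitted value close to [phi 0] would give
   [u = 1 / (1 + z j)] real part below 1/2 near the circle, but [u 0 = 1]. *)
Lemma omitted_distance (p : R) (phi : C -> Chat) (e : C) : 0 < p < 1 ->
  concave_with_pole p phi -> ~ disk_image phi (Some e) ->
  Cmod (dv (finite_part phi) 0) * (p / (1 + p) ^ 2) <= Cmod (finite_part phi 0 - e).
Proof.
  intros Hp H He. set (P := finite_part phi).
  destruct (concave_beta p phi Hp H) as (B & HB & B1 & Bp & EB). fold P in EB.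
  destruct (concave_holo p phi H) as [Hh Hs]. fold P in Hh, Hs.
  assert (HPi := concave_injective p phi H). fold P in HPi.
  assert (O0 := off_pole_0 p Hp).
  assert (NPe : forall z, off_pole p z -> P z <> e).
  { intros z Oz E. apply He. exists z. split; [apply Oz|]. rewrite (Hs z Oz), E. reflexivity. }
  assert (Np : RtoC p <> RtoC 0) by (apply RtoC_neq; lra).
  assert (Nd := concave_dv_neq_0 p phi Hp H). fold P in Nd.
  assert (N0 := Csub_neq _ _ (NPe 0 O0)).
  assert (N0' : (e - P 0)%C <> RtoC 0) by (apply Csub_neq; intros Q; apply (NPe 0 O0); auto).
  set (c := (dv P 0 / (e - P 0))%C).
  assert (Nc : c <> RtoC 0) by (apply Cmult_neq_0; [exact Nd|apply Cinv_neq_0, N0']).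
  (* q + 2 = (1 + p)^2 / p, so an omitted e that is too close to phi(0) means |c| > q + 2. *)
  set (q := / p + p).
  assert (Eq : (1 + p) ^ 2 / p = q + 2) by (unfold q; field; lra).
  assert (Hq : 0 < q) by (unfold q; assert (0 < / p) by (apply Rinv_0_lt_compat; lra); lra).
  assert (P0 : 0 < Cmod (P 0 - e)) by (apply Cmod_gt_0, N0).
  assert (Mc : Cmod c = Cmod (dv P 0) / Cmod (P 0 - e)).
  { unfold c. rewrite Cmod_div by exact N0'. rewrite (Cmod_sub_sym e). reflexivity. }
  apply Rnot_lt_le. intros L.
  assert (Lc : q + 2 < Cmod c).
  { rewrite Mc, <- Eq. apply (Rmult_lt_reg_r (Cmod (P 0 - e))); [exact P0|].
    replace (Cmod (dv P 0) / Cmod (P 0 - e) * Cmod (P 0 - e)) with (Cmod (dv P 0)) by (field; lra).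
    apply (Rmult_lt_compat_l ((1 + p) ^ 2 / p)) in L; [|rewrite Eq; lra].
    replace ((1 + p) ^ 2 / p * (Cmod (dv P 0) * (p / (1 + p) ^ 2))) with (Cmod (dv P 0)) in L
      by (field; lra). exact L. }
  set (k := Cmod c - (q + 2)). assert (Hk : 0 < k) by (unfold k; lra).
  set (j := fun z => (B z - / RtoC p - RtoC p - c)%C).
  assert (Hj : forall z, unit_disk z -> 1 + k <= Cmod (j z)).
  { intros z Dz. unfold j. assert (K := B1 z Dz).
    assert (T1 := Cmod_triangle_rev (- c)%C (/ RtoC p + RtoC p - B z)%C).
    replace (- c - (/ RtoC p + RtoC p - B z))%C with (B z - / RtoC p - RtoC p - c)%C in T1 by ring.
    assert (T2 := Cmod_triangle (/ RtoC p + RtoC p) (- B z)).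
    assert (T3 : Cmod (/ RtoC p + RtoC p) = q).
    { rewrite <- RtoC_inv, <- RtoC_plus by lra. apply Cmod_real. exact Hq. }
    rewrite Cmod_opp in T1, T2. unfold Cminus in *. rewrite T3 in T2. unfold k. lra. }
  (* 1 + z j(z) is z times the difference of P'(0) / (P(z) - P(0)) and P'(0) / (e - P(0)), which
     vanishes only if P takes the value e; the points p and 0 are checked directly. *)
  assert (ND : forall z, unit_disk z -> (1 + z * j z)%C <> RtoC 0).
  { intros z Dz. destruct (Ceq_dec z (RtoC p)) as [->|N1].
    - unfold j. rewrite Bp. replace (1 + RtoC p * (RtoC p - / RtoC p - RtoC p - c))%C
        with (- (RtoC p * c))%C by (field; exact Np).
      intros Q. apply (Cmult_neq_0 _ _ Np Nc).
      replace (RtoC p * c)%C with (- - (RtoC p * c))%C by ring. rewrite Q. ring.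
    - destruct (Ceq_dec z (RtoC 0)) as [->|N2].
      + replace (1 + 0 * j 0)%C with (RtoC 1) by ring. apply RtoC_neq. lra.
      + assert (Oz : off_pole p z) by (split; assumption). assert (E := EB z Oz N2).
        assert (NP : (P z - P 0)%C <> RtoC 0).
        { apply Csub_neq. intros Q. apply N2, HPi; assumption. }
        replace (1 + z * j z)%C with (z * (B z + / z - / RtoC p - RtoC p - c))%C
          by (unfold j; field; auto).
        rewrite <- E. apply Cmult_neq_0; [exact N2|]. apply Csub_neq. unfold c. intros Q.
        apply (NPe z Oz).
        assert (Q' : (P z - P 0 = e - P 0)%C).
        { replace (P z - P 0)%C with (dv P 0 * / (dv P 0 / (P z - P 0)))%C by (field; auto).
          rewrite Q. field. auto. }
        replace (P z) with (P z - P 0 + P 0)%C by ring. rewrite Q'. ring. }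
  set (u := fun z => (/ (1 + z * j z))%C).
  assert (Hu : forall z, unit_disk z -> holo u z).
  { intros z Dz. apply holo_inv; [|apply ND, Dz]. apply holo_plus; [apply holo_const|].
    apply holo_mult; [apply holo_id|]. repeat apply holo_minus; try apply holo_const. auto. }
  (* On this circle |z j| > 1, so |1 - u| > |u|, that is Re u < 1/2, against u(0) = 1. *)
  set (rho := / (1 + k / 2)).
  assert (Hrho : 0 < rho < 1).
  { unfold rho. split; [apply Rinv_0_lt_compat; lra|]. rewrite <- Rinv_1.
    apply Rinv_lt_contravar; lra. }
  destruct (herglotz_at (fun z => RtoC (1 / 2) - u z)%C 0 1 rho) as [K _].
  - intros z Hz. apply holo_minus; [apply holo_const|]. apply Hu.
    replace (z - 0)%C with z in Hz by ring. exact Hz.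
  - exact Hrho.
  - intros z Hz. replace (z - 0)%C with z in Hz by ring.
    assert (Dz : unit_disk z) by (unfold unit_disk; lra).
    rewrite Re_minus. simpl Re at 1. assert (Nz := ND z Dz).
    assert (Pu : 0 < Cmod (u z)) by (apply Cmod_gt_0, Cinv_neq_0, Nz).
    assert (E1 : Cmod (1 - u z) = Cmod z * Cmod (j z) * Cmod (u z)).
    { rewrite <- !Cmod_mult. f_equal. unfold u. field. exact Nz. }
    assert (Hgt : Cmod (u z) < Cmod (1 - u z)).
    { rewrite E1, Hz. assert (J := Hj z Dz).
      assert (rho * (1 + k) <= rho * Cmod (j z)) by (apply Rmult_le_compat_l; lra).
      assert (1 < rho * (1 + k)).
      { unfold rho. apply (Rmult_lt_reg_l (1 + k / 2)); [lra|].
        rewrite <- Rmult_assoc, Rinv_r by lra. lra. }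
      nra. }
    assert (S1 : Cmod (u z) ^ 2 < Cmod (1 - u z) ^ 2).
    { assert (Q := Cmod_ge_0 (u z)). nra. }
    rewrite !Cmod2_alt in S1. destruct (u z) as [a b]. simpl in *. nra.
  - rewrite Re_minus in K. unfold u in K. replace (1 + 0 * j 0)%C with (RtoC 1) in K by ring.
    replace (/ 1)%C with (RtoC 1) in K by field. simpl Re in K. lra.
Qed.

(** * The boundary of the image and its distance *)

Lemma boundary_exists (E : C -> Prop) (a b : C) : E a -> ~ E b -> exists y, boundary E y.
Proof.
  intros Ha Hb. set (l := fun s : R => (a + RtoC s * (b - a))%C).
  destruct (completeness (fun s => 0 <= s <= 1 /\ E (l s))) as [s [Hs1 Hs2]].
  { exists 1. intros s [Hs _]. lra. }
  { exists 0. split; [lra|]. unfold l. replace (a + RtoC 0 * (b - a))%C with a by ring. exact Ha. }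
  assert (S0 : 0 <= s).
  { apply Hs1. split; [lra|]. unfold l. replace (a + RtoC 0 * (b - a))%C with a by ring. exact Ha. }
  assert (S1 : s <= 1) by (apply Hs2; intros x [Hx _]; lra).
  assert (Nab : b <> a) by (intros ->; tauto). assert (Pab := Cmod_sub_pos _ _ Nab).
  assert (Hl : forall x y, Cmod (l x - l y) = Rabs (x - y) * Cmod (b - a)).
  { intros x y. rewrite <- Cmod_R, <- Cmod_mult. f_equal. unfold l. rewrite RtoC_minus. ring. }
  exists (l s). intros eps He.
  assert (Pd : 0 < eps / Cmod (b - a)) by (apply Rdiv_lt_0_compat; assumption).
  assert (Hd : forall x, Rabs (x - s) < eps / Cmod (b - a) -> Cmod (l x - l s) < eps).
  { intros x Hx. rewrite Hl, Rmult_comm. apply Rdiv_mult_lt; assumption. }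
  split.
  - apply NNPP. intros Hn. assert (s <= s - eps / Cmod (b - a)); [|lra].
    apply Hs2. intros x [Hx Ex]. apply Rnot_lt_le. intros L. apply Hn. exists (l x).
    split; [|exact Ex]. apply Hd. assert (x <= s) by (apply Hs1; auto).
    rewrite Rabs_left1; lra.
  - destruct (Rle_lt_or_eq_dec _ _ S1) as [L|L].
    + set (x := Rmin ((s + 1) / 2) (s + eps / Cmod (b - a) / 2)).
      assert (M1 := Rmin_l ((s + 1) / 2) (s + eps / Cmod (b - a) / 2)).
      assert (M2 := Rmin_r ((s + 1) / 2) (s + eps / Cmod (b - a) / 2)).
      assert (X0 : s < x) by (apply Rmin_glb_lt; lra). fold x in M1, M2.
      exists (l x). split; [apply Hd; rewrite Rabs_pos_eq; lra|]. intros Ex.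
      assert (x <= s); [|lra]. apply Hs1. split; [lra|exact Ex].
    + exists b. split; [|exact Hb]. replace b with (l 1) at 1.
      * rewrite L, sub_self, Cmod_0. exact He.
      * unfold l. ring.
Qed.

(** Nonemptiness and nonnegativity exclude the infinite values of the infimum, for which [real]
    would return a default. *)
Lemma real_Glb_bounds (S : R -> Prop) (x0 : R) : S x0 -> (forall x, S x -> 0 <= x) ->
  real (Glb_Rbar S) <= x0 /\
  forall m, (forall x, S x -> m <= x) -> m <= real (Glb_Rbar S).
Proof.
  intros H0 Hpos. destruct (Glb_Rbar_correct S) as [L G].
  assert (A := L x0 H0). assert (B := G (Finite 0) (fun x Hx => Hpos x Hx)).
  destruct (Glb_Rbar S) as [g| |]; simpl in *; try tauto.
  split; [exact A|]. intros m Hm. apply (G (Finite m)). intros x Hx. apply Hm, Hx.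
Qed.

Lemma dist_lower_bound (p : R) (phi : C -> Chat) : 0 < p < 1 -> concave_with_pole p phi ->
  Cmod (dv (finite_part phi) 0) * (p / (1 + p) ^ 2) <= dist_to_boundary phi.
Proof.
  intros Hp H. destruct (exists_omitted p phi Hp H) as [e He].
  assert (O0 := off_pole_0 p Hp). destruct (concave_holo p phi H) as [_ Hs].
  destruct (boundary_exists (fun w => disk_image phi (Some w)) (finite_part phi 0) e) as [y Hy].
  - exists (RtoC 0). split; [apply unit_disk_0|apply Hs, O0].
  - exact He.
  - unfold dist_to_boundary, euclidean_dist.
    apply (real_Glb_bounds _ (Cmod (finite_part phi 0 - y))).
    + exists y. auto.
    + intros x (y' & _ & ->). apply Cmod_ge_0.
    + intros x (y' & Hy' & ->). apply Rnot_lt_le. intros L.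
      destruct (Hy' (Cmod (dv (finite_part phi) 0) * (p / (1 + p) ^ 2) -
        Cmod (finite_part phi 0 - y')) ltac:(lra)) as [_ (e' & He' & Ne')].
      assert (K := omitted_distance p phi e' Hp H Ne').
      assert (T := Cmod_sub_triangle (finite_part phi 0) y' e').
      rewrite (Cmod_sub_sym y') in T. lra.
Qed.

(** * Majorant series *)

Definition shift (c : nat -> C) (n : nat) : C := c (S n).

(** The Cauchy product, by recursion on the first factor: peeling off c 0 and shifting c matches the
    inductions on products of expansions and of majorants. *)
Fixpoint conv (c d : nat -> C) (n : nat) : C :=
  match n with
  | O => (c O * d O)%C
  | S m => (c O * d (S m) + conv (shift c) d m)%C
  end.

Lemma psum_conv (c d : nat -> C) (z : C) (N : nat) :
  psum (conv c d) z (S N) = (c O * psum d z (S N) + z * psum (conv (shift c) d) z N)%C.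
Proof.
  induction N as [|N IH]; [simpl; ring|].
  change (psum (conv c d) z (S (S N))) with
    (psum (conv c d) z (S N) + (c O * d (S N) + conv (shift c) d N) * z ^ S N)%C.
  rewrite IH. change (psum d z (S (S N))) with (psum d z (S N) + d (S N) * z ^ S N)%C.
  change (psum (conv (shift c) d) z (S N)) with
    (psum (conv (shift c) d) z N + conv (shift c) d N * z ^ N)%C.
  rewrite (Cpow_S z N). ring.
Qed.

Lemma asy_bounded (f : C -> C) (c : nat -> C) : asy f c ->
  exists B rho, 0 <= B /\ 0 < rho /\ forall z, 0 < Cmod z < rho -> Cmod (f z) <= B.
Proof.
  intros H. destruct (H O) as (B & rho & Hr & K). exists (Rabs B), rho.
  split; [apply Rabs_pos|]. split; [exact Hr|]. intros z Hz. specialize (K z Hz). simpl in K.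
  replace (f z - 0)%C with (f z) in K by ring. assert (T := Rle_abs B). lra.
Qed.

Lemma psum_shift (c : nat -> C) (z : C) (N : nat) :
  psum c z (S N) = (c O + z * psum (shift c) z N)%C.
Proof.
  induction N as [|N IH]; [simpl; ring|].
  change (psum c z (S (S N))) with (psum c z (S N) + c (S N) * z ^ S N)%C.
  rewrite IH. change (psum (shift c) z (S N)) with (psum (shift c) z N + c (S N) * z ^ N)%C.
  rewrite (Cpow_S z N). ring.
Qed.

Lemma asy_shift (f : C -> C) (c : nat -> C) : asy f c ->
  asy (fun z => (f z - c O) / z)%C (shift c).
Proof.
  intros H N. destruct (H (S N)) as (B & rho & Hr & K). exists B, rho. split; [exact Hr|].
  intros z Hz. specialize (K z Hz). rewrite psum_shift in K.
  assert (Nz : z <> RtoC 0) by (apply Cmod_gt_0; lra).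
  apply (Rmult_le_reg_r (Cmod z)); [lra|]. rewrite <- Cmod_mult.
  replace (((f z - c O) / z - psum (shift c) z N) * z)%C
    with (f z - (c O + z * psum (shift c) z N))%C by (field; exact Nz).
  simpl in K. lra.
Qed.

(** Induction on the order for all first factors at once: f is c 0 plus z times a function with the
    shifted expansion. *)
Lemma asy_mult (f g : C -> C) (c d : nat -> C) :
  asy f c -> asy g d -> asy (fun z => f z * g z)%C (conv c d).
Proof.
  intros Hf Hg N. revert f c Hf. destruct (asy_bounded g d Hg) as (Bg & rg & Bg0 & Hrg & Kg).
  induction N as [|N IH]; intros f c Hf.
  - destruct (asy_bounded f c Hf) as (Bf & rf & Bf0 & Hrf & Kf).
    exists (Bf * Bg), (Rmin rf rg). split; [apply Rmin_pos; assumption|]. intros z Hz.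
    assert (M1 := Rmin_l rf rg). assert (M2 := Rmin_r rf rg). simpl.
    replace (f z * g z - 0)%C with (f z * g z)%C by ring. rewrite Cmod_mult, Rmult_1_r.
    apply Rmult_le_compat; try apply Cmod_ge_0; [apply Kf|apply Kg]; lra.
  - destruct (IH _ _ (asy_shift f c Hf)) as (B1 & r1 & Hr1 & K1).
    destruct (Hg (S N)) as (B2 & r2 & Hr2 & K2).
    exists (Cmod (c O) * B2 + B1), (Rmin r1 r2). split; [apply Rmin_pos; assumption|].
    intros z Hz. assert (M1 := Rmin_l r1 r2). assert (M2 := Rmin_r r1 r2).
    specialize (K1 z ltac:(lra)). specialize (K2 z ltac:(lra)). rewrite psum_conv.
    assert (Nz : z <> RtoC 0) by (apply Cmod_gt_0; lra).
    replace (f z * g z - (c O * psum d z (S N) + z * psum (conv (shift c) d) z N))%C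
      with (c O * (g z - psum d z (S N)) +
            z * ((f z - c O) / z * g z - psum (conv (shift c) d) z N))%C by (field; exact Nz).
    eapply Rle_trans; [apply Cmod_triangle|]. rewrite (Cmod_mult (c O)), (Cmod_mult z).
    assert (Cmod (c O) * Cmod (g z - psum d z (S N)) <= Cmod (c O) * (B2 * Cmod z ^ S N))
      by (apply Rmult_le_compat_l; [apply Cmod_ge_0|exact K2]).
    assert (Cmod z * Cmod ((f z - c O) / z * g z - psum (conv (shift c) d) z N) <=
      Cmod z * (B1 * Cmod z ^ N)) by (apply Rmult_le_compat_l; [lra|exact K1]).
    simpl pow in *. lra.
Qed.

Lemma psum_plus (c d : nat -> C) (z : C) (N : nat) :
  psum (fun n => c n + d n)%C z N = (psum c z N + psum d z N)%C.
Proof. induction N as [|N IH]; simpl; [ring|]. rewrite IH. ring. Qed.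

Lemma psum_scal (k : C) (c : nat -> C) (z : C) (N : nat) :
  psum (fun n => k * c n)%C z N = (k * psum c z N)%C.
Proof. induction N as [|N IH]; simpl; [ring|]. rewrite IH. ring. Qed.

Lemma asy_plus (f g : C -> C) (c d : nat -> C) :
  asy f c -> asy g d -> asy (fun z => f z + g z)%C (fun n => c n + d n)%C.
Proof.
  intros Hf Hg N. destruct (Hf N) as (B1 & r1 & Hr1 & K1). destruct (Hg N) as (B2 & r2 & Hr2 & K2).
  exists (B1 + B2), (Rmin r1 r2). split; [apply Rmin_pos; assumption|].
  intros z Hz. assert (M1 := Rmin_l r1 r2). assert (M2 := Rmin_r r1 r2).
  specialize (K1 z ltac:(lra)). specialize (K2 z ltac:(lra)). rewrite psum_plus.
  replace (f z + g z - (psum c z N + psum d z N))%C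
    with ((f z - psum c z N) + (g z - psum d z N))%C by ring.
  eapply Rle_trans; [apply Cmod_triangle|]. lra.
Qed.

Lemma asy_scal (k : C) (f : C -> C) (c : nat -> C) :
  asy f c -> asy (fun z => k * f z)%C (fun n => k * c n)%C.
Proof.
  intros Hf N. destruct (Hf N) as (B & r & Hr & K). exists (Cmod k * B), r.
  split; [exact Hr|]. intros z Hz. specialize (K z Hz). rewrite psum_scal.
  replace (k * f z - k * psum c z N)%C with (k * (f z - psum c z N))%C by ring.
  rewrite Cmod_mult, Rmult_assoc. apply Rmult_le_compat_l; [apply Cmod_ge_0|exact K].
Qed.

Definition delta (k : C) (n : nat) : C := match n with O => k | S _ => RtoC 0 end.

Lemma psum_delta (k z : C) (N : nat) : psum (delta k) z (S N) = k.
Proof.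
  induction N as [|N IH]; [simpl; ring|].
  change (psum (delta k) z (S (S N))) with (psum (delta k) z (S N) + 0 * z ^ S N)%C.
  rewrite IH. ring.
Qed.

Lemma asy_const (k : C) : asy (fun _ => k) (delta k).
Proof.
  intros [|N]; exists (Cmod k), 1; (split; [lra|]); intros z Hz.
  - simpl. replace (k - 0)%C with k by ring. lra.
  - rewrite psum_delta, sub_self, Cmod_0.
    apply Rmult_le_pos; [apply Cmod_ge_0|apply pow_le, Cmod_ge_0].
Qed.

Lemma asy_ext (f g : C -> C) (c : nat -> C) :
  near 0 (fun z => z <> RtoC 0 -> f z = g z) -> asy f c -> asy g c.
Proof.
  intros (d & Hd & E) Hf N. destruct (Hf N) as (B & r & Hr & K).
  exists B, (Rmin d r). split; [apply Rmin_pos; assumption|]. intros z Hz.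
  assert (M1 := Rmin_l d r). assert (M2 := Rmin_r d r).
  rewrite <- E; [apply K; lra| |apply Cmod_gt_0; lra].
  replace (z - 0)%C with z by ring. lra.
Qed.

(** * Majorants and Bohr's theorem *)

Fixpoint msum (c : nat -> C) (r : R) (n : nat) : R :=
  match n with O => 0 | S m => msum c r m + Cmod (c m) * r ^ m end.

Lemma msum_nonneg (c : nat -> C) (r : R) (N : nat) : 0 <= r -> 0 <= msum c r N.
Proof.
  intros Hr. induction N as [|N IH]; simpl; [lra|].
  assert (0 <= Cmod (c N) * r ^ N) by (apply Rmult_le_pos; [apply Cmod_ge_0|apply pow_le, Hr]).
  lra.
Qed.

Lemma msum_ext (c d : nat -> C) (r : R) (N : nat) :
  (forall n, Cmod (c n) = Cmod (d n)) -> msum c r N = msum d r N.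
Proof. intros H. induction N as [|N IH]; simpl; [reflexivity|]. rewrite IH, H. reflexivity. Qed.

Lemma msum_le_S (c : nat -> C) (r : R) (N : nat) : 0 <= r -> msum c r N <= msum c r (S N).
Proof.
  intros Hr. simpl.
  assert (0 <= Cmod (c N) * r ^ N) by (apply Rmult_le_pos; [apply Cmod_ge_0|apply pow_le, Hr]).
  lra.
Qed.

Lemma msum_shift (c : nat -> C) (r : R) (N : nat) :
  msum c r (S N) = Cmod (c O) + r * msum (shift c) r N.
Proof.
  induction N as [|N IH]; [simpl; ring|].
  change (msum c r (S (S N))) with (msum c r (S N) + Cmod (c (S N)) * r ^ S N).
  rewrite IH. change (msum (shift c) r (S N)) with (msum (shift c) r N + Cmod (c (S N)) * r ^ N).
  simpl. ring.
Qed.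

Lemma msum_plus (c d : nat -> C) (r : R) (N : nat) : 0 <= r ->
  msum (fun n => c n + d n)%C r N <= msum c r N + msum d r N.
Proof.
  intros Hr. induction N as [|N IH]; simpl; [lra|].
  assert (Cmod (c N + d N) * r ^ N <= (Cmod (c N) + Cmod (d N)) * r ^ N)
    by (apply Rmult_le_compat_r; [apply pow_le, Hr|apply Cmod_triangle]). lra.
Qed.

Lemma msum_scal (k : C) (c : nat -> C) (r : R) (N : nat) :
  msum (fun n => k * c n)%C r N = Cmod k * msum c r N.
Proof. induction N as [|N IH]; simpl; [ring|]. rewrite IH, Cmod_mult. ring. Qed.

Lemma msum_conv_S (c d : nat -> C) (r : R) (N : nat) : 0 <= r ->
  msum (conv c d) r (S N) <=
  Cmod (c O) * msum d r (S N) + r * msum (conv (shift c) d) r N.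
Proof.
  intros Hr. induction N as [|N IH].
  - simpl. rewrite Cmod_mult. lra.
  - change (msum (conv c d) r (S (S N))) with (msum (conv c d) r (S N) +
      Cmod (c O * d (S N) + conv (shift c) d N) * r ^ S N).
    change (msum d r (S (S N))) with (msum d r (S N) + Cmod (d (S N)) * r ^ S N).
    change (msum (conv (shift c) d) r (S N)) with
      (msum (conv (shift c) d) r N + Cmod (conv (shift c) d N) * r ^ N).
    assert (T := Cmod_triangle (c O * d (S N)) (conv (shift c) d N)). rewrite Cmod_mult in T.
    assert (P := pow_le r (S N) Hr).
    apply (Rmult_le_compat_r (r ^ S N)) in T; [|exact P]. simpl pow in *. lra.
Qed.

Lemma msum_conv (c d : nat -> C) (r : R) (N : nat) : 0 <= r ->
  msum (conv c d) r N <= msum c r N * msum d r N.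
Proof.
  intros Hr. revert c. induction N as [|N IH]; intros c; [simpl; lra|].
  eapply Rle_trans; [apply msum_conv_S, Hr|]. rewrite (msum_shift c).
  assert (P1 := msum_nonneg (shift c) r N Hr). assert (P2 := msum_nonneg d r N Hr).
  assert (L := msum_le_S d r N Hr). assert (I := IH (shift c)).
  assert (r * msum (conv (shift c) d) r N <= r * (msum (shift c) r N * msum d r (S N))).
  { apply Rmult_le_compat_l; [exact Hr|]. eapply Rle_trans; [exact I|].
    apply Rmult_le_compat_l; assumption. }
  lra.
Qed.

(** Bounding the partial sums spares carrying convergence along. The coefficients are those of an
    asymptotic expansion, so only the behaviour of f near 0 enters. *)
Definition majorized (f : C -> C) (r B : R) : Prop :=
  exists c, asy f c /\ forall N, msum c r N <= B.

Lemma majorized_ext (f g : C -> C) (r B : R) :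
  near 0 (fun z => z <> RtoC 0 -> f z = g z) -> majorized f r B -> majorized g r B.
Proof. intros E (c & Hc & K). exists c. split; [eapply asy_ext; eassumption|exact K]. Qed.

Lemma majorized_plus (f g : C -> C) (r A B : R) : 0 <= r ->
  majorized f r A -> majorized g r B -> majorized (fun z => f z + g z)%C r (A + B).
Proof.
  intros Hr (c & Hc & K) (d & Hd & L). eexists. split; [apply asy_plus; eassumption|].
  intros N. eapply Rle_trans; [apply msum_plus, Hr|]. specialize (K N). specialize (L N). lra.
Qed.

Lemma majorized_mult (f g : C -> C) (r A B : R) : 0 <= r ->
  majorized f r A -> majorized g r B -> majorized (fun z => f z * g z)%C r (A * B).
Proof.
  intros Hr (c & Hc & K) (d & Hd & L). eexists. split; [apply asy_mult; eassumption|].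
  intros N. eapply Rle_trans; [apply msum_conv, Hr|].
  apply Rmult_le_compat; auto using msum_nonneg.
Qed.

Lemma majorized_scal (k : C) (f : C -> C) (r B : R) :
  majorized f r B -> majorized (fun z => k * f z)%C r (Cmod k * B).
Proof.
  intros (c & Hc & K). eexists. split; [apply asy_scal; eassumption|].
  intros N. rewrite msum_scal. apply Rmult_le_compat_l; [apply Cmod_ge_0|apply K].
Qed.

Lemma msum_delta (k : C) (r : R) (N : nat) : msum (delta k) r N <= Cmod k.
Proof.
  destruct N as [|N]; [apply Cmod_ge_0|]. right. induction N as [|N IH]; [simpl; ring|].
  change (msum (delta k) r (S (S N))) with (msum (delta k) r (S N) + Cmod 0 * r ^ S N).
  rewrite IH, Cmod_0. ring.
Qed.

Lemma majorized_const (k : C) (r : R) : majorized (fun _ => k) r (Cmod k).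
Proof. exists (delta k). split; [apply asy_const|]. intros N. apply msum_delta. Qed.

Lemma majorized_id (r : R) : 0 <= r -> majorized (fun z => z) r r.
Proof.
  intros Hr. set (c := fun n => match n with S O => RtoC 1 | _ => RtoC 0 end).
  assert (E : forall z n, psum c z (S (S n)) = z).
  { intros z n. induction n as [|n IH]; [simpl; ring|].
    change (psum c z (S (S (S n)))) with (psum c z (S (S n)) + 0 * z ^ (S (S n)))%C.
    rewrite IH. ring. }
  exists c. split.
  - intros [|[|N]]; exists 1, 1; (split; [lra|]); intros z Hz.
    + simpl. replace (z - 0)%C with z by ring. lra.
    + simpl. replace (z - (0 + 0 * 1))%C with z by ring. lra.
    + rewrite E, sub_self, Cmod_0. rewrite Rmult_1_l. apply pow_le. lra.
  - intros [|[|N]]; [exact Hr|simpl; rewrite Cmod_0; lra|].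
    induction N as [|N IH]; [simpl; rewrite Cmod_0, Cmod_1; lra|].
    change (msum c r (S (S (S N)))) with (msum c r (S (S N)) + Cmod 0 * r ^ (S (S N))).
    rewrite Cmod_0. lra.
Qed.

(** The reciprocal u satisfies u = 1 + k w u, so its majorant U satisfies U <= 1 + k B U, which is
    solved for U because k B < 1. *)
Lemma majorized_geometric (w : C -> C) (k r B : R) : 0 <= r -> 0 <= k -> k * B < 1 ->
  near 0 (holo w) -> w 0 = RtoC 0 -> majorized w r B ->
  majorized (fun z => / (1 - RtoC k * w z))%C r (/ (1 - k * B)).
Proof.
  intros Hr Hk HkB Hw w0 (c & Hc & K).
  set (D := fun z => (1 - RtoC k * w z)%C).
  assert (HD : forall z, holo w z -> holo D z).
  { intros z Hz. apply holo_minus; [apply holo_const|].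
    apply holo_mult; [apply holo_const|exact Hz]. }
  assert (D0 : D 0 <> RtoC 0).
  { unfold D. rewrite w0. replace (1 - RtoC k * 0)%C with (RtoC 1) by ring.
    apply RtoC_neq. lra. }
  assert (ND : near 0 (fun z => D z <> RtoC 0)).
  { apply (ccont_pull D 0 (fun u => u <> RtoC 0)); [|apply near_neq, D0].
    apply holo_ccont, HD, near_self, Hw. }
  destruct (asy_exists (fun z => / D z)%C) as (u & Hu).
  { eapply near_imp; [|exact (near_and _ _ _ Hw ND)]. intros z [H1 H2].
    apply holo_inv; auto. }
  exists u. split; [exact Hu|].
  assert (E : forall n, u n = (delta 1 n + RtoC k * conv c u n)%C).
  { apply (asy_unique (fun z => / D z)%C (fun z => 1 + RtoC k * (w z * / D z))%C).
    - eapply near_imp; [|exact ND]. intros z Hz _. unfold D in *. field. exact Hz.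
    - exact Hu.
    - apply (asy_plus (fun _ => RtoC 1) (fun z => RtoC k * (w z * / D z))%C); [apply asy_const|].
      apply asy_scal. apply asy_mult; assumption. }
  intros N. assert (U0 := msum_nonneg u r N Hr).
  assert (L : msum u r N <= 1 + k * (B * msum u r N)).
  { rewrite (msum_ext u (fun n => delta 1 n + RtoC k * conv c u n)%C r N) at 1
      by (intros n; f_equal; apply E).
    eapply Rle_trans; [apply msum_plus, Hr|]. rewrite msum_scal, Cmod_R, Rabs_pos_eq by exact Hk.
    assert (A := msum_delta 1 r N). rewrite Cmod_1 in A.
    assert (A2 := msum_conv c u r N Hr).
    assert (msum c r N * msum u r N <= B * msum u r N) by (apply Rmult_le_compat_r; auto).
    assert (k * msum (conv c u) r N <= k * (B * msum u r N)) by (apply Rmult_le_compat_l; lra).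
    lra. }
  apply (Rmult_le_reg_l (1 - k * B)); [lra|]. rewrite Rinv_r by lra. lra.
Qed.

(** Bernoulli's inequality bounds r^n from below as r tends to 1. This moves coefficient estimates
    from interior circles to radius 1. *)
Lemma le_of_pow_limit (x y : R) (n : nat) : 0 <= x ->
  (forall r, 0 < r < 1 -> x * r ^ n <= y) -> x <= y.
Proof.
  intros Hx H. apply Rnot_lt_le. intros L.
  assert (B : forall h, 0 <= h <= 1 -> 1 - INR n * h <= (1 - h) ^ n).
  { intros h Hh. clear H. induction n as [|n IH]; [simpl; lra|]. rewrite S_INR. simpl pow.
    assert (P := pos_INR n). assert ((1 - h) * (1 - INR n * h) <= (1 - h) * (1 - h) ^ n)
      by (apply Rmult_le_compat_l; lra).
    assert (0 <= INR n * h * h) by (repeat apply Rmult_le_pos; lra). lra. }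
  set (h := Rmin (1 / 2) ((x - y) / (2 * (x * INR n + 1)))).
  assert (P := pos_INR n). assert (Pxn : 0 <= x * INR n) by (apply Rmult_le_pos; assumption).
  assert (h1 : h <= 1 / 2) by apply Rmin_l.
  assert (h2 : h <= (x - y) / (2 * (x * INR n + 1))) by apply Rmin_r.
  assert (h0 : 0 < h) by (apply Rmin_pos; [lra|apply Rdiv_lt_0_compat; lra]).
  specialize (H (1 - h) ltac:(lra)). specialize (B h ltac:(lra)).
  apply (Rmult_le_compat_l x) in B; [|exact Hx].
  apply (Rmult_le_compat_l (2 * (x * INR n + 1))) in h2; [|lra].
  replace (2 * (x * INR n + 1) * ((x - y) / (2 * (x * INR n + 1)))) with (x - y) in h2
    by (field; lra). lra.
Qed.

(* Bohr's theorem, from [|c_n| <= 2 (M - |c_0|)]. *)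
Lemma majorized_bohr (f : C -> C) (M r : R) : 0 <= r <= 1 / 3 ->
  holo_on unit_disk f -> (forall z, unit_disk z -> Cmod (f z) <= M) -> majorized f r M.
Proof.
  intros Hr Hf HM. destruct (asy_exists f) as (c & Hc).
  { apply (near_0_disk f 1); [lra|exact Hf]. }
  destruct (Cmod_rotate (c O)) as (e & He & Ee).
  assert (Hg := asy_plus _ _ _ _ (asy_const (RtoC M)) (asy_scal (- e) f c Hc)).
  assert (K : forall rho, 0 < rho < 1 -> 0 <= M - Cmod (c O) /\
    forall n, (1 <= n)%nat -> Cmod (c n) * rho ^ n <= 2 * (M - Cmod (c O))).
  { intros rho Hrho. destruct (herglotz_coef (fun z => RtoC M + - e * f z)%C 1 rho
      (fun n => delta (RtoC M) n + - e * c n)%C) as [K0 K1].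
    - intros z Hz. apply holo_plus; [apply holo_const|].
      apply holo_mult; [apply holo_const|apply Hf, Hz].
    - exact Hg.
    - exact Hrho.
    - intros z Hz. assert (Dz : unit_disk z) by (unfold unit_disk; lra).
      rewrite Re_plus. simpl Re at 1. assert (T := re_bound (- e * f z)%C).
      rewrite Cmod_mult, Cmod_opp, He in T. specialize (HM z Dz). lra.
    - simpl delta in K0, K1.
      assert (E0 : Re (RtoC M + - e * c O)%C = M - Cmod (c O)).
      { replace (RtoC M + - e * c O)%C with (RtoC M - e * c O)%C by ring. rewrite Ee. reflexivity. }
      rewrite E0 in K0, K1. split; [exact K0|]. intros n Hn. specialize (K1 n Hn).
      destruct n as [|n]; [lia|]. simpl delta in K1.
      replace (0 + - e * c (S n))%C with (- e * c (S n))%C in K1 by ring.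
      rewrite Cmod_mult, Cmod_opp, He, Rmult_1_l in K1. exact K1. }
  assert (K0 : 0 <= M - Cmod (c O)) by (apply (K (1 / 2)); lra).
  assert (K1 : forall n, Cmod (c (S n)) <= 2 * (M - Cmod (c O))).
  { intros n. apply (le_of_pow_limit _ _ (S n)); [apply Cmod_ge_0|].
    intros rho Hrho. apply (K rho Hrho). lia. }
  exists c. split; [exact Hc|].
  (* 2 (M - |c_0|) times the sum of 3^(-n) over n >= 1 is exactly M - |c_0|, which is where 1/3
     comes from. *)
  assert (L : forall N, msum c r (S N) <= Cmod (c O) + (M - Cmod (c O)) * (1 - (1 / 3) ^ N)).
  { induction N as [|N IH]; [simpl; lra|].
    change (msum c r (S (S N))) with (msum c r (S N) + Cmod (c (S N)) * r ^ S N).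
    assert (P : r ^ S N <= (1 / 3) ^ S N) by (apply pow_incr; lra).
    assert (Q : Cmod (c (S N)) * r ^ S N <= 2 * (M - Cmod (c O)) * (1 / 3) ^ S N).
    { apply Rmult_le_compat; [apply Cmod_ge_0|apply pow_le; lra|apply K1|exact P]. }
    simpl pow in *. lra. }
  intros [|N].
  - simpl. assert (T := Cmod_ge_0 (c O)). lra.
  - specialize (L N). assert (0 <= (M - Cmod (c O)) * (1 / 3) ^ N)
      by (apply Rmult_le_pos; [exact K0|apply pow_le; lra]). lra.
Qed.

(** Bohr's theorem is applied to w(z) / z, bounded by 1 through the Schwarz lemma; applied to w
    itself it would give only the bound 1. *)
Lemma majorized_schwarz (w : C -> C) (r : R) : 0 <= r <= 1 / 3 ->
  holo_on unit_disk w -> (forall z, unit_disk z -> Cmod (w z) <= 1) -> w 0 = RtoC 0 ->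
  majorized w r r.
Proof.
  intros Hr Hw H1 w0. apply (majorized_ext (fun z => z * sl w 0 z)%C).
  - apply near_true. intros z _. rewrite (sl_eq w 0 z) at 1. rewrite w0. ring.
  - rewrite <- (Rmult_1_r r) at 2. apply majorized_mult; [lra|apply majorized_id; lra|].
    apply majorized_bohr; [exact Hr| |].
    + intros z Dz. apply sl_holo; [apply (near_0_disk w 1); [lra|exact Hw]|auto].
    + apply schwarz; assumption.
Qed.

(** * Majorants and growth of subordinate functions *)

Lemma q_bounds (p : R) : 0 < p < 1 -> 0 < p / (1 + p ^ 2) < p.
Proof.
  intros Hp. assert (P2 : 0 < p ^ 2) by (apply pow_lt; lra).
  split; [apply Rdiv_lt_0_compat; lra|].
  apply (Rmult_lt_reg_r (1 + p ^ 2)); [lra|].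
  replace (p / (1 + p ^ 2) * (1 + p ^ 2)) with p by (field; lra).
  assert (0 < p * p ^ 2) by (apply Rmult_lt_0_compat; lra). lra.
Qed.

(** This is (1 - p r) + (p - q) r + q r = 1 divided by the denominators: the three parts of (1 - p
    z) + (p - q) z - q z om, taken with positive signs and with om replaced by 1, add up to k_p(r)
    without loss. *)
Lemma k_eq (p r : R) : 0 < p < 1 -> 0 <= r < p ->
  r * (/ (1 - / p * r) * (1 + (p - p / (1 + p ^ 2)) * (r * / (1 - p * r)))) +
  p / (1 + p ^ 2) * (r * (r * (/ (1 - / p * r) * (/ (1 - p * r) * 1)))) = k_ p r.
Proof.
  intros Hp Hr. unfold k_.
  assert (E : / (1 - / p * r) = p / (p - r)) by (field; lra). rewrite E.
  field. repeat split; nra.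
Qed.

(** The representation composed with w is majorized factor by factor: w by r, the two denominators
    by geometric series, and om(w) by 1. The bound r <= 1/3 enters through w and om(w). *)
Lemma majorized_subordinate (p r : R) (phi : C -> Chat) (w : C -> C) : 0 < p < 1 ->
  0 <= r <= 1 / 3 -> r < p -> concave_with_pole p phi ->
  holo_on unit_disk w -> (forall z, unit_disk z -> unit_disk (w z)) -> w 0 = RtoC 0 ->
  majorized (fun z => finite_part phi (w z) - finite_part phi 0)%C r
    (Cmod (dv (finite_part phi) 0) * k_ p r).
Proof.
  intros Hp Hr Hrp H Hw Dw w0. set (P := finite_part phi).
  destruct (concave_representation p phi Hp H) as (om & Hom & om1 & EP). fold P in EP.
  assert (w1 : forall z, unit_disk z -> Cmod (w z) <= 1).
  { intros z Dz. left. apply Dw, Dz. }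
  assert (Nw : near 0 (holo w)) by (apply (near_0_disk w 1); [lra|exact Hw]).
  assert (Mw := majorized_schwarz w r Hr Hw w1 w0).
  set (q := p / (1 + p ^ 2)).
  assert (Hq : 0 < q < p) by (apply q_bounds, Hp).
  assert (Hip : 0 < / p) by (apply Rinv_0_lt_compat; lra).
  assert (Mv1 : majorized (fun z => / (1 - RtoC (/ p) * w z))%C r (/ (1 - / p * r))).
  { apply majorized_geometric; try assumption; try lra.
    apply (Rmult_lt_reg_l p); [lra|]. rewrite <- Rmult_assoc, Rinv_r by lra. lra. }
  assert (Mv2 : majorized (fun z => / (1 - RtoC p * w z))%C r (/ (1 - p * r))).
  { apply majorized_geometric; try assumption; try lra. nra. }
  assert (Mom : majorized (fun z => om (w z)) r 1).
  { apply majorized_bohr; [exact Hr| |auto]. intros z Dz. apply (holo_comp om w); auto. }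
  assert (Mone : majorized (fun _ => RtoC 1) r 1).
  { assert (Q := majorized_const 1 r). rewrite Cmod_1 in Q. exact Q. }
  assert (M : majorized (fun z => dv P 0 * (w z * (/ (1 - RtoC (/ p) * w z) *
      (1 + RtoC (p - q) * (w z * / (1 - RtoC p * w z)))) +
      RtoC (- q) * (w z * (w z * (/ (1 - RtoC (/ p) * w z) * (/ (1 - RtoC p * w z) * om (w z)))))))%C r
    (Cmod (dv P 0) * (r * (/ (1 - / p * r) * (1 + (p - q) * (r * / (1 - p * r)))) +
  q * (r * (r * (/ (1 - / p * r) * (/ (1 - p * r) * 1))))))).
  { apply majorized_scal, majorized_plus; [lra| |].
    - apply majorized_mult; [lra|exact Mw|]. apply majorized_mult; [lra|exact Mv1|].
      apply majorized_plus; [lra|exact Mone|].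
      assert (Q := majorized_scal (RtoC (p - q)) _ _ _
        (majorized_mult _ _ r _ _ ltac:(lra) Mw Mv2)).
      rewrite Cmod_real in Q by lra. exact Q.
    - assert (Mom' : majorized (fun z => w z * (w z * (/ (1 - RtoC (/ p) * w z) *
        (/ (1 - RtoC p * w z) * om (w z)))))%C r
        (r * (r * (/ (1 - / p * r) * (/ (1 - p * r) * 1))))).
      { repeat (apply majorized_mult; [lra|assumption|]). exact Mom. }
      apply (majorized_scal (RtoC (- q))) in Mom'.
      rewrite Cmod_R, Rabs_left, Ropp_involutive in Mom' by lra. exact Mom'. }
  unfold q in M. rewrite k_eq in M by lra. fold q in M.
  refine (majorized_ext _ _ _ _ _ M). exists p. split; [lra|]. intros z Hz _.
  replace (z - 0)%C with z in Hz by ring.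
  assert (Dz : unit_disk z) by (unfold unit_disk; lra).
  assert (Lw : Cmod (w z) <= Cmod z) by (apply schwarz_le; assumption).
  assert (Ow : off_pole p (w z)).
  { split; [apply Dw, Dz|]. intros E. rewrite E, Cmod_real in Lw; lra. }
  rewrite (EP _ Ow). fold q.
  assert (N1 := mob_den p (w z) Hp (p_unit_disk p _ Hp (proj1 Ow))).
  assert (N2 : (RtoC p - w z)%C <> RtoC 0) by (apply Csub_neq; intros Q; apply (proj2 Ow); auto).
  assert (Np : RtoC p <> RtoC 0) by (apply RtoC_neq; lra).
  rewrite RtoC_inv, RtoC_opp, RtoC_minus by lra.
  assert (N3 : (1 - / RtoC p * w z)%C <> RtoC 0).
  { intros Q. apply N2. replace (RtoC p - w z)%C with (RtoC p * (1 - / RtoC p * w z))%C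
      by (field; exact Np). rewrite Q. ring. }
  assert (E3 : (/ (1 - / RtoC p * w z) = RtoC p / (RtoC p - w z))%C) by (field; auto).
  rewrite E3. field. auto.
Qed.

(** The splitting of [k_eq] with moduli in place of majorants, hence valid for all |u| < p. *)
Lemma subordinate_growth (p : R) (phi : C -> Chat) (u : C) : 0 < p < 1 ->
  concave_with_pole p phi -> Cmod u < p ->
  Cmod (finite_part phi u) <= Cmod (finite_part phi 0) +
    Cmod (dv (finite_part phi) 0) * k_ p (Cmod u).
Proof.
  intros Hp H Hu. set (P := finite_part phi).
  destruct (concave_representation p phi Hp H) as (om & Hom & om1 & EP). fold P in EP.
  assert (Du : unit_disk u) by (unfold unit_disk; lra).
  assert (Ou : off_pole p u).
  { split; [exact Du|]. intros E. rewrite E, Cmod_real in Hu; lra. }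
  rewrite (EP u Ou). eapply Rle_trans; [apply Cmod_triangle|]. apply Rplus_le_compat_l.
  rewrite Cmod_mult. apply Rmult_le_compat_l; [apply Cmod_ge_0|].
  assert (U0 := Cmod_ge_0 u). set (r := Cmod u) in *.
  set (q := p / (1 + p ^ 2)).
  assert (Hq : 0 < q < p) by (apply q_bounds, Hp).
  assert (N1 := mob_den p u Hp (p_unit_disk p u Hp Du)).
  assert (N2 : (RtoC p - u)%C <> RtoC 0) by (apply Csub_neq; intros Q; apply (proj2 Ou); auto).
  rewrite <- (k_eq p r Hp) by lra. fold q.
  replace (u * (1 - RtoC q * u * (1 + om u)) * RtoC p / ((RtoC p - u) * (1 - RtoC p * u)))%C
    with (u * (RtoC p / (RtoC p - u) * (1 + RtoC (p - q) * (u * / (1 - RtoC p * u)))) +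
      RtoC (- q) * (u * (u * (RtoC p / (RtoC p - u) * (/ (1 - RtoC p * u) * om u)))))%C
    by (rewrite RtoC_minus, RtoC_opp; field; auto).
  assert (B1 : Cmod (RtoC p / (RtoC p - u)) <= / (1 - / p * r)).
  { rewrite Cmod_div, Cmod_real by (exact N2 || lra).
    replace (/ (1 - / p * r)) with (p / (p - r)) by (field; lra).
    apply Rmult_le_compat_l; [lra|]. apply Rinv_le_contravar; [lra|].
    assert (T := Cmod_triangle_rev p u). rewrite Cmod_real in T by lra. exact T. }
  assert (B2 : Cmod (/ (1 - RtoC p * u)) <= / (1 - p * r)).
  { rewrite Cmod_inv by exact N1. apply Rinv_le_contravar; [nra|].
    assert (T := Cmod_triangle_rev 1 (RtoC p * u)).
    rewrite Cmod_1, Cmod_mult, Cmod_real in T by lra. exact T. }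
  eapply Rle_trans; [apply Cmod_triangle|]. rewrite !Cmod_mult.
  rewrite (Cmod_R (- q)), (Rabs_left (- q)), Ropp_involutive by lra. fold r.
  assert (C1 : Cmod (1 + RtoC (p - q) * (u * / (1 - RtoC p * u))) <=
    1 + (p - q) * (r * / (1 - p * r))).
  { eapply Rle_trans; [apply Cmod_triangle|]. rewrite Cmod_1, !Cmod_mult, (Cmod_real (p - q)) by lra.
    fold r. apply Rplus_le_compat_l, Rmult_le_compat_l; [lra|].
    apply Rmult_le_compat_l; [lra|exact B2]. }
  apply Rplus_le_compat.
  - apply Rmult_le_compat_l; [lra|].
    apply Rmult_le_compat; try apply Cmod_ge_0; assumption.
  - apply Rmult_le_compat_l; [lra|]. apply Rmult_le_compat_l; [lra|].
    apply Rmult_le_compat_l; [lra|].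
    apply Rmult_le_compat; [apply Cmod_ge_0| |exact B1|].
    + apply Rmult_le_pos; apply Cmod_ge_0.
    + apply Rmult_le_compat; try apply Cmod_ge_0; auto.
Qed.

(** * The radius equation *)

Lemma k_0 (p : R) : k_ p 0 = 0.
Proof. unfold k_, Rdiv. ring. Qed.

Lemma k_den (p x : R) : 0 < p < 1 -> 0 <= x < p -> 0 < (p - x) * (1 - p * x).
Proof. intros Hp Hx. apply Rmult_lt_0_compat; nra. Qed.

Lemma k_increasing (p x y : R) : 0 < p < 1 -> 0 <= x -> x < y -> y < p -> k_ p x < k_ p y.
Proof.
  intros Hp Hx Hxy Hy. assert (D1 := k_den p x Hp ltac:(lra)). assert (D2 := k_den p y Hp ltac:(lra)).
  unfold k_. apply (Rmult_lt_reg_r ((p - x) * (1 - p * x) * ((p - y) * (1 - p * y)))).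
  { apply Rmult_lt_0_compat; assumption. }
  replace (p * x / ((p - x) * (1 - p * x)) * ((p - x) * (1 - p * x) * ((p - y) * (1 - p * y))))
    with (p * x * ((p - y) * (1 - p * y))) by (field; split; nra).
  replace (p * y / ((p - y) * (1 - p * y)) * ((p - x) * (1 - p * x) * ((p - y) * (1 - p * y))))
    with (p * y * ((p - x) * (1 - p * x))) by (field; split; nra).
  assert (E : p * y * ((p - x) * (1 - p * x)) - p * x * ((p - y) * (1 - p * y)) =
    p * p * ((y - x) * (1 - x * y))) by ring.
  assert (0 < p * p * ((y - x) * (1 - x * y))).
  { apply Rmult_lt_0_compat; [nra|]. apply Rmult_lt_0_compat; [lra|]. nra. }
  lra.
Qed.

Lemma k_monotone (p x y : R) : 0 < p < 1 -> 0 <= x -> x <= y -> y < p -> k_ p x <= k_ p y.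
Proof.
  intros Hp Hx [Hxy| ->] Hy; [left; apply k_increasing; assumption|lra].
Qed.

Lemma k_nonneg (p x : R) : 0 < p < 1 -> 0 <= x < p -> 0 <= k_ p x.
Proof. intros Hp Hx. rewrite <- (k_0 p). apply k_monotone; lra. Qed.

Definition radius_function (K : R) (m : nat) (p t r : R) : R :=
  t * k_ p (r ^ m) + 2 * K * (1 - t) / (K + 1) * k_ p r - p / (1 + p) ^ 2.

Lemma K_factor (K : R) : 1 <= K -> 1 <= 2 * K / (K + 1).
Proof.
  intros HK. apply (Rmult_le_reg_r (K + 1)); [lra|].
  replace (2 * K / (K + 1) * (K + 1)) with (2 * K) by (field; lra). lra.
Qed.

Lemma pow_small (x p : R) (m : nat) : (1 <= m)%nat -> 0 <= x < p -> p < 1 -> 0 <= x ^ m < p.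
Proof.
  intros Hm Hx Hp. split; [apply pow_le; lra|]. destruct m as [|m]; [lia|]. simpl.
  assert (x ^ m <= 1 ^ m) by (apply pow_incr; lra). rewrite pow1 in *. nra.
Qed.

Lemma pow_increasing (x y : R) (m : nat) : (1 <= m)%nat -> 0 <= x < y -> x ^ m < y ^ m.
Proof.
  intros Hm Hxy. destruct m as [|m]; [lia|]. clear Hm. induction m as [|m IH]; [simpl; lra|].
  change (x * x ^ S m < y * y ^ S m). assert (0 <= x ^ S m) by (apply pow_le; lra). nra.
Qed.

(** The term k_p(r^m) drops out for t = 0 and k_p(r) for t = 1, so strictness is taken from the
    first when t > 0 and from the second when t = 0. *)
Lemma radius_function_increasing (K : R) (m : nat) (p t x y : R) :
  0 < p < 1 -> 1 <= K -> 0 <= t <= 1 -> (1 <= m)%nat -> 0 <= x -> x < y -> y < p ->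
  radius_function K m p t x < radius_function K m p t y.
Proof.
  intros Hp HK Ht Hm Hx Hxy Hy. unfold radius_function.
  assert (F := K_factor K HK).
  assert (A := k_increasing p x y Hp Hx Hxy Hy).
  assert (B : k_ p (x ^ m) < k_ p (y ^ m)).
  { apply k_increasing; [exact Hp|apply pow_le, Hx|apply pow_increasing; [exact Hm|lra]|].
    apply pow_small; [exact Hm|lra|lra]. }
  replace (2 * K * (1 - t) / (K + 1)) with ((1 - t) * (2 * K / (K + 1))) by (field; lra).
  destruct (Rle_lt_or_eq_dec 0 t ltac:(lra)) as [T| <-].
  - assert (t * k_ p (x ^ m) < t * k_ p (y ^ m)) by (apply Rmult_lt_compat_l; assumption).
    assert (0 <= (1 - t) * (2 * K / (K + 1))) by (apply Rmult_le_pos; lra).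
    assert ((1 - t) * (2 * K / (K + 1)) * k_ p x <= (1 - t) * (2 * K / (K + 1)) * k_ p y)
      by (apply Rmult_le_compat_l; lra). lra.
  - assert ((1 - 0) * (2 * K / (K + 1)) * k_ p x < (1 - 0) * (2 * K / (K + 1)) * k_ p y)
      by (apply Rmult_lt_compat_l; lra). lra.
Qed.

Lemma k_continuous (p x : R) : 0 < p < 1 -> 0 <= x < p -> continuity_pt (k_ p) x.
Proof.
  intros Hp Hx. assert (D := k_den p x Hp Hx). apply continuity_pt_filterlim.
  apply (ex_derive_continuous (V := R_NormedModule)). unfold k_. auto_derive.
  intros E. assert (E' : (p - x) * (1 - p * x) = (p + - x) * (1 + - (p * x))) by ring. lra.
Qed.

Lemma k_pow_continuous (p x : R) (m : nat) : 0 < p < 1 -> 0 <= x -> x ^ m < p ->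
  continuity_pt (fun r => k_ p (r ^ m)) x.
Proof.
  intros Hp Hx Hxm. apply (continuity_pt_comp (fun r => r ^ m) (k_ p)).
  - apply derivable_continuous_pt, derivable_pt_pow.
  - apply k_continuous; [exact Hp|]. split; [apply pow_le, Hx|exact Hxm].
Qed.

Lemma radius_function_continuous (K : R) (m : nat) (p t x : R) :
  0 < p < 1 -> (1 <= m)%nat -> 0 <= x < p -> continuity_pt (radius_function K m p t) x.
Proof.
  intros Hp Hm Hx. unfold radius_function.
  apply (continuity_pt_minus (fun r => t * k_ p (r ^ m) + 2 * K * (1 - t) / (K + 1) * k_ p r)
    (fun _ => p / (1 + p) ^ 2)).
  - apply (continuity_pt_plus (fun r => t * k_ p (r ^ m))
      (fun r => 2 * K * (1 - t) / (K + 1) * k_ p r)).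
    + apply (continuity_pt_scal (fun r => k_ p (r ^ m)) t).
      apply k_pow_continuous; [exact Hp|lra|]. apply pow_small; lra || assumption.
    + apply (continuity_pt_scal (k_ p)). apply k_continuous; assumption.
  - apply continuity_pt_const. intros u v. reflexivity.
Qed.

Lemma k_unbounded (p M : R) : 0 < p < 1 -> 0 <= M -> exists r, 0 < r < p /\ M < k_ p r.
Proof.
  intros Hp HM. set (d := Rmin (p / 2) (p ^ 2 / (2 * (M + 1)))).
  assert (P2 : 0 < p ^ 2) by (apply pow_lt; lra).
  assert (D1 : d <= p / 2) by apply Rmin_l.
  assert (D2 : d <= p ^ 2 / (2 * (M + 1))) by apply Rmin_r.
  assert (D0 : 0 < d) by (apply Rmin_pos; [lra|apply Rdiv_lt_0_compat; lra]).
  exists (p - d). split; [lra|].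
  assert (D := k_den p (p - d) Hp ltac:(lra)).
  unfold k_. replace (p - (p - d)) with d in * by ring.
  apply (Rmult_lt_reg_r (d * (1 - p * (p - d)))); [exact D|].
  replace (p * (p - d) / (d * (1 - p * (p - d))) * (d * (1 - p * (p - d))))
    with (p * (p - d)) by (field; split; nra).
  apply (Rmult_le_compat_l (2 * (M + 1))) in D2; [|lra].
  replace (2 * (M + 1) * (p ^ 2 / (2 * (M + 1)))) with (p ^ 2) in D2 by (field; lra).
  assert (0 < p * (p - d)) by (apply Rmult_lt_0_compat; lra).
  assert (M * (d * (1 - p * (p - d))) <= M * (d * 1)).
  { apply Rmult_le_compat_l; [exact HM|]. apply Rmult_le_compat_l; lra. }
  nra.
Qed.

(** The function is negative at 0. For t < 1, or for m = 1, it becomes positive near p because k_p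
    is unbounded there; for t = 1 and m >= 2 the last alternative of the condition gives the sign at
    p. *)
Lemma radius_exists (K : R) (m : nat) (p t : R) :
  0 < p < 1 -> 1 <= K -> 0 <= t <= 1 -> (1 <= m)%nat -> radius_exists_condition m p t ->
  exists r, is_radius K m p t r.
Proof.
  intros Hp HK Ht Hm Hc. assert (F := K_factor K HK).
  assert (C0 : 0 < p / (1 + p) ^ 2) by (apply Rdiv_lt_0_compat; [lra|apply pow_lt; lra]).
  assert (Z : 0 ^ m = 0) by (apply pow_i; lia).
  assert (L0 : forall t, radius_function K m p t 0 < 0).
  { intros t'. unfold radius_function. rewrite Z, k_0. lra. }
  assert (Main : (exists b, 0 < b < p /\ 0 < radius_function K m p t b) ->
    exists r, is_radius K m p t r).
  { intros (b & Hb & Lb).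
    destruct (IVT_interv (radius_function K m p t) 0 b) as (z & Hz & Ez).
    - intros x Hx. apply radius_function_continuous; [exact Hp|exact Hm|lra].
    - lra.
    - apply L0.
    - exact Lb.
    - exists z. split; [|exact Ez]. destruct (Req_dec z 0) as [->|N]; [specialize (L0 t); lra|lra]. }
  destruct (Rle_lt_or_eq_dec t 1 ltac:(lra)) as [T| ->].
  - apply Main. set (s := (1 - t) * (2 * K / (K + 1))).
    assert (S0 : 0 < s) by (apply Rmult_lt_0_compat; lra).
    destruct (k_unbounded p (p / (1 + p) ^ 2 / s) Hp) as (r & Hr & Kr).
    { left. apply Rdiv_lt_0_compat; assumption. }
    exists r. split; [exact Hr|]. unfold radius_function.
    replace (2 * K * (1 - t) / (K + 1)) with s by (unfold s; field; lra).
    assert (P := k_nonneg p (r ^ m) Hp (pow_small r p m Hm ltac:(lra) ltac:(lra))).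
    assert (0 <= t * k_ p (r ^ m)) by (apply Rmult_le_pos; lra).
    apply (Rmult_lt_compat_l s) in Kr; [|exact S0].
    replace (s * (p / (1 + p) ^ 2 / s)) with (p / (1 + p) ^ 2) in Kr by (field; split; lra). lra.
  - destruct (Nat.eq_dec m 1) as [->|Nm].
    + apply Main. destruct (k_unbounded p (p / (1 + p) ^ 2) Hp ltac:(lra)) as (r & Hr & Kr).
      exists r. split; [exact Hr|]. unfold radius_function. rewrite pow_1.
      replace (2 * K * (1 - 1) / (K + 1)) with 0 by (field; lra). lra.
    + destruct Hc as [Hc|[Hc|Hc]]; [lra|lia|].
      assert (Hpm : p ^ m < p).
      { destruct m as [|[|m]]; [lia|lia|]. simpl.
        assert (p ^ m <= 1 ^ m) by (apply pow_incr; lra). rewrite pow1 in *.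
        assert (0 < p ^ m) by (apply pow_lt; lra). nra. }
      (* With the term k_p(r) dropped the interval may include p, where k_p(r) itself would be a
         division by zero; p^m < p keeps the remaining term continuous. *)
      destruct (IVT_interv (fun r => k_ p (r ^ m) - p / (1 + p) ^ 2) 0 p) as (z & Hz & Ez).
      * intros x Hx. apply (continuity_pt_minus (fun r => k_ p (r ^ m)) (fun _ => p / (1 + p) ^ 2)).
        -- apply k_pow_continuous; [exact Hp|lra|]. apply Rle_lt_trans with (p ^ m); [|exact Hpm].
           apply pow_incr. lra.
        -- apply continuity_pt_const. intros u v. reflexivity.
      * lra.
      * rewrite Z, k_0. lra.
      * lra.
      * exists z. split.
        -- split.
           ++ destruct (Req_dec z 0) as [->|N]; [rewrite Z, k_0 in Ez; lra|lra].
           ++ destruct (Req_dec z p) as [->|N]; [lra|lra].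
        -- unfold radius_equation. replace (2 * K * (1 - 1) / (K + 1)) with 0 by (field; lra). lra.
Qed.

Lemma radius_unique (K : R) (m : nat) (p t r1 r2 : R) :
  0 < p < 1 -> 1 <= K -> 0 <= t <= 1 -> (1 <= m)%nat ->
  is_radius K m p t r1 -> is_radius K m p t r2 -> r1 = r2.
Proof.
  intros Hp HK Ht Hm [H1 E1] [H2 E2].
  change (radius_function K m p t r1 = 0) in E1. change (radius_function K m p t r2 = 0) in E2.
  destruct (Rtotal_order r1 r2) as [L|[E|L]]; [|exact E|].
  - assert (A := radius_function_increasing K m p t r1 r2 Hp HK Ht Hm ltac:(lra) L ltac:(lra)). lra.
  - assert (A := radius_function_increasing K m p t r2 r1 Hp HK Ht Hm ltac:(lra) L ltac:(lra)). lra.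
Qed.

(** * The inequality *)

(** [sum_n] includes the index N, whereas [psum] stops just before its last argument. *)
Lemma sum_n_psum (a : nat -> C) (z : C) (N : nat) :
  sum_n (fun k => scal (pow_n (K := C_AbsRing) z k) (a k)) N = psum a z (S N).
Proof.
  assert (E : forall k, pow_n (K := C_AbsRing) z k = (z ^ k)%C).
  { induction k as [|k IH]; [reflexivity|]. simpl. rewrite IH. reflexivity. }
  induction N as [|N IH].
  - rewrite sum_O, E. change (1 * a O = 0 + a O * 1)%C. ring.
  - rewrite sum_Sn, IH, E.
    change (psum a z (S N) + z ^ S N * a (S N) = psum a z (S N) + a (S N) * z ^ S N)%C. ring.
Qed.

Lemma pseries_limit (a : nat -> C) (z s : C) : is_pseries a z s ->
  forall eps, 0 < eps -> exists N, forall n, (N <= n)%nat -> Cmod (psum a z (S n) - s) < eps.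
Proof.
  intros H eps He. assert (L : locally s (fun u : C => Cmod (u - s) < eps)).
  { apply locally_near. exists eps. auto. }
  destruct (H _ L) as [N HN]. exists N. intros n Hn. specialize (HN n Hn).
  rewrite sum_n_psum in HN. exact HN.
Qed.

Lemma eventually_bounded (x : nat -> R) (B : R) (N : nat) :
  (forall n, (N <= n)%nat -> x n <= B) -> exists B', forall n, x n <= B'.
Proof.
  revert B. induction N as [|N IH]; intros B H; [exists B; intros; apply H; lia|].
  apply (IH (Rmax B (x N))). intros n Hn.
  destruct (Nat.eq_dec n N) as [->|Nn]; [apply Rmax_r|].
  eapply Rle_trans; [apply H; lia|apply Rmax_l].
Qed.

(** The terms of the convergent series at x = rho / 2 are bounded, so for |z| < x / 2 the tail from
    N on is dominated by a geometric series of ratio 1/2. *)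
Lemma expansion_asy (f : C -> C) (a : nat -> C) (rho : R) : 0 < rho ->
  (forall z, Cmod z < rho -> is_pseries a z (f z)) -> asy f a.
Proof.
  intros Hr H. set (x := rho / 2).
  assert (Mx : Cmod (RtoC x) = x) by (rewrite Cmod_R, Rabs_pos_eq; unfold x; lra).
  assert (HB : exists B, forall n, Cmod (a n) * x ^ n <= B).
  { destruct (pseries_limit a (RtoC x) _ (H (RtoC x) ltac:(unfold x in *; lra)) 1 Rlt_0_1)
      as [N HN].
    apply (eventually_bounded _ 2 (S N)). intros n Hn.
    destruct n as [|n]; [lia|]. assert (K1 := HN n ltac:(lia)). assert (K2 := HN (S n) ltac:(lia)).
    change (psum a (RtoC x) (S (S n))) with (psum a (RtoC x) (S n) + a (S n) * RtoC x ^ S n)%C in K2.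
    assert (T := Cmod_triangle_rev (a (S n) * RtoC x ^ S n)%C (f (RtoC x) - psum a (RtoC x) (S n))%C).
    replace (a (S n) * RtoC x ^ S n - (f (RtoC x) - psum a (RtoC x) (S n)))%C with
      (psum a (RtoC x) (S n) + a (S n) * RtoC x ^ S n - f (RtoC x))%C in T by ring.
    rewrite Cmod_sub_sym in K1. rewrite Cmod_mult, Cmod_pow, Mx in T. lra. }
  destruct HB as [B HB].
  assert (B0 : 0 <= B).
  { eapply Rle_trans; [|apply (HB O)]. rewrite Rmult_1_r. apply Cmod_ge_0. }
  intros N. exists (2 * B * (/ x) ^ N), (x / 2). assert (X0 : 0 < x) by (unfold x; lra).
  split; [lra|]. intros z Hz. set (t := Cmod z / x).
  assert (Ht : 0 <= t <= 1 / 2).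
  { unfold t. split; [apply Rmult_le_pos; [lra|left; apply Rinv_0_lt_compat, X0]|].
    apply (Rmult_le_reg_r x); [exact X0|]. unfold Rdiv at 1. rewrite Rmult_assoc, Rinv_l by lra. lra. }
  assert (Et : forall n, Cmod z ^ n = t ^ n * x ^ n).
  { intros n. rewrite <- Rpow_mult_distr. f_equal. unfold t. field. lra. }
  assert (Htail : forall M, Cmod (psum a z (N + M) - psum a z N) <= 2 * B * t ^ N * (1 - (1 / 2) ^ M)).
  { intros M. induction M as [|M IH].
    - rewrite Nat.add_0_r, sub_self, Cmod_0. simpl. lra.
    - rewrite Nat.add_succ_r. simpl psum.
      replace (psum a z (N + M) + a (N + M)%nat * z ^ (N + M) - psum a z N)%C
        with ((psum a z (N + M) - psum a z N) + a (N + M)%nat * z ^ (N + M))%C by ring.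
      eapply Rle_trans; [apply Cmod_triangle|]. rewrite Cmod_mult, Cmod_pow, Et.
      assert (K := HB (N + M)%nat). rewrite (pow_add t).
      assert (P1 : 0 <= t ^ N) by (apply pow_le; lra).
      assert (P2 : 0 <= t ^ M <= (1 / 2) ^ M) by (split; [apply pow_le; lra|apply pow_incr; lra]).
      assert (Cmod (a (N + M)%nat) * x ^ (N + M) * (t ^ N * t ^ M) <= B * (t ^ N * (1 / 2) ^ M)).
      { apply Rmult_le_compat; [|apply Rmult_le_pos; lra|exact K|apply Rmult_le_compat_l; lra].
        apply Rmult_le_pos; [apply Cmod_ge_0|apply pow_le; lra]. }
      simpl pow. lra. }
  replace (2 * B * (/ x) ^ N * Cmod z ^ N) with (2 * B * t ^ N).
  2:{ rewrite Et, pow_inv. field. apply pow_nonzero. lra. }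
  apply le_epsilon. intros eps He.
  destruct (pseries_limit a z _ (H z ltac:(unfold x in *; lra)) eps He) as [M HM].
  assert (K1 := HM (N + M)%nat ltac:(lia)). assert (K2 := Htail (S M)).
  rewrite Nat.add_succ_r in K2. rewrite Cmod_sub_sym in K1.
  assert (T := Cmod_sub_triangle (f z) (psum a z (S (N + M))) (psum a z N)).
  assert (0 <= 2 * B * t ^ N * (1 / 2) ^ S M).
  { repeat apply Rmult_le_pos; try lra; apply pow_le; lra. }
  lra.
Qed.

Lemma has_expansion_asy (f : C -> Chat) (a : nat -> C) (rho : R) : 0 < rho ->
  has_expansion rho f a -> asy (finite_part f) a.
Proof.
  intros Hr H. apply (expansion_asy _ _ rho Hr). intros z Hz.
  destruct (H z Hz) as (s & Es & Hs). unfold finite_part. rewrite Es. exact Hs.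
Qed.

(** * Extension of the dilatation across the poles of h *)

Definition punctured_limit (f : C -> C) (z : C) : C :=
  epsilon (inhabits (RtoC 0))
    (fun v => forall eps, 0 < eps -> near z (fun u => u <> z -> Cmod (f u - v) < eps)).

Lemma punctured_limit_eq (f : C -> C) (z v : C) :
  (forall eps, 0 < eps -> near z (fun u => u <> z -> Cmod (f u - v) < eps)) ->
  punctured_limit f z = v.
Proof.
  intros H. assert (K : forall eps, 0 < eps ->
    near z (fun u => u <> z -> Cmod (f u - punctured_limit f z) < eps)).
  { unfold punctured_limit. apply epsilon_spec. exists v. exact H. }
  apply Ceq_eps. intros eps He.
  destruct (near_and _ _ _ (H (eps / 2) ltac:(lra)) (K (eps / 2) ltac:(lra))) as (d & Hd & L).
  assert (Eu : (z + RtoC (d / 2) - z)%C = RtoC (d / 2)) by ring.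
  assert (Mu : Cmod (z + RtoC (d / 2) - z) = d / 2) by (rewrite Eu; apply Cmod_real; lra).
  assert (Nu : (z + RtoC (d / 2))%C <> z).
  { intros Q. rewrite Q, sub_self, Cmod_0 in Mu. lra. }
  destruct (L (z + RtoC (d / 2))%C ltac:(lra)) as [L1 L2]. specialize (L1 Nu). specialize (L2 Nu).
  assert (T := Cmod_sub_triangle (punctured_limit f z) (f (z + RtoC (d / 2))%C) v).
  rewrite (Cmod_sub_sym (punctured_limit f z) (f (z + RtoC (d / 2))%C)) in T. lra.
Qed.

Lemma ccont_punctured_limit (f : C -> C) (z : C) : ccont f z -> punctured_limit f z = f z.
Proof.
  intros H. apply punctured_limit_eq. intros eps He.
  eapply near_imp; [|exact (H eps He)]. auto.
Qed.

(* Riemann: multiply by the square of the distance, then divide it out. *)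
Lemma riemann_removable (f : C -> C) (k : R) (z : C) : 0 <= k ->
  near z (fun u => u <> z -> holo f u /\ Cmod (f u) <= k) ->
  holo (punctured_limit f) z /\ Cmod (punctured_limit f z) <= k.
Proof.
  intros Hk Hn.
  set (g := fun u => match Ceq_dec u z with
     left _ => RtoC 0 | right _ => ((u - z) * (u - z) * f u)%C end).
  assert (gz : g z = RtoC 0) by (unfold g; destruct (Ceq_dec z z); tauto).
  assert (gu : forall u, u <> z -> g u = ((u - z) * (u - z) * f u)%C)
    by (intros u Nu; unfold g; destruct (Ceq_dec u z); tauto).
  assert (Hg0 : cderiv g z 0).
  { intros eps He. destruct Hn as (d & Hd & K). exists (Rmin d (eps / (k + 1))).
    split; [apply Rmin_pos; [exact Hd|apply Rdiv_lt_0_compat; lra]|].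
    intros u Hu. assert (M1 := Rmin_l d (eps / (k + 1))). assert (M2 := Rmin_r d (eps / (k + 1))).
    rewrite gz. replace (g u - 0 - 0 * (u - z))%C with (g u) by ring.
    destruct (Ceq_dec u z) as [->|Nu]; [rewrite gz, sub_self, Cmod_0; lra|].
    rewrite gu by exact Nu. rewrite !Cmod_mult.
    destruct (K u ltac:(lra) Nu) as [_ Kb].
    assert (Hq := Rdiv_mult_lt (Cmod (u - z)) (k + 1) eps ltac:(lra) ltac:(lra)).
    assert (U0 := Cmod_ge_0 (u - z)).
    assert (Cmod (u - z) * Cmod (f u) <= eps).
    { apply Rle_trans with (Cmod (u - z) * k); [apply Rmult_le_compat_l; lra|lra]. }
    assert (Cmod (u - z) * (Cmod (u - z) * Cmod (f u)) <= Cmod (u - z) * eps)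
      by (apply Rmult_le_compat_l; lra). lra. }
  assert (Hg : near z (holo g)).
  { eapply near_imp; [|exact Hn]. intros u Hu. destruct (Ceq_dec u z) as [->|Nu];
      [eexists; exact Hg0|]. destruct (Hu Nu) as [Hf _].
    apply holo_ext with (fun u => (u - z) * (u - z) * f u)%C.
    - eapply near_imp; [|apply (near_neq z u Nu)]. intros v Hv. symmetry. apply gu, Hv.
    - repeat apply holo_mult; try exact Hf; apply holo_minus; [apply holo_id|apply holo_const|
        apply holo_id|apply holo_const]. }
  set (F := sl (sl g z) z).
  assert (Hs : near z (holo (sl g z))).
  { eapply near_imp; [|exact Hg]. intros u Hu. apply sl_holo; assumption. }
  assert (HF : holo F z) by (apply sl_holo; [exact Hs|apply near_self, Hs]).
  assert (EF : forall u, u <> z -> F u = f u).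
  { intros u Nu. assert (N := Csub_neq _ _ Nu). unfold F. rewrite sl_off, sl_at, sl_off by exact Nu.
    rewrite (dv_eq _ _ _ Hg0), gz, gu by exact Nu. field. exact N. }
  assert (Ez : punctured_limit f z = F z).
  { apply punctured_limit_eq. intros eps He.
    eapply near_imp; [|exact (holo_ccont _ _ HF eps He)]. intros u Hu Nu. rewrite <- EF; assumption. }
  split.
  - apply holo_ext with F; [|exact HF]. eapply near_imp; [|exact Hn]. intros u Hu.
    destruct (Ceq_dec u z) as [->|Nu]; [symmetry; exact Ez|]. rewrite EF by exact Nu. symmetry.
    apply ccont_punctured_limit, holo_ccont, Hu, Nu.
  - rewrite Ez. apply Rnot_lt_le. intros L.
    destruct (near_and _ _ _ Hn (Cmod_ccont_near F z k (holo_ccont _ _ HF) L)) as (d & Hd & K).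
    assert (Eu : (z + RtoC (d / 2) - z)%C = RtoC (d / 2)) by ring.
    assert (Mu : Cmod (z + RtoC (d / 2) - z) = d / 2) by (rewrite Eu; apply Cmod_real; lra).
    assert (Nu : (z + RtoC (d / 2))%C <> z).
    { intros Q. rewrite Q, sub_self, Cmod_0 in Mu. lra. }
    destruct (K (z + RtoC (d / 2))%C ltac:(lra)) as [K1 K2]. rewrite EF in K2 by exact Nu.
    destruct (K1 Nu). lra.
Qed.

Lemma analytic_or_punctured (h : C -> Chat) (z : C) : analytic_at h z \/ pole_at h z ->
  near z (fun u => u <> z -> analytic_at h u).
Proof.
  intros [H|H].
  - apply analytic_near, near_near in H. eapply near_imp; [|exact H].
    intros u Hu _. apply analytic_near, Hu.
  - destruct H as (_ & H & _). apply locally'_near in H.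
    assert (Nr := near_near _ _ H). eapply near_imp; [|exact Nr].
    intros u Hu Nu. apply analytic_near.
    eapply near_imp; [|exact (near_and _ _ _ Hu (near_neq z u Nu))].
    intros v [Hv Nv]. destruct (Hv Nv) as [A B]. split; [exact A|]. apply holo_ex_derive, B.
Qed.

(** At a pole of h the formula for the dilatation has no meaning, but poles are isolated and the
    dilatation is bounded by k off them, so its limits fill the gaps. The relation g' = om h' is
    kept only near 0, where the coefficients are read off. *)
Lemma dilatation_extension (h g : C -> Chat) (k : R) : 0 <= k ->
  harmonic_mapping h g -> sense_preserving h g ->
  (forall z, unit_disk z -> analytic_at h z -> Cmod (dilatation h g z) <= k) ->
  analytic_at h 0 ->
  exists om, holo_on unit_disk om /\ (forall z, unit_disk z -> Cmod (om z) <= k) /\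
    near 0 (fun z => dv (finite_part g) z = (om z * dv (finite_part h) z)%C).
Proof.
  intros Hk (Mh & _ & Hg) Hs Hb H0.
  set (P := finite_part h) in *. set (Q := finite_part g) in *.
  assert (Han : forall z, unit_disk z -> analytic_at h z ->
    near z (fun u => holo P u /\ holo Q u /\ dv P u <> RtoC 0 /\
      dilatation h g u = (dv Q u / dv P u)%C)).
  { intros z Dz Az. assert (Ag := Hg z Dz Az).
    apply analytic_near in Ag.
    assert (Az' := near_near _ _ (proj1 (analytic_near h z) Az)).
    eapply near_imp; [|exact (near_and _ _ _ (copen_disk z Dz) (near_and _ _ _ Az' Ag))].
    intros u (Du & Au & [_ Qu]). assert (Au' := proj2 (analytic_near h u) Au).
    apply near_self in Au. destruct Au as [_ Pu]. fold P in Pu. fold Q in Qu.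
    destruct (Hs u Du Au') as [Nd _]. fold P in Nd. rewrite C_derive_dv in Nd by exact Pu.
    repeat split; try assumption. unfold dilatation. fold P Q.
    rewrite !C_derive_dv by assumption. reflexivity. }
  assert (Hdil : forall z, unit_disk z -> analytic_at h z ->
    holo (dilatation h g) z /\ Cmod (dilatation h g z) <= k).
  { intros z Dz Az. split; [|apply Hb; assumption]. assert (N := Han z Dz Az).
    apply holo_ext with (fun u => dv Q u / dv P u)%C.
    - eapply near_imp; [|exact N]. intros u (_ & _ & _ & E). symmetry. exact E.
    - apply holo_div.
      + apply dv_holo. eapply near_imp; [|exact N]. intros u (Pu & Qu & _). assumption.
      + apply dv_holo. eapply near_imp; [|exact N]. intros u (Pu & Qu & _). assumption.
      + apply near_self in N. apply N. }
  assert (Hall : forall z, unit_disk z -> holo (punctured_limit (dilatation h g)) z /\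
    Cmod (punctured_limit (dilatation h g) z) <= k).
  { intros z Dz. apply riemann_removable; [exact Hk|].
    eapply near_imp; [|exact (near_and _ _ _ (copen_disk z Dz)
      (analytic_or_punctured h z (Mh z Dz)))].
    intros u [Du Hu] Nu. apply Hdil; auto. }
  exists (punctured_limit (dilatation h g)). split; [intros z Dz; apply Hall, Dz|].
  split; [intros z Dz; apply Hall, Dz|].
  assert (Hn := near_near _ _ (proj1 (analytic_near h 0) H0)).
  eapply near_imp; [|exact (near_and _ _ _ (copen_disk 0 unit_disk_0)
    (near_and _ _ _ Hn (Han 0 unit_disk_0 H0)))].
  intros u (Du & Au & Pu & Qu & Nd & E).
  apply (proj2 (analytic_near h u)) in Au.
  rewrite ccont_punctured_limit by (apply holo_ccont, Hdil; assumption).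
  rewrite E. field. exact Nd.
Qed.

(** The constant term is left out of the majorant because the derivative governs only the
    coefficients of positive index. *)
Lemma msum_shift_derive (a : nat -> C) (N : nat) (x : R) :
  is_derive (fun r => r * msum (shift a) r N) x (msum (dcoef a) x N).
Proof.
  induction N as [|N IH]; simpl.
  - apply (is_derive_ext (fun _ => 0)); [intros t; change (0 = t * 0); ring|]. apply (is_derive_const (V := R_NormedModule)).
  - apply (is_derive_ext (fun r => plus (r * msum (shift a) r N) (Cmod (shift a N) * r ^ S N))).
    { intros t. change (t * msum (shift a) t N + Cmod (shift a N) * t ^ S N =
        t * (msum (shift a) t N + Cmod (shift a N) * t ^ N)). simpl. ring. }
    apply (is_derive_plus (V := R_NormedModule)); [exact IH|].
    unfold dcoef, shift. rewrite Cmod_mult, Cmod_R, Rabs_pos_eq by apply pos_INR.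
    auto_derive; [exact I|]. rewrite S_INR. destruct N; simpl; ring.
Qed.

(* Integrate [sum n |b_n| x^(n-1) <= k sum n |a_n| x^(n-1)] over [0, r]. *)
Lemma dilatation_majorant (P Q om : C -> C) (a b : nat -> C) (k r : R) (N : nat) :
  0 <= r <= 1 / 3 -> holo_on unit_disk om -> (forall z, unit_disk z -> Cmod (om z) <= k) ->
  near 0 (holo P) -> near 0 (holo Q) -> asy P a -> asy Q b ->
  near 0 (fun z => dv Q z = (om z * dv P z)%C) ->
  r * msum (shift b) r N <= k * (r * msum (shift a) r N).
Proof.
  intros Hr Hom Hk HP HQ Ha Hb E.
  assert (K : forall x, 0 <= x <= r -> msum (dcoef b) x N <= k * msum (dcoef a) x N).
  (* Bohr's theorem majorizes om by k at every x <= 1/3, and the Cauchy product carries this over to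
     g' = om h'. *)
  { intros x Hx. destruct (majorized_bohr om k x ltac:(lra) Hom Hk) as (c & Hc & Kc).
    rewrite (msum_ext (dcoef b) (conv c (dcoef a))).
    - eapply Rle_trans; [apply msum_conv; lra|].
      apply Rmult_le_compat_r; [apply msum_nonneg; lra|apply Kc].
    - intros n. f_equal. revert n. apply (asy_unique (dv Q) (fun z => om z * dv P z)%C).
      + eapply near_imp; [|exact E]. auto.
      + apply asy_dv; assumption.
      + apply asy_mult; [exact Hc|apply asy_dv; assumption]. }
  set (D := fun x => k * (x * msum (shift a) x N) - x * msum (shift b) x N).
  set (D' := fun x => k * msum (dcoef a) x N - msum (dcoef b) x N).
  assert (HD : forall x, is_derive D x (D' x)).
  { intros x. apply (is_derive_minus (V := R_NormedModule)); [|apply msum_shift_derive].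
    apply (is_derive_scal (fun x => x * msum (shift a) x N)). apply msum_shift_derive. }
  destruct (MVT_gen D 0 r D') as (c & Hc & Ec).
  - intros x _. apply HD.
  - intros x _. apply continuity_pt_filterlim.
    apply (ex_derive_continuous (V := R_NormedModule)). eexists. apply HD.
  - rewrite Rmin_left, Rmax_right in Hc by lra. specialize (K c ltac:(lra)).
    assert (D0 : D 0 = 0) by (unfold D; ring).
    assert (0 <= D' c * (r - 0)) by (apply Rmult_le_pos; [unfold D'; lra|lra]).
    rewrite D0 in Ec. unfold D in Ec. lra.
Qed.

(** * Bounding the two coefficient series *)

Lemma sum_n_msum (a b : nat -> C) (r : R) (N : nat) :
  sum_n (fun n => (Cmod (a n) + Cmod (b n)) * r ^ n) N = msum a r (S N) + msum b r (S N).
Proof.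
  induction N as [|N IH]; [rewrite sum_O; simpl; ring|].
  rewrite sum_Sn, IH. unfold plus. simpl. ring.
Qed.

Lemma bounded_series (x : nat -> R) (B : R) : (forall n, 0 <= x n) ->
  (forall N, sum_n x N <= B) -> ex_series x /\ Series x <= B.
Proof.
  intros Hx HB.
  assert (F : ex_finite_lim_seq (sum_n x)).
  { apply (ex_finite_lim_seq_incr _ B); [|exact HB]. intros n. rewrite sum_Sn.
    unfold plus; simpl. specialize (Hx (S n)). lra. }
  assert (E : ex_series x) by (destruct F as [l Hl]; exists l; exact Hl).
  split; [exact E|]. assert (S := Series_correct x E).
  change (is_lim_seq (sum_n x) (Series x)) in S.
  apply (is_lim_seq_le (sum_n x) (fun _ => B) (Series x) B HB S (is_lim_seq_const B)).
Qed.

Lemma coefficient_sum (p K : R) (phi h g : C -> Chat) (a b : nat -> C) (r : R) (N : nat) :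
  0 < p < 1 -> 1 <= K -> admissible p K phi h g a b -> 0 <= r <= 1 / 3 -> r < p ->
  sum_n (fun n => (Cmod (a n) + Cmod (b n)) * r ^ n) N <=
  Cmod (finite_part phi 0) + 2 * K / (K + 1) * (Cmod (dv (finite_part phi) 0) * k_ p r).
Proof.
  intros Hp HK (Hphi & Hhg & Hsp & Hqc & Ha & Hb & b0 & (w & Hw & Dw & w0 & Ew)) Hr Hrp.
  assert (Hw' : holo_on unit_disk w) by (intros z Dz; apply holo_ex_derive, Hw, Dz).
  assert (M := majorized_subordinate p r phi w Hp Hr Hrp Hphi Hw' Dw w0).
  set (P := finite_part phi) in *. set (A := Cmod (dv P 0) * k_ p r) in *.
  assert (D0 := unit_disk_0).
  assert (Eh : forall z, unit_disk z -> finite_part h z = P (w z)).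
  { intros z Dz. unfold P, finite_part. rewrite (Ew z Dz). reflexivity. }
  assert (Ah := has_expansion_asy h a p ltac:(lra) Ha).
  assert (Ag := has_expansion_asy g b p ltac:(lra) Hb).
  (* The expansion of h gives it a finite value at 0, which excludes a pole there. *)
  assert (H0 : analytic_at h 0).
  { destruct Hhg as (Mh & _ & _). destruct (Mh 0 D0) as [Q|(Q & _)]; [exact Q|].
    destruct (Ha 0) as (s & Es & _); [rewrite Cmod_0; lra|]. rewrite Q in Es. discriminate. }
  assert (G0 : analytic_at g 0) by (apply Hhg; assumption).
  set (k := (K - 1) / (K + 1)).
  assert (Hk : 0 <= k) by (apply Rmult_le_pos; [lra|left; apply Rinv_0_lt_compat; lra]).
  destruct (dilatation_extension h g k Hk Hhg Hsp Hqc H0) as (om & Hom & om1 & Eom).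
  assert (Nh : near 0 (holo (finite_part h))).
  { apply analytic_near in H0. eapply near_imp; [|exact H0]. intros u [_ Hu]. exact Hu. }
  assert (Ng : near 0 (holo (finite_part g))).
  { apply analytic_near in G0. eapply near_imp; [|exact G0]. intros u [_ Hu]. exact Hu. }
  assert (Lb := dilatation_majorant _ _ om a b k r N Hr Hom om1 Nh Ng Ah Ag Eom).
  assert (a0 : a O = P 0).
  { rewrite (asy_ccont_0 _ a (holo_ccont _ _ (near_self _ _ Nh)) Ah), Eh, w0 by exact D0.
    reflexivity. }
  destruct M as (c & Hc & Kc).
  (* The constant phi(0) affects only index 0, so from index 1 on the coefficients of h are those
     majorized by [A]. *)
  assert (Ec : forall n, a n = (c n + delta (P 0) n)%C).
  { apply (asy_unique (finite_part h) (fun z => (P (w z) - P 0) + P 0)%C); [|exact Ah|].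
    - eapply near_imp; [|apply copen_disk, D0]. intros z Dz _. rewrite Eh by exact Dz. ring.
    - apply (asy_plus (fun z => P (w z) - P 0)%C (fun _ => P 0)); [exact Hc|apply asy_const]. }
  assert (La : r * msum (shift a) r N <= A).
  { rewrite (msum_ext (shift a) (shift c)).
    - assert (L := Kc (S N)). rewrite msum_shift in L. assert (T := Cmod_ge_0 (c O)). lra.
    - intros n. unfold shift. rewrite Ec. simpl. f_equal. ring. }
  rewrite sum_n_msum, !msum_shift, a0, b0, Cmod_0.
  assert (k * (r * msum (shift a) r N) <= k * A) by (apply Rmult_le_compat_l; assumption).
  (* The share 1 is due to h and the share k to g. *)
  replace (2 * K / (K + 1)) with (1 + k) by (unfold k; field; lra).
  lra.
Qed.

(** The inequality for the radius function is multiplied by |phi'(0)|, after which the term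
    |phi'(0)| p / (1 + p)^2 is absorbed by the distance to the boundary. *)
Lemma bohr_inequality_of_radius (p K t : R) (m : nat) (phi h g : C -> Chat) (a b : nat -> C) (z : C) :
  0 < p < 1 -> 1 <= K -> 0 <= t <= 1 -> (1 <= m)%nat ->
  admissible p K phi h g a b -> Cmod z <= 1 / 3 -> Cmod z < p ->
  radius_function K m p t (Cmod z) <= 0 ->
  bohr_inequality t m phi h a b z.
Proof.
  intros Hp HK Ht Hm Hadm Hz Hzp Hrad. unfold radius_function in Hrad. assert (Z0 := Cmod_ge_0 z).
  set (r := Cmod z) in *. set (A1 := Cmod (dv (finite_part phi) 0)).
  destruct (bounded_series (fun n => (Cmod (a n) + Cmod (b n)) * r ^ n)
    (Cmod (finite_part phi 0) + 2 * K / (K + 1) * (A1 * k_ p r))) as [Hex HS].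
  - intros n. apply Rmult_le_pos; [|apply pow_le; exact Z0].
    assert (T1 := Cmod_ge_0 (a n)). assert (T2 := Cmod_ge_0 (b n)). lra.
  - intros N. apply (coefficient_sum p K phi h g); try assumption. split; assumption.
  - split; [exact Hex|]. unfold bohr_lhs, bohr_rhs. fold r.
    destruct Hadm as (Hphi & _ & _ & _ & _ & _ & _ & (w & Hw & Dw & w0 & Ew)).
    assert (HA : 0 <= A1) by apply Cmod_ge_0.
    assert (Hrm : r ^ m <= r).
    { destruct m as [|m']; [lia|]. simpl. assert (r ^ m' <= 1 ^ m') by (apply pow_incr; lra).
      rewrite pow1 in *. nra. }
    assert (Hrm0 : 0 <= r ^ m) by (apply pow_le; exact Z0).
    assert (Dzm : unit_disk (z ^ m)%C) by (unfold unit_disk; rewrite Cmod_pow; fold r; lra).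
    assert (Hw' : holo_on unit_disk w) by (intros u Du; apply holo_ex_derive, Hw, Du).
    assert (Lw : Cmod (w (z ^ m)%C) <= r ^ m).
    { unfold r. rewrite <- Cmod_pow. apply schwarz_le; auto. intros u Du. left. apply Dw, Du. }
    assert (Hh : Cmod (finite_part h (z ^ m)%C) <= Cmod (finite_part phi 0) + A1 * k_ p (r ^ m)).
    { replace (finite_part h (z ^ m)%C) with (finite_part phi (w (z ^ m)%C))
        by (unfold finite_part; rewrite (Ew _ Dzm); reflexivity).
      eapply Rle_trans; [apply (subordinate_growth p phi _ Hp Hphi); lra|].
      apply Rplus_le_compat_l, Rmult_le_compat_l; [exact HA|].
      apply k_monotone; [exact Hp|apply Cmod_ge_0|exact Lw|lra]. }
    assert (Hd := dist_lower_bound p phi Hp Hphi). fold A1 in Hd.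
    assert (E1 : t * Cmod (finite_part h (z ^ m)%C) <=
      t * (Cmod (finite_part phi 0) + A1 * k_ p (r ^ m))) by (apply Rmult_le_compat_l; lra).
    assert (E2 : (1 - t) * Series (fun n => (Cmod (a n) + Cmod (b n)) * r ^ n) <=
      (1 - t) * (Cmod (finite_part phi 0) + 2 * K / (K + 1) * (A1 * k_ p r)))
      by (apply Rmult_le_compat_l; lra).
    apply (Rmult_le_compat_l A1) in Hrad; [|exact HA].
    assert (E3 : (1 - t) * (2 * K / (K + 1) * (A1 * k_ p r)) =
      A1 * (2 * K * (1 - t) / (K + 1) * k_ p r)) by (field; lra).
    lra.
Qed.

(** * Sharpness *)

Lemma complex_sqrt (w : C) : exists v, (v * v)%C = w.
Proof.
  destruct w as [a b]. set (m := Cmod (a, b)).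
  assert (Ha := re_bound (a, b)). simpl in Ha. fold m in Ha.
  assert (Hm : m ^ 2 = a ^ 2 + b ^ 2) by (unfold m; apply (Cmod2_alt (a, b))).
  set (x := sqrt ((m + a) / 2)). set (y := sqrt ((m - a) / 2)).
  assert (X2 : x * x = (m + a) / 2) by (apply sqrt_sqrt; lra).
  assert (Y2 : y * y = (m - a) / 2) by (apply sqrt_sqrt; lra).
  assert (XY : x * y = Rabs b / 2).
  { unfold x, y. rewrite <- sqrt_mult by lra.
    replace ((m + a) / 2 * ((m - a) / 2)) with ((b / 2) * (b / 2)) by nra.
    replace (sqrt (b / 2 * (b / 2))) with (Rabs (b / 2)) by (symmetry; apply sqrt_Rsqr_abs).
    unfold Rdiv. rewrite Rabs_mult, (Rabs_pos_eq (/ 2)) by lra. reflexivity. }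
  destruct (Rle_or_lt 0 b) as [B|B].
  - rewrite Rabs_pos_eq in XY by exact B. exists (x, y). apply C_ext; simpl; lra.
  - rewrite Rabs_left in XY by exact B. exists (x, - y). apply C_ext; simpl; nra.
Qed.

(** * The extremal function and its image *)

Definition koebe_pole (p : R) (z : C) : C :=
  (RtoC p * z / ((RtoC p - z) * (1 - RtoC p * z)))%C.

Lemma koebe_0 (p : R) : koebe_pole p 0 = RtoC 0.
Proof. unfold koebe_pole, Cdiv. ring. Qed.

(** For k = 0, which occurs as the function g when K = 1, there is no pole, so the value at p has to
    be finite. *)
Definition extremal (p : R) (k : C) (z : C) : Chat :=
  match Ceq_dec z (RtoC p) with
  | left _ => if Ceq_dec k 0 then Some (RtoC 0) else None
  | right _ => Some (k * koebe_pole p z)%C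
  end.

Lemma extremal_off (p : R) (k z : C) : z <> RtoC p ->
  extremal p k z = Some (k * koebe_pole p z)%C.
Proof. intros N. unfold extremal. destruct (Ceq_dec z p); tauto. Qed.

Lemma extremal_fin (p : R) (k z : C) : z <> RtoC p ->
  finite_part (extremal p k) z = (k * koebe_pole p z)%C.
Proof. intros N. unfold finite_part. rewrite extremal_off by exact N. reflexivity. Qed.

Lemma extremal_pole (p : R) (k : C) : k <> RtoC 0 -> extremal p k p = None.
Proof.
  intros N. unfold extremal. destruct (Ceq_dec p p); [|tauto]. destruct (Ceq_dec k 0); tauto.
Qed.

Lemma koebe_den (p : R) (z : C) : 0 < p < 1 -> off_pole p z ->
  (RtoC p - z)%C <> RtoC 0 /\ (1 - RtoC p * z)%C <> RtoC 0.
Proof.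
  intros Hp [Dz Nz]. split; [apply Csub_neq; auto|apply mob_den; [exact Hp|]].
  apply p_unit_disk; assumption.
Qed.

Lemma koebe_holo (p : R) (z : C) : 0 < p < 1 -> off_pole p z -> holo (koebe_pole p) z.
Proof.
  intros Hp Oz. destruct (koebe_den p z Hp Oz) as [N1 N2]. apply holo_div.
  - apply holo_mult; [apply holo_const|apply holo_id].
  - apply holo_mult; apply holo_minus; try apply holo_const; [apply holo_id|].
    apply holo_mult; [apply holo_const|apply holo_id].
  - apply Cmult_neq_0; assumption.
Qed.

Lemma extremal_analytic (p : R) (k z : C) : 0 < p < 1 -> off_pole p z ->
  analytic_at (extremal p k) z.
Proof.
  intros Hp Oz. apply analytic_near.
  eapply near_imp; [|apply (near_near _ _ (copen_off_pole p z Oz))].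
  intros u Nu. assert (Ou := near_self _ _ Nu). split.
  - rewrite extremal_off by apply Ou. discriminate.
  - apply holo_ext with (fun u => k * koebe_pole p u)%C.
    + eapply near_imp; [|exact Nu]. intros v Ov. symmetry. apply extremal_fin, Ov.
    + apply holo_mult; [apply holo_const|apply koebe_holo; assumption].
Qed.

Lemma extremal_pole_at (p : R) (k : C) : 0 < p < 1 -> k <> RtoC 0 ->
  simple_pole_at (extremal p k) p.
Proof.
  intros Hp Nk.
  assert (Dp : unit_disk p) by (unfold unit_disk; rewrite Cmod_real; lra).
  (* The product of u - p and the function, with the factor p - u cancelled; its value at p is the
     residue. *)
  set (v := fun u => (- (k * RtoC p * u / (1 - RtoC p * u)))%C).
  assert (N2 : (1 - RtoC p * RtoC p)%C <> RtoC 0) by (apply one_sub_sq_neq, Hp).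
  assert (Cv : ccont v p).
  { apply holo_ccont, holo_opp, holo_div; [| |exact N2].
    - apply holo_mult; [apply holo_const|apply holo_id].
    - apply holo_minus; [apply holo_const|]. apply holo_mult; [apply holo_const|apply holo_id]. }
  assert (Np : RtoC p <> RtoC 0) by (apply RtoC_neq; lra).
  assert (Nv : v p <> RtoC 0).
  { unfold v. intros Q. apply (Cmult_neq_0 (k * RtoC p * RtoC p) (/ (1 - RtoC p * RtoC p))).
    - repeat apply Cmult_neq_0; assumption.
    - apply Cinv_neq_0, N2.
    - replace (k * RtoC p * RtoC p * / (1 - RtoC p * RtoC p))%C
        with (- - (k * RtoC p * RtoC p / (1 - RtoC p * RtoC p)))%C by (unfold Cdiv; ring).
      rewrite Q. ring. }
  assert (Ev : forall u, unit_disk u -> u <> RtoC p ->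
    ((u - RtoC p) * finite_part (extremal p k) u)%C = v u).
  { intros u Du Nu. rewrite extremal_fin by exact Nu. unfold v, koebe_pole.
    destruct (koebe_den p u Hp (conj Du Nu)) as [M1 M2]. field. auto. }
  split; [split; [apply extremal_pole, Nk|split]|].
  - apply locally'_near. eapply near_imp; [|apply copen_disk, Dp]. intros u Du Nu.
    assert (A := extremal_analytic p k u Hp (conj Du Nu)).
    apply analytic_near, near_self in A. destruct A as [A B]. split; [exact A|].
    apply holo_ex_derive, B.
  - intros P [M HM]. apply locally'_near.
    assert (Pv : 0 < Cmod (v p)) by (apply Cmod_gt_0, Nv).
    destruct (near_and _ _ _ (copen_disk p Dp)
      (Cmod_ccont_near v p (Cmod (v p) / 2) Cv ltac:(lra))) as (d & Hd & K).
    assert (A0 := Rabs_pos M). assert (A1 := Rle_abs M).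
    exists (Rmin d (Cmod (v p) / 2 / (Rabs M + 1))). split.
    { apply Rmin_pos; [exact Hd|]. apply Rdiv_lt_0_compat; lra. }
    intros u Hu Nu. apply HM.
    assert (M1 := Rmin_l d (Cmod (v p) / 2 / (Rabs M + 1))).
    assert (M2 := Rmin_r d (Cmod (v p) / 2 / (Rabs M + 1))).
    destruct (K u ltac:(lra)) as [Du Ku]. rewrite <- (Ev u Du Nu), Cmod_mult in Ku.
    assert (Pu := Cmod_sub_pos _ _ Nu).
    assert (Hq := Rdiv_mult_lt (Cmod (u - RtoC p)) (Rabs M + 1) (Cmod (v p) / 2) ltac:(lra) ltac:(lra)).
    apply (Rmult_lt_reg_l (Cmod (u - RtoC p))); [exact Pu|]. nra.
  - exists (v p). split; [exact Nv|]. intros P HP. apply locally_near in HP.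
    apply locally'_near.
    eapply near_imp; [|exact (near_and _ _ _ (copen_disk p Dp) (ccont_pull _ _ _ Cv HP))].
    intros u [Du Pu] Nu. rewrite Ev by assumption. exact Pu.
Qed.

(** The cross-multiplied difference of two values is p^2 (z1 - z2) (1 - z1 z2), and the last factor
    does not vanish in the disk. *)
Lemma koebe_injective (p : R) (z1 z2 : C) : 0 < p < 1 -> off_pole p z1 -> off_pole p z2 ->
  koebe_pole p z1 = koebe_pole p z2 -> z1 = z2.
Proof.
  intros Hp O1 O2 E. destruct (koebe_den p z1 Hp O1) as [A1 B1].
  destruct (koebe_den p z2 Hp O2) as [A2 B2]. unfold koebe_pole in E.
  assert (Np : RtoC p <> RtoC 0) by (apply RtoC_neq; lra).
  apply NNPP. intros N. assert (N' := Csub_neq _ _ N).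
  assert (N3 : (1 - z1 * z2)%C <> RtoC 0).
  { intros Q. assert (Q' : (z1 * z2)%C = RtoC 1).
    { replace (z1 * z2)%C with (1 - (1 - z1 * z2))%C by ring. rewrite Q. ring. }
    apply (f_equal Cmod) in Q'. rewrite Cmod_mult, Cmod_1 in Q'.
    destruct O1 as [D1 _]. destruct O2 as [D2 _]. unfold unit_disk in *.
    assert (P1 := Cmod_ge_0 z1). assert (P2 := Cmod_ge_0 z2). nra. }
  apply (Cmult_neq_0 (RtoC p * RtoC p) ((z1 - z2) * (1 - z1 * z2))).
  - apply Cmult_neq_0; assumption.
  - apply Cmult_neq_0; assumption.
  - replace (RtoC p * RtoC p * ((z1 - z2) * (1 - z1 * z2)))%C with
      ((RtoC p * z1 / ((RtoC p - z1) * (1 - RtoC p * z1)) -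
        RtoC p * z2 / ((RtoC p - z2) * (1 - RtoC p * z2))) *
       ((RtoC p - z1) * (1 - RtoC p * z1) * ((RtoC p - z2) * (1 - RtoC p * z2))))%C
      by (field; auto).
    rewrite E. ring.
Qed.

(** The reciprocal of k_p(z) is z + 1 / z - p - 1 / p, so taking the value u amounts to a quadratic
    equation whose roots have product 1. *)
Lemma koebe_quadratic (p : R) (z u : C) : 0 < p < 1 -> off_pole p z -> u <> RtoC 0 ->
  (koebe_pole p z = u <-> (z * z - (/ u + RtoC p + / RtoC p) * z + 1)%C = RtoC 0).
Proof.
  intros Hp Oz Nu. destruct (koebe_den p z Hp Oz) as [A B].
  assert (Np : RtoC p <> RtoC 0) by (apply RtoC_neq; lra).
  assert (E : (z * z - (/ u + RtoC p + / RtoC p) * z + 1)%C =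
    ((u - koebe_pole p z) * ((RtoC p - z) * (1 - RtoC p * z)) / (u * RtoC p))%C)
    by (unfold koebe_pole; field; auto).
  rewrite E. split.
  - intros ->. rewrite sub_self. field. auto.
  - intros Q. apply NNPP. intros N. revert Q. apply Cmult_neq_0.
    + apply Cmult_neq_0; [apply Csub_neq; auto|apply Cmult_neq_0; assumption].
    + apply Cinv_neq_0, Cmult_neq_0; assumption.
Qed.

(** The ends of the omitted slit are boundary values: k_p(1) here, and k_p(-1) for [slit_hi]. *)
Definition slit_lo (p : R) : R := - (p / (1 - p) ^ 2).
Definition slit_hi (p : R) : R := - (p / (1 + p) ^ 2).

(** Taking reciprocals turns the slit into the interval [-2, 2] of values of z + 1 / z on the unit
    circle. *)
Lemma slit_inverse (p x : R) : 0 < p < 1 ->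
  (slit_lo p <= x <= slit_hi p <-> x < 0 /\ -2 <= / x + p + / p <= 2).
Proof.
  intros Hp. unfold slit_lo, slit_hi.
  assert (E1 : p / (1 - p) ^ 2 = / (/ p + p - 2)) by (field; split; nra).
  assert (E2 : p / (1 + p) ^ 2 = / (/ p + p + 2)) by (field; split; nra).
  assert (Q : 0 < / p + p - 2).
  { replace (/ p + p - 2) with ((1 - p) ^ 2 / p) by (field; lra).
    apply Rdiv_lt_0_compat; [apply pow_lt; lra|lra]. }
  rewrite E1, E2. set (q := / p + p) in *.
  assert (P1 : 0 < / (q - 2)) by (apply Rinv_0_lt_compat; lra).
  assert (P2 : 0 < / (q + 2)) by (apply Rinv_0_lt_compat; lra).
  split.
  - intros [H1 H2]. assert (X : 0 < - x) by lra. split; [lra|].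
    assert (I1 : / / (q - 2) <= / (- x)) by (apply Rinv_le_contravar; lra).
    assert (I2 : / (- x) <= / / (q + 2)) by (apply Rinv_le_contravar; lra).
    rewrite Rinv_inv in I1, I2. rewrite Rinv_opp in I1, I2. unfold q in *. lra.
  - intros [X H]. assert (Y : 0 < - x) by lra.
    assert (E : - x = / - / x) by (rewrite Rinv_opp, Rinv_inv; reflexivity).
    assert (I1 : / (q + 2) <= - x).
    { rewrite E. apply Rinv_le_contravar; [|unfold q; lra].
      rewrite <- Rinv_opp. apply Rinv_0_lt_compat, Y. }
    assert (I2 : - x <= / (q - 2)).
    { rewrite E. apply Rinv_le_contravar; [lra|unfold q in *; lra]. }
    lra.
Qed.

(* [z + 1/z] maps the punctured disk onto the complement of [[-2, 2]]. *)
Lemma extremal_complement (p : R) (u : C) : 0 < p < 1 ->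
  (~ disk_image (extremal p 1) (Some u) <->
   exists x, u = RtoC x /\ slit_lo p <= x <= slit_hi p).
Proof.
  intros Hp. assert (N1 : RtoC 1 <> RtoC 0) by (apply RtoC_neq; lra).
  assert (Np : RtoC p <> RtoC 0) by (apply RtoC_neq; lra).
  assert (Him : disk_image (extremal p 1) (Some u) <-> exists z, off_pole p z /\ koebe_pole p z = u).
  { split.
    - intros (z & Dz & Ez). assert (Nz : z <> RtoC p).
      { intros ->. rewrite extremal_pole in Ez by exact N1. discriminate. }
      exists z. split; [split; assumption|]. rewrite extremal_off in Ez by exact Nz.
      injection Ez as Ez. rewrite <- Ez. ring.
    - intros (z & Oz & Ez). exists z. split; [apply Oz|].
      rewrite extremal_off by apply Oz. f_equal. rewrite Ez. ring. }
  rewrite Him. split.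
  - intros Hn. assert (Nu : u <> RtoC 0).
    { intros ->. apply Hn. exists (RtoC 0). split; [apply off_pole_0, Hp|].
      apply koebe_0. }
    set (s := (/ u + RtoC p + / RtoC p)%C).
    (* The roots have product 1, and a root inside the disk would be a preimage of u. So both lie on
       the circle, are conjugate, and s = 2 Re z1 is real. *)
    destruct (complex_sqrt (s * s - 4)%C) as [v Hv].
    set (z1 := ((s + v) / 2)%C). set (z2 := ((s - v) / 2)%C).
    assert (Esum : (z1 + z2)%C = s) by (unfold z1, z2; field).
    assert (Eprod : (z1 * z2)%C = RtoC 1).
    { unfold z1, z2. replace ((s + v) / 2 * ((s - v) / 2))%C with ((s * s - v * v) / 4)%C by field.
      rewrite Hv. field. }
    assert (Hroot : forall a b, (a + b)%C = s -> (a * b)%C = RtoC 1 -> Cmod a < 1 -> False).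
    { intros a b Eab Pab Ha. apply Hn. exists a.
      assert (Ra : (a * a - s * a + 1)%C = RtoC 0) by (rewrite <- Eab, <- Pab; ring).
      assert (Na : a <> RtoC p).
      { intros ->. apply (Cinv_neq_0 u Nu).
        replace (/ u)%C with (- (RtoC p * RtoC p - s * RtoC p + 1) / RtoC p)%C
          by (unfold s; field; auto).
        rewrite Ra. field. exact Np. }
      assert (Oa : off_pole p a) by (split; assumption). split; [exact Oa|].
      apply koebe_quadratic; assumption. }
    assert (Mprod : Cmod z1 * Cmod z2 = 1) by (rewrite <- Cmod_mult, Eprod; apply Cmod_1).
    assert (P1 := Cmod_ge_0 z1). assert (P2 := Cmod_ge_0 z2).
    destruct (Rtotal_order (Cmod z1) 1) as [L|[L|L]].
    + destruct (Hroot z1 z2 Esum Eprod L).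
    + assert (Ez2 : z2 = Cconj z1).
      { rewrite (conj_circle z1 L). assert (Nz1 : z1 <> RtoC 0) by (apply Cmod_gt_0; lra).
        replace z2 with (z1 * z2 / z1)%C by (field; exact Nz1). rewrite Eprod. field. exact Nz1. }
      assert (Es : s = RtoC (2 * Re z1)).
      { rewrite <- Esum, Ez2. apply C_ext; simpl; ring. }
      assert (R1 := re_bound z1). rewrite L in R1.
      set (y := 2 * Re z1 - p - / p).
      assert (Ey : (/ u)%C = RtoC y).
      { unfold y. rewrite !RtoC_minus, <- Es, RtoC_inv by lra. unfold s. ring. }
      assert (Ny : y <> 0).
      { intros Q. rewrite Q in Ey. apply (Cinv_neq_0 u Nu Ey). }
      assert (Q2 : 2 < / p + p).
      { assert (0 < (1 - p) ^ 2 / p) by (apply Rdiv_lt_0_compat; [apply pow_lt; lra|lra]).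
        replace ((1 - p) ^ 2 / p) with (/ p + p - 2) in H by (field; lra). lra. }
      assert (Y0 : y < 0) by (unfold y; lra).
      exists (/ y). split.
      * rewrite RtoC_inv by exact Ny. rewrite <- Ey. field. exact Nu.
      * apply slit_inverse; [exact Hp|]. split; [apply Rinv_lt_0_compat, Y0|].
        rewrite Rinv_inv. unfold y. lra.
    + destruct (Hroot z2 z1).
      * rewrite <- Esum. ring.
      * rewrite <- Eprod. ring.
      * nra.
  - intros (x & -> & Hx) (z & Oz & Ez). apply slit_inverse in Hx; [|exact Hp].
    destruct Hx as [X0 Hs].
    apply koebe_quadratic in Ez; [|exact Hp|exact Oz|apply RtoC_neq; lra].
    rewrite <- !RtoC_inv, <- !RtoC_plus in Ez by lra.
    set (s := / x + p + / p) in *. destruct Oz as [Dz _]. unfold unit_disk in Dz.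
    assert (Z2 := Cmod2_alt z). assert (Z0 := Cmod_ge_0 z).
    destruct z as [a b]. cbn [Re Im fst snd] in Z2.
    assert (E1 := f_equal Re Ez). assert (E2 := f_equal Im Ez). simpl in E1, E2.
    assert (H1 : a ^ 2 + b ^ 2 < 1) by nra.
    (* The imaginary part of the equation. Either the root is real, and then s in [-2, 2] forces it
       to be 1 or -1, or s = 2 a and its modulus is 1; both contradict |z| < 1. *)
    assert (H2 : b * (2 * a - s) = 0) by lra.
    apply Rmult_integral in H2. destruct H2 as [->|H2].
    + assert (0 <= (a - s / 2) ^ 2) by apply pow2_ge_0. nra.
    + assert (s = 2 * a) by lra. subst s. nra.
Qed.

Lemma extremal_concave (p : R) : 0 < p < 1 -> concave_with_pole p (extremal p 1).
Proof.
  intros Hp. assert (N1 : RtoC 1 <> RtoC 0) by (apply RtoC_neq; lra). split; [|split; [|split]].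
  - intros z Dz Nz. apply extremal_analytic; [exact Hp|split; assumption].
  - apply extremal_pole_at; assumption.
  - intros z1 z2 D1 D2 E.
    destruct (Ceq_dec z1 (RtoC p)) as [->|M1]; destruct (Ceq_dec z2 (RtoC p)) as [->|M2];
      [reflexivity| | |].
    + rewrite extremal_pole, extremal_off in E by assumption. discriminate.
    + rewrite (extremal_off p 1 z1), extremal_pole in E by assumption. discriminate.
    + rewrite !extremal_off, !Cmult_1_l in E by assumption.
      apply (koebe_injective p); [exact Hp|split; assumption|split; assumption|].
      congruence.
  - intros u v s Hs Hu Hv. apply extremal_complement; [exact Hp|].
    apply extremal_complement in Hu; [|exact Hp]. apply extremal_complement in Hv; [|exact Hp].
    destruct Hu as (x & -> & Hx). destruct Hv as (y & -> & Hy).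
    exists (s * x + (1 - s) * y). split; [rewrite RtoC_plus, !RtoC_mult; reflexivity|]. nra.
Qed.

(** From partial fractions: k_p(z) is p / (1 - p^2) times the difference of 1 / (1 - z / p) and 1 /
    (1 - p z). *)
Definition koebe_coef (p : R) (n : nat) : R := p / (1 - p ^ 2) * ((/ p) ^ n - p ^ n).

Lemma geometric_psum (c z : C) (N : nat) :
  (psum (fun n => c ^ n)%C z N * (1 - c * z) = 1 - (c * z) ^ N)%C.
Proof.
  induction N as [|N IH]; [simpl; ring|]. simpl psum.
  replace ((psum (fun n => c ^ n)%C z N + c ^ N * z ^ N) * (1 - c * z))%C
    with (psum (fun n => c ^ n)%C z N * (1 - c * z) + c ^ N * z ^ N * (1 - c * z))%C by ring.
  rewrite IH, <- Cpow_mult_l, (Cpow_S (c * z) N). ring.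
Qed.

Lemma pseries_of_limit (a : nat -> C) (z s : C) :
  (forall eps, 0 < eps -> exists N, forall n, (N <= n)%nat -> Cmod (psum a z (S n) - s) < eps) ->
  is_pseries a z s.
Proof.
  intros H P HP. apply locally_near in HP. destruct HP as (d & Hd & K).
  destruct (H d Hd) as [N HN]. exists N. intros n Hn.
  rewrite sum_n_psum. apply K, HN, Hn.
Qed.

Lemma Cpow_limit (x : C) (eps : R) : Cmod x < 1 -> 0 < eps ->
  exists N, forall n, (N <= n)%nat -> Cmod (x ^ n) < eps.
Proof.
  intros Hx He. assert (X0 := Cmod_ge_0 x).
  destruct (pow_lt_1_zero (Cmod x) ltac:(rewrite Rabs_pos_eq; lra) eps He) as [N HN].
  exists N. intros n Hn. specialize (HN n Hn). rewrite Cmod_pow.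
  rewrite Rabs_pos_eq in HN by (apply pow_le, X0). exact HN.
Qed.

Lemma koebe_pseries (p : R) (k z : C) : 0 < p < 1 -> Cmod z < p ->
  is_pseries (fun n => k * RtoC (koebe_coef p n))%C z (k * koebe_pole p z)%C.
Proof.
  intros Hp Hz. assert (Z0 := Cmod_ge_0 z).
  assert (Oz : off_pole p z).
  { split; [unfold unit_disk; lra|]. intros ->. rewrite Cmod_real in Hz; lra. }
  destruct (koebe_den p z Hp Oz) as [N1 N2].
  assert (Np : RtoC p <> RtoC 0) by (apply RtoC_neq; lra).
  assert (N4 := one_sub_sq_neq p Hp).
  set (al := (k * (RtoC p / (1 - RtoC p * RtoC p)))%C).
  set (c1 := (/ RtoC p)%C). set (c2 := RtoC p).
  assert (N3 : (1 - c1 * z)%C <> RtoC 0).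
  { intros Q. apply N1. replace (RtoC p - z)%C with (RtoC p * (1 - c1 * z))%C
      by (unfold c1; field; exact Np). rewrite Q. ring. }
  assert (Ea : forall n, (k * RtoC (koebe_coef p n))%C = (al * (c1 ^ n + (-1) * c2 ^ n))%C).
  { intros n. unfold koebe_coef, al, c1, c2.
    rewrite RtoC_mult, RtoC_div, !RtoC_minus, !RtoC_pow, RtoC_inv by nra.
    replace (RtoC p ^ 2)%C with (RtoC p * RtoC p)%C by ring. field. exact N4. }
  assert (Ep : forall N, psum (fun n => k * RtoC (koebe_coef p n))%C z N =
    (k * koebe_pole p z - al * ((c1 * z) ^ N / (1 - c1 * z) - (c2 * z) ^ N / (1 - c2 * z)))%C).
  { intros N. transitivity (al * (psum (fun n => c1 ^ n)%C z N + (-1) * psum (fun n => c2 ^ n)%C z N))%C.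
    - rewrite <- psum_scal, <- psum_plus, <- psum_scal.
      induction N as [|N IH]; simpl psum; [reflexivity|]. rewrite IH, Ea. reflexivity.
    - assert (G1 := geometric_psum c1 z N). assert (G2 := geometric_psum c2 z N).
      replace (psum (fun n => c1 ^ n)%C z N) with ((1 - (c1 * z) ^ N) / (1 - c1 * z))%C
        by (rewrite <- G1; field; exact N3).
      replace (psum (fun n => c2 ^ n)%C z N) with ((1 - (c2 * z) ^ N) / (1 - c2 * z))%C
        by (rewrite <- G2; field; exact N2).
      assert (Ek : (k * koebe_pole p z)%C = (al * (/ (1 - c1 * z) - / (1 - c2 * z)))%C).
      { unfold koebe_pole, al, c2.
        assert (E3 : (/ (1 - c1 * z))%C = (RtoC p / (RtoC p - z))%C).
        { replace (RtoC p - z)%C with (RtoC p * (1 - c1 * z))%C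
            by (unfold c1; field; exact Np). field. auto. }
        rewrite E3. field. auto. }
      rewrite Ek. unfold Cdiv. ring. }
  apply pseries_of_limit. intros eps He.
  set (M := Cmod al * (Cmod (/ (1 - c1 * z)) + Cmod (/ (1 - c2 * z))) + 1).
  assert (M0 : 0 < M).
  { assert (P1 := Cmod_ge_0 al). assert (P2 := Cmod_ge_0 (/ (1 - c1 * z))).
    assert (P3 := Cmod_ge_0 (/ (1 - c2 * z))). unfold M.
    assert (0 <= Cmod al * (Cmod (/ (1 - c1 * z)) + Cmod (/ (1 - c2 * z)))) by (apply Rmult_le_pos; lra).
    lra. }
  assert (Q1 : Cmod (c1 * z) < 1).
  { unfold c1. rewrite Cmod_mult, Cmod_inv, Cmod_real by (exact Np || lra).
    apply (Rmult_lt_reg_l p); [lra|]. rewrite <- Rmult_assoc, Rinv_r by lra. lra. }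
  assert (Q2 : Cmod (c2 * z) < 1) by (unfold c2; rewrite Cmod_mult, Cmod_real by lra; nra).
  destruct (Cpow_limit (c1 * z) (eps / M) Q1) as [n1 K1]; [apply Rdiv_lt_0_compat; lra|].
  destruct (Cpow_limit (c2 * z) (eps / M) Q2) as [n2 K2]; [apply Rdiv_lt_0_compat; lra|].
  exists (n1 + n2)%nat. intros n Hn. rewrite Ep.
  specialize (K1 (S n) ltac:(lia)). specialize (K2 (S n) ltac:(lia)).
  set (x1 := ((c1 * z) ^ S n)%C) in *. set (x2 := ((c2 * z) ^ S n)%C) in *.
  replace (k * koebe_pole p z - al * (x1 / (1 - c1 * z) - x2 / (1 - c2 * z)) - k * koebe_pole p z)%C
    with (al * (x2 * / (1 - c2 * z) - x1 * / (1 - c1 * z)))%C by (unfold Cdiv; ring).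
  rewrite Cmod_mult. set (e := eps / M) in *.
  assert (Ee : e * M = eps) by (unfold e; field; lra).
  assert (T := Cmod_triangle (x2 * / (1 - c2 * z)) (- (x1 * / (1 - c1 * z)))).
  rewrite Cmod_opp, !Cmod_mult in T. unfold Cminus at 1.
  assert (P1 := Cmod_ge_0 al). assert (P2 := Cmod_ge_0 (/ (1 - c1 * z))).
  assert (P3 := Cmod_ge_0 (/ (1 - c2 * z))).
  assert (E0 : 0 < e) by (unfold e; apply Rdiv_lt_0_compat; lra).
  assert (A1 : Cmod x2 * Cmod (/ (1 - c2 * z)) <= e * Cmod (/ (1 - c2 * z)))
    by (apply Rmult_le_compat_r; lra).
  assert (A2 : Cmod x1 * Cmod (/ (1 - c1 * z)) <= e * Cmod (/ (1 - c1 * z)))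
    by (apply Rmult_le_compat_r; lra).
  apply Rle_lt_trans with (Cmod al * (e * (Cmod (/ (1 - c1 * z)) + Cmod (/ (1 - c2 * z))))).
  - apply Rmult_le_compat_l; [exact P1|]. lra.
  - rewrite <- Ee. unfold M. nra.
Qed.

(** Because of this sign the majorant series of the extremal function at r is k_p(r) itself. *)
Lemma koebe_coef_nonneg (p : R) (n : nat) : 0 < p < 1 -> 0 <= koebe_coef p n.
Proof.
  intros Hp. unfold koebe_coef. apply Rmult_le_pos.
  - apply Rmult_le_pos; [lra|]. left. apply Rinv_0_lt_compat. nra.
  - assert (p ^ n <= (/ p) ^ n); [|lra]. apply pow_incr. split; [lra|].
    apply Rle_trans with 1; [lra|]. rewrite <- Rinv_1. apply Rinv_le_contravar; lra.
Qed.

Lemma koebe_series (p r : R) : 0 < p < 1 -> 0 <= r < p ->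
  is_series (fun n => koebe_coef p n * r ^ n) (k_ p r).
Proof.
  intros Hp Hr.
  assert (Q1 : Rabs (r / p) < 1).
  { rewrite Rabs_pos_eq by (apply Rmult_le_pos; [lra|left; apply Rinv_0_lt_compat; lra]).
    apply (Rmult_lt_reg_r p); [lra|]. unfold Rdiv. rewrite Rmult_assoc, Rinv_l by lra. lra. }
  assert (Q2 : Rabs (p * r) < 1) by (rewrite Rabs_pos_eq; nra).
  assert (S := is_series_scal (p / (1 - p ^ 2)) _ _
    (is_series_minus _ _ _ _ (is_series_geom _ Q1) (is_series_geom _ Q2))).
  replace (k_ p r) with (scal (p / (1 - p ^ 2)) (minus (/ (1 - r / p)) (/ (1 - p * r)))).
  - eapply is_series_ext; [|exact S]. intros n. unfold koebe_coef, Rdiv.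
    rewrite !Rpow_mult_distr. unfold scal, minus, plus, opp; simpl. unfold mult; simpl. ring.
  - unfold k_, scal, minus, plus, opp; simpl. unfold mult; simpl. field.
    repeat split; nra.
Qed.

(** An upper bound is enough for sharpness, and the end k_p(-1) of the slit provides it. *)
Lemma extremal_dist (p : R) : 0 < p < 1 -> dist_to_boundary (extremal p 1) <= p / (1 + p) ^ 2.
Proof.
  intros Hp. assert (Np : RtoC p <> RtoC 0) by (apply RtoC_neq; lra).
  assert (F0 : finite_part (extremal p 1) 0 = RtoC 0).
  { rewrite extremal_fin by auto. rewrite koebe_0. ring. }
  assert (Pc : 0 < p / (1 + p) ^ 2) by (apply Rdiv_lt_0_compat; [lra|apply pow_lt; lra]).
  assert (Lc : slit_lo p <= slit_hi p).
  { unfold slit_lo, slit_hi. apply Ropp_le_contravar. apply Rmult_le_compat_l; [lra|].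
    apply Rinv_le_contravar; [apply pow_lt; lra|]. apply pow_incr. lra. }
  unfold dist_to_boundary, euclidean_dist. rewrite F0.
  apply (real_Glb_bounds _ (p / (1 + p) ^ 2)).
  - exists (RtoC (slit_hi p)). split.
    + intros eps He. split.
      (* A real point just to the right of the slit, hence in the image. *)
      * exists (RtoC (slit_hi p + eps / 2)). split.
        -- rewrite <- RtoC_minus, Cmod_real; lra.
        -- apply NNPP. intros Hn. apply extremal_complement in Hn; [|exact Hp].
           destruct Hn as (x & Ex & Hx). apply RtoC_inj in Ex. lra.
      * exists (RtoC (slit_hi p)). split; [rewrite sub_self, Cmod_0; exact He|].
        apply extremal_complement; [exact Hp|]. exists (slit_hi p). split; [reflexivity|lra].
    + rewrite <- RtoC_minus. unfold slit_hi. rewrite Cmod_real; lra.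
  - intros x (y & _ & ->). apply Cmod_ge_0.
Qed.

(** The dilatation of this pair is the constant (K - 1) / (K + 1), the largest modulus allowed, and
    h' has no zeros because k_p is univalent; the subordinating map is the identity. *)
Lemma extremal_admissible (p K : R) : 0 < p < 1 -> 1 <= K ->
  admissible p K (extremal p 1) (extremal p 1) (extremal p (RtoC ((K - 1) / (K + 1))))
    (fun n => 1 * RtoC (koebe_coef p n))%C
    (fun n => RtoC ((K - 1) / (K + 1)) * RtoC (koebe_coef p n))%C.
Proof.
  intros Hp HK. set (k := (K - 1) / (K + 1)).
  assert (Hk : 0 <= k < 1).
  { unfold k. split; [apply Rmult_le_pos; [lra|left; apply Rinv_0_lt_compat; lra]|].
    apply (Rmult_lt_reg_r (K + 1)); [lra|]. unfold Rdiv. rewrite Rmult_assoc, Rinv_l; lra. }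
  assert (N1 : RtoC 1 <> RtoC 0) by (apply RtoC_neq; lra).
  assert (Hc := extremal_concave p Hp).
  assert (Han : forall z, unit_disk z -> analytic_at (extremal p 1) z -> off_pole p z).
  { intros z Dz A. split; [exact Dz|]. intros ->. apply analytic_near, near_self in A.
    destruct A as [A _]. apply A, extremal_pole, N1. }
  assert (Hf : forall c z, off_pole p z -> cderiv (finite_part (extremal p c)) z (c * dv (koebe_pole p) z)).
  { intros c z Oz. apply cderiv_ext with (fun u => c * koebe_pole p u)%C.
    - eapply near_imp; [|apply (copen_off_pole p z Oz)]. intros u Ou. symmetry.
      apply extremal_fin, Ou.
    - replace (c * dv (koebe_pole p) z)%C with (0 * koebe_pole p z + c * dv (koebe_pole p) z)%C by ring.
      apply (cderiv_mult (fun _ => c) (koebe_pole p)); [apply cderiv_const|].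
      apply dv_correct, koebe_holo; assumption. }
  assert (Hd : forall c z, off_pole p z ->
    C_derive (finite_part (extremal p c)) z = (c * dv (koebe_pole p) z)%C).
  { intros c z Oz. rewrite C_derive_dv by (eexists; apply Hf, Oz). apply dv_eq, Hf, Oz. }
  assert (Nd : forall z, off_pole p z -> dv (koebe_pole p) z <> RtoC 0).
  { intros z Oz. apply (injective_dv_neq_0 _ (off_pole p)); [apply copen_off_pole| | |exact Oz].
    - intros u Ou. apply koebe_holo; assumption.
    - intros u v Ou Ov. apply koebe_injective; assumption. }
  assert (Edil : forall z, off_pole p z -> dilatation (extremal p 1) (extremal p (RtoC k)) z = RtoC k).
  { intros z Oz. unfold dilatation. rewrite !Hd by exact Oz. field. apply Nd, Oz. }
  assert (Mdil : Cmod (RtoC k) = k) by (rewrite Cmod_R, Rabs_pos_eq; lra).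
  assert (Hexp : forall c, has_expansion p (extremal p c) (fun n => c * RtoC (koebe_coef p n))%C).
  { intros c z Hz. exists (c * koebe_pole p z)%C. split.
    - apply extremal_off. intros ->. rewrite Cmod_real in Hz; lra.
    - apply koebe_pseries; assumption. }
  split; [exact Hc|]. split; [|split; [|split; [|split; [apply Hexp|split; [apply Hexp|split]]]]].
  - assert (Hmer : forall c, meromorphic_in_disk (extremal p c)).
    { intros c z Dz. destruct (Ceq_dec z (RtoC p)) as [->|Nz].
      - destruct (Ceq_dec c (RtoC 0)) as [->|Nc]; [left|right; apply extremal_pole_at; assumption].
        apply analytic_near. apply near_true. intros u.
        assert (E0 : forall v, extremal p 0 v = Some (RtoC 0)).
        { intros v. unfold extremal. destruct (Ceq_dec v p).
          - destruct (Ceq_dec 0 0); tauto.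
          - f_equal. ring. }
        split; [rewrite E0; discriminate|]. apply holo_ext with (fun _ => RtoC 0).
        + apply near_true. intros v. unfold finite_part. rewrite E0. reflexivity.
        + apply holo_const.
      - left. apply extremal_analytic; [exact Hp|split; assumption]. }
    split; [apply Hmer|]. split; [apply Hmer|]. intros z Dz A.
    apply extremal_analytic; [exact Hp|apply Han; assumption].
  - intros z Dz A. assert (Oz := Han z Dz A). split.
    + rewrite Hd by exact Oz. apply Cmult_neq_0; [exact N1|apply Nd, Oz].
    + rewrite Edil, Mdil by exact Oz. lra.
  - intros z Dz A. assert (Oz := Han z Dz A). rewrite Edil, Mdil by exact Oz. unfold k. lra.
  - unfold koebe_coef. simpl. rewrite Rminus_diag, Rmult_0_r. ring.
  - exists (fun z => z). split; [|split; [|split]]; auto.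
    intros z _. apply holo_ex_derive, holo_id.
Qed.

(** At z = rho the left side is the radius function plus p / (1 + p)^2, the right side is at most p
    / (1 + p)^2, and the radius function is positive beyond its zero. *)
Lemma radius_sharp (p K t : R) (m : nat) (R0 : R) : 0 < p < 1 -> 1 <= K -> 0 <= t <= 1 ->
  (1 <= m)%nat -> is_radius K m p t R0 -> sharp_radius K m p t R0.
Proof.
  intros Hp HK Ht Hm [HR0 ER0] rho Hrho. set (k := (K - 1) / (K + 1)).
  assert (Hk : 0 <= k) by (apply Rmult_le_pos; [lra|left; apply Rinv_0_lt_compat; lra]).
  assert (N1 : RtoC 1 <> RtoC 0) by (apply RtoC_neq; lra).
  assert (Np : RtoC p <> RtoC 0) by (apply RtoC_neq; lra).
  set (a := fun n => (1 * RtoC (koebe_coef p n))%C).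
  set (b := fun n => (RtoC k * RtoC (koebe_coef p n))%C).
  assert (Ser : is_series (fun n => (Cmod (a n) + Cmod (b n)) * Cmod (RtoC rho) ^ n) ((1 + k) * k_ p rho)).
  { eapply is_series_ext; [|exact (is_series_scal (1 + k) _ _ (koebe_series p rho Hp ltac:(lra)))].
    intros n. assert (P := koebe_coef_nonneg p n Hp). unfold a, b.
    rewrite !Cmod_mult, !Cmod_R, !Rabs_pos_eq by lra.
    unfold scal; simpl. unfold mult; simpl. ring. }
  exists (extremal p 1), (extremal p 1), (extremal p (RtoC k)), a, b, (RtoC rho).
  split; [apply extremal_admissible; assumption|].
  split; [rewrite Cmod_real; lra|]. split; [eexists; exact Ser|].
  assert (F0 : finite_part (extremal p 1) 0 = RtoC 0).
  { rewrite extremal_fin by auto. rewrite koebe_0. ring. }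
  unfold bohr_rhs, bohr_lhs. rewrite F0, Cmod_0, (is_series_unique _ _ Ser).
  assert (Hrm := pow_small rho p m Hm ltac:(lra) ltac:(lra)).
  assert (Fm : Cmod (finite_part (extremal p 1) (RtoC rho ^ m)%C) = k_ p (rho ^ m)).
  { rewrite <- RtoC_pow, extremal_fin by (apply RtoC_neq; lra).
    assert (D := k_den p (rho ^ m) Hp Hrm).
    assert (E : (1 * koebe_pole p (RtoC (rho ^ m)))%C = RtoC (k_ p (rho ^ m))).
    { unfold k_, koebe_pole. rewrite RtoC_div, !RtoC_mult, !RtoC_minus, !RtoC_mult by lra.
      ring. }
    rewrite E, Cmod_R, Rabs_pos_eq; [reflexivity|apply k_nonneg; assumption]. }
  rewrite Fm. assert (Dd := extremal_dist p Hp).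
  change (radius_function K m p t R0 = 0) in ER0.
  assert (A := radius_function_increasing K m p t R0 rho Hp HK Ht Hm ltac:(lra) ltac:(lra) ltac:(lra)).
  unfold radius_function in A at 2.
  replace (2 * K * (1 - t) / (K + 1)) with ((1 - t) * (1 + k)) in A by (unfold k; field; lra).
  lra.
Qed.

Theorem theorem3p1 (p K t : R) (m : nat)
  (hp : 0 < p < 1) (hK : 1 <= K) (ht : 0 <= t <= 1) (hm : (1 <= m)%nat) :
  (radius_exists_condition m p t ->
     exists! R0 : R, is_radius K m p t R0) /\
  (forall R0 : R, is_radius K m p t R0 ->
     (forall R1 : R, is_radius K m p t R1 -> R1 = R0) /\
     (forall (phi h g : C -> Chat) (a b : nat -> C),
        admissible p K phi h g a b ->
        forall z : C, Cmod z <= Rmin R0 (1 / 3) ->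
          bohr_inequality t m phi h a b z) /\
     (R0 <= 1 / 3 -> sharp_radius K m p t R0)).
Proof.
  split.
  - intros Hc. destruct (radius_exists K m p t hp hK ht hm Hc) as [r Hr].
    exists r. split; [exact Hr|]. intros r' Hr'.
    apply (radius_unique K m p t); assumption.
  - intros R0 HR0. split; [|split].
    + intros R1 HR1. apply (radius_unique K m p t); assumption.
    + intros phi h g a b Hadm z Hz.
      assert (H1 := Rmin_l R0 (1 / 3)). assert (H2 := Rmin_r R0 (1 / 3)).
      assert (Z0 := Cmod_ge_0 z). destruct HR0 as [B0 E0].
      change (radius_function K m p t R0 = 0) in E0.
      assert (HF : radius_function K m p t (Cmod z) <= 0).
      { destruct (Req_dec (Cmod z) R0) as [->|N]; [lra|].
        assert (A := radius_function_increasing K m p t (Cmod z) R0 hp hK ht hm Z0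
          ltac:(lra) ltac:(lra)). lra. }
      apply (bohr_inequality_of_radius p K t m phi h g a b z hp hK ht hm Hadm);
        [lra|lra|exact HF].
    + intros _. apply radius_sharp; assumption.
Qed.
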